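(* Let $\alpha>0$, $\beta>0$, and let $\gamma_0,\gamma_1$ be constants with $\gamma_0\sqrt{\alpha}\neq\gamma_1$. Assume that $u_0\in\mathcal{S}([0,\infty))$, $\zeta\in C^\infty([0,\infty))$, and $f\in C^\infty(\overline{\mathbb{R}^+\times\mathbb{R}^+})$ is such that for every $T>0$ and all nonnegative integers $n,m,\ell$, $$\sup\left\{x^\ell\left|\frac{\partial^{n+m}f(x,t)}{\partial x^n\partial t^m}\right| : x>0,\ 0\le t\le T\right\}<\infty .$$ For $x>0$ and $t>0$ define $$\begin{aligned}u(x,t)=&\ \frac{1}{2\pi}\int_{-\infty}^{\infty}\hat{u}_0(\lambda)e^{i\lambda x-\omega(\lambda)t}\,d\lambda-\frac{1}{2\pi}\int_{\mathcal{K}}\hat{u}_0(-\lambda)\frac{\gamma_0-i\gamma_1\lambda}{\gamma_0+i\gamma_1\lambda}e^{i\lambda x-\omega(\lambda)t}\,d\lambda\\&-\frac{i}{\pi}\int_{\mathcal{K}}\frac{e^{i\lambda x-\omega(\lambda)t}}{(1+\alpha\lambda^2)(i\gamma_1\lambda+\gamma_0)}\lambda\,\tilde{\zeta}(\lambda,t)\,d\lambda\\&+\frac{1}{2\pi}\int_{-\infty}^{\infty}\frac{e^{i\lambda x-\omega(\lambda)t}}{1+\alpha\lambda^2}F(\lambda,t)\,d\lambda-\frac{1}{2\pi}\int_{\mathcal{K}}\frac{e^{i\lambda x-\omega(\lambda)t}}{1+\alpha\lambda^2}\frac{\gamma_0-i\gamma_1\lambda}{\gamma_0+i\gamma_1\lambda}F(-\lambda,t)\,d\lambda,\end{aligned}$$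 where $\omega,\hat u_0,\tilde\zeta,F,\mathcal{K}$ are as defined in the context. Then $u(x,t)$ is $C^\infty$ (jointly) for $(x,t)\in\mathbb{R}^+\times\mathbb{R}^+$, it satisfies the differential equation $$\partial_t u-\alpha\,\partial_{xxt}u-\beta\,\partial_{xx}u=f\quad\text{in } \mathbb{R}^+\times\mathbb{R}^+,$$ $$\lim_{t\to0^+}u(x,t)=u_0(x),\quad\text{uniformly for } x>0,$$ and, for every $T>0$, $$\lim_{x\to0^+}\left\{\gamma_0[\alpha u_t(x,t)+\beta u(x,t)]+\gamma_1[\alpha u_{xt}(x,t)+\beta u_x(x,t)]\right\}=\zeta(t),\quad\text{uniformly for } 0<t\le T.$$
   Context: $\mathbb{R}^+=(0,\infty)$. $\mathcal{S}([0,\infty))$ is the space of functions $g\in C^\infty([0,\infty))$ with $\sup_{x\ge0}x^\ell|g^{(n)}(x)|<\infty$ for all nonnegative integers $n,\ell$. $C^\infty(\overline{\mathbb{R}^+\times\mathbb{R}^+})$ denotes functions smooth up to the boundary on $[0,\infty)\times[0,\infty)$. Notation: $$\omega(\lambda)=\frac{\beta\lambda^2}{1+\alpha\lambda^2},\qquad \hat u_0(\lambda)=\int_0^\infty e^{-i\lambda x}u_0(x)\,dx\quad(\operatorname{Im}\lambda\le0),$$ $$\tilde\zeta(\lambda,t)=\int_0^t e^{\omega(\lambda)\tau}\zeta(\tau)\,d\tau,\qquad \hat f(\lambda,t)=\int_0^\infty e^{-i\lambda x}f(x,t)\,dx\quad(\operatorname{Im}\lambda\le0),$$ $$F(\lambda,t)=\int_0^t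 e^{\omega(\lambda)\tau}\hat f(\lambda,\tau)\,d\tau\quad(\operatorname{Im}\lambda\le0).$$ Note that $\omega(-\lambda)=\omega(\lambda)$. $\mathcal{K}$ is a sufficiently small simple closed curve surrounding the point $i/\sqrt{\alpha}$, traversed counterclockwise: it lies, together with its interior, in $\{\operatorname{Im}\lambda>0\}$, and, if $\gamma_1\ne0$, the point $i\gamma_0/\gamma_1$ lies neither on $\mathcal{K}$ nor inside it. The integral $\int_{-\infty}^\infty\hat u_0(\lambda)e^{i\lambda x-\omega(\lambda)t}d\lambda$ is in general only conditionally convergent and is understood as an improper integral. *)

(* Defs.v *)
From Stdlib Require Import Reals.
From Coquelicot Require Import Coquelicot.

Open Scope R_scope.

(* [g' x] is the derivative of [g] at [x] relative to [D]: two-sided at interior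
   points of [D], one-sided at an end point of an interval [D]. *)
Definition derivative_on (D : R -> Prop) (g g' : R -> C) : Prop :=
  forall x : R, D x ->
    filterdiff (K := R_AbsRing) (U := R_NormedModule) (V := C_R_NormedModule)
      g (within D (locally x)) (fun h : R => scal h (g' x)).

Definition Rpos (x : R) : Prop := 0 < x.
Definition Rnonneg (x : R) : Prop := 0 <= x.

(* [G n] is the n-th derivative of [g] on [D]; its values off [D] are irrelevant. *)
Definition derivatives_on (D : R -> Prop) (g : R -> C) (G : nat -> R -> C) : Prop :=
  (forall x : R, D x -> G 0%nat x = g x) /\
  (forall n : nat, derivative_on D (G n) (G (S n))).

Definition smooth_on (D : R -> Prop) (g : R -> C) : Prop :=
  exists G : nat -> R -> C, derivatives_on D g G.

Definition schwartz_half_line (g : R -> C) : Prop :=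
  exists G : nat -> R -> C,
    derivatives_on Rnonneg g G /\
    forall n l : nat, exists M : R,
      forall x : R, 0 <= x -> x ^ l * Cmod (G n x) <= M.

(* [P n m] is the partial derivative of order [n] in the first variable and [m]
   in the second variable of [f], on the product [D * D]; all of them are jointly
   continuous there.  For [D := Rnonneg] this is smoothness up to the boundary of
   the quadrant, for [D := Rpos] joint smoothness in the open quadrant. *)
Definition partials_on (D : R -> Prop) (f : R -> R -> C)
    (P : nat -> nat -> R -> R -> C) : Prop :=
  (forall x t : R, D x -> D t -> P 0%nat 0%nat x t = f x t) /\
  (forall (n m : nat) (t : R), D t ->
     derivative_on D (fun x : R => P n m x t) (fun x : R => P (S n) m x t)) /\
  (forall (n m : nat) (x : R), D x ->
     derivative_on D (P n m x) (P n (S m) x)) /\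
  (forall n m : nat,
     continuous_on (T := prod_UniformSpace R_UniformSpace R_UniformSpace)
       (U := C_UniformSpace)
       (fun p : R * R => D (fst p) /\ D (snd p))
       (fun p : R * R => P n m (fst p) (snd p))).

Definition Cexp (z : C) : C :=
  (exp (Re z) * cos (Im z), exp (Re z) * sin (Im z)).

Definition CRInt (g : R -> C) (a b : R) : C :=
  RInt (V := C_R_CompleteNormedModule) g a b.

Definition half_line_int (g : R -> C) : C :=
  RInt_gen (V := C_R_CompleteNormedModule) g (at_point 0) (Rbar_locally p_infty).

(* Improper integrals over the whole line: both end points tend to infinity
   independently. *)
Definition real_line_int (h : C -> C) : C :=
  RInt_gen (V := C_R_CompleteNormedModule) (fun l : R => h (RtoC l))
    (Rbar_locally m_infty) (Rbar_locally p_infty).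

Definition ex_real_line_int (h : C -> C) : Prop :=
  ex_RInt_gen (V := C_R_NormedModule) (fun l : R => h (RtoC l))
    (Rbar_locally m_infty) (Rbar_locally p_infty).

Definition segment (a b x : R) : Prop := a <= x <= b.

Definition C1_on (a b : R) (g : R -> C) : Prop :=
  exists g' : R -> C,
    derivative_on (segment a b) g g' /\
    continuous_on (T := R_UniformSpace) (U := C_UniformSpace) (segment a b) g'.

Definition piecewise_C1 (K : R -> C) : Prop :=
  exists (N : nat) (s : nat -> R),
    s 0%nat = 0 /\ s N = 1 /\
    forall j : nat, (j < N)%nat -> s j < s (S j) /\ C1_on (s j) (s (S j)) K.

Definition simple_closed (K : R -> C) : Prop :=
  K 0 = K 1 /\
  forall s s' : R, 0 <= s < 1 -> 0 <= s' < 1 -> K s = K s' -> s = s'.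

Definition on_curve (K : R -> C) (z : C) : Prop :=
  exists s : R, 0 <= s <= 1 /\ K s = z.

(* The bounded component of the complement of the curve.  That complement is
   open, so its components are its path components. *)
Definition inside_curve (K : R -> C) (z : C) : Prop :=
  ~ on_curve K z /\
  exists M : R, forall c : R -> C,
    continuous_on (T := R_UniformSpace) (U := C_UniformSpace) (segment 0 1) c ->
    c 0 = z ->
    (forall s : R, 0 <= s <= 1 -> ~ on_curve K (c s)) ->
    Cmod (c 1) <= M.

(* [Derive] takes arbitrary values at the finitely many corners of a piecewise
   C^1 curve and at the end points, which does not affect the integral. *)
Definition velocity (K : R -> C) (s : R) : C :=
  (Derive (fun r : R => Re (K r)) s, Derive (fun r : R => Im (K r)) s).

Definition contour_int (K : R -> C) (h : C -> C) : C :=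
  CRInt (fun s : R => (h (K s) * velocity K s)%C) 0 1.

Definition winding_number (K : R -> C) (z : C) : C :=
  (/ (2 * PI * Ci) * contour_int K (fun l : C => / (l - z)))%C.

Definition counterclockwise (K : R -> C) : Prop :=
  forall z : C, inside_curve K z -> winding_number K z = 1%C.

Definition admissible_contour (alpha : R) (gamma0 gamma1 : C) (K : R -> C) : Prop :=
  piecewise_C1 K /\ simple_closed K /\ counterclockwise K /\
  inside_curve K (Ci / sqrt alpha)%C /\
  (forall z : C, on_curve K z \/ inside_curve K z -> 0 < Im z) /\
  (gamma1 <> 0%C ->
     ~ on_curve K (Ci * gamma0 / gamma1)%C /\
     ~ inside_curve K (Ci * gamma0 / gamma1)%C).

Definition omega (alpha beta : R) (l : C) : C :=
  (beta * l ^ 2 / (1 + alpha * l ^ 2))%C.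

Definition half_fourier (g : R -> C) (l : C) : C :=
  half_line_int (fun x : R => (Cexp (- (Ci * l * x)) * g x)%C).

Definition zeta_tilde (alpha beta : R) (zeta : R -> C) (l : C) (t : R) : C :=
  CRInt (fun tau : R => (Cexp (omega alpha beta l * tau) * zeta tau)%C) 0 t.

Definition F_transform (alpha beta : R) (f : R -> R -> C) (l : C) (t : R) : C :=
  CRInt (fun tau : R =>
    (Cexp (omega alpha beta l * tau) * half_fourier (fun x : R => f x tau) l)%C) 0 t.

Definition kernel (alpha beta x t : R) (l : C) : C :=
  Cexp (Ci * l * x - omega alpha beta l * t)%C.

Definition reflection (gamma0 gamma1 l : C) : C :=
  ((gamma0 - Ci * gamma1 * l) / (gamma0 + Ci * gamma1 * l))%C.

Definition u0_integrand (alpha beta : R) (u0 : R -> C) (x t : R) (l : C) : C :=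
  (half_fourier u0 l * kernel alpha beta x t l)%C.

Definition f_integrand (alpha beta : R) (f : R -> R -> C) (x t : R) (l : C) : C :=
  (kernel alpha beta x t l / (1 + alpha * l ^ 2) * F_transform alpha beta f l t)%C.

Definition solution (alpha beta : R) (gamma0 gamma1 : C) (u0 zeta : R -> C)
    (f : R -> R -> C) (K : R -> C) (x t : R) : C :=
  (  / (2 * PI) * real_line_int (u0_integrand alpha beta u0 x t)
   - / (2 * PI) * contour_int K (fun l : C =>
       half_fourier u0 (- l) * reflection gamma0 gamma1 l * kernel alpha beta x t l)
   - Ci / PI * contour_int K (fun l : C =>
       kernel alpha beta x t l / ((1 + alpha * l ^ 2) * (Ci * gamma1 * l + gamma0))
       * l * zeta_tilde alpha beta zeta l t)
   + / (2 * PI) * real_line_int (f_integrand alpha beta f x t)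
   - / (2 * PI) * contour_int K (fun l : C =>
       kernel alpha beta x t l / (1 + alpha * l ^ 2) * reflection gamma0 gamma1 l
       * F_transform alpha beta f (- l) t))%C.

(* Main.v *)
Require Import Defs.
From Stdlib Require Import Reals Arith Lra Lia Classical ClassicalEpsilon FunctionalExtensionality PropExtensionality.
From Coquelicot Require Import Coquelicot.

Open Scope R_scope.

(** Put [c = beta / alpha].  Then [omega l = c - c / (1 + alpha l^2)], so the integrands have an
    essential singularity at [i / sqrt alpha], which the contour surrounds, and a pole at the
    zero of [gamma0 + i gamma1 l], which lies outside.  The terms in [u0] and [f] also contain
    integrals over the whole line, not all of them absolutely convergent.  The proof turns
    everything into integrals over the compact contour, where differentiation and limits are
    harmless.

    The deformation of the line is [heat_line_contour]: for [z >= 0] the integral of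
    [exp (i l z) exp (mu / (1 + alpha l^2)) / (1 + alpha l^2)] over the line equals that over
    the contour.  For the powers of [1 / (1 + alpha l^2)] in place of the exponential, both
    integrals are bounded solutions of the same linear equations in [z]
    ([even_int_pow_int]), and Taylor's formula for the exponential does the rest.  On the contour,
    residues are computed from two facts only: exact integrands integrate to
    zero, and winding numbers are constant off the curve.  By Fubini the term with [F] becomes
    a convolution with this kernel, and then an integral over the contour ([f_integrand_line]).

    The integral with the transform of [u0] converges only conditionally.  Since
    [exp (- omega t)] differs from [exp (- c t)] by an integral over time
    ([relaxation_integral]), the [u0] term is, for each [l], the sum of
    [exp (- c t)] times the integrand of Fourier inversion and of the [f] term with the
    source [c exp (- c t) u0].  Hence the solution is [exp (- c t) u0 (x)] plus two
    functions [sol] with vanishing initial values, one for this source and one for the given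
    [f] and [zeta] ([solution_decomposition]).  Fourier inversion is proved in
    [fourier_inversion] by dividing by [1 + alpha l^2].

    Each [sol] is the contour integral of [evolution], the solution of an ordinary
    differential equation in [t] with the exponent [- omega] and the inhomogeneity [forcing].
    Differentiation under the integral gives smoothness, up to [x = 0] ([family_KI]).
    The operator of the equation maps the integrand to [(1 + alpha l^2) forcing], which is
    regular inside the contour and integrates to zero ([KI_forcing_regular]), plus the
    source times [l / (1 + alpha l^2)], whose residue gives back the source, plus an exact
    term ([sol_equation]).  At [x = 0] the reflected source cancels the free one in the
    boundary condition, and the same integrals give [zeta] ([robin_trace_0]).  Finally
    [sol] is [O(t)] uniformly in [x] ([sol_small]), while [exp (- c t) u0] has the right initial
    values and satisfies [alpha u_t + beta u = 0], so that it does not disturb the boundary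
    condition. *)

(** * Continuity and derivatives of complex-valued functions *)

(** [C] is regarded as a real normed space: this is the structure in which [derivative_on] and
    the complex integrals are stated. *)
Notation contp f p := (continuous (U := C_UniformSpace) f p).
Notation cont f := (forall p, continuous (U := C_UniformSpace) f p).
Notation der f x l :=
  (is_derive (K := R_AbsRing) (V := C_R_NormedModule) f x l).
Notation RR := (prod_UniformSpace R_UniformSpace R_UniformSpace).
Notation RRR := (prod_UniformSpace RR R_UniformSpace).

Lemma Cmod_ball (x y : C) (eps : R) : Cmod (y - x)%C < eps -> ball (M := C_UniformSpace) x eps y.
Proof. exact (C_NormedModule_mixin_compat1 x y eps). Qed.

Lemma contp_iff {T : UniformSpace} (f : T -> C) (p : T) :
  contp f p <->
  forall eps, 0 < eps -> locally p (fun q => Cmod (f q - f p)%C < eps).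
Proof.
  split.
  - intros H eps Heps.
    assert (He : 0 < eps / sqrt 2).
    { apply Rdiv_lt_0_compat; [exact Heps | apply sqrt_lt_R0; lra]. }
    specialize (H _ (locally_ball (f p) (mkposreal _ He))).
    unfold filtermap in H.
    revert H; apply filter_imp; intros q Hq.
    apply (C_NormedModule_mixin_compat2 (f p) (f q)) in Hq.
    simpl in Hq.
    replace eps with (sqrt 2 * (eps / sqrt 2)); [exact Hq |].
    field. apply Rgt_not_eq, sqrt_lt_R0; lra.
  - intros H P [eps HP].
    specialize (H eps (cond_pos eps)).
    unfold filtermap. revert H; apply filter_imp; intros q Hq.
    apply HP, Cmod_ball, Hq.
Qed.

Lemma contp_ext {T : UniformSpace} (f g : T -> C) (p : T) :
  (forall q, f q = g q) -> contp f p -> contp g p.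
Proof. exact (continuous_ext f g p). Qed.

Lemma contp_pair {T : UniformSpace} (f g : T -> R) (p : T) :
  continuous f p -> continuous g p -> contp (fun q => (f q, g q) : C) p.
Proof.
  intros Hf Hg.
  apply (continuous_comp_2 f g (fun a b => (a, b) : C)); trivial.
  apply continuous_ext with (f := fun z : R * R => z).
  - now intros [a b].
  - apply continuous_id.
Qed.

Lemma contp_Re {T : UniformSpace} (f : T -> C) (p : T) :
  contp f p -> continuous (fun q => Re (f q)) p.
Proof. intros H. apply (continuous_comp f (fun z : C => fst z)); [exact H |]. apply continuous_fst. Qed.

Lemma contp_Im {T : UniformSpace} (f : T -> C) (p : T) :
  contp f p -> continuous (fun q => Im (f q)) p.
Proof. intros H. apply (continuous_comp f (fun z : C => snd z)); [exact H |]. apply continuous_snd. Qed.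

Lemma contp_const {T : UniformSpace} (c : C) (p : T) : contp (fun _ : T => c) p.
Proof. apply continuous_const. Qed.

Lemma contp_RtoC {T : UniformSpace} (f : T -> R) (p : T) :
  continuous f p -> contp (fun q => RtoC (f q)) p.
Proof. intros H. apply contp_pair; [exact H | apply continuous_const]. Qed.

Lemma contp_plus {T : UniformSpace} (f g : T -> C) (p : T) :
  contp f p -> contp g p -> contp (fun q => f q + g q)%C p.
Proof. intros Hf Hg. exact (continuous_plus (V := C_R_NormedModule) f g p Hf Hg). Qed.

Lemma contp_opp {T : UniformSpace} (f : T -> C) (p : T) :
  contp f p -> contp (fun q => - f q)%C p.
Proof. intros Hf. exact (continuous_opp (V := C_R_NormedModule) f p Hf). Qed.

Lemma contp_minus {T : UniformSpace} (f g : T -> C) (p : T) :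
  contp f p -> contp g p -> contp (fun q => f q - g q)%C p.
Proof. intros Hf Hg. apply contp_plus; [exact Hf | now apply contp_opp]. Qed.

Lemma contR_mult {T : UniformSpace} (f g : T -> R) (p : T) :
  continuous f p -> continuous g p -> continuous (fun q => f q * g q) p.
Proof. intros Hf Hg. exact (continuous_mult (K := R_AbsRing) f g p Hf Hg). Qed.

Lemma contR_plus {T : UniformSpace} (f g : T -> R) (p : T) :
  continuous f p -> continuous g p -> continuous (fun q => f q + g q) p.
Proof. intros Hf Hg. exact (continuous_plus (V := R_NormedModule) f g p Hf Hg). Qed.

Lemma contR_opp {T : UniformSpace} (f : T -> R) (p : T) :
  continuous f p -> continuous (fun q => - f q) p.
Proof. intros Hf. exact (continuous_opp (V := R_NormedModule) f p Hf). Qed.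

Lemma contR_minus {T : UniformSpace} (f g : T -> R) (p : T) :
  continuous f p -> continuous g p -> continuous (fun q => f q - g q) p.
Proof. intros Hf Hg. apply contR_plus; [exact Hf | now apply contR_opp]. Qed.

Lemma contR_comp {T : UniformSpace} (f : T -> R) (g : R -> R) (p : T) :
  continuous f p -> continuity_pt g (f p) -> continuous (fun q => g (f q)) p.
Proof.
  intros Hf Hg. apply (continuous_comp f g); [exact Hf |].
  now apply continuity_pt_filterlim.
Qed.

Ltac ct_real :=
  repeat match goal with
  | |- continuous (fun q => Rplus _ _) _ => apply contR_plus
  | |- continuous (fun q => Rminus _ _) _ => apply contR_minus
  | |- continuous (fun q => Rmult _ _) _ => apply contR_mult
  | |- continuous (fun q => Ropp _) _ => apply contR_opp
  | |- continuous (fun q => Re _) _ => apply contp_Re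
  | |- continuous (fun q => Im _) _ => apply contp_Im
  | |- continuous (fun _ => ?c) _ => apply continuous_const
  | H : _ |- _ => exact H
  end.

Lemma contp_mult {T : UniformSpace} (f g : T -> C) (p : T) :
  contp f p -> contp g p -> contp (fun q => f q * g q)%C p.
Proof.
  intros Hf Hg.
  refine (contp_pair (fun q => Re (f q) * Re (g q) - Im (f q) * Im (g q))
                     (fun q => Re (f q) * Im (g q) + Im (f q) * Re (g q)) p _ _); ct_real.
Qed.

Lemma contp_inv {T : UniformSpace} (f : T -> C) (p : T) :
  f p <> 0%C -> contp f p -> contp (fun q => / f q)%C p.
Proof.
  intros Hn Hf.
  assert (Hd : Re (f p) * Re (f p) + Im (f p) * Im (f p) <> 0).
  { replace (_ + _) with (Cmod (f p) ^ 2) by (rewrite Cmod2_alt; ring).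
    apply pow_nonzero, Rgt_not_eq, Cmod_gt_0, Hn. }
  assert (Hi : continuous (fun q => / (Re (f q) * Re (f q) + Im (f q) * Im (f q))) p).
  { refine (contR_comp (fun q => Re (f q) * Re (f q) + Im (f q) * Im (f q)) Rinv p _ _).
    - ct_real.
    - apply (continuity_pt_inv id); [apply derivable_continuous_pt, derivable_pt_id | exact Hd]. }
  apply (continuous_ext (fun q => (Re (f q) * / (Re (f q) * Re (f q) + Im (f q) * Im (f q)),
     - Im (f q) * / (Re (f q) * Re (f q) + Im (f q) * Im (f q))) : C)).
  { intros q. unfold Cinv, Rdiv, Re, Im. simpl. rewrite !Rmult_1_r. reflexivity. }
  refine (contp_pair (fun q => Re (f q) * / (Re (f q) * Re (f q) + Im (f q) * Im (f q)))
          (fun q => - Im (f q) * / (Re (f q) * Re (f q) + Im (f q) * Im (f q))) p _ _); ct_real.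
Qed.

Lemma contp_div {T : UniformSpace} (f g : T -> C) (p : T) :
  g p <> 0%C -> contp f p -> contp g p -> contp (fun q => f q / g q)%C p.
Proof. intros Hn Hf Hg. apply contp_mult; [exact Hf | now apply contp_inv]. Qed.

Lemma contp_pow {T : UniformSpace} (f : T -> C) (n : nat) (p : T) :
  contp f p -> contp (fun q => f q ^ n)%C p.
Proof.
  intros Hf. induction n as [|n IH]; simpl.
  - apply contp_const.
  - now apply contp_mult.
Qed.

Lemma contp_Cexp {T : UniformSpace} (f : T -> C) (p : T) :
  contp f p -> contp (fun q => Cexp (f q)) p.
Proof.
  intros Hf. unfold Cexp.
  apply contp_pair; apply contR_mult.
  - apply (contR_comp (fun q => Re (f q)) exp); [now apply contp_Re |].
    apply derivable_continuous_pt, derivable_pt_exp.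
  - apply (contR_comp (fun q => Im (f q)) cos); [now apply contp_Im |].
    apply continuity_cos.
  - apply (contR_comp (fun q => Re (f q)) exp); [now apply contp_Re |].
    apply derivable_continuous_pt, derivable_pt_exp.
  - apply (contR_comp (fun q => Im (f q)) sin); [now apply contp_Im |].
    apply continuity_sin.
Qed.

Lemma contR_Cmod {T : UniformSpace} (f : T -> C) (p : T) :
  contp f p -> continuous (fun q => Cmod (f q)) p.
Proof.
  intros Hf.
  apply (continuous_ext (fun q => sqrt (Re (f q) * Re (f q) + Im (f q) * Im (f q)))).
  { intros q. unfold Cmod, Re, Im. f_equal. ring. }
  refine (contR_comp (fun q => Re (f q) * Re (f q) + Im (f q) * Im (f q)) sqrt p _ _); [ct_real |].
  apply continuity_pt_sqrt. nra.
Qed.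

Lemma contp_app {T : UniformSpace} (f : R -> C) (g : T -> R) (p : T) :
  cont f -> continuous g p -> contp (fun q => f (g q)) p.
Proof. intros Hf Hg. apply (continuous_comp g f); [exact Hg | apply Hf]. Qed.

Lemma contp_app2 {T : UniformSpace} (f : R -> R -> C) (g1 g2 : T -> R) (p : T) :
  cont (fun q : RR => f (fst q) (snd q)) ->
  continuous g1 p -> continuous g2 p -> contp (fun q => f (g1 q) (g2 q)) p.
Proof. intros Hf H1 H2. apply (continuous_comp_2 g1 g2 f); trivial. Qed.

Lemma contp_app3 {T : UniformSpace} (f : R -> R -> R -> C) (g1 g2 g3 : T -> R) (p : T) :
  cont (fun q : RRR => f (fst (fst q)) (snd (fst q)) (snd q)) ->
  continuous g1 p -> continuous g2 p -> continuous g3 p ->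
  contp (fun q => f (g1 q) (g2 q) (g3 q)) p.
Proof.
  intros Hf H1 H2 H3.
  apply (continuous_comp_2 (V := RR) (fun q => (g1 q, g2 q)) g3
           (fun z c => f (fst z) (snd z) c)); trivial.
  apply (continuous_comp_2 g1 g2 (fun a b => (a, b))); trivial.
  apply continuous_ext with (f := fun z : R * R => z).
  - now intros [a b].
  - apply continuous_id.
Qed.

Lemma contp_fst {T1 T2 : UniformSpace} (p : T1 * T2) :
  continuous (fun q : prod_UniformSpace T1 T2 => fst q) p.
Proof. destruct p. apply continuous_fst. Qed.

Lemma contp_snd {T1 T2 : UniformSpace} (p : T1 * T2) :
  continuous (fun q : prod_UniformSpace T1 T2 => snd q) p.
Proof. destruct p. apply continuous_snd. Qed.

Lemma contR_fst {T1 T2 : UniformSpace} {V : UniformSpace} (f : T1 -> V) (p : T1 * T2) :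
  continuous f (fst p) -> continuous (fun q : prod_UniformSpace T1 T2 => f (fst q)) p.
Proof.
  intros H. destruct p as [a b].
  apply (continuous_comp (U := prod_UniformSpace T1 T2) fst f); [apply continuous_fst | exact H].
Qed.

Lemma contR_snd {T1 T2 : UniformSpace} {V : UniformSpace} (f : T2 -> V) (p : T1 * T2) :
  continuous f (snd p) -> continuous (fun q : prod_UniformSpace T1 T2 => f (snd q)) p.
Proof.
  intros H. destruct p as [a b].
  apply (continuous_comp (U := prod_UniformSpace T1 T2) snd f); [apply continuous_snd | exact H].
Qed.

Lemma contp_fst_comp {S T1 T2 : UniformSpace} (f : S -> T1 * T2) (p : S) :
  continuous (U := prod_UniformSpace T1 T2) f p -> continuous (fun q => fst (f q)) p.
Proof. intros H. apply (continuous_comp f fst); [exact H | apply contp_fst]. Qed.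

Lemma contp_snd_comp {S T1 T2 : UniformSpace} (f : S -> T1 * T2) (p : S) :
  continuous (U := prod_UniformSpace T1 T2) f p -> continuous (fun q => snd (f q)) p.
Proof. intros H. apply (continuous_comp f snd); [exact H | apply contp_snd]. Qed.

Lemma contR_Rmax {T : UniformSpace} (f g : T -> R) (p : T) :
  continuous f p -> continuous g p -> continuous (fun q => Rmax (f q) (g q)) p.
Proof.
  intros Hf Hg.
  apply continuous_ext with (f := fun q => (f q + g q + Rabs (f q - g q)) * / 2).
  - intros q. unfold Rmax, Rabs. destruct Rle_dec; destruct Rcase_abs; lra.
  - apply contR_mult; [apply contR_plus; [ct_real |] | ct_real].
    apply (contR_comp (fun q => f q - g q) Rabs); [now apply contR_minus |].
    apply Rcontinuity_abs.
Qed.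

(** The hypotheses come first, so that the continuity of an unknown function, possibly of
    several variables, is found in the context before the goal is split any further. *)
Ltac ct_step :=
  match goal with
  | H : _ |- _ => exact H
  | H : forall p, continuous ?f p |- continuous ?f _ => apply H
  | |- continuous (fun _ => ?c) _ => apply continuous_const
  | |- continuous (fun q => q) _ => apply continuous_id
  | |- continuous fst _ => apply contp_fst
  | |- continuous snd _ => apply contp_snd
  | |- continuous (fun q => fst q) _ => apply contp_fst
  | |- continuous (fun q => snd q) _ => apply contp_snd
  | |- continuous (fun q => Cplus _ _) _ => apply contp_plus
  | |- continuous (fun q => Cminus _ _) _ => apply contp_minus
  | |- continuous (fun q => Cmult _ _) _ => apply contp_mult
  | |- continuous (fun q => Copp _) _ => apply contp_opp
  | |- continuous (fun q => Cpow _ _) _ => apply contp_pow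
  | |- continuous (fun q => Cexp _) _ => apply contp_Cexp
  | |- continuous (fun q => Cdiv _ _) _ => apply contp_div
  | |- continuous (fun q => Cinv _) _ => apply contp_inv
  | |- continuous (fun q => RtoC _) _ => apply contp_RtoC
  | |- continuous (Rminus ?c) _ => apply (contR_minus (fun _ => c) (fun q => q))
  | |- continuous (Rplus ?c) _ => apply (contR_plus (fun _ => c) (fun q => q))
  | |- continuous (Rmult ?c) _ => apply (contR_mult (fun _ => c) (fun q => q))
  | |- continuous (Cmult ?c) _ => apply (contp_mult (fun _ => c) (fun q => q))
  | |- continuous RtoC _ => apply (contp_RtoC (fun q => q))
  | |- continuous (fun q => Rplus _ _) _ => apply contR_plus
  | |- continuous (fun q => Rminus _ _) _ => apply contR_minus
  | |- continuous (fun q => Rmult _ _) _ => apply contR_mult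
  | |- continuous (fun q => Ropp _) _ => apply contR_opp
  | |- continuous (fun q => Rmax _ _) _ => apply contR_Rmax
  | |- continuous (fun q => Cmod _) _ => apply contR_Cmod
  | H : forall p, continuous (fun q => ?f (fst (fst q)) (snd (fst q)) (snd q)) p
      |- continuous (fun q => ?f _ _ _) _ => apply (contp_app3 f); [exact H | | | ]
  | H : forall p, continuous (fun q => ?f (fst q) (snd q)) p
      |- continuous (fun q => ?f _ _) _ => apply (contp_app2 f); [exact H | | ]
  | H : forall p, continuous (fun r => ?g (?k r)) p
      |- continuous (fun q => ?g (?k _)) _ => apply (contp_app (fun r => g (k r))); [exact H | ]
  | H : forall p, continuous ?f p
      |- continuous (fun q => ?f _) _ => apply (contp_app f); [exact H | ]
  | |- continuous (fun q => fst _) _ => apply contp_fst_comp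
  | |- continuous (fun q => snd _) _ => apply contp_snd_comp
  | |- continuous (fun q => _ (fst q)) _ => apply contR_fst
  | |- continuous (fun q => _ (snd q)) _ => apply contR_snd
  end.
Ltac ct := intros; repeat ct_step.

Lemma der_pair (f g : R -> R) (x a b : R) :
  is_derive f x a -> is_derive g x b -> der (fun y => (f y, g y) : C) x (a, b).
Proof.
  intros Hf Hg.
  apply (filterdiff_ext_lin _ (fun h : R => (scal h a, scal h b) : C)).
  2: { intros h. reflexivity. }
  apply (filterdiff_comp_2 (K := R_AbsRing) (T := R_NormedModule) (U := R_NormedModule)
          (V := R_NormedModule) (W := C_R_NormedModule) f g (fun u v : R => (u, v) : C)
          (fun h => scal h a) (fun h => scal h b) (fun u v : R => (u, v) : C)).
  - exact Hf.
  - exact Hg.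
  - apply filterdiff_ext with (f := fun t : R * R => t).
    + now intros [u v].
    + apply (filterdiff_ext_lin _ (fun t : R * R => t)).
      * apply filterdiff_id.
      * now intros [u v].
Qed.

Lemma der_Re (f : R -> C) (x : R) (l : C) : der f x l -> is_derive (fun y => Re (f y)) x (Re l).
Proof.
  intros H.
  apply (filterdiff_ext_lin _ (fun h : R => fst (scal (V := C_R_NormedModule) h l))).
  2: { intros h. reflexivity. }
  apply (filterdiff_comp' (V := C_R_NormedModule) (W := R_NormedModule) f (fun z : C => fst z) x
           (fun h => scal h l) (fun z => fst z)).
  - exact H.
  - apply filterdiff_linear, is_linear_fst.
Qed.

Lemma der_Im (f : R -> C) (x : R) (l : C) : der f x l -> is_derive (fun y => Im (f y)) x (Im l).
Proof.
  intros H.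
  apply (filterdiff_ext_lin _ (fun h : R => snd (scal (V := C_R_NormedModule) h l))).
  2: { intros h. reflexivity. }
  apply (filterdiff_comp' (V := C_R_NormedModule) (W := R_NormedModule) f (fun z : C => snd z) x
           (fun h => scal h l) (fun z => snd z)).
  - exact H.
  - apply filterdiff_linear, is_linear_snd.
Qed.

Lemma der_of_parts (f : R -> C) (x : R) (l : C) :
  is_derive (fun y => Re (f y)) x (Re l) -> is_derive (fun y => Im (f y)) x (Im l) -> der f x l.
Proof.
  intros H1 H2. rewrite (surjective_pairing l).
  apply (is_derive_ext (fun y => (Re (f y), Im (f y)) : C)).
  - intros t. symmetry. apply surjective_pairing.
  - now apply der_pair.
Qed.

Lemma der_eq (f : R -> C) (x : R) (l l' : C) : l = l' -> der f x l -> der f x l'.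
Proof. now intros ->. Qed.

Lemma der_ext (f g : R -> C) (x : R) (l : C) :
  (forall t, f t = g t) -> der f x l -> der g x l.
Proof. intros H Hf. exact (is_derive_ext (V := C_R_NormedModule) f g x l H Hf). Qed.

Lemma der_cont (f : R -> C) (x : R) (l : C) : der f x l -> contp f x.
Proof.
  intros H. apply (ex_derive_continuous (V := C_R_NormedModule) f x). now exists l.
Qed.

Lemma der_const (c : C) (x : R) : der (fun _ => c) x (RtoC 0).
Proof. exact (is_derive_const (V := C_R_NormedModule) c x). Qed.

Lemma der_RtoC (f : R -> R) (x l : R) : is_derive f x l -> der (fun y => RtoC (f y)) x (RtoC l).
Proof. intros H. apply der_pair; [exact H |]. apply (is_derive_const (V := R_NormedModule) 0 x). Qed.

Lemma der_id (x : R) : der (fun y => RtoC y) x (RtoC 1).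
Proof. apply der_RtoC. apply (is_derive_id (K := R_AbsRing)). Qed.

Lemma der_plus (f g : R -> C) (x : R) (a b : C) :
  der f x a -> der g x b -> der (fun y => f y + g y)%C x (a + b)%C.
Proof. intros Hf Hg. exact (is_derive_plus (V := C_R_NormedModule) f g x a b Hf Hg). Qed.

Lemma der_opp (f : R -> C) (x : R) (a : C) : der f x a -> der (fun y => - f y)%C x (- a)%C.
Proof. intros Hf. exact (is_derive_opp (V := C_R_NormedModule) f x a Hf). Qed.

Lemma der_minus (f g : R -> C) (x : R) (a b : C) :
  der f x a -> der g x b -> der (fun y => f y - g y)%C x (a - b)%C.
Proof. intros Hf Hg. apply der_plus; [exact Hf | now apply der_opp]. Qed.

Lemma derR_mult (f g : R -> R) (x a b : R) :
  is_derive f x a -> is_derive g x b ->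
  is_derive (fun y => f y * g y) x (a * g x + f x * b).
Proof. intros Hf Hg. exact (is_derive_mult f g x a b Hf Hg Rmult_comm). Qed.

Lemma der_mult (f g : R -> C) (x : R) (a b : C) :
  der f x a -> der g x b -> der (fun y => f y * g y)%C x (a * g x + f x * b)%C.
Proof.
  intros Hf Hg.
  pose proof (der_Re _ _ _ Hf) as f1. pose proof (der_Im _ _ _ Hf) as f2.
  pose proof (der_Re _ _ _ Hg) as g1. pose proof (der_Im _ _ _ Hg) as g2.
  apply der_of_parts.
  - replace (Re (a * g x + f x * b)%C) with
      ((Re a * Re (g x) + Re (f x) * Re b) - (Im a * Im (g x) + Im (f x) * Im b))
      by (simpl; unfold Re, Im; ring).
    apply (is_derive_minus (fun y => Re (f y) * Re (g y)) (fun y => Im (f y) * Im (g y)));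
      now apply derR_mult.
  - replace (Im (a * g x + f x * b)%C) with
      ((Re a * Im (g x) + Re (f x) * Im b) + (Im a * Re (g x) + Im (f x) * Re b))
      by (simpl; unfold Re, Im; ring).
    apply (is_derive_plus (fun y => Re (f y) * Im (g y)) (fun y => Im (f y) * Re (g y)));
      now apply derR_mult.
Qed.

Lemma der_Cmult_l (c : C) (f : R -> C) (x : R) (a : C) :
  der f x a -> der (fun y => c * f y)%C x (c * a)%C.
Proof.
  intros Hf. eapply der_eq; [| apply (der_mult (fun _ => c) f); [apply der_const | exact Hf]].
  simpl. ring.
Qed.

Lemma der_Cmult_r (c : C) (f : R -> C) (x : R) (a : C) :
  der f x a -> der (fun y => f y * c)%C x (a * c)%C.
Proof.
  intros Hf. eapply der_eq; [| apply (der_mult f (fun _ => c)); [exact Hf | apply der_const]].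
  ring.
Qed.

Lemma der_Cexp (f : R -> C) (x : R) (a : C) :
  der f x a -> der (fun y => Cexp (f y)) x (a * Cexp (f x))%C.
Proof.
  intros Hf.
  pose proof (der_Re _ _ _ Hf) as f1. pose proof (der_Im _ _ _ Hf) as f2.
  assert (E : is_derive (fun y => exp (Re (f y))) x (Re a * exp (Re (f x)))).
  { apply (is_derive_comp exp (fun y => Re (f y))); [apply is_derive_exp | exact f1]. }
  apply der_of_parts; unfold Cexp; simpl.
  - replace (_ - _) with
      (Re a * exp (Re (f x)) * cos (Im (f x))
       + exp (Re (f x)) * (Im a * - sin (Im (f x)))) by (unfold Re, Im; ring).
    apply (derR_mult (fun y => exp (Re (f y))) (fun y => cos (Im (f y)))); [exact E |].
    apply (is_derive_comp cos (fun y => Im (f y))); [apply is_derive_cos | exact f2].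
  - replace (_ + _) with
      (Re a * exp (Re (f x)) * sin (Im (f x))
       + exp (Re (f x)) * (Im a * cos (Im (f x)))) by (unfold Re, Im; ring).
    apply (derR_mult (fun y => exp (Re (f y))) (fun y => sin (Im (f y)))); [exact E |].
    apply (is_derive_comp sin (fun y => Im (f y))); [apply is_derive_sin | exact f2].
Qed.

Lemma der_inv (f : R -> C) (x : R) (a : C) :
  f x <> 0%C -> der f x a -> der (fun y => / f y)%C x (- a / (f x * f x))%C.
Proof.
  intros Hn Hf.
  pose proof (der_Re _ _ _ Hf) as f1. pose proof (der_Im _ _ _ Hf) as f2.
  assert (Hd : Re (f x) ^ 2 + Im (f x) ^ 2 <> 0).
  { rewrite <- Cmod2_alt. apply pow_nonzero, Rgt_not_eq, Cmod_gt_0, Hn. }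
  assert (D : is_derive (fun y => Re (f y) ^ 2 + Im (f y) ^ 2) x
                (2 * Re a * Re (f x) + 2 * Im a * Im (f x))).
  { replace (2 * Re a * Re (f x) + 2 * Im a * Im (f x)) with
      ((Re a * Re (f x) + Re (f x) * Re a) + (Im a * Im (f x) + Im (f x) * Im a)) by ring.
    apply (is_derive_ext (fun y => Re (f y) * Re (f y) + Im (f y) * Im (f y))).
    { intros t; simpl; ring. }
    apply (is_derive_plus (fun y => Re (f y) * Re (f y)) (fun y => Im (f y) * Im (f y)));
      now apply derR_mult. }
  apply der_of_parts.
  - apply (is_derive_ext (fun y => Re (f y) / (Re (f y) ^ 2 + Im (f y) ^ 2)));
      [intros t; reflexivity |].
    evar_last.
    + apply (is_derive_div (fun y => Re (f y)) (fun y => Re (f y) ^ 2 + Im (f y) ^ 2));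
        [exact f1 | exact D | exact Hd].
    + destruct a as [a1 a2], (f x) as [u v]. unfold Re, Im in *. simpl in *. field.
      split; intros E; apply Hd; nra.
  - apply (is_derive_ext (fun y => - Im (f y) / (Re (f y) ^ 2 + Im (f y) ^ 2)));
      [intros t; reflexivity |].
    evar_last.
    + apply (is_derive_div (fun y => - Im (f y)) (fun y => Re (f y) ^ 2 + Im (f y) ^ 2));
        [apply (is_derive_opp (V := R_NormedModule)); exact f2 | exact D | exact Hd].
    + destruct a as [a1 a2], (f x) as [u v]. unfold opp, Re, Im in *. simpl in *. field.
      split; intros E; apply Hd; nra.
Qed.

Lemma der_pow (f : R -> C) (n : nat) (x : R) (a : C) :
  der f x a -> der (fun y => f y ^ S n)%C x (INR (S n) * f x ^ n * a)%C.
Proof.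
  intros Hf. induction n as [|n IH].
  - eapply der_eq; [| apply (is_derive_ext (V := C_R_NormedModule) f);
      [intros t; simpl; symmetry; apply Cmult_1_r | exact Hf]].
    simpl. ring.
  - eapply der_eq; [| apply (is_derive_ext (V := C_R_NormedModule) (fun y => f y * f y ^ S n)%C);
      [intros t; reflexivity | apply der_mult; [exact Hf | exact IH]]].
    rewrite (S_INR (S n)), RtoC_plus. simpl Cpow. ring.
Qed.

Lemma Cexp_plus (z w : C) : Cexp (z + w) = (Cexp z * Cexp w)%C.
Proof.
  unfold Cexp, Cmult; simpl. unfold Re, Im; simpl.
  rewrite exp_plus, cos_plus, sin_plus. apply injective_projections; simpl; ring.
Qed.

Lemma Cexp_0 : Cexp 0 = 1%C.
Proof. unfold Cexp; simpl. rewrite exp_0, cos_0, sin_0. apply injective_projections; simpl; ring. Qed.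

Lemma Cexp_RtoC (x : R) : Cexp x = RtoC (exp x).
Proof. unfold Cexp; simpl. rewrite cos_0, sin_0. apply injective_projections; simpl; ring. Qed.

Lemma Cmod_Cexp (z : C) : Cmod (Cexp z) = exp (Re z).
Proof.
  unfold Cmod, Cexp; simpl.
  transitivity (sqrt (Rsqr (exp (Re z)))); [| apply sqrt_Rsqr, Rlt_le, exp_pos].
  f_equal. pose proof (sin2_cos2 (Im z)) as H. unfold Rsqr in *.
  transitivity (exp (Re z) * exp (Re z) * (sin (Im z) * sin (Im z) + cos (Im z) * cos (Im z))).
  - unfold Re, Im. ring.
  - rewrite H. ring.
Qed.

Lemma Cexp_opp_l (z : C) : (Cexp (- z) * Cexp z)%C = 1%C.
Proof. rewrite <- Cexp_plus. replace (- z + z)%C with (RtoC 0) by ring. apply Cexp_0. Qed.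

(** * Integrals over segments, with parameters *)

Notation cont2 h := (cont (fun q : RR => h (fst q) (snd q))).

(** Cover the segment by finitely many intervals on which [h] varies by less than [eps / 2];
    the smallest of their radii serves for all [s] at once. *)
Lemma tube {T : UniformSpace} (h : T -> R -> C) (p0 : T) (a b : R) :
  (forall s, a <= s <= b ->
     contp (fun q : prod_UniformSpace T R_UniformSpace => h (fst q) (snd q)) (p0, s)) ->
  forall eps, 0 < eps ->
  locally p0 (fun p => forall s, a <= s <= b -> Cmod (h p s - h p0 s)%C < eps).
Proof.
  intros H eps Heps.
  assert (Hd : forall s, exists d : posreal, a <= s <= b ->
    forall p s', ball p0 d p -> Rabs (s' - s) < d -> Cmod (h p s' - h p0 s)%C < eps / 2).
  { intros s. destruct (classic (a <= s <= b)) as [Hs | Hs].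
    - specialize (H s Hs). apply contp_iff with (eps := eps / 2) in H; [| lra].
      destruct H as [d Hd]. exists d. intros _ p s' Hp Hs'.
      apply (Hd (p, s')). split; [exact Hp | exact Hs'].
    - exists (mkposreal 1 Rlt_0_1). intros Hs'. contradiction. }
  pose (delta := fun s => proj1_sig (constructive_indefinite_description _ (Hd s))).
  assert (Hdelta : forall s, a <= s <= b ->
    forall p s', ball p0 (delta s) p -> Rabs (s' - s) < delta s ->
      Cmod (h p s' - h p0 s)%C < eps / 2).
  { intros s. exact (proj2_sig (constructive_indefinite_description _ (Hd s))). }
  destruct (compactness_value_1d a b delta) as [d Hcd].
  exists d. intros p Hp s Hs. apply NNPP. intros Hn.
  apply (Hcd s Hs). intros [t [Ht [Hst Hdt]]]. apply Hn.
  replace (h p s - h p0 s)%C with ((h p s - h p0 t) - (h p0 s - h p0 t))%C by ring.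
  apply Rle_lt_trans with (Cmod (h p s - h p0 t)%C + Cmod (h p0 s - h p0 t)%C).
  { unfold Cminus at 1. eapply Rle_trans; [apply Cmod_triangle |]. rewrite Cmod_opp. lra. }
  pose proof (Hdelta t Ht p s (ball_le _ _ _ Hdt _ Hp) Hst).
  pose proof (Hdelta t Ht p0 s (ball_center p0 (delta t)) Hst). lra.
Qed.

Lemma bounded_on_segment (g : R -> C) (a b : R) :
  (forall s, a <= s <= b -> contp g s) -> exists M, forall s, a <= s <= b -> Cmod (g s) <= M.
Proof.
  intros H. destruct (Rle_dec a b) as [Hab | Hab].
  - assert (Hc : forall s, a <= s <= b -> continuity_pt (fun s => Cmod (g s)) s).
    { intros s Hs. apply continuity_pt_filterlim. apply (contR_Cmod g s), H, Hs. }
    destruct (continuity_ab_maj (fun s => Cmod (g s)) a b Hab Hc) as [m [Hm _]].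
    exists (Cmod (g m)). exact Hm.
  - exists 0. intros s Hs. lra.
Qed.

Lemma scal_C (k : R) (z : C) : scal (V := C_R_NormedModule) k z = (RtoC k * z)%C.
Proof.
  destruct z as [x y]. unfold scal; simpl. unfold prod_scal, scal; simpl. unfold mult; simpl.
  unfold Cmult; simpl. apply injective_projections; simpl; ring.
Qed.

Lemma norm_C (z : C) : norm (V := C_R_NormedModule) z = Cmod z.
Proof. symmetry. exact (Cmod_norm z). Qed.

Lemma ex_CRInt (g : R -> C) (a b : R) : cont g -> ex_RInt (V := C_R_CompleteNormedModule) g a b.
Proof. intros H. apply (ex_RInt_continuous (V := C_R_CompleteNormedModule)). intros z _. apply H. Qed.

Lemma is_CRInt (g : R -> C) (a b : R) : cont g -> is_RInt (V := C_R_NormedModule) g a b (CRInt g a b).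
Proof. intros H. exact (RInt_correct (V := C_R_CompleteNormedModule) g a b (ex_CRInt g a b H)). Qed.

Lemma CRInt_unique (g : R -> C) (a b : R) (l : C) :
  is_RInt (V := C_R_NormedModule) g a b l -> CRInt g a b = l.
Proof. intros H. exact (is_RInt_unique (V := C_R_CompleteNormedModule) g a b l H). Qed.

Lemma CRInt_ext (f g : R -> C) (a b : R) :
  (forall x, Rmin a b < x < Rmax a b -> f x = g x) -> CRInt f a b = CRInt g a b.
Proof. intros H. apply (RInt_ext (V := C_R_CompleteNormedModule)). exact H. Qed.

Lemma CRInt_point (f : R -> C) (a : R) : CRInt f a a = RtoC 0.
Proof. exact (RInt_point (V := C_R_CompleteNormedModule) a f). Qed.

Lemma CRInt_plus (f g : R -> C) (a b : R) :
  cont f -> cont g -> CRInt (fun x => f x + g x)%C a b = (CRInt f a b + CRInt g a b)%C.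
Proof.
  intros Hf Hg. exact (RInt_plus (V := C_R_CompleteNormedModule) f g a b
    (ex_CRInt f a b Hf) (ex_CRInt g a b Hg)).
Qed.

Lemma CRInt_opp (f : R -> C) (a b : R) :
  cont f -> CRInt (fun x => - f x)%C a b = (- CRInt f a b)%C.
Proof.
  intros Hf. exact (RInt_opp (V := C_R_CompleteNormedModule) f a b (ex_CRInt f a b Hf)).
Qed.

Lemma CRInt_minus (f g : R -> C) (a b : R) :
  cont f -> cont g -> CRInt (fun x => f x - g x)%C a b = (CRInt f a b - CRInt g a b)%C.
Proof.
  intros Hf Hg. unfold Cminus. rewrite CRInt_plus, CRInt_opp; trivial. ct.
Qed.

Lemma is_CRInt_Cmult (c : C) (f : R -> C) (a b : R) (l : C) :
  is_RInt (V := C_R_NormedModule) f a b l ->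
  is_RInt (V := C_R_NormedModule) (fun x => c * f x)%C a b (c * l)%C.
Proof.
  intros H.
  pose proof (is_RInt_fct_extend_fst (U := R_NormedModule) (V := R_NormedModule) f a b l H) as H1.
  pose proof (is_RInt_fct_extend_snd (U := R_NormedModule) (V := R_NormedModule) f a b l H) as H2.
  apply (is_RInt_fct_extend_pair (U := R_NormedModule) (V := R_NormedModule)
    (fun x => c * f x)%C a b (fst c * fst l - snd c * snd l) (fst c * snd l + snd c * fst l)).
  - apply (is_RInt_minus (V := R_NormedModule) (fun x => fst c * fst (f x)) (fun x => snd c * snd (f x)));
      now apply (is_RInt_scal (V := R_NormedModule)).
  - apply (is_RInt_plus (V := R_NormedModule) (fun x => fst c * snd (f x)) (fun x => snd c * fst (f x)));
      now apply (is_RInt_scal (V := R_NormedModule)).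
Qed.

Lemma CRInt_Cmult (c : C) (f : R -> C) (a b : R) :
  cont f -> CRInt (fun x => c * f x)%C a b = (c * CRInt f a b)%C.
Proof. intros Hf. apply CRInt_unique, is_CRInt_Cmult, is_CRInt, Hf. Qed.

Lemma CRInt_Chasles (f : R -> C) (a b c : R) :
  cont f -> (CRInt f a b + CRInt f b c)%C = CRInt f a c.
Proof.
  intros Hf. exact (RInt_Chasles (V := C_R_CompleteNormedModule) f a b c
    (ex_CRInt f a b Hf) (ex_CRInt f b c Hf)).
Qed.

Lemma CRInt_const (c : C) (a b : R) : CRInt (fun _ => c) a b = (RtoC (b - a)%R * c)%C.
Proof.
  rewrite <- scal_C. exact (RInt_const (V := C_R_CompleteNormedModule) a b c).
Qed.

Lemma Cmod_CRInt_le (f : R -> C) (a b M : R) :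
  a <= b -> cont f -> (forall x, a <= x <= b -> Cmod (f x) <= M) ->
  Cmod (CRInt f a b) <= (b - a) * M.
Proof.
  intros Hab Hf HM. rewrite <- norm_C.
  apply (norm_RInt_le_const (V := C_R_NormedModule) f a b _ M Hab).
  - intros x Hx. rewrite norm_C. now apply HM.
  - now apply is_CRInt.
Qed.

Lemma Cmod_CRInt_le_RInt (f : R -> C) (g : R -> R) (a b l : R) :
  a <= b -> cont f -> (forall x, a <= x <= b -> Cmod (f x) <= g x) ->
  is_RInt g a b l -> Cmod (CRInt f a b) <= l.
Proof.
  intros Hab Hf HM Hl. rewrite <- norm_C.
  apply (norm_RInt_le (V := C_R_NormedModule) f g a b _ l Hab); trivial.
  - intros x Hx. rewrite norm_C. now apply HM.
  - now apply is_CRInt.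
Qed.

Lemma der_CRInt (g : R -> C) (a x : R) : cont g -> der (fun y => CRInt g a y) x (g x).
Proof.
  intros Hg. apply (is_derive_RInt (V := C_R_NormedModule) g (fun y => CRInt g a y) a x).
  - apply filter_forall. intros y. now apply is_CRInt.
  - apply Hg.
Qed.

Lemma derR_zero_const (f : R -> R) (a b : R) :
  a <= b -> (forall x, a < x < b -> is_derive f x 0) ->
  (forall x, a <= x <= b -> continuous f x) -> f b = f a.
Proof.
  intros Hab Hd Hc.
  destruct (MVT_gen f a b (fun _ => 0)) as [c [_ E]].
  - intros x. rewrite Rmin_left, Rmax_right by lra. apply Hd.
  - intros x. rewrite Rmin_left, Rmax_right by lra. intros Hx.
    apply continuity_pt_filterlim, Hc, Hx.
  - lra.
Qed.

Lemma der_zero_const (f : R -> C) (a b : R) :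
  a <= b -> (forall x, a < x < b -> der f x (RtoC 0)) ->
  (forall x, a <= x <= b -> contp f x) -> f b = f a.
Proof.
  intros Hab Hd Hc. apply injective_projections.
  - apply (derR_zero_const (fun x => Re (f x)) a b Hab).
    + intros x Hx. apply (der_Re f x (RtoC 0)), Hd, Hx.
    + intros x Hx. apply contp_Re, Hc, Hx.
  - apply (derR_zero_const (fun x => Im (f x)) a b Hab).
    + intros x Hx. apply (der_Im f x (RtoC 0)), Hd, Hx.
    + intros x Hx. apply contp_Im, Hc, Hx.
Qed.

(** Derivatives are only required inside the segment: the data have two-sided derivatives
    only inside their half line. *)
Lemma CRInt_der (F g : R -> C) (a b : R) :
  a <= b -> cont g -> (forall x, a < x < b -> der F x (g x)) ->
  (forall x, a <= x <= b -> contp F x) -> CRInt g a b = (F b - F a)%C.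
Proof.
  intros Hab Hg Hd Hc.
  assert (E : (F b - CRInt g a b = F a - CRInt g a a)%C).
  { apply (der_zero_const (fun x => F x - CRInt g a x)%C a b Hab).
    - intros x Hx. eapply der_eq; [| apply der_minus; [apply Hd, Hx | apply der_CRInt, Hg]]. ring.
    - intros x Hx. apply contp_minus; [apply Hc, Hx |].
      eapply der_cont. apply der_CRInt, Hg. }
  rewrite CRInt_point in E.
  replace (F b - F a)%C with ((F b - CRInt g a b) + CRInt g a b - F a)%C by ring.
  rewrite E. ring.
Qed.

Lemma CRInt_der_all (F g : R -> C) (a b : R) :
  cont g -> (forall x, der F x (g x)) -> CRInt g a b = (F b - F a)%C.
Proof.
  intros Hg Hd. apply CRInt_unique.
  apply (is_RInt_derive (V := C_R_CompleteNormedModule) F g a b).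
  - intros x _. apply Hd.
  - intros x _. apply Hg.
Qed.

Lemma CRInt_scale (g : R -> C) (t : R) :
  cont g -> CRInt g 0 t = (RtoC t * CRInt (fun th => g (t * th)%R) 0 1)%C.
Proof.
  intros Hg. rewrite <- CRInt_Cmult.
  2: { intros p. apply (contp_app g (fun th => t * th)); [exact Hg |]. ct. }
  symmetry. apply CRInt_unique.
  apply (is_RInt_ext (V := C_R_NormedModule) (fun y => scal t (g (t * y + 0)))).
  - intros x _. rewrite scal_C, Rplus_0_r. reflexivity.
  - apply (is_RInt_comp_lin (V := C_R_NormedModule) g t 0 0 1).
    rewrite Rmult_0_r, Rplus_0_l, Rmult_1_r, Rplus_0_r. now apply is_CRInt.
Qed.

Lemma cont2_r (h : R -> R -> C) (x : R) : cont2 h -> cont (fun s => h x s).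
Proof. intros H p. apply (contp_app2 h (fun _ => x) (fun s => s)); [exact H | ct | ct]. Qed.

Lemma cont2_l (h : R -> R -> C) (s : R) : cont2 h -> cont (fun x => h x s).
Proof. intros H p. apply (contp_app2 h (fun x => x) (fun _ => s)); [exact H | ct | ct]. Qed.

Lemma contT_r {T : UniformSpace} (h : T -> R -> C) (p : T) :
  cont (fun q : prod_UniformSpace T R_UniformSpace => h (fst q) (snd q)) -> cont (fun s => h p s).
Proof.
  intros H s.
  apply (continuous_comp_2 (fun _ => p) (fun s => s) h s); [ct | ct | apply (H (p, s))].
Qed.

(** Continuity in the parameter is uniform over the segment of integration, by the tube
    argument. *)
Lemma cont_CRInt {T : UniformSpace} (h : T -> R -> C) (a b : R) :
  cont (fun q : prod_UniformSpace T R_UniformSpace => h (fst q) (snd q)) ->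
  cont (fun p => CRInt (fun s => h p s) a b).
Proof.
  assert (Hle : forall a b, a <= b ->
    cont (fun q : prod_UniformSpace T R_UniformSpace => h (fst q) (snd q)) ->
    cont (fun p => CRInt (fun s => h p s) a b)).
  { clear a b. intros a b Hab H p0. apply contp_iff. intros eps Heps.
    assert (Hpos : 0 < eps / (b - a + 1)) by (apply Rdiv_lt_0_compat; lra).
    generalize (tube h p0 a b (fun s _ => H (p0, s)) _ Hpos).
    apply filter_imp. intros p Hp.
    rewrite <- CRInt_minus by (now apply contT_r).
    apply Rle_lt_trans with ((b - a) * (eps / (b - a + 1))).
    - apply Cmod_CRInt_le; trivial.
      + intros s. apply contp_minus; now apply contT_r.
      + intros s Hs. apply Rlt_le, Hp, Hs.
    - apply Rmult_lt_reg_r with (b - a + 1); [lra |]. field_simplify; [nra | lra]. }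
  intros H p. destruct (Rle_dec a b) as [Hab | Hab].
  - now apply Hle.
  - apply (continuous_ext (fun p => - CRInt (fun s => h p s) b a)%C).
    + intros q. symmetry. unfold CRInt.
      rewrite <- (opp_RInt_swap (V := C_R_CompleteNormedModule) (fun s => h q s)).
      reflexivity.
      apply ex_CRInt. now apply contT_r.
    + apply contp_opp. apply Hle; [lra | exact H].
Qed.

(** The difference quotient of the integrand differs from [h' x0 s] by a mean of [h' y s -
    h' x0 s], which the tube argument makes small for all [s] at once. *)
Lemma der_CRInt_param (h h' : R -> R -> C) (a b x0 : R) :
  a <= b -> cont2 h -> cont2 h' ->
  locally x0 (fun x => forall s, a <= s <= b -> der (fun x => h x s) x (h' x s)) ->
  der (fun x => CRInt (h x) a b) x0 (CRInt (h' x0) a b).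
Proof.
  intros Hab Hh Hh' [d Hd].
  split; [apply is_linear_scal_l |].
  intros x1 Hx1. apply (is_filter_lim_locally_unique x0 x1) in Hx1.
  rewrite <- Hx1. clear x1 Hx1.
  intros [eps Heps]. simpl.
  assert (Hpos : 0 < eps / (b - a + 1)) by (apply Rdiv_lt_0_compat; lra).
  destruct (tube h' x0 a b (fun s _ => Hh' (x0, s)) _ Hpos) as [d1 Hd1].
  assert (Hdd : 0 < Rmin d d1) by (apply Rmin_pos; apply cond_pos).
  exists (mkposreal _ Hdd). intros x Hx. simpl in Hx.
  assert (Hx1 : Rabs (x - x0) < d).
  { eapply Rlt_le_trans; [exact Hx | apply Rmin_l]. }
  assert (Hx2 : Rabs (x - x0) < d1).
  { eapply Rlt_le_trans; [exact Hx | apply Rmin_r]. }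
  assert (Hbtw : forall y, Rmin x0 x <= y <= Rmax x0 x -> Rabs (y - x0) <= Rabs (x - x0)).
  { intros y Hy. revert Hy. unfold Rmin, Rmax. destruct Rle_dec; unfold Rabs;
      destruct Rcase_abs; destruct Rcase_abs; lra. }
  (* the error term of [h _ s] is the integral of the variation of [h'] *)
  assert (K : forall s, a <= s <= b ->
    Cmod (h x s - h x0 s - RtoC (x - x0)%R * h' x0 s)%C <= Rabs (x - x0) * (eps / (b - a + 1))).
  { intros s Hs.
    assert (Hi : is_RInt (V := C_R_NormedModule) (fun y => h' y s - h' x0 s)%C x0 x
             (h x s - h x0 s - RtoC (x - x0)%R * h' x0 s)%C).
    { apply (is_RInt_minus (V := C_R_NormedModule) (fun y => h' y s) (fun _ => h' x0 s)).
      - apply (is_RInt_derive (V := C_R_CompleteNormedModule) (fun x => h x s) (fun x => h' x s)).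
        + intros y Hy. apply Hd; [| exact Hs]. eapply Rle_lt_trans; [apply Hbtw, Hy | exact Hx1].
        + intros y Hy. apply (cont2_l h' s Hh').
      - rewrite <- scal_C. apply (is_RInt_const (V := C_R_NormedModule)). }
    rewrite <- norm_C.
    assert (Hb : forall y, Rmin x0 x <= y <= Rmax x0 x ->
      norm (V := C_R_NormedModule) (h' y s - h' x0 s)%C <= eps / (b - a + 1)).
    { intros y Hy. rewrite norm_C. apply Rlt_le, Hd1; [| exact Hs].
      eapply Rle_lt_trans; [apply Hbtw, Hy | exact Hx2]. }
    destruct (Rle_dec x0 x) as [Hle | Hle].
    - rewrite (Rabs_pos_eq (x - x0)) by lra.
      apply (norm_RInt_le_const (V := C_R_NormedModule) (fun y => h' y s - h' x0 s)%C x0 x _ _ Hle);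
        [| exact Hi].
      intros y Hy. apply Hb. now rewrite Rmin_left, Rmax_right.
    - rewrite (Rabs_left1 (x - x0)) by lra.
      rewrite <- (norm_opp (V := C_R_NormedModule)).
      replace (- (x - x0)) with (x0 - x) by ring.
      apply (norm_RInt_le_const (V := C_R_NormedModule) (fun y => h' y s - h' x0 s)%C x x0); [lra | |].
      + intros y Hy. apply Hb. rewrite Rmin_right, Rmax_left; lra.
      + now apply (is_RInt_swap (V := C_R_NormedModule)). }
  match goal with |- norm ?u <= _ => set (w := u) end.
  assert (Ew : w = CRInt (fun s => h x s - h x0 s - RtoC (x - x0)%R * h' x0 s)%C a b).
  { rewrite CRInt_minus, CRInt_minus, CRInt_Cmult.
    - rewrite <- scal_C. reflexivity.
    - now apply cont2_r.
    - now apply cont2_r.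
    - now apply cont2_r.
    - intros p. apply contp_minus; now apply cont2_r.
    - intros p. apply contp_mult; [ct | now apply cont2_r]. }
  rewrite Ew, norm_C.
  apply Rle_trans with ((b - a) * (Rabs (x - x0) * (eps / (b - a + 1)))).
  - apply Cmod_CRInt_le; trivial.
    intros p. apply contp_minus; [apply contp_minus; now apply cont2_r |].
    apply contp_mult; [ct | now apply cont2_r].
  - change (norm (minus x x0)) with (Rabs (x - x0)).
    pose proof (Rabs_pos (x - x0)).
    apply Rmult_le_reg_r with (b - a + 1); [lra |]. field_simplify; [nra | lra].
Qed.

(** As functions of the upper end point [b] the two sides vanish at [a] and have the same
    derivative, the inner integral. *)
Lemma CRInt_swap (h : R -> R -> C) (a b c d : R) :
  a <= b -> c <= d -> cont2 h ->
  CRInt (fun x => CRInt (fun y => h x y) c d) a b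
  = CRInt (fun y => CRInt (fun x => h x y) a b) c d.
Proof.
  intros Hab Hcd Hh.
  assert (Hi : cont (fun x => CRInt (fun y => h x y) c d)) by (apply cont_CRInt, Hh).
  assert (E : forall x, der (fun x => CRInt (fun y => CRInt (fun x' => h x' y) a x) c d) x
                (CRInt (fun y => h x y) c d)).
  { intros x.
    apply (der_CRInt_param (fun x y => CRInt (fun x' => h x' y) a x) h c d x Hcd).
    - intros q0. apply (continuous_ext (fun q : RR => RtoC (fst q - a)%R *
        CRInt (fun th => h (a + (fst q - a) * th)%R (snd q)) 0 1)%C).
      + intros [x' y]. change R in x', y. simpl.
        assert (Hs : cont (fun x => h (a + x) y)).
        { intros p. apply (contp_app2 h (fun x => a + x) (fun _ => y)); [exact Hh | ct | ct]. }
        rewrite <- (CRInt_scale (fun x => h (a + x) y) (x' - a)) by exact Hs.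
        apply CRInt_unique.
        apply (is_RInt_ext (V := C_R_NormedModule) (fun x => scal 1 (h (1 * x + a) y))).
        { intros x0 _. rewrite scal_C, Cmult_1_l.
          replace (1 * x0 + a) with (a + x0) by ring. reflexivity. }
        apply (is_RInt_comp_lin (V := C_R_NormedModule) (fun x => h x y) 1 a 0 (x' - a)).
        replace (1 * 0 + a) with a by ring. replace (1 * (x' - a) + a) with x' by ring.
        apply is_CRInt. now apply cont2_l.
      + apply contp_mult; [ct |].
        apply (cont_CRInt (fun (q : RR) th => h (a + (fst q - a) * th) (snd q)) 0 1).
        intros p.
        apply (contp_app2 h (fun p : RRR => a + (fst (fst p) - a) * snd p)
                 (fun p : RRR => snd (fst p))); [exact Hh | |]; ct.
    - exact Hh.
    - apply filter_forall. intros y s _. apply (der_CRInt (fun x' => h x' s) a y).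
      now apply cont2_l. }
  etransitivity; [exact (CRInt_der_all _ _ a b Hi E) | cbv beta].
  rewrite (CRInt_ext (fun y => CRInt (fun x' => h x' y) a a) (fun _ => RtoC 0) c d).
  - rewrite CRInt_const. ring.
  - intros y _. apply CRInt_point.
Qed.

(** * Integrals over half lines *)

(** Decay of this order survives all the operations below and makes every half-line integral
    converge with a tail of order [M / (1 + q)], uniformly in parameters. *)
Definition dec (g : R -> C) (M : R) : Prop :=
  forall y, 0 <= y -> Cmod (g y) <= M / (1 + y) ^ 2.

Lemma contR_Rmin {T : UniformSpace} (f g : T -> R) (p : T) :
  continuous f p -> continuous g p -> continuous (fun q => Rmin (f q) (g q)) p.
Proof.
  intros Hf Hg.
  apply continuous_ext with (f := fun q => - Rmax (- f q) (- g q)).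
  - intros q. unfold Rmax, Rmin. destruct Rle_dec; destruct Rle_dec; lra.
  - apply contR_opp, contR_Rmax; now apply contR_opp.
Qed.

Definition clamp (a b x : R) : R := Rmax a (Rmin b x).

Lemma clamp_in (a b x : R) : a <= b -> a <= clamp a b x <= b.
Proof.
  intros H. unfold clamp, Rmax, Rmin. repeat destruct Rle_dec; lra.
Qed.

Lemma clamp_id (a b x : R) : a <= x <= b -> clamp a b x = x.
Proof.
  intros H. unfold clamp, Rmax, Rmin. repeat destruct Rle_dec; lra.
Qed.

Lemma cont_clamp {T : UniformSpace} (a b : R) (f : T -> R) (p : T) :
  continuous f p -> continuous (fun q => clamp a b (f q)) p.
Proof.
  intros H. apply contR_Rmax; [apply continuous_const | apply contR_Rmin]; [apply continuous_const | exact H].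
Qed.

Lemma one_plus_sqr_pos (y : R) : 0 <= y -> 0 < (1 + y) ^ 2.
Proof. intros H. apply pow_lt. lra. Qed.

Lemma dec_nonneg (g : R -> C) (M : R) : dec g M -> 0 <= M.
Proof.
  intros H. specialize (H 0 (Rle_refl 0)). pose proof (Cmod_ge_0 (g 0)).
  replace (M / (1 + 0) ^ 2) with M in H by field. lra.
Qed.

Lemma dec_mono (g : R -> C) (M N : R) : M <= N -> dec g M -> dec g N.
Proof.
  intros H Hg y Hy. eapply Rle_trans; [apply Hg, Hy |].
  apply Rmult_le_compat_r; [| exact H]. apply Rlt_le, Rinv_0_lt_compat, one_plus_sqr_pos, Hy.
Qed.

Lemma dec_bound (g : R -> C) (M y : R) : dec g M -> 0 <= y -> Cmod (g y) <= M.
Proof.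
  intros H Hy. eapply Rle_trans; [apply H, Hy |]. pose proof (dec_nonneg g M H).
  pose proof (one_plus_sqr_pos y Hy).
  apply Rmult_le_reg_r with ((1 + y) ^ 2); [assumption |].
  unfold Rdiv. rewrite Rmult_assoc, Rinv_l by lra. nra.
Qed.

Lemma dec_plus (f g : R -> C) (M N : R) : dec f M -> dec g N -> dec (fun y => f y + g y)%C (M + N).
Proof.
  intros Hf Hg y Hy. eapply Rle_trans; [apply Cmod_triangle |].
  specialize (Hf y Hy). specialize (Hg y Hy). unfold Rdiv in *. lra.
Qed.

Lemma dec_mult (f g : R -> C) (M N : R) :
  dec f M -> (forall y, 0 <= y -> Cmod (g y) <= N) -> dec (fun y => g y * f y)%C (N * M).
Proof.
  intros Hf Hg y Hy. rewrite Cmod_mult. specialize (Hf y Hy). specialize (Hg y Hy).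
  unfold Rdiv in *. rewrite Rmult_assoc. apply Rmult_le_compat; trivial; apply Cmod_ge_0.
Qed.

Lemma dec_opp (f : R -> C) (M : R) : dec f M -> dec (fun y => - f y)%C M.
Proof. intros Hf y Hy. rewrite Cmod_opp. now apply Hf. Qed.

Lemma dec_tail (g : R -> C) (M p q : R) :
  cont g -> dec g M -> 0 <= p <= q -> Cmod (CRInt g p q) <= M / (1 + p).
Proof.
  intros Hc Hg Hpq.
  apply Rle_trans with (- M / (1 + q) - - M / (1 + p)).
  - apply (Cmod_CRInt_le_RInt g (fun y => M / (1 + y) ^ 2) p q); [lra | exact Hc | |].
    + intros y Hy. apply Hg. lra.
    + apply (is_RInt_derive (V := R_CompleteNormedModule) (fun y => - M / (1 + y))).
      * intros y Hy. rewrite Rmin_left, Rmax_right in Hy by lra.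
        auto_derive; [lra |]. field. lra.
      * intros y Hy. rewrite Rmin_left, Rmax_right in Hy by lra.
        apply (ex_derive_continuous (V := R_NormedModule)). auto_derive.
        pose proof (one_plus_sqr_pos y). nra.
  - pose proof (dec_nonneg g M Hg).
    assert (0 <= M / (1 + q)) by (apply Rmult_le_pos; [lra | apply Rlt_le, Rinv_0_lt_compat; lra]).
    unfold Rdiv in *. lra.
Qed.

Lemma Rdiv_small (M eps : R) : 0 < eps -> 0 <= M -> exists N, 0 < N /\ forall q, N < q -> M / (1 + q) < eps.
Proof.
  intros He HM. exists (M / eps + 1). split.
  - assert (0 <= M / eps) by (apply Rmult_le_pos; [lra | apply Rlt_le, Rinv_0_lt_compat; lra]). lra.
  - intros q Hq.
    assert (0 <= M / eps) by (apply Rmult_le_pos; [lra | apply Rlt_le, Rinv_0_lt_compat; lra]).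
    apply Rmult_lt_reg_r with (1 + q); [lra |].
    unfold Rdiv at 1. rewrite Rmult_assoc, Rinv_l, Rmult_1_r by lra.
    replace M with (eps * (M / eps)) at 1 by (field; lra).
    apply Rmult_lt_compat_l; lra.
Qed.

Lemma is_half_line (g : R -> C) (L : C) :
  cont g ->
  (forall eps, 0 < eps -> exists N, forall q, N < q -> Cmod (CRInt g 0 q - L)%C < eps) ->
  is_RInt_gen (V := C_R_NormedModule) g (at_point 0) (Rbar_locally p_infty) L.
Proof.
  intros Hc HL P [eps HP].
  destruct (HL eps (cond_pos eps)) as [N HN].
  exists (fun a => a = 0) (fun q => N < q).
  - reflexivity.
  - now exists N.
  - intros a q -> Hq. exists (CRInt g 0 q). split; [now apply is_CRInt |].
    apply HP, Cmod_ball, HN, Hq.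
Qed.

Lemma half_line_unique (g : R -> C) (L : C) :
  is_RInt_gen (V := C_R_NormedModule) g (at_point 0) (Rbar_locally p_infty) L ->
  half_line_int g = L.
Proof.
  intros H.
  exact (@is_RInt_gen_unique C_R_CompleteNormedModule (at_point 0) (Rbar_locally p_infty)
           _ _ g L H).
Qed.

Lemma half_line_lim (g : R -> C) (L : C) :
  cont g ->
  (forall eps, 0 < eps -> exists N, forall q, N < q -> Cmod (CRInt g 0 q - L)%C < eps) ->
  half_line_int g = L.
Proof. intros. apply half_line_unique, is_half_line; assumption. Qed.

(** The integrals up to [q] form a Cauchy net because of [dec_tail]; the limit inherits the
    bound. *)
Lemma half_line_tail (g : R -> C) (M q : R) :
  cont g -> dec g M -> 0 <= q -> Cmod (CRInt g 0 q - half_line_int g)%C <= M / (1 + q).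
Proof.
  intros Hc Hg Hq.
  pose proof (dec_nonneg g M Hg) as HM.
  assert (Hdiff : forall p q, 0 <= p <= q -> Cmod (CRInt g 0 q - CRInt g 0 p)%C <= M / (1 + p)).
  { intros p r Hpr. rewrite <- (CRInt_Chasles g 0 p r Hc).
    replace (CRInt g 0 p + CRInt g p r - CRInt g 0 p)%C with (CRInt g p r) by ring.
    now apply dec_tail. }
  assert (HL : exists L : C, filterlim (fun q => CRInt g 0 q) (Rbar_locally p_infty) (locally (T := C_R_CompleteNormedModule) L)).
  { apply (filterlim_locally_cauchy (U := C_R_CompleteNormedModule) (F := Rbar_locally p_infty)
      (fun q => CRInt g 0 q)).
    intros eps.
    destruct (Rdiv_small M eps (cond_pos eps) HM) as [N [HN0 HN]].
    exists (fun q => N < q). split; [now exists N |].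
    intros u v Hu Hv. destruct (Rle_dec u v) as [H | H].
    - apply (Cmod_ball (CRInt g 0 u) (CRInt g 0 v)).
      eapply Rle_lt_trans; [apply Hdiff; lra | now apply HN].
    - apply ball_sym, (Cmod_ball (CRInt g 0 v) (CRInt g 0 u)).
      eapply Rle_lt_trans; [apply Hdiff; lra | now apply HN]. }
  destruct HL as [L HL].
  assert (HL' : forall eps, 0 < eps -> exists N, forall q, N < q -> Cmod (CRInt g 0 q - L)%C < eps).
  { intros eps Heps.
    assert (Hp : 0 < eps / sqrt 2) by (apply Rdiv_lt_0_compat; [exact Heps | apply sqrt_lt_R0; lra]).
    destruct (HL _ (locally_ball (T := C_R_CompleteNormedModule) L (mkposreal _ Hp))) as [N HN].
    exists N. intros r Hr. specialize (HN r Hr).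
    apply (C_NormedModule_mixin_compat2 L (CRInt g 0 r)) in HN. simpl in HN.
    replace eps with (sqrt 2 * (eps / sqrt 2)); [exact HN |].
    field. apply Rgt_not_eq, sqrt_lt_R0; lra. }
  rewrite (half_line_lim g L Hc HL').
  apply Rle_plus_epsilon. intros eps Heps.
  destruct (HL' eps Heps) as [N HN].
  specialize (HN (Rmax (N + 1) q)).
  assert (Hm : N < Rmax (N + 1) q) by (eapply Rlt_le_trans; [| apply Rmax_l]; lra).
  specialize (HN Hm).
  pose proof (Hdiff q (Rmax (N + 1) q) (conj Hq (Rmax_r _ _))) as Hd.
  replace (CRInt g 0 q - L)%C with
    ((CRInt g 0 (Rmax (N + 1) q) - L) - (CRInt g 0 (Rmax (N + 1) q) - CRInt g 0 q))%C by ring.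
  eapply Rle_trans; [apply Cmod_triangle |]. rewrite Cmod_opp. lra.
Qed.

Lemma is_half_line_dec (g : R -> C) (M : R) :
  cont g -> dec g M ->
  is_RInt_gen (V := C_R_NormedModule) g (at_point 0) (Rbar_locally p_infty) (half_line_int g).
Proof.
  intros Hc Hg. apply is_half_line; [exact Hc |]. intros eps Heps.
  destruct (Rdiv_small M eps Heps (dec_nonneg g M Hg)) as [N [HN0 HN]].
  exists N. intros q Hq. eapply Rle_lt_trans; [apply (half_line_tail g M q Hc Hg); lra | now apply HN].
Qed.

(** An improper integral is a choice of limit, so equal integrands are compared through the
    sets of their limits. *)
Lemma half_line_ext (f g : R -> C) :
  (forall y, 0 <= y -> f y = g y) -> half_line_int f = half_line_int g.
Proof.
  intros H. unfold half_line_int, RInt_gen. f_equal.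
  apply functional_extensionality. intros l. apply propositional_extensionality.
  assert (K : forall f g : R -> C, (forall y, 0 <= y -> f y = g y) ->
    is_RInt_gen (V := C_R_NormedModule) f (at_point 0) (Rbar_locally p_infty) l ->
    is_RInt_gen (V := C_R_NormedModule) g (at_point 0) (Rbar_locally p_infty) l).
  { clear. intros f g H. apply is_RInt_gen_ext.
    exists (fun a => a = 0) (fun q => 0 < q); [reflexivity | now exists 0 |].
    intros a q -> Hq x Hx. simpl in Hx. rewrite Rmin_left in Hx by lra. apply H. lra. }
  split; apply K; [exact H | intros y Hy; symmetry; now apply H].
Qed.

Lemma half_line_plus (f g : R -> C) (M N : R) :
  cont f -> cont g -> dec f M -> dec g N ->
  half_line_int (fun y => f y + g y)%C = (half_line_int f + half_line_int g)%C.
Proof.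
  intros Hf Hg Df Dg. apply half_line_unique.
  apply (is_RInt_gen_plus (V := C_R_NormedModule)); eapply is_half_line_dec; eassumption.
Qed.

Lemma half_line_Cmult (c : C) (f : R -> C) (M : R) :
  cont f -> dec f M -> half_line_int (fun y => c * f y)%C = (c * half_line_int f)%C.
Proof.
  intros Hf Df. apply half_line_lim; [ct |]. intros eps Heps.
  pose proof (dec_nonneg f M Df).
  destruct (Rdiv_small (Cmod c * M) eps Heps) as [N [HN0 HN]].
  { apply Rmult_le_pos; [apply Cmod_ge_0 | assumption]. }
  exists N. intros q Hq. rewrite CRInt_Cmult by exact Hf.
  replace (c * CRInt f 0 q - c * half_line_int f)%C with (c * (CRInt f 0 q - half_line_int f))%C by ring.
  rewrite Cmod_mult. eapply Rle_lt_trans; [| apply (HN q Hq)].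
  unfold Rdiv. rewrite Rmult_assoc. apply Rmult_le_compat_l; [apply Cmod_ge_0 |].
  apply half_line_tail; trivial. lra.
Qed.

Lemma half_line_bound (g : R -> C) (M : R) : cont g -> dec g M -> Cmod (half_line_int g) <= M.
Proof.
  intros Hc Hg. pose proof (half_line_tail g M 0 Hc Hg (Rle_refl 0)) as H.
  rewrite CRInt_point in H.
  replace (RtoC 0 - half_line_int g)%C with (- half_line_int g)%C in H by ring.
  rewrite Cmod_opp in H. replace (M / (1 + 0)) with M in H by field. exact H.
Qed.

Lemma half_line_cont {T : UniformSpace} (h : T -> R -> C) (p0 : T) (M : R) :
  cont (fun q : prod_UniformSpace T R_UniformSpace => h (fst q) (snd q)) ->
  locally p0 (fun p => dec (h p) M) ->
  contp (fun p => half_line_int (h p)) p0.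
Proof.
  intros Hc HM. apply contp_iff. intros eps Heps.
  assert (HM0 : 0 <= M) by (apply (dec_nonneg (h p0)), (locally_singleton _ _ HM)).
  destruct (Rdiv_small M (eps / 3)) as [N [HN0 HN]]; [lra | exact HM0 |].
  pose proof (cont_CRInt h 0 (N + 1) Hc p0) as Hi.
  apply contp_iff with (eps := eps / 3) in Hi; [| lra].
  generalize (filter_and _ _ HM Hi). apply filter_imp. intros p [Hp Hpi].
  assert (Hn : M / (1 + (N + 1)) < eps / 3) by (apply HN; lra).
  assert (E : forall p, dec (h p) M -> Cmod (CRInt (h p) 0 (N + 1) - half_line_int (h p))%C < eps / 3).
  { intros p' Hp'. eapply Rle_lt_trans; [apply (half_line_tail (h p') M) | exact Hn];
      [now apply contT_r | exact Hp' | lra]. }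
  pose proof (E p Hp) as E1. pose proof (E p0 (locally_singleton _ _ HM)) as E2.
  replace (half_line_int (h p) - half_line_int (h p0))%C with
    ((CRInt (h p) 0 (N + 1) - CRInt (h p0) 0 (N + 1))
     - (CRInt (h p) 0 (N + 1) - half_line_int (h p))
     + (CRInt (h p0) 0 (N + 1) - half_line_int (h p0)))%C by ring.
  eapply Rle_lt_trans; [apply Cmod_triangle |].
  eapply Rle_lt_trans; [apply Rplus_le_compat_r, Cmod_triangle |]. rewrite Cmod_opp.
  change (fun s => h p s) with (h p) in Hpi. change (fun s => h p0 s) with (h p0) in Hpi. lra.
Qed.

Lemma dec_CRInt (h : R -> R -> C) (a b M : R) :
  a <= b -> cont2 h -> (forall x, a <= x <= b -> dec (h x) M) ->
  dec (fun y => CRInt (fun x => h x y) a b) ((b - a) * M).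
Proof.
  intros Hab Hc HM y Hy. unfold Rdiv. rewrite Rmult_assoc.
  apply Cmod_CRInt_le; [exact Hab | now apply cont2_l |].
  intros x Hx. now apply HM.
Qed.

Lemma half_line_CRInt_swap (h : R -> R -> C) (a b M : R) :
  a <= b -> cont2 h -> (forall x, a <= x <= b -> dec (h x) M) ->
  CRInt (fun x => half_line_int (h x)) a b = half_line_int (fun y => CRInt (fun x => h x y) a b).
Proof.
  assert (Hglob : forall h : R -> R -> C, a <= b -> cont2 h -> (forall x, dec (h x) M) ->
    CRInt (fun x => half_line_int (h x)) a b = half_line_int (fun y => CRInt (fun x => h x y) a b)).
  { clear h. intros h Hab Hc HM. symmetry.
    assert (Hci : cont (fun x => half_line_int (h x))).
    { intros x. apply (half_line_cont h x M Hc). apply filter_forall, HM. }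
    assert (Hcy : cont (fun y => CRInt (fun x => h x y) a b)).
    { apply (cont_CRInt (fun y x => h x y) a b). intros q.
      apply (contp_app2 h (fun q : RR => snd q) (fun q : RR => fst q)); [exact Hc | ct | ct]. }
    apply half_line_lim; [exact Hcy |].
    intros eps Heps.
    pose proof (dec_nonneg _ _ (HM 0)) as HM0.
    destruct (Rdiv_small ((b - a) * M) eps Heps) as [N [HN0 HN]]; [nra |].
    exists N. intros q Hq.
    assert (Hsw : CRInt (fun y => CRInt (fun x => h x y) a b) 0 q
                  = CRInt (fun x => CRInt (h x) 0 q) a b).
    { symmetry. apply CRInt_swap; [exact Hab | lra | exact Hc]. }
    rewrite Hsw.
    assert (Hcq : cont (fun x => CRInt (h x) 0 q)) by apply (cont_CRInt h 0 q Hc).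
    rewrite <- CRInt_minus by assumption.
    eapply Rle_lt_trans; [| apply (HN q Hq)]. unfold Rdiv. rewrite Rmult_assoc.
    apply Cmod_CRInt_le; [exact Hab | ct |].
    intros x _. apply half_line_tail; [now apply cont2_r | apply HM | lra]. }
  intros Hab Hc HM.
  specialize (Hglob (fun x y => h (clamp a b x) y) Hab).
  rewrite (CRInt_ext _ (fun x => half_line_int (h (clamp a b x)))).
  - etransitivity; [apply Hglob |].
    + intros q. apply (contp_app2 h (fun q : RR => clamp a b (fst q)) (fun q : RR => snd q));
        [exact Hc | apply cont_clamp; ct | ct].
    + intros x. apply HM. now apply clamp_in.
    + apply half_line_ext. intros y _. apply CRInt_ext. intros x Hx.
      rewrite Rmin_left, Rmax_right in Hx by lra. rewrite clamp_id; [reflexivity | lra].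
  - intros x Hx. rewrite Rmin_left, Rmax_right in Hx by lra. rewrite clamp_id; [reflexivity | lra].
Qed.

(** By Fubini the half-line integral of [h x] is that of [h a] plus the integral from [a] to
    [x] of the half-line integrals of [h'], to which the fundamental theorem applies. The
    parameter is clamped to a neighbourhood of [x0] where the bounds hold. *)
Lemma half_line_der (h h' : R -> R -> C) (x0 M : R) :
  cont2 h -> cont2 h' ->
  locally x0 (fun x => forall y, 0 <= y -> der (fun x => h x y) x (h' x y)) ->
  locally x0 (fun x => dec (h x) M /\ dec (h' x) M) ->
  der (fun x => half_line_int (h x)) x0 (half_line_int (h' x0)).
Proof.
  intros Hc Hc' Hd HM.
  destruct (filter_and _ _ Hd HM) as [d Hd0].
  pose (a := x0 - d / 2). pose (b := x0 + d / 2).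
  pose proof (cond_pos d) as Hdp.
  assert (Hin : forall x, a <= x <= b -> (forall y, 0 <= y -> der (fun x => h x y) x (h' x y))
                /\ dec (h x) M /\ dec (h' x) M).
  { intros x Hx. unfold a, b in Hx.
    assert (Hball : ball x0 d x).
    { change (Rabs (x - x0) < d). apply Rabs_def1; lra. }
    exact (Hd0 x Hball). }
  pose (hc := fun x => h' (clamp a b x)).
  pose (G := fun x => half_line_int (hc x)).
  assert (Hab : a <= b) by (unfold a, b; lra).
  assert (HcC : cont2 hc).
  { intros q. apply (contp_app2 h' (fun q : RR => clamp a b (fst q)) (fun q : RR => snd q));
        [exact Hc' | apply cont_clamp; ct | ct]. }
  assert (HG : cont G).
  { intros x. apply (half_line_cont hc x M).
    - exact HcC.
    - apply filter_forall. intros z. apply Hin. now apply clamp_in. }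
  assert (Eq : forall x, a <= x <= b ->
    (half_line_int (h x) = half_line_int (h a) + CRInt G a x)%C).
  { intros x Hx. unfold G.
    rewrite (half_line_CRInt_swap hc a x M); [| lra | exact HcC |].
    2: { intros z _. apply Hin. now apply clamp_in. }
    assert (Hsub : forall y, 0 <= y -> CRInt (fun z => hc z y) a x = (h x y + - h a y)%C).
    { intros y Hy. rewrite (CRInt_ext _ (fun z => h' z y)).
      - apply (CRInt_der (fun z => h z y)); [lra | now apply cont2_l | |].
        + intros z Hz. apply (proj1 (Hin z ltac:(lra))). exact Hy.
        + intros z _. apply (cont2_l h y Hc).
      - intros z Hz. rewrite Rmin_left, Rmax_right in Hz by lra.
        unfold hc. rewrite clamp_id; [reflexivity | lra]. }
    rewrite (half_line_ext (fun y => CRInt (fun z => hc z y) a x) _ Hsub).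
    rewrite (half_line_plus (h x) (fun y => - h a y)%C M M).
    - replace (half_line_int (fun y => - h a y)%C) with (- half_line_int (h a))%C; [ring |].
      transitivity (half_line_int (fun y => - (1) * h a y)%C).
      + rewrite (half_line_Cmult _ (h a) M); [ring | now apply cont2_r | apply Hin; lra].
      + apply half_line_ext. intros y _. ring.
    - now apply cont2_r.
    - intros p. apply contp_opp. now apply cont2_r.
    - now apply Hin.
    - apply dec_opp. apply Hin. lra. }
  assert (Ex : half_line_int (h' x0) = G x0).
  { unfold G, hc. rewrite clamp_id; [reflexivity | unfold a, b; lra]. }
  rewrite Ex.
  apply (is_derive_ext_loc (V := C_R_NormedModule) (fun x => half_line_int (h a) + CRInt G a x)%C).
  - exists (mkposreal _ (ltac:(lra) : 0 < d / 2)). intros x Hx. symmetry. apply Eq.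
    change (Rabs (x - x0) < d / 2) in Hx. apply Rabs_def2 in Hx. unfold a, b. lra.
  - eapply der_eq; [| apply der_plus; [apply der_const | apply der_CRInt, HG]]. ring.
Qed.

(** Finite [q] in the outer integral reduces to [half_line_CRInt_swap]; the remainder is the
    integral of tails, of order [M / (1 + q)]. The values of [h] for negative arguments are
    replaced by those at 0. *)
Lemma half_line_swap (h : R -> R -> C) (M : R) :
  cont2 h ->
  (forall x y, 0 <= x -> 0 <= y -> Cmod (h x y) <= M / (1 + x) ^ 2 / (1 + y) ^ 2) ->
  half_line_int (fun x => half_line_int (h x))
  = half_line_int (fun y => half_line_int (fun x => h x y)).
Proof.
  intros Hc HM.
  pose (k := fun x y => h (Rmax 0 x) (Rmax 0 y)).
  assert (Hpos : forall x, 0 <= Rmax 0 x) by (intros; apply Rmax_l).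
  assert (Hk : cont2 k).
  { intros q. apply (contp_app2 h (fun q : RR => Rmax 0 (fst q)) (fun q : RR => Rmax 0 (snd q)));
      [exact Hc | ct | ct]. }
  assert (Hk' : cont2 (fun y x => k x y)).
  { intros q. apply (contp_app2 k (fun q : RR => snd q) (fun q : RR => fst q)); [exact Hk | ct | ct]. }
  assert (HM0 : 0 <= M).
  { pose proof (HM 0 0 (Rle_refl 0) (Rle_refl 0)) as H0. pose proof (Cmod_ge_0 (h 0 0)).
    replace (M / (1 + 0) ^ 2 / (1 + 0) ^ 2) with M in H0 by field. lra. }
  assert (Hle : forall x, 0 <= x -> M / (1 + x) ^ 2 <= M).
  { intros x Hx. pose proof (one_plus_sqr_pos x Hx). apply Rmult_le_reg_r with ((1 + x) ^ 2); [assumption |].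
    unfold Rdiv. rewrite Rmult_assoc, Rinv_l by lra. nra. }
  assert (D1' : forall x, dec (k x) (M / (1 + Rmax 0 x) ^ 2)).
  { intros x y Hy. unfold k. rewrite (Rmax_right 0 y Hy). now apply HM. }
  assert (D2' : forall y, dec (fun x => k x y) (M / (1 + Rmax 0 y) ^ 2)).
  { intros y x Hx. unfold k. rewrite (Rmax_right 0 x Hx).
    eapply Rle_trans; [apply HM; trivial |]. right. unfold Rdiv. ring. }
  assert (D1 : forall x, dec (k x) M) by (intros x; eapply dec_mono; [apply Hle, Hpos | apply D1']).
  assert (D2 : forall y, dec (fun x => k x y) M) by (intros y; eapply dec_mono; [apply Hle, Hpos | apply D2']).
  assert (C1 : cont (fun x => half_line_int (k x))).
  { intros x. apply (half_line_cont k x M Hk), filter_forall, D1. }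
  assert (C2 : cont (fun y => half_line_int (fun x => k x y))).
  { intros x. apply (half_line_cont (fun y x => k x y) x M Hk'), filter_forall, D2. }
  transitivity (half_line_int (fun x => half_line_int (k x))).
  { apply half_line_ext. intros x Hx. apply half_line_ext. intros y Hy.
    unfold k. now rewrite !Rmax_right. }
  transitivity (half_line_int (fun y => half_line_int (fun x => k x y))).
  2: { apply half_line_ext. intros y Hy. apply half_line_ext. intros x Hx.
    unfold k. now rewrite !Rmax_right. }
  apply half_line_lim; [exact C1 |]. intros eps Heps.
  destruct (Rdiv_small M eps Heps HM0) as [N [HN0 HN]].
  exists N. intros q Hq.
  assert (Hsw : CRInt (fun x => half_line_int (k x)) 0 q
    = half_line_int (fun y => CRInt (fun x => k x y) 0 q)).
  { apply half_line_CRInt_swap with M; [lra | exact Hk | intros x _; apply D1]. }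
  rewrite Hsw.
  (* the difference is the half-line integral of the tails *)
  assert (Ct : cont (fun y => CRInt (fun x => k x y) 0 q)) by apply (cont_CRInt (fun y x => k x y) 0 q Hk').
  assert (Dt : dec (fun y => CRInt (fun x => k x y) 0 q - half_line_int (fun x => k x y))%C (M / (1 + q))).
  { intros y Hy.
    eapply Rle_trans; [apply (half_line_tail _ (M / (1 + Rmax 0 y) ^ 2));
      [now apply cont2_l | apply D2' | lra] |].
    rewrite Rmax_right by exact Hy. right. unfold Rdiv. ring. }
  assert (Dq : dec (fun y => half_line_int (fun x => k x y)) M).
  { intros y Hy. pose proof (half_line_bound _ _ (cont2_l k y Hk) (D2' y)) as Hb.
    rewrite (Rmax_right 0 y Hy) in Hb. exact Hb. }
  replace (half_line_int (fun y => CRInt (fun x => k x y) 0 q) - half_line_int (fun y => half_line_int (fun x => k x y)))%C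
    with (half_line_int (fun y => CRInt (fun x => k x y) 0 q - half_line_int (fun x => k x y))%C).
  - eapply Rle_lt_trans; [apply (half_line_bound _ (M / (1 + q))) | now apply HN]; [| exact Dt].
    intros y. apply contp_minus; [apply Ct | apply C2].
  - transitivity (half_line_int (fun y => (CRInt (fun x => k x y) 0 q - half_line_int (fun x => k x y)) + half_line_int (fun x => k x y))%C
      - half_line_int (fun y => half_line_int (fun x => k x y)))%C.
    + rewrite (half_line_plus _ _ (M / (1 + q)) M); trivial.
      * ring.
      * intros y. apply contp_minus; [apply Ct | apply C2].
    + f_equal. apply half_line_ext. intros y _. ring.
Qed.

(** * One-sided derivatives, finite sums, and the pieces of a contour *)

Lemma der_of_within (D : R -> Prop) (f : R -> C) (x : R) (l : C) :
  locally x D ->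
  filterdiff (K := R_AbsRing) (U := R_NormedModule) (V := C_R_NormedModule)
      f (within D (locally x)) (fun h : R => scal h l) ->
  der f x l.
Proof.
  intros HD [Hl Hf]. split; [exact Hl |].
  intros y Hy. apply (is_filter_lim_locally_unique x y) in Hy. rewrite <- Hy.
  assert (Hx : is_filter_lim (within D (locally x)) x).
  { intros P HP. unfold within. revert HP. apply filter_imp. intros z Hz _. exact Hz. }
  intros eps. specialize (Hf x Hx eps). unfold within in Hf.
  generalize (filter_and _ _ HD Hf). apply filter_imp. intros z [H1 H2]. now apply H2.
Qed.

Lemma contp_of_within (D : R -> Prop) (f : R -> C) (x : R) (l : C) :
  filterdiff (K := R_AbsRing) (U := R_NormedModule) (V := C_R_NormedModule)
      f (within D (locally x)) (fun h : R => scal h l) ->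
  D x ->
  filterlim f (within D (locally x)) (locally (T := C_UniformSpace) (f x)).
Proof.
  intros Hf Dx.
  assert (Hpf : ProperFilter (within D (locally x))).
  { constructor.
    - intros P HP. exists x. apply (locally_singleton x _ HP), Dx.
    - apply within_filter, locally_filter. }
  apply (filterdiff_continuous_aux (U := R_NormedModule) (V := C_R_NormedModule)
           (F := within D (locally x)) f).
  - eexists. exact Hf.
  - intros P HP. unfold within. revert HP. apply filter_imp. intros z Hz _. exact Hz.
Qed.

(** Turns continuity relative to [D] into plain continuity along a map into [D], such as the
    retraction of the line onto a segment. *)
Lemma cont_comp_within {T S : UniformSpace} (D : S -> Prop) (f : S -> C) (g : T -> S) (p : T) :
  (forall q, D (g q)) -> continuous g p ->
  filterlim f (within D (locally (g p))) (locally (T := C_UniformSpace) (f (g p))) ->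
  contp (fun q => f (g q)) p.
Proof.
  intros HD Hg Hf. apply (filterlim_comp _ _ _ g f _ (within D (locally (g p)))); [| exact Hf].
  intros P HP. unfold within in HP. apply Hg in HP. unfold filtermap in *.
  revert HP. apply filter_imp. intros q Hq. apply Hq, HD.
Qed.

Fixpoint Csum (n : nat) (f : nat -> C) : C :=
  match n with
  | O => RtoC 0
  | S n => (Csum n f + f n)%C
  end.

Lemma Csum_ext (n : nat) (f g : nat -> C) :
  (forall j, (j < n)%nat -> f j = g j) -> Csum n f = Csum n g.
Proof.
  induction n as [|n IH]; intros H; simpl; [reflexivity |].
  rewrite IH, (H n); auto.
Qed.

Lemma Csum_plus (n : nat) (f g : nat -> C) :
  Csum n (fun j => f j + g j)%C = (Csum n f + Csum n g)%C.
Proof. induction n as [|n IH]; simpl; [ring | rewrite IH; ring]. Qed.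

Lemma Csum_Cmult (n : nat) (c : C) (f : nat -> C) :
  Csum n (fun j => c * f j)%C = (c * Csum n f)%C.
Proof. induction n as [|n IH]; simpl; [ring | rewrite IH; ring]. Qed.

Lemma Csum_zero (n : nat) : Csum n (fun _ => RtoC 0) = RtoC 0.
Proof. induction n as [|n IH]; simpl; [reflexivity | rewrite IH; ring]. Qed.

Lemma Csum_telescope (n : nat) (f : nat -> C) :
  Csum n (fun j => f (S j) - f j)%C = (f n - f 0%nat)%C.
Proof. induction n as [|n IH]; simpl; [ring | rewrite IH; ring]. Qed.

Lemma cont_Csum {T : UniformSpace} (n : nat) (f : T -> nat -> C) :
  (forall j, (j < n)%nat -> cont (fun p => f p j)) -> cont (fun p => Csum n (f p)).
Proof.
  induction n as [|n IH]; intros H p; simpl; [ct |].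
  apply contp_plus; [apply IH; auto | apply H; auto].
Qed.

Lemma der_Csum (n : nat) (f f' : R -> nat -> C) (x : R) :
  (forall j, (j < n)%nat -> der (fun y => f y j) x (f' x j)) ->
  der (fun y => Csum n (f y)) x (Csum n (f' x)).
Proof.
  induction n as [|n IH]; intros H; simpl; [apply der_const |].
  apply der_plus; [apply IH; auto | apply H; auto].
Qed.

(** A piecewise smooth parametrization in which each piece [k j] and its velocity [v j],
    given on the segment from [s j] to [s (j+1)], are extended to the whole line by
    constants, so that all integrands below are continuous on the line. *)
Definition contour_pieces (K : R -> C) (N : nat) (s : nat -> R) (k v : nat -> R -> C) : Prop :=
  s 0%nat = 0 /\ s N = 1 /\
  forall j, (j < N)%nat ->
    s j < s (S j) /\ cont (k j) /\ cont (v j) /\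
    (forall r, k j r = K (clamp (s j) (s (S j)) r)) /\
    (forall r, s j < r < s (S j) -> der (k j) r (v j r)) /\
    (forall r, s j < r < s (S j) -> velocity K r = v j r).

Lemma contour_pieces_exist (K : R -> C) :
  piecewise_C1 K -> exists N s k v, contour_pieces K N s k v.
Proof.
  intros [N [s [H0 [H1 H]]]].
  assert (Hg : forall j, exists g : R -> C, (j < N)%nat ->
    derivative_on (segment (s j) (s (S j))) K g /\
    continuous_on (T := R_UniformSpace) (U := C_UniformSpace) (segment (s j) (s (S j))) g).
  { intros j. destruct (classic (j < N)%nat) as [Hj | Hj].
    - destruct (H j Hj) as [_ [g Hg]]. now exists g.
    - exists (fun _ => RtoC 0). intros Hj'. contradiction. }
  pose (g := fun j => proj1_sig (constructive_indefinite_description _ (Hg j))).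
  assert (Hgs : forall j, (j < N)%nat ->
    derivative_on (segment (s j) (s (S j))) K (g j) /\
    continuous_on (T := R_UniformSpace) (U := C_UniformSpace) (segment (s j) (s (S j))) (g j)).
  { intros j. exact (proj2_sig (constructive_indefinite_description _ (Hg j))). }
  exists N, s, (fun j r => K (clamp (s j) (s (S j)) r)), (fun j r => g j (clamp (s j) (s (S j)) r)).
  split; [exact H0 | split; [exact H1 |]].
  intros j Hj. destruct (Hgs j Hj) as [Hd Hc]. destruct (H j Hj) as [Hlt _].
  assert (Hin : forall r, segment (s j) (s (S j)) (clamp (s j) (s (S j)) r)).
  { intros r. apply clamp_in. lra. }
  assert (Hder : forall r, s j < r < s (S j) -> der K r (g j r)).
  { intros r Hr. apply (der_of_within (segment (s j) (s (S j)))).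
    - apply (filter_imp (fun y => s j < y /\ y < s (S j))); [intros y Hy; unfold segment; lra |].
      apply filter_and; [apply (open_gt (s j)) | apply (open_lt (s (S j)))]; lra.
    - apply Hd. unfold segment. lra. }
  split; [exact Hlt |]. split; [| split; [| split; [reflexivity | split]]].
  - intros r. apply (cont_comp_within (segment (s j) (s (S j))) K); [exact Hin | apply cont_clamp; ct |].
    apply contp_of_within with (l := g j (clamp (s j) (s (S j)) r)); [apply Hd, Hin | apply Hin].
  - intros r. apply (cont_comp_within (segment (s j) (s (S j))) (g j)); [exact Hin | apply cont_clamp; ct |].
    apply Hc, Hin.
  - intros r Hr. rewrite clamp_id by lra.
    apply (is_derive_ext_loc (V := C_R_NormedModule) K); [| now apply Hder].
    apply (filter_imp (fun y => s j < y /\ y < s (S j))).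
    + intros y Hy. rewrite clamp_id; [reflexivity | lra].
    + apply filter_and; [apply (open_gt (s j)) | apply (open_lt (s (S j)))]; lra.
  - intros r Hr. rewrite clamp_id by lra. unfold velocity.
    specialize (Hder r Hr).
    apply injective_projections; simpl; apply is_derive_unique;
      [apply (der_Re _ _ _ Hder) | apply (der_Im _ _ _ Hder)].
Qed.

Lemma CRInt_Csum (n : nat) (f : R -> nat -> C) (a b : R) :
  (forall j, (j < n)%nat -> cont (fun x => f x j)) ->
  CRInt (fun x => Csum n (f x)) a b = Csum n (fun j => CRInt (fun x => f x j) a b).
Proof.
  induction n as [|n IH]; intros H; simpl.
  - rewrite CRInt_const. ring.
  - rewrite CRInt_plus, IH; auto. apply cont_Csum. auto.
Qed.

Lemma dec_Csum (n : nat) (f : R -> nat -> C) (M : nat -> R) :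
  (forall j, (j < n)%nat -> dec (fun y => f y j) (M j)) -> exists M', dec (fun y => Csum n (f y)) M'.
Proof.
  induction n as [|n IH]; intros H.
  - exists 0. intros y Hy. simpl. rewrite Cmod_0. unfold Rdiv. lra.
  - destruct IH as [M' HM']; [auto |]. exists (M' + M n). simpl.
    apply dec_plus; [exact HM' | apply H; auto].
Qed.

Lemma half_line_zero : half_line_int (fun _ => RtoC 0) = RtoC 0.
Proof.
  apply half_line_lim; [ct |]. intros eps Heps. exists 0. intros q _.
  rewrite CRInt_const. replace (RtoC (q - 0)%R * RtoC 0 - RtoC 0)%C with (RtoC 0) by ring.
  rewrite Cmod_0. exact Heps.
Qed.

Lemma half_line_Csum (n : nat) (f : R -> nat -> C) (M : nat -> R) :
  (forall j, (j < n)%nat -> cont (fun y => f y j)) ->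
  (forall j, (j < n)%nat -> dec (fun y => f y j) (M j)) ->
  half_line_int (fun y => Csum n (f y)) = Csum n (fun j => half_line_int (fun y => f y j)).
Proof.
  induction n as [|n IH]; intros Hc Hd; simpl.
  - apply half_line_zero.
  - destruct (dec_Csum n f M) as [M' HM']; [auto |].
    rewrite (half_line_plus _ _ M' (M n)), IH; auto.
    apply cont_Csum. auto.
Qed.

(** * Complex constants and the roots of 1 + alpha l^2 *)

Lemma der_unique (f : R -> C) (x : R) (a b : C) : der f x a -> der f x b -> a = b.
Proof.
  intros Ha Hb. apply injective_projections.
  - change (Re a = Re b). rewrite <- (is_derive_unique _ _ _ (der_Re _ _ _ Ha)).
    apply is_derive_unique, (der_Re _ _ _ Hb).
  - change (Im a = Im b). rewrite <- (is_derive_unique _ _ _ (der_Im _ _ _ Ha)).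
    apply is_derive_unique, (der_Im _ _ _ Hb).
Qed.

Lemma Ci_sqr : (Ci * Ci)%C = (- RtoC 1)%C.
Proof. unfold Ci, Cmult; simpl. apply injective_projections; simpl; ring. Qed.

Lemma Ci_neq_0 : Ci <> RtoC 0.
Proof. intros E. apply (f_equal snd) in E. simpl in E. lra. Qed.

Lemma RtoC_neq_0 (x : R) : x <> 0 -> RtoC x <> RtoC 0.
Proof. intros H E. apply H. now apply RtoC_inj. Qed.

Lemma root_sqrt (alpha : R) : 0 < alpha -> alpha * (/ sqrt alpha * / sqrt alpha) = 1.
Proof.
  intros H. pose proof (sqrt_lt_R0 alpha H).
  rewrite <- (sqrt_sqrt alpha) at 1 by lra. field. lra.
Qed.

Lemma factor_root (alpha : R) (l : C) : 0 < alpha ->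
  (1 + alpha * l ^ 2 = alpha * ((l - Ci * RtoC (/ sqrt alpha)) * (l + Ci * RtoC (/ sqrt alpha))))%C.
Proof.
  intros H.
  replace (alpha * ((l - Ci * RtoC (/ sqrt alpha)) * (l + Ci * RtoC (/ sqrt alpha))))%C
    with (alpha * l ^ 2 - (Ci * Ci) * RtoC (alpha * (/ sqrt alpha * / sqrt alpha))%R)%C.
  - rewrite root_sqrt, Ci_sqr by exact H. ring.
  - rewrite !RtoC_mult. simpl. ring.
Qed.

(** * Bounded solutions of linear equations and Taylor polynomials of the exponential *)

(** Apply the real mean value theorem to the component of [F] in the direction of its
    increment. *)
Lemma mean_value (F F' : R -> C) (G G' : R -> R) (a b : R) :
  a <= b ->
  (forall x, a < x < b -> der F x (F' x)) -> (forall x, a <= x <= b -> contp F x) ->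
  (forall x, a < x < b -> is_derive G x (G' x)) -> (forall x, a <= x <= b -> continuous G x) ->
  (forall x, a < x < b -> Cmod (F' x) <= G' x) ->
  Cmod (F b - F a)%C <= G b - G a.
Proof.
  intros Hab HF HFc HG HGc Hle.
  assert (Hmono : forall (f f' : R -> R), (forall x, a < x < b -> is_derive f x (f' x)) ->
    (forall x, a <= x <= b -> continuous f x) -> (forall x, a < x < b -> 0 <= f' x) -> f a <= f b).
  { intros f f' Hd Hc Hp.
    pose (df := fun x => if Rlt_dec a x then if Rlt_dec x b then f' x else 0 else 0).
    destruct (MVT_gen f a b df) as [c [_ E]].
    - intros x. rewrite Rmin_left, Rmax_right by lra. intros Hx. unfold df.
      destruct Rlt_dec; [destruct Rlt_dec |]; try lra. now apply Hd.
    - intros x. rewrite Rmin_left, Rmax_right by lra. intros Hx.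
      apply continuity_pt_filterlim, Hc, Hx.
    - assert (0 <= df c).
      { unfold df. destruct Rlt_dec; [destruct Rlt_dec |]; try lra. apply Hp. lra. }
      nra. }
  set (w := (F b - F a)%C).
  pose proof (Cmod_ge_0 w) as Hw.
  assert (HGm : G a <= G b).
  { apply (Hmono G G'); trivial. intros x Hx. eapply Rle_trans; [apply Cmod_ge_0 | now apply Hle]. }
  destruct (Req_dec (Cmod w) 0) as [E | E]; [lra |].
  (* project on the direction of the increment *)
  pose (f := fun x => Cmod w * G x - Re (Cconj w * F x)%C).
  assert (Hf : f a <= f b).
  { apply (Hmono f (fun x => Cmod w * G' x - Re (Cconj w * F' x)%C)).
    - intros x Hx. apply (is_derive_minus (V := R_NormedModule)).
      + apply (is_derive_scal G x (Cmod w)). now apply HG.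
      + apply (der_Re (fun x => Cconj w * F x)%C), der_Cmult_l. now apply HF.
    - intros x Hx. unfold f. apply contR_minus.
      + apply contR_mult; [apply continuous_const | now apply HGc].
      + apply (contp_Re (fun x => Cconj w * F x)%C). apply contp_mult; [ct | now apply HFc].
    - intros x Hx. specialize (Hle x Hx).
      pose proof (re_le_Cmod (Cconj w * F' x)%C) as Hre. rewrite Cmod_mult, Cmod_conj in Hre.
      pose proof (Rle_abs (Re (Cconj w * F' x)%C)). nra. }
  unfold f in Hf.
  assert (Ew : Re (Cconj w * F b)%C - Re (Cconj w * F a)%C = Cmod w * Cmod w).
  { transitivity (Cmod w ^ 2); [| ring]. rewrite Cmod2_alt. unfold w, Cconj, Re, Im. simpl. ring. }
  nra.
Qed.

(** The solution grows like [exp (a z)] unless its value at [z0] is balanced by the later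
    values of [e]: integrate the derivative of [exp (- a (z - z0)) Q] up to a point so large
    that the bound [M] is damped away. *)
Lemma bounded_growing_solution (Q e : R -> C) (a z0 M d : R) :
  0 < a -> 0 <= d ->
  (forall z, z0 < z -> der Q z (a * Q z + e z)%C) -> (forall z, z0 <= z -> contp Q z) ->
  (forall z, z0 < z -> Cmod (e z) <= d) -> (forall z, z0 <= z -> Cmod (Q z) <= M) ->
  Cmod (Q z0) <= d / a.
Proof.
  intros Ha Hd0 Hder Hc He HM.
  pose (F := fun y : R => (Cexp (RtoC (- a * (y - z0))) * Q y)%C).
  assert (HF : forall y, z0 < y -> der F y (Cexp (RtoC (- a * (y - z0))) * e y)%C).
  { intros y Hy. unfold F.
    eapply der_eq; [| apply der_mult; [apply der_Cexp, der_RtoC | apply Hder, Hy]].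
    2: { instantiate (1 := - a). auto_derive; [trivial | ring]. }
    cbv beta. rewrite RtoC_opp. ring. }
  assert (Hall : forall T, z0 < T -> Cmod (Q z0) <= exp (- a * (T - z0)) * M + d / a).
  { intros T HT.
    assert (Hmv : Cmod (F T - F z0)%C <= - d / a * exp (- a * (T - z0)) - - d / a * exp (- a * (z0 - z0))).
    { apply (mean_value F (fun y => Cexp (RtoC (- a * (y - z0))) * e y)%C
               (fun y => - d / a * exp (- a * (y - z0))) (fun y => d * exp (- a * (y - z0)))).
      - lra.
      - intros y Hy. apply HF. lra.
      - intros y Hy. unfold F. apply contp_mult; [ct | apply Hc; lra].
      - intros y Hy. auto_derive; [trivial | unfold Rminus; field; lra].
      - intros y Hy. apply (ex_derive_continuous (V := R_NormedModule)). auto_derive. trivial.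
      - intros y Hy. rewrite Cmod_mult, Cmod_Cexp. simpl Re. rewrite Rmult_comm.
        apply Rmult_le_compat_r; [apply Rlt_le, exp_pos | apply He; lra]. }
    assert (E0 : F z0 = Q z0).
    { unfold F. replace (- a * (z0 - z0)) with 0 by ring. rewrite Cexp_0. ring. }
    rewrite E0 in Hmv.
    assert (HT' : Cmod (F T) <= exp (- a * (T - z0)) * M).
    { unfold F. rewrite Cmod_mult, Cmod_Cexp. simpl Re. apply Rmult_le_compat_l; [apply Rlt_le, exp_pos | apply HM; lra]. }
    replace (- a * (z0 - z0)) with 0 in Hmv by ring. rewrite exp_0 in Hmv.
    pose proof (exp_pos (- a * (T - z0))).
    assert (0 <= d / a) by (apply Rmult_le_pos; [exact Hd0 | apply Rlt_le, Rinv_0_lt_compat, Ha]).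
    replace (Q z0) with (F T - (F T - Q z0))%C by ring.
    eapply Rle_trans; [apply Cmod_triangle |]. rewrite Cmod_opp.
    replace (- d / a) with (- (d / a)) in Hmv by (field; lra). nra. }
  apply Rle_plus_epsilon. intros eps Heps.
  assert (HM0 : 0 <= M) by (eapply Rle_trans; [apply Cmod_ge_0 | apply (HM z0 (Rle_refl z0))]).
  (* then [exp (- a (T - z0)) M <= eps], since [y <= exp y] *)
  pose (T := z0 + (M + 1) / (a * eps)).
  assert (Hp : 0 < (M + 1) / (a * eps)) by (apply Rdiv_lt_0_compat; [lra | now apply Rmult_lt_0_compat]).
  assert (HT : z0 < T) by (unfold T; lra).
  specialize (Hall T HT).
  assert (Hexp : exp (- a * (T - z0)) * M <= eps).
  { replace (- a * (T - z0)) with (- (a * (T - z0))) by ring. rewrite exp_Ropp.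
    assert (Hy : a * (T - z0) = (M + 1) / eps) by (unfold T; field; lra).
    rewrite Hy.
    assert (Hpos : 0 < (M + 1) / eps) by (apply Rdiv_lt_0_compat; lra).
    pose proof (exp_ineq1 _ (Rgt_not_eq _ _ Hpos)) as Hin.
    apply Rmult_le_reg_l with (exp ((M + 1) / eps)); [apply exp_pos |].
    rewrite <- Rmult_assoc, Rinv_r, Rmult_1_l by apply Rgt_not_eq, exp_pos.
    apply Rle_trans with ((M + 1) / eps * eps); [field_simplify; lra |].
    apply Rmult_le_compat_r; lra. }
  lra.
Qed.

(** Integrate the derivative of [exp (a (x - z)) y]. *)
Lemma decaying_solution (y e : R -> C) (a z0 z d : R) :
  0 < a -> 0 <= d -> z0 <= z ->
  (forall x, z0 < x < z -> der y x (- a * y x + e x)%C) -> (forall x, z0 <= x <= z -> contp y x) ->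
  (forall x, z0 < x < z -> Cmod (e x) <= d) ->
  Cmod (y z - Cexp (RtoC (- a * (z - z0))) * y z0)%C <= d / a.
Proof.
  intros Ha Hd0 Hz Hder Hc He.
  pose (F := fun x : R => (Cexp (RtoC (a * (x - z))) * y x)%C).
  assert (Hmv : Cmod (F z - F z0)%C <= d / a * exp (a * (z - z)) - d / a * exp (a * (z0 - z))).
  { apply (mean_value F (fun x => Cexp (RtoC (a * (x - z))) * e x)%C
             (fun x => d / a * exp (a * (x - z))) (fun x => d * exp (a * (x - z)))).
    - exact Hz.
    - intros x Hx. unfold F.
      eapply der_eq; [| apply der_mult; [apply der_Cexp, der_RtoC | apply Hder, Hx]].
      2: { instantiate (1 := a). auto_derive; [trivial | ring]. }
      cbv beta. ring.
    - intros x Hx. unfold F. apply contp_mult; [ct | now apply Hc].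
    - intros x Hx. auto_derive; [trivial | unfold Rminus; field; lra].
    - intros x Hx. apply (ex_derive_continuous (V := R_NormedModule)). auto_derive. trivial.
    - intros x Hx. rewrite Cmod_mult, Cmod_Cexp. simpl Re. rewrite Rmult_comm.
      apply Rmult_le_compat_r; [apply Rlt_le, exp_pos | now apply He]. }
  unfold F in Hmv. replace (a * (z - z)) with 0 in Hmv by ring. rewrite Cexp_0, exp_0 in Hmv.
  replace (- a * (z - z0)) with (a * (z0 - z)) by ring.
  rewrite Cmult_1_l in Hmv.
  assert (0 <= d / a * exp (a * (z0 - z))).
  { apply Rmult_le_pos; [| apply Rlt_le, exp_pos].
    apply Rmult_le_pos; [exact Hd0 | apply Rlt_le, Rinv_0_lt_compat, Ha]. }
  lra.
Qed.

Lemma exp_monotone (x y : R) : x <= y -> exp x <= exp y.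
Proof.
  intros H. destruct (Rle_lt_or_eq_dec x y H) as [Hlt | ->]; [| lra].
  apply Rlt_le, exp_increasing, Hlt.
Qed.

Definition exp_taylor (n : nat) (w : C) : C := Csum n (fun j => w ^ j * / INR (fact j))%C.

Lemma der_exp_taylor (n : nat) (w : C) (th : R) :
  der (fun th : R => exp_taylor (S n) (th * w)%C) th (w * exp_taylor n (th * w))%C.
Proof.
  induction n as [|n IH].
  - unfold exp_taylor. simpl.
    eapply der_eq; [| apply (is_derive_ext (V := C_R_NormedModule) (fun _ => RtoC 1)); [| apply der_const]].
    + simpl. ring.
    + intros t. simpl. field.
  - apply (der_ext
      (fun th : R => exp_taylor (S n) (th * w) + / INR (fact (S n)) * (th * w) ^ S n)%C).
    { intros t. unfold exp_taylor. cbn [Csum]. ring. }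
    eapply der_eq; [| apply der_plus; [apply IH | apply der_Cmult_l, der_pow, der_Cmult_r, der_id]].
    unfold exp_taylor at 2. cbn [Csum]. fold (exp_taylor n (th * w)).
    replace (INR (fact (S n))) with (INR (S n) * INR (fact n)) by (rewrite <- mult_INR; reflexivity).
    rewrite RtoC_mult. field. split; apply RtoC_neq_0; [apply INR_fact_neq_0 | apply not_0_INR; lia].
Qed.

Lemma exp_taylor_0 (n : nat) : exp_taylor (S n) 0 = RtoC 1.
Proof.
  induction n as [|n IH].
  - unfold exp_taylor. simpl. field.
  - change (exp_taylor (S n) 0 + RtoC 0 ^ S n * / INR (fact (S n)) = RtoC 1)%C.
    rewrite IH. cbn [Cpow]. ring.
Qed.

(** Induction on [n]: along the segment from 0 to [w] the derivative of the error is [w]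
    times the previous error. *)
Lemma exp_taylor_error (n : nat) (w : C) :
  Cmod (Cexp w - exp_taylor n w)%C <= Cmod w ^ n / INR (fact n) * exp (Cmod w).
Proof.
  assert (Hexp : forall th : R, 0 <= th <= 1 -> Cmod (Cexp (th * w)) <= exp (Cmod w)).
  { intros th Hth. rewrite Cmod_Cexp. apply exp_monotone.
    eapply Rle_trans; [apply Rle_abs |]. eapply Rle_trans; [apply re_le_Cmod |].
    rewrite Cmod_mult, Cmod_R, Rabs_pos_eq by lra. pose proof (Cmod_ge_0 w). nra. }
  assert (G : forall n (th : R), 0 <= th <= 1 ->
    Cmod (Cexp (th * w) - exp_taylor n (th * w))%C <= (th * Cmod w) ^ n / INR (fact n) * exp (Cmod w)).
  { clear n. induction n as [|n IH]; intros th Hth.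
    - unfold exp_taylor. simpl. replace (Cexp (th * w) - RtoC 0)%C with (Cexp (th * w)) by ring.
      specialize (Hexp th Hth). lra.
    - pose (F := fun th : R => (Cexp (th * w) - exp_taylor (S n) (th * w))%C).
      assert (HF : forall y, der F y (w * (Cexp (y * w) - exp_taylor n (y * w)))%C).
      { intros y. eapply der_eq; [| apply der_minus; [apply der_Cexp, der_Cmult_r, der_id | apply der_exp_taylor]].
        cbv beta. ring. }
      assert (F0 : F 0 = RtoC 0).
      { unfold F. replace (RtoC 0 * w)%C with (RtoC 0) by ring.
        rewrite Cexp_0, exp_taylor_0. ring. }
      pose (g := fun y : R => (y * Cmod w) ^ S n / INR (fact (S n)) * exp (Cmod w)).
      assert (Hg : forall y, is_derive g y (Cmod w * ((y * Cmod w) ^ n / INR (fact n) * exp (Cmod w)))).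
      { intros y. unfold g. rewrite fact_simpl, mult_INR.
        auto_derive; [trivial |]. simpl pred.
        field. split; [apply INR_fact_neq_0 | change (INR (S n) <> 0); apply not_0_INR; lia]. }
      assert (Hmv : Cmod (F th - F 0)%C <= g th - g 0).
      { apply (mean_value F _ g _ 0 th (proj1 Hth)) with (1 := fun x _ => HF x) (3 := fun x _ => Hg x).
        - intros x _. eapply der_cont, HF.
        - intros x _. apply (ex_derive_continuous (V := R_NormedModule)). eexists. apply Hg.
        - intros x Hx. rewrite Cmod_mult. apply Rmult_le_compat_l; [apply Cmod_ge_0 |]. apply IH. lra. }
      rewrite F0 in Hmv. replace (F th - RtoC 0)%C with (F th) in Hmv by ring.
      assert (g0 : g 0 = 0) by (unfold g; simpl; unfold Rdiv; ring).
      rewrite g0 in Hmv. unfold F, g in Hmv. lra. }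
  specialize (G n 1). rewrite Rmult_1_l, Cmult_1_l in G. apply G. lra.
Qed.

(** * Integrals over the line *)

Definition ldec (g : R -> C) (M : R) : Prop := forall l, Cmod (g l) <= M / (1 + Rabs l) ^ 2.

Lemma CRInt_reflect (g : R -> C) (A B : R) : cont g ->
  CRInt g (- A) B = (CRInt g 0 B + CRInt (fun l => g (- l)%R) 0 A)%C.
Proof.
  intros Hc. rewrite <- (CRInt_Chasles g (- A) 0 B Hc). rewrite Cplus_comm. f_equal.
  apply CRInt_unique.
  assert (H : is_RInt (V := C_R_NormedModule) (fun l => opp (g (- l)%R)) 0 A (CRInt g (- 0) (- A))).
  { apply (is_RInt_comp_opp (V := C_R_NormedModule)). now apply is_CRInt. }
  rewrite Ropp_0 in H.
  assert (E : CRInt g 0 (- A) = (- CRInt (fun l => g (- l)%R) 0 A)%C).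
  { rewrite <- (CRInt_opp (fun l => g (- l)%R)).
    - symmetry. apply CRInt_unique. exact H.
    - intros p. apply (contp_app g (fun l => - l)); [exact Hc | ct]. }
  pose proof (is_RInt_swap (V := C_R_NormedModule) g _ _ _ (is_CRInt g 0 (- A) Hc)) as H2.
  rewrite E in H2. change (is_RInt (V := C_R_NormedModule) g (- A) 0 (- - CRInt (fun l => g (- l)%R) 0 A)%C) in H2.
  replace (- - CRInt (fun l => g (- l)%R) 0 A)%C with (CRInt (fun l => g (- l)%R) 0 A) in H2 by ring.
  exact H2.
Qed.

(** Both end points tend to infinity independently, hence the two bounds [A] and [B]. *)
Lemma is_line (g : R -> C) (L : C) :
  cont g ->
  (forall eps, 0 < eps -> exists N, forall A B, N < A -> N < B -> Cmod (CRInt g (- A) B - L)%C < eps) ->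
  is_RInt_gen (V := C_R_NormedModule) g (Rbar_locally m_infty) (Rbar_locally p_infty) L.
Proof.
  intros Hc HL P [eps HP].
  destruct (HL eps (cond_pos eps)) as [N HN].
  exists (fun x => x < - N) (fun q => N < q).
  - now exists (- N).
  - now exists N.
  - intros x q Hx Hq. simpl in *. exists (CRInt g x q). split; [now apply is_CRInt |].
    apply HP, Cmod_ball. replace x with (- - x) by ring. apply HN; lra.
Qed.

Lemma line_dec_halves (g : R -> C) (M : R) : ldec g M -> dec g M /\ dec (fun l => g (- l)%R) M.
Proof.
  intros H. split; intros y Hy.
  - specialize (H y). now rewrite Rabs_pos_eq in H.
  - specialize (H (- y)). rewrite Rabs_Ropp, Rabs_pos_eq in H; assumption.
Qed.

Lemma line_tail (g : R -> C) (M A B : R) :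
  cont g -> ldec g M -> 0 <= A -> 0 <= B ->
  Cmod (CRInt g (- A) B - half_line_int (fun l => g l + g (- l)%R))%C <= M / (1 + A) + M / (1 + B).
Proof.
  intros Hc HM HA HB. destruct (line_dec_halves g M HM) as [D1 D2].
  assert (Hc' : cont (fun l => g (- l)%R)).
  { intros p. apply (contp_app g (fun l => - l)); [exact Hc | ct]. }
  rewrite (half_line_plus g (fun l => g (- l)%R) M M), CRInt_reflect by assumption.
  pose proof (half_line_tail g M B Hc D1 HB).
  pose proof (half_line_tail _ M A Hc' D2 HA).
  match goal with |- Cmod ?x <= _ => replace x with
    ((CRInt g 0 B - half_line_int g) + (CRInt (fun l => g (- l)%R) 0 A - half_line_int (fun l => g (- l)%R)))%C by ring end.
  eapply Rle_trans; [apply Cmod_triangle |]. rewrite (Rplus_comm (M / _)). apply Rplus_le_compat; assumption.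
Qed.

Lemma is_line_dec (g : R -> C) (M : R) : cont g -> ldec g M ->
  is_RInt_gen (V := C_R_NormedModule) g (Rbar_locally m_infty) (Rbar_locally p_infty)
    (half_line_int (fun l => g l + g (- l)%R))%C.
Proof.
  intros Hc HM. apply is_line; [exact Hc |]. intros eps Heps.
  destruct (Rdiv_small M (eps / 2)) as [N [HN0 HN]]; [lra | apply (dec_nonneg g), line_dec_halves, HM |].
  exists N. intros A B HA HB.
  pose proof (line_tail g M A B Hc HM ltac:(lra) ltac:(lra)).
  pose proof (HN A HA). pose proof (HN B HB). lra.
Qed.

Lemma zero_of_small (z : C) (c : R) : (forall A, 1 < A -> Cmod z <= c / A) -> z = RtoC 0.
Proof.
  intros H. apply Cmod_eq_0, Rle_antisym; [| apply Cmod_ge_0].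
  apply Rle_plus_epsilon. intros eps Heps. rewrite Rplus_0_l.
  pose proof (Rabs_pos c). pose proof (Rle_abs c).
  assert (Hq : 0 <= Rabs c / eps) by (apply Rmult_le_pos; [lra | apply Rlt_le, Rinv_0_lt_compat; lra]).
  eapply Rle_trans; [apply (H (Rabs c / eps + 2)); lra |].
  apply Rmult_le_reg_r with (Rabs c / eps + 2); [lra |].
  unfold Rdiv at 1. rewrite Rmult_assoc, Rinv_l, Rmult_1_r by lra.
  replace (eps * (Rabs c / eps + 2)) with (Rabs c + 2 * eps) by (field; lra). lra.
Qed.

Lemma value_at_end (f : R -> C) (c : C) (z : R) :
  0 < z -> contp f 0 -> (forall x, 0 < x < z -> f x = c) -> f 0 = c.
Proof.
  intros Hz Hf H.
  assert (E : (f 0 - c)%C = RtoC 0).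
  { apply Cmod_eq_0, Rle_antisym; [| apply Cmod_ge_0].
    apply Rle_plus_epsilon. intros eps Heps. rewrite Rplus_0_l.
    destruct (proj1 (contp_iff f 0) Hf eps Heps) as [d Hd].
    pose (x := Rmin (d / 2) (z / 2)).
    pose proof (cond_pos d).
    assert (Hx : 0 < x) by (apply Rmin_pos; lra).
    assert (Hx1 : x <= d / 2) by apply Rmin_l. assert (Hx2 : x <= z / 2) by apply Rmin_r.
    assert (Hb : ball 0 d x) by (change (Rabs (x - 0) < d); apply Rabs_def1; lra).
    specialize (Hd x Hb). rewrite (H x) in Hd by lra.
    replace (f 0 - c)%C with (- (c - f 0))%C by ring. rewrite Cmod_opp. lra. }
  replace (f 0) with ((f 0 - c) + c)%C by ring. rewrite E. ring.
Qed.

(** * Powers of 1 / (1 + alpha l^2) on the real line *)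

Section Solution.

Variable alpha : R.
Hypothesis Halpha : 0 < alpha.

Local Notation a := (/ sqrt alpha).

(** The symbol of [1 / (1 - alpha d^2/dx^2)]; its pole [i / sqrt alpha] is the singularity
    inside the contour. *)
Definition res (l : C) : C := (/ (1 + alpha * l ^ 2))%C.

(** The values of [res] on the real line. *)
Definition rres (l : R) : R := / (1 + alpha * l ^ 2).

Lemma rres_den (l : R) : 0 < 1 + alpha * l ^ 2.
Proof. pose proof (pow2_ge_0 l). nra. Qed.

Lemma res_RtoC (l : R) : res l = RtoC (rres l).
Proof.
  unfold res, rres. rewrite RtoC_inv by apply Rgt_not_eq, rres_den.
  rewrite RtoC_plus, RtoC_mult, RtoC_pow. reflexivity.
Qed.

Lemma rres_pos (l : R) : 0 < rres l.
Proof. apply Rinv_0_lt_compat, rres_den. Qed.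

Lemma rres_le_1 (l : R) : rres l <= 1.
Proof.
  unfold rres. rewrite <- Rinv_1. apply Rinv_le_contravar; [lra |]. pose proof (pow2_ge_0 l). nra.
Qed.

Lemma rres_sqr (l : R) : (1 + l ^ 2) * rres l <= 1 + / alpha.
Proof.
  pose proof (rres_den l). pose proof (pow2_ge_0 l).
  assert (0 < / alpha) by now apply Rinv_0_lt_compat.
  apply Rmult_le_reg_r with (1 + alpha * l ^ 2); [assumption |].
  unfold rres. rewrite Rmult_assoc, Rinv_l by lra.
  replace ((1 + / alpha) * (1 + alpha * l ^ 2)) with (1 + / alpha + alpha * l ^ 2 + (/ alpha * alpha) * l ^ 2) by ring.
  rewrite Rinv_l by lra. nra.
Qed.

Lemma rres_abs (l : R) : Rabs l * rres l <= 1 + / alpha.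
Proof.
  eapply Rle_trans; [| apply (rres_sqr l)]. apply Rmult_le_compat_r; [apply Rlt_le, rres_pos |].
  pose proof (Rabs_pos l). rewrite <- (pow2_abs l). nra.
Qed.

Lemma rres_dec (l : R) : rres l <= 2 * (1 + / alpha) / (1 + Rabs l) ^ 2.
Proof.
  pose proof (one_plus_sqr_pos (Rabs l) (Rabs_pos l)) as Hp.
  apply Rmult_le_reg_r with ((1 + Rabs l) ^ 2); [exact Hp |].
  unfold Rdiv. rewrite Rmult_assoc, Rinv_l, Rmult_1_r by lra.
  pose proof (rres_sqr l) as Hs. pose proof (rres_pos l).
  assert ((1 + Rabs l) ^ 2 <= 2 * (1 + l ^ 2)).
  { rewrite <- (pow2_abs l). pose proof (pow2_ge_0 (Rabs l - 1)%R). nra. }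
  nra.
Qed.

Lemma cont_rres {T : UniformSpace} (f : T -> R) (p : T) : continuous f p -> continuous (fun q => rres (f q)) p.
Proof.
  intros H. apply (contR_comp f rres); [exact H |]. apply continuity_pt_filterlim.
  apply (ex_derive_continuous (V := R_NormedModule)). unfold rres. auto_derive.
  pose proof (rres_den (f p)). simpl in *. lra.
Qed.

(** The remainder in the differential equation for the truncated integral of [exp (i l z) /
    (1 + alpha l^2)]: the pole above the line has been cancelled. *)
Definition lower_pole_int (A B z : R) : C :=
  CRInt (fun l => Cexp (Ci * l * z) * / (l + Ci * a))%C (- A) B.

Lemma lower_pole_neq (l : R) : (l + Ci * a)%C <> RtoC 0.
Proof.
  intros E. apply (f_equal snd) in E. simpl in E.
  pose proof (Rinv_0_lt_compat _ (sqrt_lt_R0 alpha Halpha)). lra.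
Qed.

Lemma Cmod_Cexp_imag (x : R) : Cmod (Cexp (Ci * x)) = 1.
Proof. rewrite Cmod_Cexp. replace (Re (Ci * x)%C) with 0 by (simpl; ring). apply exp_0. Qed.

Lemma Cmod_Cexp_line (l z : R) : Cmod (Cexp (Ci * l * z)) = 1.
Proof. rewrite <- Cmult_assoc, <- RtoC_mult. apply Cmod_Cexp_imag. Qed.

Lemma Cmod_ge_Im (z : C) : Rabs (Im z) <= Cmod z.
Proof. eapply Rle_trans; [apply Rmax_r | apply Rmax_Cmod]. Qed.

Lemma lower_pole_inv_le (l : R) : Cmod (/ (l + Ci * a))%C <= sqrt alpha.
Proof.
  pose proof (sqrt_lt_R0 alpha Halpha) as Hs.
  pose proof (Rinv_0_lt_compat _ Hs).
  rewrite Cmod_inv by apply lower_pole_neq.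
  rewrite <- (Rinv_inv (sqrt alpha)) at 2. apply Rinv_le_contravar; [assumption |].
  eapply Rle_trans; [| apply Cmod_ge_Im]. simpl.
  replace (0 + (0 * 0 + 1 * a)) with a by ring. apply Rle_abs.
Qed.

Lemma Cinv_imag_minus (B : R) : 0 < B -> Cmod (/ (Ci * B - a))%C <= / B.
Proof.
  intros HB.
  assert (Hle : B <= Cmod (Ci * B - a)%C).
  { eapply Rle_trans; [| apply Cmod_ge_Im]. simpl.
    replace (0 * 0 + 1 * B + - 0) with B by ring. apply Rle_abs. }
  rewrite Cmod_inv by (apply Cmod_gt_0; lra). now apply Rinv_le_contravar.
Qed.

Lemma Cinv_imag_plus (B : R) : 0 < B -> Cmod (/ (- (Ci * B) - a))%C <= / B.
Proof.
  intros HB.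
  assert (Hle : B <= Cmod (- (Ci * B) - a)%C).
  { eapply Rle_trans; [| apply Cmod_ge_Im]. simpl.
    replace (- (0 * 0 + 1 * B) + - 0) with (- B) by ring. rewrite Rabs_Ropp. apply Rle_abs. }
  rewrite Cmod_inv by (apply Cmod_gt_0; lra). now apply Rinv_le_contravar.
Qed.

(** The derivative brings down [i l = i (l + i a) + a]; the first part cancels the pole and
    integrates explicitly. *)
Lemma der_lower_pole_int (A B z : R) : 0 < A -> 0 < B -> 0 < z ->
  der (lower_pole_int A B) z
    (a * lower_pole_int A B z + (Cexp (Ci * B * z) - Cexp (- (Ci * A * z))) / z)%C.
Proof.
  intros HA HB Hz.
  assert (Hc : cont (fun l : R => / (l + Ci * a))%C).
  { intros l. apply contp_inv; [apply lower_pole_neq | ct]. }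
  assert (Hc2 : cont2 (fun z l : R => Cexp (Ci * l * z) * / (l + Ci * a))%C).
  { intros q. apply contp_mult; [ct |]. apply (contp_app (fun l : R => / (l + Ci * a))%C); [exact Hc | ct]. }
  assert (Hc2' : cont2 (fun z l : R => Ci * l * Cexp (Ci * l * z) * / (l + Ci * a))%C).
  { intros q. apply contp_mult; [ct |]. apply (contp_app (fun l : R => / (l + Ci * a))%C); [exact Hc | ct]. }
  apply (der_eq _ z (CRInt (fun l => Ci * l * Cexp (Ci * l * z) * / (l + Ci * a))%C (- A) B)).
  2: { apply (der_CRInt_param (fun z l : R => Cexp (Ci * l * z) * / (l + Ci * a))%C
         (fun z l : R => Ci * l * Cexp (Ci * l * z) * / (l + Ci * a))%C (- A) B z); [lra | exact Hc2 | exact Hc2' |].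
       apply filter_forall. intros y l _. apply der_Cmult_r.
       eapply der_eq; [| apply der_Cexp, der_Cmult_l, der_id]. cbv beta. ring. }
  assert (Hzc : RtoC z <> RtoC 0) by (apply RtoC_neq_0; lra).
  rewrite (CRInt_ext _ (fun l => Ci * Cexp (Ci * l * z) + a * (Cexp (Ci * l * z) * / (l + Ci * a)))%C).
  - rewrite CRInt_plus, !CRInt_Cmult.
    + fold (lower_pole_int A B z).
      rewrite (CRInt_der_all (fun l : R => / (Ci * z) * Cexp (Ci * l * z))%C).
      * replace (Ci * RtoC (- A) * z)%C with (- (Ci * A * z))%C by (rewrite RtoC_opp; ring).
        field. split; [exact Hzc | apply Ci_neq_0].
      * ct.
      * intros x. eapply der_eq; [| apply der_Cmult_l, der_Cexp, der_Cmult_r, der_Cmult_l, der_id].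
        cbv beta. field. split; [exact Hzc | apply Ci_neq_0].
    + intros l. apply (cont2_r _ z Hc2 l).
    + ct.
    + ct.
    + intros l. apply contp_mult; [ct |]. apply (cont2_r _ z Hc2 l).
  - intros l _. pose proof (lower_pole_neq l) as Hn.
    assert (E : (Ci * l * Cexp (Ci * l * z) =
      Ci * Cexp (Ci * l * z) * (l + Ci * a) - (Ci * Ci) * a * Cexp (Ci * l * z))%C) by ring.
    rewrite E, Ci_sqr. field. exact Hn.
Qed.

(** The integrand only decays like [1 / l], but the integral is a bounded solution of the
    growing equation of [der_lower_pole_int], and the oscillating inhomogeneity of that
    equation is matched up to order [1 / z^2] by the explicit function [corr]. Hence the
    integral is as small as [corr] and [1 / (a z^2)]. *)
Lemma lower_pole_int_le (A B z : R) : 0 < A -> 0 < B -> 0 < z ->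
  Cmod (lower_pole_int A B z) <= (/ A + / B) * (/ z + sqrt alpha / z ^ 2).
Proof.
  intros HA HB Hz.
  pose proof (sqrt_lt_R0 alpha Halpha) as Hs. pose proof (Rinv_0_lt_compat _ Hs) as Ha.
  pose proof (Rinv_0_lt_compat _ HA) as HiA. pose proof (Rinv_0_lt_compat _ HB) as HiB.
  assert (HzR : forall y, z <= y -> RtoC y <> RtoC 0) by (intros y Hy; apply RtoC_neq_0; lra).
  pose (bB := (/ (Ci * B - a))%C). pose (bA := (/ (- (Ci * A) - a))%C).
  pose proof (Cinv_imag_minus B HB) as LB. fold bB in LB.
  pose proof (Cinv_imag_plus A HA) as LA. fold bA in LA.
  assert (EB : (bB * (Ci * B - a) = 1)%C).
  { apply Cinv_l. intros E. apply (f_equal snd) in E. simpl in E. lra. }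
  assert (EA : (bA * (- (Ci * A) - a) = 1)%C).
  { apply Cinv_l. intros E. apply (f_equal snd) in E. simpl in E. lra. }
  (* an approximate solution of the same differential equation *)
  pose (corr := fun y : R => ((bB * Cexp (Ci * B * y) - bA * Cexp (- (Ci * A * y))) * / y)%C).
  pose (e := fun y : R => ((bB * Cexp (Ci * B * y) - bA * Cexp (- (Ci * A * y))) * (/ y * / y))%C).
  assert (Lnum : forall y : R, Cmod (bB * Cexp (Ci * B * y) - bA * Cexp (- (Ci * A * y)))%C <= / A + / B).
  { intros y. eapply Rle_trans; [apply Cmod_triangle |]. rewrite Cmod_opp, !Cmod_mult, Cmod_Cexp_line.
    replace (- (Ci * A * y))%C with (Ci * RtoC (- A) * y)%C by (rewrite RtoC_opp; ring).
    rewrite Cmod_Cexp_line. lra. }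
  assert (Linv : forall y, z <= y -> Cmod (/ y)%C <= / z).
  { intros y Hy. rewrite Cmod_inv, Cmod_R, Rabs_pos_eq by (try apply HzR; lra).
    now apply Rinv_le_contravar. }
  assert (Lcorr : forall y, z <= y -> Cmod (corr y) <= (/ A + / B) * / z).
  { intros y Hy. unfold corr. rewrite Cmod_mult.
    apply Rmult_le_compat; try apply Cmod_ge_0; [apply Lnum | now apply Linv]. }
  assert (Le : forall y, z <= y -> Cmod (e y) <= (/ A + / B) * (/ z * / z)).
  { intros y Hy. unfold e. rewrite Cmod_mult, Cmod_mult.
    apply Rmult_le_compat; try apply Cmod_ge_0; [apply Rmult_le_pos; apply Cmod_ge_0 | apply Lnum |].
    apply Rmult_le_compat; try apply Cmod_ge_0; now apply Linv. }
  assert (Hcorr : forall y, z <= y -> der corr y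
    (a * corr y + (Cexp (Ci * B * y) - Cexp (- (Ci * A * y))) / y - e y)%C).
  { intros y Hy. unfold corr, e.
    eapply der_eq; [| apply der_mult; [apply der_minus; apply der_Cmult_l, der_Cexp;
      [apply der_Cmult_l, der_id | apply der_opp, der_Cmult_l, der_id]
      | apply der_inv; [now apply HzR | apply der_id]]].
    cbv beta. specialize (HzR y Hy).
    transitivity ((a * ((bB * Cexp (Ci * B * y) - bA * Cexp (- (Ci * A * y))) * / y) +
      ((bB * (Ci * B - a)) * Cexp (Ci * B * y) - (bA * (- (Ci * A) - a)) * Cexp (- (Ci * A * y))) / y -
      (bB * Cexp (Ci * B * y) - bA * Cexp (- (Ci * A * y))) * (/ y * / y))%C).
    - field. exact HzR.
    - rewrite EA, EB. field. exact HzR. }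
  assert (HP : Cmod (lower_pole_int A B z - corr z)%C <= (/ A + / B) * (/ z * / z) / a).
  { apply (bounded_growing_solution (fun y => lower_pole_int A B y - corr y)%C e a z
      ((A + B) * sqrt alpha + (/ A + / B) * / z)).
    - exact Ha.
    - pose proof (Rinv_0_lt_compat z Hz). apply Rmult_le_pos; nra.
    - intros y Hy. eapply der_eq; [| apply der_minus; [apply der_lower_pole_int; lra | apply Hcorr; lra]]. ring.
    - intros y Hy. eapply der_cont. apply der_minus; [apply der_lower_pole_int; lra | apply Hcorr; lra].
    - intros y Hy. apply Le. lra.
    - intros y Hy. eapply Rle_trans; [apply Cmod_triangle |]. rewrite Cmod_opp.
      apply Rplus_le_compat; [| now apply Lcorr].
      unfold lower_pole_int. replace (A + B) with (B - - A) by ring.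
      apply Cmod_CRInt_le; [lra | |].
      + intros l. apply contp_mult; [ct |]. apply contp_inv; [apply lower_pole_neq | ct].
      + intros l _. rewrite Cmod_mult, Cmod_Cexp_line, Rmult_1_l. apply lower_pole_inv_le. }
  replace (lower_pole_int A B z) with ((lower_pole_int A B z - corr z) + corr z)%C by ring.
  eapply Rle_trans; [apply Cmod_triangle |].
  specialize (Lcorr z (Rle_refl z)).
  replace ((/ A + / B) * (/ z * / z) / a) with ((/ A + / B) * (sqrt alpha / z ^ 2)) in HP
    by (field; lra). lra.
Qed.

Lemma Cexp_two_cos (x : R) : (Cexp (Ci * x) + Cexp (- (Ci * x)))%C = RtoC (2 * cos x).
Proof.
  unfold Cexp. simpl.
  replace (0 * x - 1 * 0) with 0 by ring. replace (0 * 0 + 1 * x) with x by ring.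
  rewrite Ropp_0, exp_0, cos_neg, sin_neg. apply injective_projections; simpl; ring.
Qed.

(** The integral of [exp (i l z) / (1 + alpha l^2)^n] over the line, folded onto the half
    line. *)
Definition even_int (n : nat) (z : R) : C :=
  half_line_int (fun l => RtoC (2 * cos (l * z) * rres l ^ n)).

(** [cdec / (1 + |l|)^2] dominates [2 / (1 + alpha l^2)] and the integrands of [even_int]
    and [even_int']. *)
Definition cdec : R := 4 * (1 + / alpha) * (1 + / alpha).

Lemma cdec_pos : 0 < cdec.
Proof. unfold cdec. pose proof (Rinv_0_lt_compat _ Halpha). nra. Qed.

Lemma rres_pow_le (n : nat) (l : R) : rres l ^ S n <= rres l.
Proof.
  pose proof (rres_pos l). pose proof (rres_le_1 l).
  simpl. rewrite <- (Rmult_1_r (rres l)) at 3. apply Rmult_le_compat_l; [lra |].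
  rewrite <- (pow1 n). apply pow_incr. lra.
Qed.

Lemma rres_pow_pos (n : nat) (l : R) : 0 < rres l ^ n.
Proof. apply pow_lt, rres_pos. Qed.

Lemma dec_trig (n : nat) (t w : R -> R) :
  (forall l, Rabs (t l) <= 1) -> (forall l, 0 <= l -> 0 <= w l * rres l <= 1 + / alpha) ->
  dec (fun l => RtoC (2 * w l * t l * rres l ^ S (S n))) cdec.
Proof.
  intros Ht Hw l Hl. rewrite Cmod_R, !Rabs_mult, (Rabs_pos_eq 2) by lra.
  specialize (Ht l). specialize (Hw l Hl). pose proof (rres_pos l) as Hr.
  rewrite (Rabs_pos_eq (rres l ^ S (S n))) by apply Rlt_le, rres_pow_pos.
  assert (Hwl : 0 <= w l).
  { apply Rmult_le_reg_r with (rres l); [exact Hr | lra]. }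
  rewrite (Rabs_pos_eq (w l) Hwl).
  change (rres l ^ S (S n)) with (rres l * rres l ^ S n).
  pose proof (rres_pow_le n l) as Hp. pose proof (rres_pow_pos (S n) l) as Hp0.
  pose proof (rres_dec l) as Hd. rewrite (Rabs_pos_eq l Hl) in Hd.
  apply Rle_trans with (2 * (1 + / alpha) * rres l).
  - replace (2 * w l * Rabs (t l) * (rres l * rres l ^ S n))
      with (2 * (w l * rres l) * (Rabs (t l) * rres l ^ S n)) by ring.
    apply Rmult_le_compat; [nra | pose proof (Rabs_pos (t l)); nra | lra |].
    pose proof (Rabs_pos (t l)). nra.
  - unfold cdec. pose proof (Rinv_0_lt_compat _ Halpha).
    apply Rle_trans with (2 * (1 + / alpha) * (2 * (1 + / alpha) / (1 + l) ^ 2)).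
    + apply Rmult_le_compat_l; lra.
    + right. unfold Rdiv. ring.
Qed.

Lemma dec_even (n : nat) (z : R) : dec (fun l => RtoC (2 * cos (l * z) * rres l ^ S n)) cdec.
Proof.
  intros l Hl. rewrite Cmod_R, !Rabs_mult, (Rabs_pos_eq 2) by lra.
  rewrite (Rabs_pos_eq (rres l ^ S n)) by apply Rlt_le, rres_pow_pos.
  pose proof (rres_pow_le n l) as Hp. pose proof (rres_pow_pos (S n) l) as Hp0.
  pose proof (rres_dec l) as Hd. rewrite (Rabs_pos_eq l Hl) in Hd.
  assert (Hc : Rabs (cos (l * z)) <= 1) by (apply Rabs_le, COS_bound).
  pose proof (Rabs_pos (cos (l * z))).
  pose proof (Rinv_0_lt_compat _ Halpha).
  apply Rle_trans with (2 * (2 * (1 + / alpha) / (1 + l) ^ 2)).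
  - nra.
  - unfold cdec, Rdiv. rewrite <- !Rmult_assoc. apply Rmult_le_compat_r.
    + apply Rlt_le, Rinv_0_lt_compat, one_plus_sqr_pos, Hl.
    + nra.
Qed.

Lemma cont_trig {T : UniformSpace} (g t f : T -> R) (phi : R -> R) (n : nat) (p : T) :
  continuous g p -> continuous t p -> continuity phi -> continuous f p ->
  contp (fun q => RtoC (g q * phi (t q) * rres (f q) ^ n)) p.
Proof.
  intros Hg Ht Hphi Hf. apply contp_RtoC. apply contR_mult; [apply contR_mult |].
  - exact Hg.
  - apply (contR_comp t phi); [exact Ht | apply Hphi].
  - apply (contR_comp (fun q => rres (f q)) (fun x => x ^ n)).
    + now apply cont_rres.
    + apply derivable_continuous_pt, derivable_pt_pow.
Qed.

Lemma cont2_even (n : nat) : cont2 (fun z l => RtoC (2 * cos (l * z) * rres l ^ n)).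
Proof.
  intros p. apply (cont_trig (fun _ => 2) (fun q : RR => snd q * fst q) (fun q : RR => snd q) cos n p);
    [ct | ct | apply continuity_cos | ct].
Qed.

Lemma cont_even_int (n : nat) : cont (even_int (S n)).
Proof.
  intros z. apply (half_line_cont (fun z l => RtoC (2 * cos (l * z) * rres l ^ S n)) z cdec).
  - apply cont2_even.
  - apply filter_forall. intros y. apply dec_even.
Qed.

Lemma even_int_bound (n : nat) (z : R) : Cmod (even_int (S n) z) <= cdec.
Proof. apply half_line_bound; [apply (cont2_r _ z (cont2_even (S n))) | apply dec_even]. Qed.

Definition even_int' (n : nat) (z : R) : C :=
  half_line_int (fun l => RtoC (- (2 * l * sin (l * z) * rres l ^ n))).

Lemma dec_even' (n : nat) (z : R) : dec (fun l => RtoC (- (2 * l * sin (l * z) * rres l ^ S (S n)))) cdec.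
Proof.
  intros l Hl. rewrite RtoC_opp, Cmod_opp. revert l Hl.
  apply (dec_trig n (fun l => sin (l * z)) (fun l => l)).
  - intros l. apply Rabs_le, SIN_bound.
  - intros l Hl. pose proof (rres_abs l) as H. rewrite (Rabs_pos_eq l Hl) in H.
    pose proof (rres_pos l). nra.
Qed.

Lemma cont2_even' (n : nat) : cont2 (fun z l => RtoC (- (2 * l * sin (l * z) * rres l ^ n))).
Proof.
  intros p. apply continuous_ext with (f := fun q : RR => (- RtoC (2 * snd q * sin (snd q * fst q) * rres (snd q) ^ n))%C).
  - intros q. now rewrite RtoC_opp.
  - apply contp_opp. apply (cont_trig (fun q : RR => 2 * snd q) (fun q : RR => snd q * fst q) (fun q : RR => snd q) sin n p);
      [ct | ct | apply continuity_sin | ct].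
Qed.

Lemma cont_even_int' (n : nat) : cont (even_int' (S (S n))).
Proof.
  intros z. apply (half_line_cont (fun z l => RtoC (- (2 * l * sin (l * z) * rres l ^ S (S n)))) z cdec).
  - apply cont2_even'.
  - apply filter_forall. intros y. apply dec_even'.
Qed.

Lemma even_int'_bound (n : nat) (z : R) : Cmod (even_int' (S (S n)) z) <= cdec.
Proof. apply half_line_bound; [apply (cont2_r _ z (cont2_even' (S (S n)))) | apply dec_even']. Qed.

Lemma even_int'_0 (n : nat) : even_int' n 0 = RtoC 0.
Proof.
  unfold even_int'. rewrite <- half_line_zero at 1. apply half_line_ext. intros l _.
  rewrite Rmult_0_r, sin_0. f_equal. ring.
Qed.

Lemma der_even_int (n : nat) (z : R) : der (even_int (S (S n))) z (even_int' (S (S n)) z).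
Proof.
  apply (half_line_der (fun z l => RtoC (2 * cos (l * z) * rres l ^ S (S n)))
     (fun z l => RtoC (- (2 * l * sin (l * z) * rres l ^ S (S n)))) z cdec).
  - apply cont2_even.
  - apply cont2_even'.
  - apply filter_forall. intros x l _. apply der_RtoC. auto_derive; [trivial | simpl; ring].
  - apply filter_forall. intros x. split; [apply (dec_even (S n)) | apply dec_even'].
Qed.

(** [alpha l^2 / (1 + alpha l^2)^(n+1)] is the difference of two consecutive powers. *)
Lemma der_even_int' (n : nat) (z : R) :
  der (even_int' (S (S n))) z ((even_int (S (S n)) z - even_int (S n) z) / alpha)%C.
Proof.
  assert (Hal : RtoC alpha <> RtoC 0) by (apply RtoC_neq_0; lra).
  pose (h'' := fun z l : R => RtoC (2 * - l ^ 2 * cos (l * z) * rres l ^ S (S n))).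
  apply (der_eq _ z (half_line_int (h'' z))).
  - transitivity (half_line_int (fun l => RtoC (/ alpha) * RtoC (2 * cos (l * z) * rres l ^ S (S n))
       + RtoC (- / alpha) * RtoC (2 * cos (l * z) * rres l ^ S n))%C).
    + apply half_line_ext. intros l _. unfold h''.
      assert (E : rres l ^ S n = rres l ^ S (S n) * (1 + alpha * l ^ 2)).
      { simpl. unfold rres. field. pose proof (rres_den l). simpl in *. lra. }
      rewrite E, <- !RtoC_mult, <- RtoC_plus. f_equal. field. lra.
    + rewrite (half_line_plus _ _ (Cmod (RtoC (/ alpha)) * cdec) (Cmod (RtoC (- / alpha)) * cdec)).
      * rewrite (half_line_Cmult _ _ cdec), (half_line_Cmult _ _ cdec).
        -- fold (even_int (S (S n)) z) (even_int (S n) z). rewrite RtoC_opp, RtoC_inv by lra. field. exact Hal.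
        -- apply (cont2_r _ z (cont2_even (S n))).
        -- apply dec_even.
        -- apply (cont2_r _ z (cont2_even (S (S n)))).
        -- apply dec_even.
      * intros l. apply contp_mult; [ct | apply (cont2_r _ z (cont2_even (S (S n))))].
      * intros l. apply contp_mult; [ct | apply (cont2_r _ z (cont2_even (S n)))].
      * apply (dec_mult (fun l => RtoC (2 * cos (l * z) * rres l ^ S (S n))) (fun _ => RtoC (/ alpha))); [apply dec_even | intros; lra].
      * apply (dec_mult (fun l => RtoC (2 * cos (l * z) * rres l ^ S n)) (fun _ => RtoC (- / alpha))); [apply dec_even | intros; lra].
  - apply (half_line_der (fun z l => RtoC (- (2 * l * sin (l * z) * rres l ^ S (S n)))) h'' z cdec).
    + apply cont2_even'.
    + intros p. apply (cont_trig (fun q : RR => 2 * - (snd q) ^ 2) (fun q : RR => snd q * fst q) (fun q : RR => snd q) cos (S (S n)) p);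
      [simpl; ct | ct | apply continuity_cos | ct].
    + apply filter_forall. intros x l _. apply der_RtoC. auto_derive; [trivial | simpl; ring].
    + apply filter_forall. intros x. split; [apply dec_even' |].
      intros l Hl. unfold h''.
      replace (2 * - l ^ 2 * cos (l * x) * rres l ^ S (S n)) with (- (2 * l ^ 2 * cos (l * x) * rres l ^ S (S n))) by ring.
      rewrite RtoC_opp, Cmod_opp. revert l Hl.
      apply (dec_trig n (fun l => cos (l * x)) (fun l => l ^ 2)).
      * intros l. apply Rabs_le, COS_bound.
      * intros l Hl. pose proof (rres_sqr l) as H.
        pose proof (rres_pos l). pose proof (pow2_ge_0 l). nra.
Qed.

(** The primitive is an arctangent. *)
Lemma even_int_1_0 : even_int 1 0 = RtoC (PI * a).
Proof.
  pose proof (sqrt_lt_R0 alpha Halpha) as Hs.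
  apply half_line_lim; [apply (cont2_r _ 0 (cont2_even 1)) |].
  assert (E : forall q, CRInt (fun l => RtoC (2 * cos (l * 0) * rres l ^ 1)) 0 q = RtoC (2 * a * atan (sqrt alpha * q))).
  { intros q. rewrite (CRInt_der_all (fun l => RtoC (2 * a * atan (sqrt alpha * l)))).
    - rewrite Rmult_0_r, atan_0, Rmult_0_r. ring.
    - apply (cont2_r _ 0 (cont2_even 1)).
    - intros l. apply der_RtoC. auto_derive; [trivial |].
      rewrite Rmult_0_r, cos_0. unfold rres.
      pose proof (rres_den l) as Hd. pose proof (sqrt_sqrt alpha ltac:(lra)) as Hsq.
      replace (sqrt alpha * l * (sqrt alpha * l * 1)) with (alpha * l ^ 2)
        by (transitivity (sqrt alpha * sqrt alpha * l ^ 2); [now rewrite Hsq | ring]).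
      simpl in *. field. lra. }
  intros eps Heps.
  destruct (Rdiv_small (2 * a * a) eps Heps) as [N [HN0 HN]].
  { pose proof (Rinv_0_lt_compat _ Hs). nra. }
  exists (N + 1). intros q Hq. rewrite E, <- RtoC_minus, Cmod_R.
  assert (Hsq : 0 < sqrt alpha * q) by (apply Rmult_lt_0_compat; lra).
  assert (Hi : 0 < / (sqrt alpha * q)) by now apply Rinv_0_lt_compat.
  pose proof (atan_inv _ Hsq) as Hat.
  assert (Hle : 0 <= atan (/ (sqrt alpha * q)) <= / (sqrt alpha * q)).
  { split.
    - rewrite <- atan_0. apply Rlt_le, atan_increasing, Hi.
    - assert (Hmv := MVT_cor2 atan (fun x => / (1 + x ^ 2)) 0 (/ (sqrt alpha * q)) Hi).
      destruct Hmv as [c [Ec Hc]].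
      { intros x _. apply is_derive_Reals. auto_derive; [trivial | field; nra]. }
      rewrite atan_0, !Rminus_0_r in Ec. rewrite Ec.
      assert (0 < / (1 + c ^ 2) <= 1).
      { split; [apply Rinv_0_lt_compat; nra |]. rewrite <- Rinv_1. apply Rinv_le_contravar; nra. }
      nra. }
  replace (2 * a * atan (sqrt alpha * q) - PI * a) with (- (2 * a * atan (/ (sqrt alpha * q)))) by (rewrite Hat; field; lra).
  pose proof (Rinv_0_lt_compat _ Hs) as Ha.
  rewrite Rabs_Ropp, Rabs_pos_eq by nra.
  apply Rle_lt_trans with (2 * a * a / (1 + (q - 1))).
  - replace (2 * a * a / (1 + (q - 1))) with (2 * a * / (sqrt alpha * q)) by (field; lra). nra.
  - apply HN. lra.
Qed.

(** For [z > 0] the truncation [r] to the segment from [- A] to [A] satisfies [r' = - a r]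
    up to [lower_pole_int], that is up to [O(1 / A)]; in the limit [r' = - a r] holds
    exactly, and the value at 0 is known. *)
Lemma even_int_1 (z : R) : 0 <= z -> even_int 1 z = RtoC (PI * a * exp (- a * z)).
Proof.
  pose proof (sqrt_lt_R0 alpha Halpha) as Hs. pose proof (Rinv_0_lt_compat _ Hs) as Ha.
  assert (Hal : RtoC alpha <> RtoC 0) by (apply RtoC_neq_0; lra).
  pose (g := fun z l : R => (Cexp (Ci * l * z) * RtoC (rres l))%C).
  assert (Hg : cont2 g).
  { intros q. unfold g. apply contp_mult; [ct | apply contp_RtoC, cont_rres; ct]. }
  assert (Hg' : cont2 (fun z l : R => Ci * l * g z l)%C).
  { intros q. apply contp_mult; [ct | apply Hg]. }
  pose (r := fun A z : R => CRInt (g z) (- A) A).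
  (* [i l = - a + i (l - i a)], and the second part cancels the pole above the line *)
  assert (Hr : forall A z, 0 < A -> 0 < z -> der (r A) z (- a * r A z + Ci / alpha * lower_pole_int A A z)%C).
  { intros A y HA Hy.
    apply (der_eq _ y (CRInt (fun l : R => Ci * l * g y l)%C (- A) A)).
    - unfold r, lower_pole_int.
      rewrite (CRInt_ext _ (fun l => - a * g y l + Ci / alpha * (Cexp (Ci * l * y) * / (l + Ci * a)))%C).
      + assert (C1 : cont (g y)) by now apply cont2_r.
        assert (C2 : cont (fun l : R => Cexp (Ci * l * y) * / (l + Ci * a))%C).
        { intros l. apply contp_mult; [ct |]. apply contp_inv; [now apply lower_pole_neq | ct]. }
        rewrite CRInt_plus, !CRInt_Cmult; trivial; ct.
      + intros l _. unfold g. rewrite <- res_RtoC by exact Halpha. unfold res.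
        rewrite factor_root by exact Halpha.
        pose proof (lower_pole_neq l) as Hn.
        assert (Hn2 : (l - Ci * a)%C <> RtoC 0).
        { intros E. apply (f_equal snd) in E. simpl in E. lra. }
        transitivity ((- a + Ci * (l - Ci * a)) * Cexp (Ci * l * y) * / (alpha * ((l - Ci * a) * (l + Ci * a))) + ((Ci * Ci + 1) * a * Cexp (Ci * l * y) * / (alpha * ((l - Ci * a) * (l + Ci * a)))))%C.
        * ring.
        * rewrite Ci_sqr. field. repeat split; assumption.
    - apply (der_CRInt_param g (fun z l : R => Ci * l * g z l)%C (- A) A y); [lra | exact Hg | exact Hg' |].
      apply filter_forall. intros x l _. unfold g.
      eapply der_eq; [| apply der_Cmult_r, der_Cexp, der_Cmult_l, der_id]. cbv beta. ring. }
  assert (Hlim : forall A z, 1 < A -> Cmod (r A z - even_int 1 z)%C <= 2 * cdec / A).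
  { intros A y HA.
    assert (Ldec : ldec (g y) cdec).
    { intros l. unfold g. rewrite Cmod_mult, Cmod_Cexp_line, Rmult_1_l, Cmod_R, Rabs_pos_eq by (apply Rlt_le, rres_pos).
      eapply Rle_trans; [apply rres_dec |].
      apply Rmult_le_compat_r; [apply Rlt_le, Rinv_0_lt_compat, one_plus_sqr_pos, Rabs_pos |].
      unfold cdec. pose proof (Rinv_0_lt_compat _ Halpha). nra. }
    pose proof (line_tail (g y) cdec A A (cont2_r g y Hg) Ldec ltac:(lra) ltac:(lra)) as Ht.
    replace (half_line_int (fun l => g y l + g y (- l)%R)%C) with (even_int 1 y) in Ht.
    - eapply Rle_trans; [exact Ht |].
      pose proof cdec_pos.
      assert (/ (1 + A) <= / A) by (apply Rinv_le_contravar; lra).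
      unfold Rdiv. nra.
    - apply half_line_ext. intros l _. unfold g.
      replace (rres (- l)) with (rres l) by (unfold rres; f_equal; ring).
      rewrite pow_1, RtoC_mult, <- Cexp_two_cos, RtoC_opp, RtoC_mult.
      replace (Ci * - l * y)%C with (- (Ci * (l * y)))%C by ring.
      replace (Ci * l * y)%C with (Ci * (l * y))%C by ring. ring. }
  (* the limit of [A] at infinity, on a segment away from 0 *)
  assert (Hz0 : forall z0 z, 0 < z0 <= z ->
    even_int 1 z = (Cexp (RtoC (- a * (z - z0))) * even_int 1 z0)%C).
  { intros z0 y Hz0.
    set (E := Cexp (RtoC (- a * (y - z0)))).
    assert (HE : Cmod E <= 1).
    { unfold E. rewrite Cmod_Cexp. simpl. rewrite <- exp_0. apply exp_monotone. nra. }
    pose (c := / z0 + sqrt alpha / z0 ^ 2).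
    assert (Hc0 : 0 <= c).
    { unfold c. pose proof (Rinv_0_lt_compat z0 (proj1 Hz0)).
      assert (0 < / z0 ^ 2) by (apply Rinv_0_lt_compat; nra). unfold Rdiv. nra. }
    assert (Hd : (even_int 1 y - E * even_int 1 z0)%C = RtoC 0).
    { apply zero_of_small with (c := / alpha * (2 * c) / a + 4 * cdec). intros A HA.
      assert (Hdec : Cmod (r A y - E * r A z0)%C <= / alpha * (2 / A * c) / a).
      { apply (decaying_solution (r A) (fun x => Ci / alpha * lower_pole_int A A x)%C); [exact Ha | | lra | | |].
        - apply Rmult_le_pos; [apply Rlt_le, Rinv_0_lt_compat, Halpha |].
          apply Rmult_le_pos; [| exact Hc0]. apply Rlt_le, Rdiv_lt_0_compat; lra.
        - intros x Hx. apply Hr; lra.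
        - intros x Hx. eapply der_cont, Hr; lra.
        - intros x Hx. unfold Cdiv. rewrite !Cmod_mult, Cmod_Ci, Rmult_1_l, Cmod_inv, Cmod_R, Rabs_pos_eq by (trivial; lra).
          apply Rmult_le_compat_l; [apply Rlt_le, Rinv_0_lt_compat, Halpha |].
          eapply Rle_trans; [apply lower_pole_int_le; lra |].
          replace (/ A + / A) with (2 / A) by (field; lra).
          apply Rmult_le_compat_l; [apply Rlt_le, Rdiv_lt_0_compat; lra |].
          unfold c, Rdiv. apply Rplus_le_compat; [apply Rinv_le_contravar; lra |].
          apply Rmult_le_compat_l; [lra |]. apply Rinv_le_contravar; [nra | apply pow_incr; lra]. }
      pose proof (Hlim A y HA) as H1. pose proof (Hlim A z0 HA) as H2.
      replace (even_int 1 y - E * even_int 1 z0)%C with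
        ((r A y - E * r A z0) - (r A y - even_int 1 y) + E * (r A z0 - even_int 1 z0))%C by ring.
      eapply Rle_trans; [apply Cmod_triangle |].
      eapply Rle_trans; [apply Rplus_le_compat_r, Cmod_triangle |]. rewrite Cmod_opp, Cmod_mult.
      assert (H3 : Cmod E * Cmod (r A z0 - even_int 1 z0)%C <= 2 * cdec / A).
      { pose proof (Cmod_ge_0 (r A z0 - even_int 1 z0)%C). pose proof (Cmod_ge_0 E). nra. }
      replace ((/ alpha * (2 * c) / a + 4 * cdec) / A) with (/ alpha * (2 / A * c) / a + 2 * cdec / A + 2 * cdec / A) by (field; lra).
      lra. }
    replace (even_int 1 y) with ((even_int 1 y - E * even_int 1 z0) + E * even_int 1 z0)%C by ring.
    rewrite Hd. ring. }
  intros Hz. destruct (Rle_lt_or_eq_dec 0 z Hz) as [Hz' | <-].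
  - symmetry.
    transitivity (Cexp (RtoC (- a * (z - 0))) * even_int 1 0)%C.
    + rewrite even_int_1_0, Cexp_RtoC, Rminus_0_r, <- RtoC_mult. f_equal. ring.
    + apply (value_at_end (fun z0 => Cexp (RtoC (- a * (z - z0))) * even_int 1 z0)%C _ z Hz').
      * pose proof (cont_even_int 0). ct.
      * intros x Hx. symmetry. apply Hz0. lra.
  - rewrite even_int_1_0. rewrite Rmult_0_r, exp_0. f_equal. ring.
Qed.

(** * Integration along the contour *)

Variables (K : R -> C) (N : nat) (s : nat -> R) (k v : nat -> R -> C).
Hypothesis HK : contour_pieces K N s k v.

(** The contour integral written with the pieces; it agrees with [contour_int] by
    [contour_int_KI], and inherits the calculus of integrals with continuous integrands. *)
Definition KI (h : C -> C) : C :=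
  Csum N (fun j => CRInt (fun r => h (k j r) * v j r)%C (s j) (s (S j))).

(** The pieces are constant outside their segments, so all these points lie on the curve. *)
Definition onK (l : C) : Prop := exists j r, (j < N)%nat /\ l = k j r.

(** Joint continuity in a parameter and in the position on each piece of the contour. *)
Definition kcont {T : UniformSpace} (h : T -> C -> C) : Prop :=
  forall j, (j < N)%nat ->
    cont (fun q : prod_UniformSpace T R_UniformSpace => h (fst q) (k j (snd q))).

Definition kcont1 (h : C -> C) : Prop := forall j, (j < N)%nat -> cont (fun r => h (k j r)).

Lemma s_lt (j : nat) : (j < N)%nat -> s j < s (S j).
Proof. intros Hj. destruct HK as [_ [_ H]]. exact (proj1 (H j Hj)). Qed.

Lemma cont_k (j : nat) : (j < N)%nat -> cont (k j).
Proof. intros Hj. destruct HK as [_ [_ H]]. destruct (H j Hj) as [_ [Hk _]]. exact Hk. Qed.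

Lemma cont_v (j : nat) : (j < N)%nat -> cont (v j).
Proof. intros Hj. destruct HK as [_ [_ H]]. destruct (H j Hj) as [_ [_ [Hv _]]]. exact Hv. Qed.

Lemma der_k (j : nat) (r : R) : (j < N)%nat -> s j < r < s (S j) -> der (k j) r (v j r).
Proof. intros Hj Hr. destruct HK as [_ [_ H]]. destruct (H j Hj) as [_ [_ [_ [_ [H5 _]]]]]. now apply H5. Qed.

Lemma s_range (j : nat) : (j <= N)%nat -> 0 <= s j <= 1.
Proof.
  intros Hj. destruct HK as [H0 [H1 _]].
  assert (Hup : forall j, (j <= N)%nat -> 0 <= s j).
  { induction j0 as [|j0 IH]; intros H; [lra |]. pose proof (s_lt j0 ltac:(lia)).
    specialize (IH ltac:(lia)). lra. }
  assert (Hdown : forall i, (i <= N)%nat -> s (N - i)%nat <= 1).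
  { induction i as [|i IH]; intros H; [rewrite Nat.sub_0_r; lra |].
    pose proof (s_lt (N - S i)%nat ltac:(lia)) as Hl.
    replace (S (N - S i)) with (N - i)%nat in Hl by lia. specialize (IH ltac:(lia)). lra. }
  split; [now apply Hup |]. replace j with (N - (N - j))%nat by lia. apply Hdown. lia.
Qed.

Lemma onK_on_curve (l : C) : onK l -> on_curve K l.
Proof.
  intros [j [r [Hj ->]]]. destruct HK as [_ [_ H]].
  destruct (H j Hj) as [Hs [_ [_ [E _]]]]. rewrite E.
  exists (clamp (s j) (s (S j)) r). split; [| reflexivity].
  pose proof (clamp_in (s j) (s (S j)) r ltac:(lra)).
  pose proof (s_range j ltac:(lia)). pose proof (s_range (S j) ltac:(lia)). lra.
Qed.

Lemma kcont1_T {T : UniformSpace} (h : T -> C -> C) (p : T) : kcont h -> kcont1 (h p).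
Proof. intros H j Hj. exact (contT_r (fun p r => h p (k j r)) p (H j Hj)). Qed.

Lemma contour_int_KI (h : C -> C) : kcont1 h -> contour_int K h = KI h.
Proof.
  intros Hh. unfold contour_int.
  assert (Hpart : forall n, (n <= N)%nat ->
    is_RInt (V := C_R_NormedModule) (fun r => h (K r) * velocity K r)%C 0 (s n)
      (Csum n (fun j => CRInt (fun r => h (k j r) * v j r)%C (s j) (s (S j))))).
  { destruct HK as [H0 [_ H]]. induction n as [|n IH]; intros Hn; simpl.
    - rewrite H0. apply (is_RInt_point (V := C_R_NormedModule)).
    - apply (is_RInt_Chasles (V := C_R_NormedModule) _ 0 (s n) (s (S n))); [apply IH; lia |].
      apply (is_RInt_ext (V := C_R_NormedModule) (fun r => h (k n r) * v n r)%C).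
      + pose proof (s_lt n Hn). intros r. rewrite Rmin_left, Rmax_right by lra. intros Hr.
        destruct (H n Hn) as [_ [_ [_ [E [_ Ev]]]]].
        rewrite (Ev r Hr), E, clamp_id by lra. reflexivity.
      + apply is_CRInt. pose proof (cont_v n Hn). intros p. apply contp_mult; [apply (Hh n Hn) | ct]. }
  specialize (Hpart N (Nat.le_refl N)). destruct HK as [_ [H1 _]]. rewrite H1 in Hpart.
  apply CRInt_unique, Hpart.
Qed.

Lemma kcont1_int (h : C -> C) (j : nat) :
  kcont1 h -> (j < N)%nat -> cont (fun r => h (k j r) * v j r)%C.
Proof. intros Hh Hj p. apply contp_mult; [apply (Hh j Hj) | now apply cont_v]. Qed.

Lemma KI_ext (h1 h2 : C -> C) : (forall l, onK l -> h1 l = h2 l) -> KI h1 = KI h2.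
Proof.
  intros H. apply Csum_ext. intros j Hj. apply CRInt_ext. intros r _.
  rewrite H; [reflexivity | now exists j, r].
Qed.

Lemma KI_plus (h1 h2 : C -> C) :
  kcont1 h1 -> kcont1 h2 -> KI (fun l => h1 l + h2 l)%C = (KI h1 + KI h2)%C.
Proof.
  intros H1 H2. unfold KI. rewrite <- Csum_plus. apply Csum_ext. intros j Hj.
  rewrite <- CRInt_plus by now apply kcont1_int.
  apply CRInt_ext. intros r _. ring.
Qed.

Lemma KI_Cmult (c : C) (h : C -> C) : kcont1 h -> KI (fun l => c * h l)%C = (c * KI h)%C.
Proof.
  intros H. unfold KI. rewrite <- Csum_Cmult. apply Csum_ext. intros j Hj.
  rewrite <- CRInt_Cmult by now apply kcont1_int.
  apply CRInt_ext. intros r _. ring.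
Qed.

Lemma KI_zero : KI (fun _ => RtoC 0) = RtoC 0.
Proof.
  transitivity (Csum N (fun _ => RtoC 0)); [| apply Csum_zero]. apply Csum_ext. intros j Hj.
  rewrite (CRInt_ext _ (fun _ => RtoC 0)); [rewrite CRInt_const; ring |].
  intros r _. apply Cmult_0_l.
Qed.

Lemma kcont_int {T : UniformSpace} (h : T -> C -> C) (j : nat) :
  kcont h -> (j < N)%nat ->
  cont (fun q : prod_UniformSpace T R_UniformSpace => h (fst q) (k j (snd q)) * v j (snd q))%C.
Proof.
  intros Hh Hj p. apply contp_mult; [apply (Hh j Hj) |].
  pose proof (cont_v j Hj). ct.
Qed.

Lemma KI_cont {T : UniformSpace} (h : T -> C -> C) : kcont h -> cont (fun p => KI (h p)).
Proof.
  intros Hh. apply cont_Csum. intros j Hj.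
  apply (cont_CRInt (fun p r => h p (k j r) * v j r)%C). now apply kcont_int.
Qed.

Lemma KI_der (h h' : R -> C -> C) (x0 : R) :
  kcont (T := R_UniformSpace) h -> kcont (T := R_UniformSpace) h' ->
  locally x0 (fun x => forall l, onK l -> der (fun x => h x l) x (h' x l)) ->
  der (fun x => KI (h x)) x0 (KI (h' x0)).
Proof.
  intros Hh Hh' Hd.
  apply (der_Csum N (fun x j => CRInt (fun r => h x (k j r) * v j r)%C (s j) (s (S j)))
                    (fun x j => CRInt (fun r => h' x (k j r) * v j r)%C (s j) (s (S j)))).
  intros j Hj.
  apply (der_CRInt_param (fun x r => h x (k j r) * v j r)%C (fun x r => h' x (k j r) * v j r)%C).
  - apply Rlt_le, s_lt, Hj.
  - apply (kcont_int h j Hh Hj).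
  - apply (kcont_int h' j Hh' Hj).
  - revert Hd. apply filter_imp. intros x Hx r _.
    apply der_Cmult_r, Hx. now exists j, r.
Qed.

Lemma KI_CRInt_swap (h : R -> C -> C) (a b : R) :
  a <= b -> kcont (T := R_UniformSpace) h ->
  CRInt (fun x => KI (h x)) a b = KI (fun l => CRInt (fun x => h x l) a b).
Proof.
  intros Hab Hh. unfold KI. rewrite CRInt_Csum.
  - apply Csum_ext. intros j Hj.
    rewrite (CRInt_swap (fun x r => h x (k j r) * v j r)%C);
      [| exact Hab | apply Rlt_le, s_lt, Hj | apply (kcont_int h j Hh Hj)].
    apply CRInt_ext. intros r _.
    rewrite (CRInt_ext _ (fun x => v j r * h x (k j r))%C) by (intros; ring).
    rewrite CRInt_Cmult; [ring |].
    apply (cont2_l (fun x r => h x (k j r)) r), (Hh j Hj).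
  - intros j Hj. apply (cont_CRInt (fun x r => h x (k j r) * v j r)%C). apply (kcont_int h j Hh Hj).
Qed.

Lemma v_bound : exists V, 0 <= V /\ forall j r, (j < N)%nat -> s j <= r <= s (S j) -> Cmod (v j r) <= V.
Proof.
  assert (G : forall n, (n <= N)%nat ->
    exists V, 0 <= V /\ forall j r, (j < n)%nat -> s j <= r <= s (S j) -> Cmod (v j r) <= V).
  { induction n as [|n IH]; intros Hn.
    - exists 0. split; [lra | intros; lia].
    - destruct (IH ltac:(lia)) as [V [HV0 HV]].
      destruct (bounded_on_segment (v n) (s n) (s (S n))) as [M HM].
      { intros r _. now apply cont_v. }
      exists (V + Rabs M). split; [pose proof (Rabs_pos M); lra |].
      intros j r Hj Hr. pose proof (Rle_abs M). pose proof (Rabs_pos M).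
      destruct (Nat.eq_dec j n) as [-> | Hjn].
      + specialize (HM r Hr). lra.
      + specialize (HV j r ltac:(lia) Hr). lra. }
  apply (G N (Nat.le_refl N)).
Qed.

(** [L] bounds the length of the contour. *)
Lemma KI_bound : exists L, 0 <= L /\ forall h M,
  kcont1 h -> (forall l, onK l -> Cmod (h l) <= M) -> Cmod (KI h) <= L * M.
Proof.
  destruct v_bound as [V [HV0 HV]].
  exists (INR N * V). split; [apply Rmult_le_pos; [apply pos_INR | exact HV0] |].
  intros h M Hh HM.
  assert (G : forall n, (n <= N)%nat ->
    Cmod (Csum n (fun j => CRInt (fun r => h (k j r) * v j r)%C (s j) (s (S j)))) <= INR n * V * M).
  { induction n as [|n IH]; intros Hn.
    - simpl. rewrite Cmod_0. lra.
    - rewrite S_INR. cbn [Csum]. eapply Rle_trans; [apply Cmod_triangle |].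
      specialize (IH ltac:(lia)).
      assert (B : Cmod (CRInt (fun r => h (k n r) * v n r)%C (s n) (s (S n))) <= (s (S n) - s n) * (V * M)).
      { apply Cmod_CRInt_le; [apply Rlt_le, s_lt, Hn | now apply kcont1_int |].
        intros r Hr. rewrite Cmod_mult, Rmult_comm.
        apply Rmult_le_compat; try apply Cmod_ge_0; [now apply HV | apply HM; now exists n, r]. }
      assert (HM0 : 0 <= M).
      { eapply Rle_trans; [apply Cmod_ge_0 | apply (HM (k n 0)); now exists n, 0]. }
      pose proof (s_range n ltac:(lia)). pose proof (s_range (S n) ltac:(lia)).
      pose proof (s_lt n Hn). assert (0 <= V * M) by now apply Rmult_le_pos. nra. }
  apply (G N (Nat.le_refl N)).
Qed.

Lemma onK_bounded (h : C -> C) : kcont1 h -> exists M, 0 <= M /\ forall l, onK l -> Cmod (h l) <= M.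
Proof.
  intros Hh.
  assert (G : forall n, (n <= N)%nat ->
    exists M, 0 <= M /\ forall j r, (j < n)%nat -> Cmod (h (k j r)) <= M).
  { induction n as [|n IH]; intros Hn.
    - exists 0. split; [lra | intros; lia].
    - destruct (IH ltac:(lia)) as [V [HV0 HV]].
      destruct (bounded_on_segment (fun r => h (k n r)) (s n) (s (S n))) as [M HM].
      { intros r _. now apply Hh. }
      exists (V + Rabs M). split; [pose proof (Rabs_pos M); lra |].
      intros j r Hj. pose proof (Rle_abs M). pose proof (Rabs_pos M).
      destruct (Nat.eq_dec j n) as [-> | Hjn].
      + destruct HK as [_ [_ H3]]. destruct (H3 n Hn) as [Hs [_ [_ [E _]]]].
        replace (k n r) with (k n (clamp (s n) (s (S n)) r)).
        * specialize (HM _ (clamp_in (s n) (s (S n)) r ltac:(lra))). lra.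
        * rewrite !E. f_equal. apply clamp_id. apply clamp_in. lra.
      + specialize (HV j r ltac:(lia)). lra. }
  destruct (G N (Nat.le_refl N)) as [M [HM0 HM]]. exists M. split; [exact HM0 |].
  intros l [j [r [Hj ->]]]. now apply HM.
Qed.

Lemma KI_half_line_swap (h : R -> C -> C) (M : R) :
  kcont (T := R_UniformSpace) h -> (forall l, onK l -> dec (fun y => h y l) M) ->
  half_line_int (fun y => KI (h y)) = KI (fun l => half_line_int (fun y => h y l)).
Proof.
  intros Hh HM. unfold KI. destruct v_bound as [V [HV0 HV]].
  assert (Hsw : forall j, (j < N)%nat -> cont2 (fun r y => h y (k j r) * v j r)%C).
  { intros j Hj q. apply contp_mult.
    - apply (contp_app2 (fun y r => h y (k j r)) (fun q : RR => snd q) (fun q : RR => fst q));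
        [apply (Hh j Hj) | ct | ct].
    - pose proof (cont_v j Hj). ct. }
  assert (HD : forall j r, (j < N)%nat -> s j <= r <= s (S j) ->
    dec (fun y => h y (k j r) * v j r)%C (V * M)).
  { intros j r Hj Hr y Hy. rewrite Cmult_comm. revert y Hy.
    apply (dec_mult (fun y => h y (k j r)) (fun _ => v j r)).
    - apply HM. now exists j, r.
    - intros y _. now apply HV. }
  rewrite (half_line_Csum N (fun y j => CRInt (fun r => h y (k j r) * v j r)%C (s j) (s (S j)))
             (fun j => (s (S j) - s j) * (V * M))).
  - apply Csum_ext. intros j Hj. pose proof (s_lt j Hj).
    rewrite <- (half_line_CRInt_swap (fun r y => h y (k j r) * v j r)%C (s j) (s (S j)) (V * M));
      [| lra | now apply Hsw | intros r Hr; now apply HD].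
    apply CRInt_ext. intros r Hr. rewrite Rmin_left, Rmax_right in Hr by lra.
    transitivity (half_line_int (fun y => v j r * h y (k j r))%C).
    { apply half_line_ext. intros. ring. }
    rewrite (half_line_Cmult _ _ M); [ring | | apply HM; now exists j, r].
    apply (cont2_l (fun y r => h y (k j r)) r), (Hh j Hj).
  - intros j Hj. apply (cont_CRInt (fun y r => h y (k j r) * v j r)%C). apply (kcont_int h j Hh Hj).
  - intros j Hj. pose proof (s_lt j Hj). apply (dec_CRInt (fun r y => h y (k j r) * v j r)%C); [lra | now apply Hsw |].
    intros r Hr. now apply HD.
Qed.

(** The increments of [P] over the pieces telescope, and the curve is closed. *)
Lemma KI_exact (P P' : C -> C) :
  K 0 = K 1 -> kcont1 P -> kcont1 P' ->
  (forall j r, (j < N)%nat -> s j < r < s (S j) ->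
     der (fun r => P (k j r)) r (P' (k j r) * v j r)%C) ->
  KI P' = RtoC 0.
Proof.
  intros Hcl HP HP' Hd. unfold KI.
  destruct HK as [H0 [H1 H]].
  rewrite (Csum_ext N _ (fun j => P (K (s (S j))) - P (K (s j)))%C).
  - rewrite (Csum_telescope N (fun j => P (K (s j)))), H0, H1, Hcl. ring.
  - intros j Hj. pose proof (s_lt j Hj) as Hs.
    rewrite (CRInt_der (fun r => P (k j r)));
      [| lra | now apply kcont1_int | intros r Hr; now apply Hd | intros r _; now apply HP].
    destruct (H j Hj) as [_ [_ [_ [E _]]]]. rewrite !E.
    rewrite !clamp_id by lra. reflexivity.
Qed.

Local Notation kcontR := (kcont (T := R_UniformSpace)).
Local Notation kcontRR := (kcont (T := RR)).

(** * Exact integrands, simple poles and winding numbers *)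

Section Cauchy.

Hypothesis Hclosed : K 0 = K 1.

Lemma KI_minus (h1 h2 : C -> C) :
  kcont1 h1 -> kcont1 h2 -> KI (fun l => h1 l - h2 l)%C = (KI h1 - KI h2)%C.
Proof.
  intros H1 H2.
  assert (H2' : kcont1 (fun l => - RtoC 1 * h2 l)%C).
  { intros j Hj p. pose proof (H2 j Hj). ct. }
  rewrite (KI_ext _ (fun l => h1 l + - RtoC 1 * h2 l)%C) by (intros; ring).
  rewrite (KI_plus h1 _ H1 H2').
  rewrite (KI_Cmult _ h2 H2). ring.
Qed.

Lemma KI_one : KI (fun _ => RtoC 1) = RtoC 0.
Proof.
  apply (KI_exact (fun l => l)); trivial.
  - intros j Hj. now apply cont_k.
  - intros j Hj p. ct.
  - intros j r Hj Hr. rewrite Cmult_1_l. now apply der_k.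
Qed.

Lemma KI_Cexp (z : R) : KI (fun l => Cexp (Ci * l * z)) = RtoC 0.
Proof.
  destruct (Req_dec z 0) as [-> | Hz].
  - transitivity (KI (fun _ => RtoC 1)); [| apply KI_one]. apply KI_ext. intros l _.
    replace (Ci * l * RtoC 0)%C with (RtoC 0) by ring. apply Cexp_0.
  - assert (Hiz : (Ci * z)%C <> RtoC 0).
    { apply Cmult_neq_0; [apply Ci_neq_0 | now apply RtoC_neq_0]. }
    apply (KI_exact (fun l => / (Ci * z) * Cexp (Ci * l * z))%C); trivial.
    + intros j Hj p. pose proof (cont_k j Hj). ct.
    + intros j Hj p. pose proof (cont_k j Hj). ct.
    + intros j r Hj Hr.
      eapply der_eq; [| apply der_Cmult_l, der_Cexp, der_Cmult_r, der_Cmult_l, (der_k j r Hj Hr)].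
      cbv beta. field. split; [now apply RtoC_neq_0 | apply Ci_neq_0].
Qed.

Lemma kcont1_Cexp (z : R) : kcont1 (fun l => Cexp (Ci * l * z)).
Proof. intros j Hj p. pose proof (cont_k j Hj). ct. Qed.

Lemma kcont1_pole (p : C) : (forall l, onK l -> l <> p) -> kcont1 (fun l => / (l - p))%C.
Proof.
  intros Hp j Hj r. pose proof (cont_k j Hj). apply contp_inv; [| ct].
  intros E. apply (Hp (k j r)); [now exists j, r |]. replace (k j r) with ((k j r - p) + p)%C by ring.
  rewrite E. ring.
Qed.

(** In [z] the left-hand side solves [W' = i p W], because [l / (l - p)] is [1 + p / (l -
    p)] and the integral of the entire function [exp (i l z)] vanishes. *)
Lemma KI_Cexp_mult_pole (p : C) (g : C -> C) (z : R) :
  kcont1 g -> (forall l, onK l -> (g l * (l - p) = 1)%C) ->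
  KI (fun l => Cexp (Ci * l * z) * g l)%C = (Cexp (Ci * p * z) * KI g)%C.
Proof.
  intros Hc Hp.
  pose (W := fun z : R => KI (fun l => Cexp (Ci * l * z) * g l)%C).
  assert (HW : forall z, der W z (Ci * p * W z)%C).
  { intros y.
    apply (der_eq W y (KI (fun l => Ci * l * Cexp (Ci * l * y) * g l)%C)).
    - unfold W.
      rewrite (KI_ext _ (fun l => Ci * Cexp (Ci * l * y) + Ci * p * (Cexp (Ci * l * y) * g l))%C).
      + rewrite KI_plus, !KI_Cmult, KI_Cexp.
        * ring.
        * intros j Hj r. pose proof (cont_k j Hj). pose proof (Hc j Hj). ct.
        * apply kcont1_Cexp.
        * intros j Hj r. pose proof (cont_k j Hj). ct.
        * intros j Hj r. pose proof (cont_k j Hj). pose proof (Hc j Hj). ct.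
      + intros l Hl. specialize (Hp l Hl).
        transitivity (Ci * Cexp (Ci * l * y) * (g l * (l - p)) + Ci * p * (Cexp (Ci * l * y) * g l))%C;
          [ring | rewrite Hp; ring].
    - apply (KI_der (fun z l => Cexp (Ci * l * z) * g l)%C
               (fun z l => Ci * l * Cexp (Ci * l * z) * g l)%C).
      + intros j Hj q. pose proof (cont_k j Hj). pose proof (Hc j Hj). ct.
      + intros j Hj q. pose proof (cont_k j Hj). pose proof (Hc j Hj). ct.
      + apply filter_forall. intros x l _. apply der_Cmult_r.
        eapply der_eq; [| apply der_Cexp, der_Cmult_l, der_id]. cbv beta. ring. }
  assert (E : forall b : R, (Cexp (- (Ci * p * b)) * W b = W 0)%C).
  { intros b.
    pose (F := fun y : R => (Cexp (- (Ci * p * y)) * W y)%C).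
    assert (HF : forall y, der F y (RtoC 0)).
    { intros y. unfold F.
      eapply der_eq; [| apply der_mult; [apply der_Cexp, der_opp, der_Cmult_l, der_id | apply HW]]. cbv beta. ring. }
    assert (Hcst : F b = F 0).
    { destruct (Rle_dec 0 b).
      - apply (der_zero_const F 0 b); [assumption | auto |].
        intros x _. eapply der_cont, HF.
      - symmetry. apply (der_zero_const F b 0); [lra | auto |].
        intros x _. eapply der_cont, HF. }
    unfold F in Hcst. rewrite Hcst.
    replace (- (Ci * p * RtoC 0))%C with (RtoC 0) by ring. rewrite Cexp_0. ring. }
  change (W z = Cexp (Ci * p * z) * KI g)%C.
  replace (KI g) with (W 0).
  - rewrite <- (E z), Cmult_assoc, <- Cexp_plus.
    replace (Ci * p * z + - (Ci * p * z))%C with (RtoC 0) by ring. rewrite Cexp_0. ring.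
  - unfold W. apply KI_ext. intros l _.
    replace (Ci * l * RtoC 0)%C with (RtoC 0) by ring. rewrite Cexp_0. ring.
Qed.

(** Along a segment from [w] to [w'] that avoids the contour, the derivative of the integral
    is the integral of an exact form. *)
Lemma winding_locally_constant (w : C) : (forall l, onK l -> l <> w) ->
  exists d, 0 < d /\ forall w', Cmod (w' - w)%C < d ->
    KI (fun l => / (l - w'))%C = KI (fun l => / (l - w))%C.
Proof.
  intros Hw.
  destruct (onK_bounded _ (kcont1_pole w Hw)) as [D [HD0 HD]].
  (* the contour keeps the distance [1 / (D + 1)] from [w] *)
  exists (/ (2 * (D + 1))). split; [apply Rinv_0_lt_compat; lra |].
  intros w' Hw'.
  pose (u := fun y : R => (w + RtoC (clamp 0 1 y) * (w' - w))%C).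
  assert (Hdist : forall l, onK l -> / (D + 1) <= Cmod (l - w)%C).
  { intros l Hl. assert (Hn : (l - w)%C <> RtoC 0).
    { intros E. apply (Hw l Hl). replace l with ((l - w) + w)%C by ring. rewrite E. ring. }
    specialize (HD l Hl). rewrite Cmod_inv in HD by exact Hn.
    rewrite <- (Rinv_inv (Cmod (l - w)%C)).
    apply Rinv_le_contravar; [| lra]. apply Rinv_0_lt_compat. now apply Cmod_gt_0. }
  assert (Hu : forall y l, onK l -> (l - u y)%C <> RtoC 0).
  { intros y l Hl E. specialize (Hdist l Hl).
    replace (l - w)%C with ((l - u y) + RtoC (clamp 0 1 y) * (w' - w))%C in Hdist by (unfold u; ring).
    rewrite E, Cplus_0_l, Cmod_mult, Cmod_R in Hdist.
    pose proof (clamp_in 0 1 y ltac:(lra)) as Hcl.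
    rewrite Rabs_pos_eq in Hdist by lra.
    assert (Hlt : / (2 * (D + 1)) < / (D + 1)) by (apply Rinv_lt_contravar; nra).
    assert (clamp 0 1 y * Cmod (w' - w)%C <= Cmod (w' - w)%C).
    { pose proof (Cmod_ge_0 (w' - w)%C). nra. }
    lra. }
  assert (Hcu : forall j, (j < N)%nat ->
    cont (fun q : RR => / (k j (snd q) - u (fst q)))%C).
  { intros j Hj q. pose proof (cont_k j Hj). apply contp_inv.
    - apply Hu. now exists j, (snd q).
    - unfold u. ct. apply cont_clamp. ct. }
  pose (h := fun (y : R) (l : C) => (/ (l - u y))%C).
  pose (h' := fun (y : R) (l : C) => ((w' - w) * (/ (l - u y) * / (l - u y)))%C).
  assert (E : KI (h 1) = KI (h 0)).
  { apply (der_zero_const (fun y => KI (h y)) 0 1); [lra | |].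
    - intros y Hy.
      apply (der_eq _ _ (KI (h' y))).
      + apply (KI_exact (fun l => - (w' - w) * / (l - u y))%C); trivial.
        * intros j Hj p. pose proof (Hcu j Hj).
          apply contp_mult; [ct |].
          apply (contp_app2 (fun y r => / (k j r - u y))%C (fun _ => y) (fun p => p)); [assumption | ct | ct].
        * intros j Hj p. pose proof (Hcu j Hj). unfold h'.
          assert (Hc1 : cont (fun r => / (k j r - u y))%C).
          { intros p'. apply (contp_app2 (fun y r => / (k j r - u y))%C (fun _ => y) (fun p => p)); [assumption | ct | ct]. }
          ct.
        * intros j r Hj Hr.
          eapply der_eq; [| apply der_Cmult_l, der_inv; [| apply der_minus; [apply (der_k j r Hj Hr) | apply der_const]]].
          -- cbv beta. unfold h'. field. apply (Hu y). now exists j, r.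
          -- apply Hu. now exists j, r.
      + apply (KI_der h h').
        * intros j Hj. apply (Hcu j Hj).
        * intros j Hj p. pose proof (Hcu j Hj). unfold h'. ct.
        * apply (filter_imp (fun y => 0 < y /\ y < 1)).
          -- intros x Hx l Hl. unfold h, h'.
             apply (is_derive_ext_loc (V := C_R_NormedModule) (fun x => / (l - (w + RtoC x * (w' - w))))%C).
             { apply (filter_imp (fun y => 0 < y /\ y < 1)).
               - intros x' Hx'. unfold u. rewrite clamp_id; [reflexivity | lra].
               - apply filter_and; [apply (open_gt 0) | apply (open_lt 1)]; lra. }
             assert (Ex : (w + RtoC x * (w' - w))%C = u x) by (unfold u; rewrite clamp_id; [reflexivity | lra]).
             eapply der_eq; [| apply der_inv;
               [| apply der_minus; [apply der_const | apply der_plus; [apply der_const | apply der_Cmult_r, der_id]]]].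
             ++ cbv beta. rewrite Ex. field. now apply Hu.
             ++ rewrite Ex. now apply Hu.
          -- apply filter_and; [apply (open_gt 0) | apply (open_lt 1)]; lra.
    - intros y _. apply (KI_cont h). intros j Hj. apply (Hcu j Hj). }
  unfold h in E.
  rewrite (KI_ext (fun l => / (l - w'))%C (fun l => / (l - u 1))%C).
  - rewrite E. apply KI_ext. intros l _. unfold u. rewrite clamp_id by lra.
    f_equal. ring.
  - intros l _. unfold u. rewrite clamp_id by lra. f_equal. ring.
Qed.

(** A point that is neither on the curve nor inside can be joined, off the curve, to points
    arbitrarily far away; the integral is constant along the path and small at its end. *)
Lemma winding_outside (p : C) : ~ on_curve K p -> ~ inside_curve K p ->
  KI (fun l => / (l - p))%C = RtoC 0.
Proof.
  intros Hon Hin.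
  assert (HonK : forall w, ~ on_curve K w -> forall l, onK l -> l <> w).
  { intros w Hw l Hl ->. apply Hw. now apply onK_on_curve. }
  destruct KI_bound as [L [HL0 HL]].
  destruct (onK_bounded (fun l => l)) as [B [HB0 HB]].
  { intros j Hj. now apply cont_k. }
  (* the winding integral at [p] is that at points arbitrarily far away *)
  assert (Hfar : forall M, exists w, M < Cmod w /\ ~ on_curve K w /\
    KI (fun l => / (l - p))%C = KI (fun l => / (l - w))%C).
  { intros M. apply NNPP. intros Hno. apply Hin. split; [exact Hon |].
    exists M. intros c Hc Hc0 Hcav. apply Rnot_lt_le. intros Hlt. apply Hno.
    exists (c 1). split; [exact Hlt |]. split; [apply Hcav; lra |].
    pose (ct := fun y : R => c (clamp 0 1 y)).
    assert (Hct : cont ct).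
    { intros y. apply (cont_comp_within (segment 0 1) c).
      - intros q. apply clamp_in. lra.
      - apply cont_clamp. apply continuous_id.
      - apply Hc. apply clamp_in. lra. }
    assert (Hoff : forall y, ~ on_curve K (ct y)).
    { intros y. apply Hcav. apply clamp_in. lra. }
    pose (phi := fun y : R => KI (fun l => / (l - ct y))%C).
    assert (Hphi : forall y, der phi y (RtoC 0)).
    { intros y. destruct (winding_locally_constant (ct y) (HonK _ (Hoff y))) as [d [Hd0 Hd]].
      pose proof (proj1 (contp_iff ct y) (Hct y) d Hd0) as Hloc.
      apply (is_derive_ext_loc (V := C_R_NormedModule) (fun _ => phi y)).
      - revert Hloc. apply filter_imp. intros z Hz. symmetry. apply Hd, Hz.
      - apply der_const. }
    assert (E : phi 1 = phi 0).
    { apply (der_zero_const phi 0 1); [lra | auto |]. intros x _. eapply der_cont, Hphi. }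
    unfold phi, ct in E. rewrite !clamp_id in E by lra. rewrite Hc0 in E. symmetry. exact E. }
  apply Cmod_eq_0. apply Rle_antisym; [| apply Cmod_ge_0].
  apply Rle_plus_epsilon. intros eps Heps. rewrite Rplus_0_l.
  destruct (Hfar (B + (L + 1) / eps)) as [w [Hw [Hwoff ->]]].
  assert (Hpos : 0 < (L + 1) / eps) by (apply Rdiv_lt_0_compat; lra).
  apply Rle_trans with (L * (eps / (L + 1))).
  - apply HL.
    + apply kcont1_pole. now apply HonK.
    + intros l Hl. specialize (HB l Hl).
      assert (Hd : (L + 1) / eps <= Cmod (l - w)%C).
      { pose proof (Cmod_triangle (w - l)%C l) as Ht.
        replace (w - l + l)%C with w in Ht by ring.
        replace (l - w)%C with (- (w - l))%C by ring. rewrite Cmod_opp. lra. }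
      rewrite Cmod_inv by (apply Cmod_gt_0; lra).
      replace (eps / (L + 1)) with (/ ((L + 1) / eps)) by (field; lra).
      now apply Rinv_le_contravar.
  - apply Rmult_le_reg_r with (L + 1); [lra |]. field_simplify; [nra | lra].
Qed.

End Cauchy.

(** * Contour integrals of the functions in the solution formula *)

Variables gamma0 gamma1 : C.
Hypothesis Hgamma : (gamma0 * sqrt alpha)%C <> gamma1.
Hypothesis Hadm : admissible_contour alpha gamma0 gamma1 K.

Lemma K_closed : K 0 = K 1.
Proof. destruct Hadm as [_ [[H _] _]]. exact H. Qed.

Lemma a_pos : 0 < a.
Proof. apply Rinv_0_lt_compat, sqrt_lt_R0, Halpha. Qed.

Lemma onK_Im (l : C) : onK l -> 0 < Im l.
Proof.
  intros Hl. destruct Hadm as [_ [_ [_ [_ [H _]]]]]. apply H. left.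
  now apply onK_on_curve.
Qed.

Lemma inside_root : inside_curve K (Ci * RtoC a)%C.
Proof.
  destruct Hadm as [_ [_ [_ [H _]]]].
  replace (Ci * RtoC a)%C with (Ci / sqrt alpha)%C; [exact H |].
  unfold Cdiv. rewrite RtoC_inv; [reflexivity |]. apply Rgt_not_eq, sqrt_lt_R0, Halpha.
Qed.

Lemma onK_neq_root (l : C) : onK l -> (l - Ci * RtoC a)%C <> RtoC 0.
Proof.
  intros Hl E. destruct inside_root as [Hn _]. apply Hn.
  replace (Ci * RtoC a)%C with l; [now apply onK_on_curve |].
  replace l with ((l - Ci * RtoC a) + Ci * RtoC a)%C by ring. rewrite E. ring.
Qed.

Lemma onK_neq_conj_root (l : C) : onK l -> (l - - (Ci * RtoC a))%C <> RtoC 0.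
Proof.
  intros Hl E. pose proof (onK_Im l Hl) as H. pose proof a_pos.
  apply (f_equal snd) in E. simpl in E. unfold Im in H. lra.
Qed.

Lemma onK_res (l : C) : onK l -> (1 + alpha * l ^ 2)%C <> RtoC 0.
Proof.
  intros Hl. rewrite factor_root by exact Halpha.
  apply Cmult_neq_0; [apply RtoC_neq_0; lra |].
  apply Cmult_neq_0; [now apply onK_neq_root |].
  replace (l + Ci * RtoC a)%C with (l - - (Ci * RtoC a))%C by ring. now apply onK_neq_conj_root.
Qed.

(** A zero on the contour would be the point [i gamma0 / gamma1], which is excluded; if
    [gamma1 = 0] then [gamma0] is not zero. *)
Lemma onK_robin (l : C) : onK l -> (gamma0 + Ci * gamma1 * l)%C <> RtoC 0.
Proof.
  intros Hl E. destruct (classic (gamma1 = RtoC 0)) as [E1 | E1].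
  - rewrite E1 in *. apply Hgamma.
    replace gamma0 with (gamma0 + Ci * RtoC 0 * l)%C by ring. rewrite E. ring.
  - destruct Hadm as [_ [_ [_ [_ [_ H]]]]]. destruct (H E1) as [Hn _]. apply Hn.
    replace (Ci * gamma0 / gamma1)%C with l; [now apply onK_on_curve |].
    replace gamma0 with ((gamma0 + Ci * gamma1 * l) - Ci * gamma1 * l)%C by ring. rewrite E.
    replace (Ci * (RtoC 0 - Ci * gamma1 * l) / gamma1)%C with (- (Ci * Ci) * l)%C by (field; exact E1).
    rewrite Ci_sqr. ring.
Qed.

Lemma kcont1_res : kcont1 res.
Proof.
  intros j Hj p. pose proof (cont_k j Hj). unfold res.
  apply contp_inv; [apply onK_res; now exists j, p | ct].
Qed.

Definition robin (l : C) : C := (/ (gamma0 + Ci * gamma1 * l))%C.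

Lemma kcont1_robin : kcont1 robin.
Proof.
  intros j Hj p. pose proof (cont_k j Hj).
  apply contp_inv; [apply onK_robin; now exists j, p | ct].
Qed.

Lemma Cneq_minus (l p : C) : (l - p)%C <> RtoC 0 -> l <> p.
Proof. intros H E. apply H. rewrite E. ring. Qed.

Lemma winding_root : KI (fun l => / (l - Ci * RtoC a))%C = (2 * PI * Ci)%C.
Proof.
  destruct Hadm as [_ [_ [Hcc _]]].
  specialize (Hcc _ inside_root). unfold winding_number in Hcc.
  rewrite contour_int_KI in Hcc.
  - assert (Hn : (2 * PI * Ci)%C <> RtoC 0).
    { apply Cmult_neq_0; [| apply Ci_neq_0]. rewrite <- RtoC_mult. apply RtoC_neq_0.
      pose proof PI_RGT_0. lra. }
    transitivity (2 * PI * Ci * (/ (2 * PI * Ci) * KI (fun l => / (l - Ci * RtoC a))))%C.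
    + field. split; [apply Ci_neq_0 | apply RtoC_neq_0]. pose proof PI_RGT_0. lra.
    + rewrite Hcc. ring.
  - apply kcont1_pole. intros l Hl. now apply Cneq_minus, onK_neq_root.
Qed.

Lemma winding_conj_root : KI (fun l => / (l - - (Ci * RtoC a)))%C = RtoC 0.
Proof.
  pose proof a_pos as Ha. destruct Hadm as [_ [_ [_ [_ [HIm _]]]]].
  apply (winding_outside K_closed).
  - intros H. specialize (HIm _ (or_introl H)). simpl in HIm. lra.
  - intros H. specialize (HIm _ (or_intror H)). simpl in HIm. lra.
Qed.

Lemma kcont1_root : kcont1 (fun l => / (l - Ci * RtoC a))%C.
Proof. apply kcont1_pole. intros l Hl. now apply Cneq_minus, onK_neq_root. Qed.

Lemma kcont1_conj_root : kcont1 (fun l => / (l - - (Ci * RtoC a)))%C.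
Proof. apply kcont1_pole. intros l Hl. now apply Cneq_minus, onK_neq_conj_root. Qed.

Lemma a_sqr : (RtoC alpha * (RtoC a * RtoC a))%C = RtoC 1.
Proof. rewrite <- !RtoC_mult, root_sqrt by exact Halpha. reflexivity. Qed.

Lemma Ca_neq_0 : RtoC a <> RtoC 0.
Proof. apply RtoC_neq_0. pose proof a_pos. lra. Qed.

(** Only the first of the two poles lies inside the contour. *)
Lemma res_partial_fractions (l : C) : onK l ->
  res l = (RtoC a / (2 * Ci) * (/ (l - Ci * RtoC a) - / (l - - (Ci * RtoC a))))%C.
Proof.
  intros Hl. unfold res. rewrite factor_root by exact Halpha.
  pose proof (onK_neq_root l Hl). pose proof (onK_neq_conj_root l Hl) as H1.
  assert (H2 : (l + Ci * RtoC a)%C <> RtoC 0).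
  { intros E. apply H1. rewrite <- E. ring. }
  pose proof Ca_neq_0. pose proof Ci_neq_0.
  assert (Hal : RtoC alpha <> RtoC 0) by (apply RtoC_neq_0; lra).
  transitivity (RtoC alpha * (RtoC a * RtoC a) * / (RtoC alpha * ((l - Ci * RtoC a) * (l + Ci * RtoC a))))%C.
  { rewrite a_sqr. ring. }
  field. repeat split; assumption || (intros E; apply H1; rewrite <- E; ring).
Qed.

(** The Green's function of [1 - alpha d^2/dx^2], up to a factor; for negative [z] it is the
    growing exponential and not the even extension. *)
Lemma KI_res_Cexp (z : R) :
  KI (fun l => Cexp (Ci * l * z) * res l)%C = RtoC (PI * a * exp (- a * z)).
Proof.
  rewrite (KI_ext _ (fun l => RtoC a / (2 * Ci) *
     (Cexp (Ci * l * z) * / (l - Ci * RtoC a) - Cexp (Ci * l * z) * / (l - - (Ci * RtoC a))))%C).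
  2: { intros l Hl. rewrite res_partial_fractions by exact Hl. ring. }
  pose proof kcont1_root as H1. pose proof kcont1_conj_root as H2.
  assert (H1' : kcont1 (fun l => Cexp (Ci * l * z) * / (l - Ci * RtoC a))%C).
  { intros j Hj p. specialize (H1 j Hj). pose proof (cont_k j Hj). cbv beta in H1.
    apply contp_mult; [ct | apply H1]. }
  assert (H2' : kcont1 (fun l => Cexp (Ci * l * z) * / (l - - (Ci * RtoC a)))%C).
  { intros j Hj p. specialize (H2 j Hj). pose proof (cont_k j Hj). cbv beta in H2.
    apply contp_mult; [ct | apply H2]. }
  rewrite KI_Cmult, KI_minus; trivial.
  2: { intros j Hj p. apply contp_minus; [now apply H1' | now apply H2']. }
  rewrite (KI_Cexp_mult_pole K_closed (Ci * RtoC a)),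
          (KI_Cexp_mult_pole K_closed (- (Ci * RtoC a))); trivial.
  - rewrite winding_root, winding_conj_root.
    replace (Ci * (Ci * RtoC a) * RtoC z)%C with (RtoC (- a * z)).
    + rewrite Cexp_RtoC, !RtoC_mult. field. apply Ci_neq_0.
    + transitivity (Ci * Ci * (RtoC a * RtoC z))%C; [| ring].
      rewrite Ci_sqr, RtoC_mult, RtoC_opp. ring.
  - intros l Hl. apply Cinv_l. now apply onK_neq_conj_root.
  - intros l Hl. apply Cinv_l. now apply onK_neq_root.
Qed.

(** By partial fractions, [l res l] has residue [1 / (2 alpha)] at the pole. *)
Lemma KI_id_res : KI (fun l => l * res l)%C = (PI * Ci / alpha)%C.
Proof.
  pose proof kcont1_root as H1. pose proof kcont1_conj_root as H2.
  assert (Hal : RtoC alpha <> RtoC 0) by (apply RtoC_neq_0; lra).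
  rewrite (KI_ext _ (fun l => / (2 * alpha) * (/ (l - Ci * RtoC a) + / (l - - (Ci * RtoC a))))%C).
  - rewrite KI_Cmult, KI_plus, winding_root, winding_conj_root; trivial.
    + field. exact Hal.
    + intros j Hj p. apply contp_plus; [now apply H1 | now apply H2].
  - intros l Hl. unfold res. rewrite factor_root by exact Halpha.
    pose proof (onK_neq_root l Hl). pose proof (onK_neq_conj_root l Hl) as H3.
    field. repeat split; try assumption; intros E; apply H3; rewrite <- E; ring.
Qed.

Lemma der_res_k (j : nat) (r : R) : (j < N)%nat -> s j < r < s (S j) ->
  der (fun r => res (k j r)) r (- (2 * alpha) * k j r * v j r * res (k j r) ^ 2)%C.
Proof.
  intros Hj Hr.
  assert (Hn : (1 + alpha * k j r ^ 2)%C <> RtoC 0) by (apply onK_res; now exists j, r).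
  unfold res. eapply der_eq; [| apply der_inv; [exact Hn |
    apply der_plus; [apply der_const | apply der_Cmult_l, (der_pow _ 1), (der_k j r Hj Hr)]]].
  replace (RtoC (INR 2)) with (RtoC 1 + RtoC 1)%C by (simpl; rewrite RtoC_plus; reflexivity).
  simpl in *. field. rewrite Cmult_1_r in Hn. exact Hn.
Qed.

(** [l res l ^ (n + 2)] is, up to a factor, the derivative of [res l ^ (n + 1)]. *)
Lemma KI_id_res_pow (n : nat) : KI (fun l => l * res l ^ (S (S n)))%C = RtoC 0.
Proof.
  assert (Hal : RtoC alpha <> RtoC 0) by (apply RtoC_neq_0; lra).
  assert (Hn : RtoC (INR (S n)) <> RtoC 0) by (apply RtoC_neq_0, not_0_INR; lia).
  pose proof kcont1_res as Hr.
  apply (KI_exact (fun l => - / (2 * alpha * INR (S n)) * res l ^ (S n))%C); trivial.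
  - exact K_closed.
  - intros j Hj p. specialize (Hr j Hj). pose proof (cont_k j Hj). ct.
  - intros j Hj p. specialize (Hr j Hj). pose proof (cont_k j Hj). ct.
  - intros j r Hj Hr'.
    eapply der_eq; [| apply der_Cmult_l, der_pow, (der_res_k j r Hj Hr')].
    cbv beta. simpl Cpow. field. split; assumption.
Qed.

(** The integrand is, up to a factor, the derivative of [exp (mu res l)], in spite of its
    essential singularity. *)
Lemma KI_id_res_Cexp (mu : R) : KI (fun l => l * res l ^ 2 * Cexp (mu * res l))%C = RtoC 0.
Proof.
  destruct (Req_dec mu 0) as [-> | Hmu].
  - transitivity (KI (fun l => l * res l ^ 2)%C); [| apply (KI_id_res_pow 0)]. apply KI_ext. intros l _.
    replace (RtoC 0 * res l)%C with (RtoC 0) by ring. rewrite Cexp_0. ring.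
  - assert (Hal : RtoC alpha <> RtoC 0) by (apply RtoC_neq_0; lra).
    assert (Hm : RtoC mu <> RtoC 0) by now apply RtoC_neq_0.
    pose proof kcont1_res as Hr.
    apply (KI_exact (fun l => - / (2 * alpha * mu) * Cexp (mu * res l))%C); trivial.
    + exact K_closed.
    + intros j Hj p. specialize (Hr j Hj). pose proof (cont_k j Hj). ct.
    + intros j Hj p. specialize (Hr j Hj). pose proof (cont_k j Hj). ct.
    + intros j r Hj Hr'.
      eapply der_eq; [| apply der_Cmult_l, der_Cexp, der_Cmult_l, (der_res_k j r Hj Hr')].
      cbv beta. field. split; assumption.
Qed.

(** For [gamma1 <> 0] this is the integral around the pole [i gamma0 / gamma1], which lies
    outside; for [gamma1 = 0] the integrand is entire. *)
Lemma KI_Cexp_robin (z : R) :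
  KI (fun l => Cexp (Ci * l * z) * / (gamma0 + Ci * gamma1 * l))%C = RtoC 0.
Proof.
  destruct (classic (gamma1 = RtoC 0)) as [E1 | E1].
  - rewrite (KI_ext _ (fun l => / gamma0 * Cexp (Ci * l * z))%C).
    + rewrite KI_Cmult, (KI_Cexp K_closed); [ring |].
      apply kcont1_Cexp.
    + intros l _. rewrite E1. replace (gamma0 + Ci * RtoC 0 * l)%C with gamma0 by ring. ring.
  - destruct Hadm as [_ [_ [_ [_ [_ H]]]]]. destruct (H E1) as [Hon Hin].
    set (p := (Ci * gamma0 / gamma1)%C) in *.
    assert (Hp : forall l, onK l -> (l - p)%C <> RtoC 0).
    { intros l Hl E. apply Hon.
      replace p with l; [now apply onK_on_curve |].
      replace l with ((l - p) + p)%C by ring. rewrite E. ring. }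
    assert (Hfac : forall l, (gamma0 + Ci * gamma1 * l = Ci * gamma1 * (l - p))%C).
    { intros l. unfold p.
      transitivity (Ci * gamma1 * l - (Ci * Ci) * gamma0)%C; [rewrite Ci_sqr; ring |]. field. exact E1. }
    assert (Hc : kcont1 (fun l => / (l - p))%C).
    { apply kcont1_pole. intros l Hl. now apply Cneq_minus, Hp. }
    rewrite (KI_ext _ (fun l => / (Ci * gamma1) * (Cexp (Ci * l * z) * / (l - p)))%C).
    + rewrite KI_Cmult.
      * rewrite (KI_Cexp_mult_pole K_closed p), (winding_outside K_closed p Hon Hin); trivial.
        -- ring.
        -- intros l Hl. now apply Cinv_l, Hp.
      * intros j Hj r. specialize (Hc j Hj). pose proof (cont_k j Hj).
        apply contp_mult; [ct | apply Hc].
    + intros l Hl. rewrite Hfac. specialize (Hp l Hl). pose proof Ci_neq_0.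
      field. repeat split; assumption.
Qed.

(** The derivative of [KI_Cexp_robin] in [z]. *)
Lemma KI_Cexp_id_robin (z : R) :
  KI (fun l => Cexp (Ci * l * z) * l * / (gamma0 + Ci * gamma1 * l))%C = RtoC 0.
Proof.
  assert (E : (Ci * KI (fun l => Cexp (Ci * l * z) * l * / (gamma0 + Ci * gamma1 * l)))%C = RtoC 0).
  { rewrite <- KI_Cmult.
    2: { intros j Hj p. pose proof (kcont1_robin j Hj) as H. pose proof (cont_k j Hj).
         apply contp_mult; [ct | apply H]. }
    apply (der_unique (fun z : R => KI (fun l => Cexp (Ci * l * z) * / (gamma0 + Ci * gamma1 * l))%C) z).
    - apply (KI_der (fun (z : R) l => Cexp (Ci * l * z) * / (gamma0 + Ci * gamma1 * l))%C
        (fun (z : R) l => Ci * (Cexp (Ci * l * z) * l * / (gamma0 + Ci * gamma1 * l)))%C).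
      + intros j Hj q. pose proof (kcont1_robin j Hj) as H. pose proof (cont_k j Hj).
        apply contp_mult; [ct |].
        apply (contp_app (fun r => / (gamma0 + Ci * gamma1 * k j r))%C); [exact H | ct].
      + intros j Hj q. pose proof (kcont1_robin j Hj) as H. pose proof (cont_k j Hj).
        apply contp_mult; [ct |]. apply contp_mult; [ct |].
        apply (contp_app (fun r => / (gamma0 + Ci * gamma1 * k j r))%C); [exact H | ct].
      + apply filter_forall. intros x l _.
        eapply der_eq; [| apply der_Cmult_r, der_Cexp, der_Cmult_l, der_id]. cbv beta. ring.
    - apply (is_derive_ext (V := C_R_NormedModule) (fun _ => RtoC 0)).
      + intros t. symmetry. apply KI_Cexp_robin.
      + apply der_const. }
  transitivity (- (Ci * Ci) * KI (fun l => Cexp (Ci * l * z) * l * / (gamma0 + Ci * gamma1 * l)))%C.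
  - rewrite Ci_sqr. ring.
  - transitivity (- Ci * (Ci * KI (fun l => Cexp (Ci * l * z) * l * / (gamma0 + Ci * gamma1 * l))))%C; [ring |].
    rewrite E. ring.
Qed.

(** * Deformation of the real line to the contour *)

(** Continuity along each piece, with the continuity of the common ingredients of the
    integrands at hand. *)
Ltac kct :=
  let j := fresh "j" in let Hj := fresh "Hj" in
  intros j Hj; intros;
  let H1 := fresh in pose proof (cont_k j Hj) as H1;
  let H2 := fresh in pose proof (kcont1_res j Hj) as H2;
  ct.

Definition contour_pow_int (n : nat) (z : R) : C := KI (fun l => Cexp (Ci * l * z) * res l ^ n)%C.

Definition contour_pow_int' (n : nat) (z : R) : C := KI (fun l => Ci * l * Cexp (Ci * l * z) * res l ^ n)%C.

Lemma der_contour_pow_int (n : nat) (z : R) : der (contour_pow_int n) z (contour_pow_int' n z).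
Proof.
  apply (KI_der (fun z l => Cexp (Ci * l * z) * res l ^ n)%C
           (fun z l => Ci * l * Cexp (Ci * l * z) * res l ^ n)%C).
  - kct.
  - kct.
  - apply filter_forall. intros x l _.
    eapply der_eq; [| apply der_Cmult_r, der_Cexp, der_Cmult_l, der_id]. cbv beta. ring.
Qed.

(** The same recursion as in [der_even_int'], so that both integrals can be compared. *)
Lemma der_contour_pow_int' (n : nat) (z : R) :
  der (contour_pow_int' (S n)) z ((contour_pow_int (S n) z - contour_pow_int n z) / alpha)%C.
Proof.
  assert (Hal : RtoC alpha <> RtoC 0) by (apply RtoC_neq_0; lra).
  apply (der_eq _ z (KI (fun l => (Ci * l) * (Ci * l) * Cexp (Ci * l * z) * res l ^ S n)%C)).
  - unfold contour_pow_int.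
    rewrite (KI_ext _ (fun l => / alpha * (Cexp (Ci * l * z) * res l ^ S n - Cexp (Ci * l * z) * res l ^ n))%C).
    + rewrite KI_Cmult, KI_minus.
      * field. exact Hal.
      * kct.
      * kct.
      * kct.
    + intros l Hl.
      pose proof (onK_res l Hl) as Hn.
      assert (E : (res l ^ n = res l ^ S n * (1 + alpha * l ^ 2))%C).
      { simpl Cpow at 2. unfold res. field. exact Hn. }
      rewrite E.
      transitivity ((Ci * Ci) * l ^ 2 * Cexp (Ci * l * z) * res l ^ S n)%C; [ring |].
      rewrite Ci_sqr. field. exact Hal.
  - apply (KI_der (fun z l => Ci * l * Cexp (Ci * l * z) * res l ^ S n)%C
           (fun z l => Ci * l * (Ci * l) * Cexp (Ci * l * z) * res l ^ S n)%C).
    + kct.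
    + kct.
    + apply filter_forall. intros x l _.
      eapply der_eq; [| apply der_Cmult_r, der_Cmult_l, der_Cexp, der_Cmult_l, der_id]. cbv beta. ring.
Qed.

Lemma contour_pow_int'_0 (n : nat) : contour_pow_int' (S (S n)) 0 = RtoC 0.
Proof.
  unfold contour_pow_int'.
  rewrite (KI_ext _ (fun l => Ci * (l * res l ^ S (S n)))%C).
  - rewrite KI_Cmult; [| kct].
    rewrite KI_id_res_pow. ring.
  - intros l _. replace (Ci * l * RtoC 0)%C with (RtoC 0) by ring. rewrite Cexp_0. ring.
Qed.

Lemma Cmod_Cexp_onK (l : C) (z : R) : onK l -> 0 <= z -> Cmod (Cexp (Ci * l * z)) <= 1.
Proof.
  intros Hl Hz. rewrite Cmod_Cexp, <- exp_0. apply exp_monotone.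
  pose proof (onK_Im l Hl) as H.
  destruct l as [x y]. simpl in *. unfold Im in H. simpl in H. nra.
Qed.

Lemma KI_Cexp_bounded (q : C -> C) : kcont1 q ->
  exists M, 0 <= M /\ forall z, 0 <= z -> Cmod (KI (fun l => Cexp (Ci * l * z) * q l)%C) <= M.
Proof.
  intros Hq. destruct KI_bound as [L [HL0 HL]].
  destruct (onK_bounded q Hq) as [B [HB0 HB]].
  exists (L * B). split; [nra |]. intros z Hz. apply HL.
  - intros j Hj p. specialize (Hq j Hj). pose proof (cont_k j Hj). ct.
  - intros l Hl. rewrite Cmod_mult. pose proof (Cmod_Cexp_onK l z Hl Hz). specialize (HB l Hl).
    pose proof (Cmod_ge_0 (q l)). pose proof (Cmod_ge_0 (Cexp (Ci * l * z))). nra.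
Qed.

(** Induction on the exponent. Once the previous powers agree, the difference [D] solves
    [alpha D'' = D], is bounded, and has [D'(0) = 0]. Hence the growing mode [D' + a D]
    vanishes, and then [D (0) = 0] and [D = 0]. *)
Lemma even_int_pow_int (n : nat) (z : R) : 0 <= z -> even_int (S n) z = contour_pow_int (S n) z.
Proof.
  pose proof a_pos as Ha. pose proof (sqrt_lt_R0 alpha Halpha) as Hs.
  revert z. induction n as [|n IH]; intros z Hz.
  - rewrite even_int_1 by assumption. unfold contour_pow_int.
    rewrite (KI_ext _ (fun l => Cexp (Ci * l * z) * res l)%C) by (intros; simpl; ring).
    rewrite KI_res_Cexp. reflexivity.
  - pose (D := fun y => (even_int (S (S n)) y - contour_pow_int (S (S n)) y)%C).
    pose (D' := fun y => (even_int' (S (S n)) y - contour_pow_int' (S (S n)) y)%C).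
    assert (HD : forall y, der D y (D' y)).
    { intros y. apply der_minus; [now apply der_even_int | apply der_contour_pow_int]. }
    assert (Haa : (/ alpha)%C = (a * a)%C).
    { rewrite <- RtoC_mult, <- RtoC_inv by lra. f_equal.
      apply Rmult_eq_reg_l with alpha; [| lra]. rewrite root_sqrt, Rinv_r; lra. }
    assert (HD' : forall y, 0 < y -> der D' y (a * a * D y)%C).
    { intros y Hy. eapply der_eq; [| apply der_minus; [now apply der_even_int' | apply der_contour_pow_int']].
      cbv beta. rewrite IH by lra. unfold D, Cdiv. rewrite Haa. ring. }
    assert (D'0 : D' 0 = RtoC 0).
    { unfold D'. rewrite even_int'_0, contour_pow_int'_0. ring. }
    (* the growing mode: [p] solves the equation with [+ a] *)
    pose (p := fun y => (D' y + a * D y)%C).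
    assert (Hcp : cont p).
    { assert (C1 : cont D) by (intros y; eapply der_cont, HD).
      assert (C2 : cont D').
      { intros y. apply contp_minus; [now apply cont_even_int' |]. eapply der_cont, der_contour_pow_int'. }
      intros y. unfold p. apply contp_plus; [apply C2 | apply contp_mult; [apply contp_const | apply C1]]. }
    destruct (KI_Cexp_bounded (fun l => res l ^ S (S n))%C) as [M1 [HM10 HM1]]; [kct |].
    destruct (KI_Cexp_bounded (fun l => Ci * l * res l ^ S (S n))%C) as [M2 [HM20 HM2]]; [kct |].
    assert (Hp0 : forall y, 0 <= y -> p y = RtoC 0).
    { intros y Hy. apply Cmod_eq_0, Rle_antisym; [| apply Cmod_ge_0].
      apply Rle_trans with (0 / a); [| right; field; lra].
      apply (bounded_growing_solution p (fun _ => RtoC 0) a y ((cdec + M2) + a * (cdec + M1))).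
      - exact Ha.
      - lra.
      - intros x Hx. unfold p.
        eapply der_eq; [| apply der_plus; [apply HD'; lra | apply der_Cmult_l, HD]]. cbv beta. ring.
      - intros x _. apply Hcp.
      - intros x _. rewrite Cmod_0. lra.
      - intros x Hx. unfold p. eapply Rle_trans; [apply Cmod_triangle |].
        rewrite Cmod_mult, Cmod_R, Rabs_pos_eq by lra.
        apply Rplus_le_compat; [| apply Rmult_le_compat_l; [lra |]].
        + unfold D'. eapply Rle_trans; [apply Cmod_triangle |]. rewrite Cmod_opp.
          apply Rplus_le_compat; [now apply even_int'_bound |].
          unfold contour_pow_int'. rewrite (KI_ext _ (fun l => Cexp (Ci * l * x) * (Ci * l * res l ^ S (S n)))%C) by (intros; ring).
          apply HM2. lra.
        + unfold D. eapply Rle_trans; [apply Cmod_triangle |]. rewrite Cmod_opp.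
          apply Rplus_le_compat; [now apply even_int_bound |]. apply HM1. lra. }
    assert (D0 : D 0 = RtoC 0).
    { pose proof (Hp0 0 (Rle_refl 0)) as E. unfold p in E. rewrite D'0 in E.
      replace (D 0) with (/ a * (RtoC 0 + a * D 0))%C.
      - rewrite E. ring.
      - field. apply Ca_neq_0. }
    assert (Dz : (D z - Cexp (RtoC (- a * (z - 0))) * D 0)%C = RtoC 0).
    { apply Cmod_eq_0, Rle_antisym; [| apply Cmod_ge_0].
      apply Rle_trans with (0 / a); [| right; field; lra].
      apply (decaying_solution D (fun _ => RtoC 0) a 0 z 0); [exact Ha | lra | exact Hz | | |].
      - intros x Hx. eapply der_eq; [| apply HD]. pose proof (Hp0 x ltac:(lra)) as E. unfold p in E.
        replace (D' x) with ((D' x + a * D x) - a * D x)%C by ring. rewrite E. ring.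
      - intros x _. eapply der_cont, HD.
      - intros x _. rewrite Cmod_0. lra. }
    rewrite D0 in Dz. unfold D in Dz.
    replace (even_int (S (S n)) z) with ((even_int (S (S n)) z - contour_pow_int (S (S n)) z - Cexp (RtoC (- a * (z - 0))) * RtoC 0) + contour_pow_int (S (S n)) z)%C by ring.
    rewrite Dz. ring.
Qed.

(** For [z >= 0] and [mu = beta t / alpha] this is, up to the factor [exp (- mu)] and
    normalization, the kernel with which a source acts after the time [t] on the whole line. *)
Definition heat_int (mu z : R) : C := KI (fun l => Cexp (Ci * l * z) * (res l * Cexp (mu * res l)))%C.

Definition heat_line (mu z : R) : C :=
  half_line_int (fun l => RtoC (2 * cos (l * z)) * (res l * Cexp (mu * res l)))%C.

Lemma line_res_cont : cont (fun l : R => res l).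
Proof.
  intros p. apply continuous_ext with (f := fun l : R => RtoC (rres l)).
  - intros l. symmetry. now apply res_RtoC.
  - apply contp_RtoC, cont_rres; ct.
Qed.

Lemma even_int_res (n : nat) (z : R) :
  even_int n z = half_line_int (fun l => RtoC (2 * cos (l * z)) * res l ^ n)%C.
Proof.
  apply half_line_ext. intros l _. rewrite res_RtoC by exact Halpha.
  now rewrite <- RtoC_pow, <- RtoC_mult.
Qed.

Lemma cont_two_cos (z : R) : cont (fun l : R => RtoC (2 * cos (l * z))).
Proof.
  intros p. apply contp_RtoC, contR_mult; [ct |].
  apply (contR_comp (fun l => l * z) cos); [ct | apply continuity_cos].
Qed.

Lemma dec_two_cos_res (z : R) (q : R -> C) (M : R) : 0 <= M -> (forall l, Cmod (q l) <= M) ->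
  dec (fun l : R => RtoC (2 * cos (l * z)) * (res l * q l))%C (M * cdec).
Proof.
  intros HM Hq l Hl.
  replace (RtoC (2 * cos (l * z)) * (res l * q l))%C with (q l * RtoC (2 * cos (l * z) * rres l ^ 1))%C.
  - revert l Hl. apply (dec_mult (fun l => RtoC (2 * cos (l * z) * rres l ^ 1)) q).
    + now apply dec_even.
    + intros l _. apply Hq.
  - rewrite res_RtoC, pow_1 by exact Halpha. rewrite (RtoC_mult _ (rres l)). ring.
Qed.

Lemma line_res_taylor (n : nat) (mu z : R) :
  half_line_int (fun l => RtoC (2 * cos (l * z)) * (res l * exp_taylor n (mu * res l)))%C
  = Csum n (fun j => RtoC mu ^ j * / INR (fact j) * even_int (S j) z)%C /\
  exists M, dec (fun l => RtoC (2 * cos (l * z)) * (res l * exp_taylor n (mu * res l)))%C M.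
Proof.
  pose proof line_res_cont as Hr. pose proof (cont_two_cos z) as Hcos.
  assert (Hterm : forall j, cont (fun l : R => RtoC mu ^ j * / INR (fact j) * (RtoC (2 * cos (l * z)) * res l ^ S j))%C) by ct.
  assert (Dterm : forall j, dec (fun l : R => RtoC (2 * cos (l * z)) * res l ^ S j)%C cdec).
  { intros j l Hl. rewrite res_RtoC, <- RtoC_pow, <- RtoC_mult by exact Halpha. now apply dec_even. }
  assert (E : forall l : R, (RtoC (2 * cos (l * z)) * (res l * exp_taylor n (mu * res l)))%C
    = Csum n (fun j => RtoC mu ^ j * / INR (fact j) * (RtoC (2 * cos (l * z)) * res l ^ S j))%C).
  { intros l. unfold exp_taylor. rewrite <- !Csum_Cmult. apply Csum_ext. intros j _.
    rewrite Cpow_mult_l. cbn [Cpow]. ring. }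
  assert (Ds : forall j, dec (fun l : R => RtoC mu ^ j * / INR (fact j) * (RtoC (2 * cos (l * z)) * res l ^ S j))%C
     (Cmod (RtoC mu ^ j * / INR (fact j))%C * cdec)).
  { intros j. apply (dec_mult (fun l : R => RtoC (2 * cos (l * z)) * res l ^ S j)%C (fun _ => RtoC mu ^ j * / INR (fact j))%C); [apply Dterm | intros; lra]. }
  split.
  - rewrite (half_line_ext _ _ (fun l _ => E l)).
    rewrite (half_line_Csum n (fun l j => RtoC mu ^ j * / INR (fact j) * (RtoC (2 * cos (l * z)) * res l ^ S j))%C
              (fun j => Cmod (RtoC mu ^ j * / INR (fact j))%C * cdec)) by auto.
    apply Csum_ext. intros j _. rewrite (half_line_Cmult _ _ cdec), even_int_res; auto. ct.
  - destruct (dec_Csum n (fun l j => RtoC mu ^ j * / INR (fact j) * (RtoC (2 * cos (l * z)) * res l ^ S j))%C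
      (fun j => Cmod (RtoC mu ^ j * / INR (fact j))%C * cdec)) as [M HM]; [auto |].
    exists M. intros l Hl. rewrite E. now apply HM.
Qed.

Lemma kcont1_Csum (n : nat) (f : nat -> C -> C) : (forall j, kcont1 (f j)) -> kcont1 (fun l => Csum n (fun j => f j l)).
Proof. intros H i Hi. apply (cont_Csum n (fun r j => f j (k i r))). intros j _. now apply H. Qed.

Lemma KI_Csum (n : nat) (f : nat -> C -> C) : (forall j, kcont1 (f j)) ->
  KI (fun l => Csum n (fun j => f j l)) = Csum n (fun j => KI (f j)).
Proof.
  intros H. induction n as [|n IH]; simpl.
  - apply KI_zero.
  - rewrite KI_plus, IH; [reflexivity | now apply kcont1_Csum | apply H].
Qed.

Lemma KI_res_taylor (n : nat) (mu z : R) :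
  KI (fun l => Cexp (Ci * l * z) * (res l * exp_taylor n (mu * res l)))%C
  = Csum n (fun j => RtoC mu ^ j * / INR (fact j) * contour_pow_int (S j) z)%C.
Proof.
  rewrite (KI_ext _ (fun l => Csum n (fun j => RtoC mu ^ j * / INR (fact j) * (Cexp (Ci * l * z) * res l ^ S j))%C)).
  - rewrite (KI_Csum n (fun j l => RtoC mu ^ j * / INR (fact j) * (Cexp (Ci * l * z) * res l ^ S j))%C).
    + apply Csum_ext. intros j _. rewrite KI_Cmult; [reflexivity | kct].
    + intros j. kct.
  - intros l _. unfold exp_taylor. rewrite <- !Csum_Cmult. apply Csum_ext. intros j _.
    rewrite Cpow_mult_l. cbn [Cpow]. ring.
Qed.

Lemma kcont1_res_taylor (n : nat) (mu z : R) :
  kcont1 (fun l => Cexp (Ci * l * z) * (res l * exp_taylor n (mu * res l)))%C.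
Proof.
  unfold exp_taylor. intros j Hj p. pose proof (cont_k j Hj).
  pose proof (kcont1_res j Hj).
  apply contp_mult; [ct |]. apply contp_mult; [ct |].
  apply (cont_Csum n (fun r i => (mu * res (k j r)) ^ i * / INR (fact i))%C). ct.
Qed.

Lemma cont_exp_taylor_line (n : nat) (mu : R) : cont (fun l : R => exp_taylor n (mu * res l)).
Proof.
  pose proof line_res_cont. unfold exp_taylor.
  apply (cont_Csum n (fun (l : R) i => (mu * res l) ^ i * / INR (fact i))%C). ct.
Qed.

(** The deformation of the real line to the contour, on which everything rests. Taylor's
    formula for the exponential reduces it to powers of [res], with an error that is uniform
    on the line and on the contour because [res] is bounded on both. *)
Lemma heat_line_contour (mu z : R) : 0 <= mu -> 0 <= z -> heat_line mu z = heat_int mu z.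
Proof.
  intros Hmu Hz.
  destruct KI_bound as [L [HL0 HL]].
  destruct (onK_bounded res kcont1_res) as [B [HB0 HB]].
  pose (B1 := B + 1). pose (X := mu * B1).
  pose (Er := fun n => X ^ n / INR (fact n) * exp X).
  assert (HX : 0 <= X) by (unfold X, B1; nra).
  assert (HEr : forall n w, Cmod w <= X -> Cmod (Cexp w - exp_taylor n w)%C <= Er n).
  { intros n w Hw. eapply Rle_trans; [apply exp_taylor_error |]. unfold Er.
    pose proof (Cmod_ge_0 w).
    apply Rmult_le_compat; [| apply Rlt_le, exp_pos | | now apply exp_monotone].
    - apply Rmult_le_pos; [now apply pow_le | apply Rlt_le, Rinv_0_lt_compat, INR_fact_lt_0].
    - apply Rmult_le_compat_r; [apply Rlt_le, Rinv_0_lt_compat, INR_fact_lt_0 | now apply pow_incr]. }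
  assert (HEr0 : forall n, 0 <= Er n).
  { intros n. eapply Rle_trans; [apply Cmod_ge_0 | apply (HEr n (RtoC 0))]. rewrite Cmod_0. exact HX. }
  assert (Hw1 : forall l : R, Cmod (mu * res l)%C <= X).
  { intros l. rewrite Cmod_mult, res_RtoC, !Cmod_R, !Rabs_pos_eq by (trivial; apply Rlt_le, rres_pos).
    unfold X, B1. pose proof (rres_le_1 l). pose proof (rres_pos l). nra. }
  assert (Hw2 : forall l, onK l -> Cmod (mu * res l)%C <= X).
  { intros l Hl. rewrite Cmod_mult, Cmod_R, Rabs_pos_eq by exact Hmu. specialize (HB l Hl). unfold X, B1. nra. }
  pose proof line_res_cont as Hr. pose proof (cont_two_cos z) as Hcos.
  (* the Taylor polynomials cancel term by term, and [Er n] bounds both remainders *)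
  assert (Hdiff : forall n, Cmod (heat_line mu z - heat_int mu z)%C <= (cdec + L * B) * Er n).
  { intros n.
    assert (E1 : heat_line mu z = (half_line_int (fun l => RtoC (2 * cos (l * z)) * (res l * (Cexp (mu * res l) - exp_taylor n (mu * res l))))
        + half_line_int (fun l => RtoC (2 * cos (l * z)) * (res l * exp_taylor n (mu * res l))))%C).
    { destruct (line_res_taylor n mu z) as [_ [M HM]]. pose proof (cont_exp_taylor_line n mu).
      rewrite <- (half_line_plus _ _ (Er n * cdec) M); trivial.
      - apply half_line_ext. intros l _. ring.
      - ct.
      - ct.
      - apply dec_two_cos_res; [apply HEr0 |]. intros l. apply HEr, Hw1. }
    assert (E2 : heat_int mu z = (KI (fun l => Cexp (Ci * l * z) * (res l * (Cexp (mu * res l) - exp_taylor n (mu * res l))))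
        + KI (fun l => Cexp (Ci * l * z) * (res l * exp_taylor n (mu * res l))))%C).
    { assert (C1 : kcont1 (fun l => Cexp (Ci * l * z) * (res l * Cexp (mu * res l)))%C) by kct.
      pose proof (kcont1_res_taylor n mu z) as C2.
      assert (C3 : kcont1 (fun l => Cexp (Ci * l * z) * (res l * (Cexp (mu * res l) - exp_taylor n (mu * res l))))%C).
      { intros j Hj p. apply (contp_ext (fun r => (Cexp (Ci * k j r * z) * (res (k j r) * Cexp (mu * res (k j r))))
          - (Cexp (Ci * k j r * z) * (res (k j r) * exp_taylor n (mu * res (k j r)))))%C).
        - intros r. ring.
        - apply contp_minus; [apply (C1 j Hj) | apply (C2 j Hj)]. }
      unfold heat_int. rewrite <- (KI_plus _ _ C3 C2).
      apply KI_ext. intros l _. ring. }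
    rewrite E1, E2, KI_res_taylor, (proj1 (line_res_taylor n mu z)).
    rewrite (Csum_ext n (fun j => RtoC mu ^ j * / INR (fact j) * even_int (S j) z)%C
              (fun j => RtoC mu ^ j * / INR (fact j) * contour_pow_int (S j) z)%C)
      by (intros j _; now rewrite even_int_pow_int).
    match goal with |- Cmod ((?x + ?y) - (?u + ?y))%C <= _ => replace ((x + y) - (u + y))%C with (x - u)%C by ring end.
    eapply Rle_trans; [apply Cmod_triangle |]. rewrite Cmod_opp, Rmult_plus_distr_r.
    apply Rplus_le_compat.
    - rewrite (Rmult_comm cdec). apply half_line_bound.
      + pose proof (cont_exp_taylor_line n mu). ct.
      + apply dec_two_cos_res; [apply HEr0 |]. intros l. apply HEr, Hw1.
    - rewrite Rmult_assoc. apply HL.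
      + intros j Hj p. pose proof (cont_k j Hj).
        pose proof (kcont1_res j Hj) as Hres.
        apply contp_mult; [ct |]. apply contp_mult; [ct |]. apply contp_minus; [ct |].
        apply (cont_Csum n (fun r i => (mu * res (k j r)) ^ i * / INR (fact i))%C). ct.
      + intros l Hl. rewrite !Cmod_mult.
        pose proof (Cmod_Cexp_onK l z Hl Hz). pose proof (HEr n _ (Hw2 l Hl)).
        specialize (HB l Hl).
        rewrite <- (Rmult_1_l (B * Er n)).
        apply Rmult_le_compat; try apply Cmod_ge_0; [apply Rmult_le_pos; apply Cmod_ge_0 | assumption |].
        apply Rmult_le_compat; try apply Cmod_ge_0; assumption. }
  assert (E : (heat_line mu z - heat_int mu z)%C = RtoC 0).
  { apply Cmod_eq_0, Rle_antisym; [| apply Cmod_ge_0].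
    apply Rle_plus_epsilon. intros eps Heps. rewrite Rplus_0_l.
    pose (c := (cdec + L * B) * exp X).
    assert (Hc : 0 < c).
    { unfold c. apply Rmult_lt_0_compat; [| apply exp_pos]. pose proof cdec_pos. nra. }
    destruct (cv_speed_pow_fact X (eps / c)) as [n Hn]; [apply Rdiv_lt_0_compat; lra |].
    specialize (Hn n (Nat.le_refl n)). unfold Rdist in Hn. rewrite Rminus_0_r in Hn.
    apply Rabs_def2 in Hn. destruct Hn as [Hn _].
    eapply Rle_trans; [apply (Hdiff n) |].
    replace ((cdec + L * B) * Er n) with (c * (X ^ n / INR (fact n))) by (unfold c, Er; ring).
    apply Rle_trans with (c * (eps / c)); [apply Rmult_le_compat_l; lra |]. right. field. lra. }
  replace (heat_line mu z) with ((heat_line mu z - heat_int mu z) + heat_int mu z)%C by ring.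
  rewrite E. ring.
Qed.

(** * The half-line transform, and convolutions with the kernel *)

Lemma Cmod_Cexp_lower (l : C) (x : R) : Im l <= 0 -> 0 <= x -> Cmod (Cexp (- (Ci * l * x))) <= 1.
Proof.
  intros Hl Hx. rewrite Cmod_Cexp, <- exp_0. apply exp_monotone.
  destruct l as [p q]. simpl in *. unfold Im in Hl. simpl in Hl. nra.
Qed.

Lemma cont_fourier_integrand (g : R -> C) (l : C) : cont g -> cont (fun x : R => Cexp (- (Ci * l * x)) * g x)%C.
Proof. intros Hg. ct. Qed.

Lemma dec_fourier_integrand (g : R -> C) (l : C) (M : R) : dec g M -> Im l <= 0 ->
  dec (fun x : R => Cexp (- (Ci * l * x)) * g x)%C M.
Proof.
  intros Hg Hl. rewrite <- (Rmult_1_l M).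
  apply (dec_mult g (fun x : R => Cexp (- (Ci * l * x)))); [exact Hg |].
  intros y Hy. now apply Cmod_Cexp_lower.
Qed.

Lemma half_fourier_bound (g : R -> C) (l : C) (M : R) : cont g -> dec g M -> Im l <= 0 ->
  Cmod (half_fourier g l) <= M.
Proof.
  intros Hc Hg Hl. apply half_line_bound; [now apply cont_fourier_integrand | now apply dec_fourier_integrand].
Qed.

Lemma half_fourier_ext (f g : R -> C) (l : C) :
  (forall y, 0 <= y -> f y = g y) -> half_fourier f l = half_fourier g l.
Proof. intros H. apply half_line_ext. intros y Hy. now rewrite H. Qed.

Lemma half_fourier_plus (f g : R -> C) (l : C) (M M' : R) :
  cont f -> cont g -> dec f M -> dec g M' -> Im l <= 0 ->
  half_fourier (fun x => f x + g x)%C l = (half_fourier f l + half_fourier g l)%C.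
Proof.
  intros Hf Hg Df Dg Hl. unfold half_fourier.
  rewrite <- (half_line_plus _ _ M M') by
    (first [now apply cont_fourier_integrand | now apply dec_fourier_integrand]).
  apply half_line_ext. intros y _. ring.
Qed.

Lemma half_fourier_Cmult (c : C) (f : R -> C) (l : C) (M : R) :
  cont f -> dec f M -> Im l <= 0 ->
  half_fourier (fun x => c * f x)%C l = (c * half_fourier f l)%C.
Proof.
  intros Hf Df Hl. unfold half_fourier.
  rewrite <- (half_line_Cmult c _ M) by
    (first [now apply cont_fourier_integrand | now apply dec_fourier_integrand]).
  apply half_line_ext. intros y _. ring.
Qed.

Lemma cont_half_fourier {T : UniformSpace} (g : T -> R -> C) (lam : T -> C) (p0 : T) (M : R) :
  cont (fun q : prod_UniformSpace T R_UniformSpace => g (fst q) (snd q)) ->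
  cont lam -> (forall p, Im (lam p) <= 0) -> locally p0 (fun p => dec (g p) M) ->
  contp (fun p => half_fourier (g p) (lam p)) p0.
Proof.
  intros Hg Hl Him HM.
  apply (half_line_cont (fun p x => Cexp (- (Ci * lam p * x)) * g p x)%C p0 M).
  - intros q. apply contp_mult; [| apply Hg]. ct.
  - revert HM. apply filter_imp. intros p Hp. now apply dec_fourier_integrand.
Qed.

(** Up to the factor [exp (- mu)] this is [exp (- omega t) / (1 + alpha l^2)] with [mu =
    beta t / alpha]. *)
Definition heat_symbol (mu : R) (l : C) : C := (res l * Cexp (mu * res l))%C.

Lemma cont_heat_symbol_line : cont2 (fun mu l : R => heat_symbol mu l).
Proof. intros q. pose proof line_res_cont. unfold heat_symbol. ct. Qed.

Lemma heat_symbol_le (mu M l : R) : 0 <= mu <= M -> Cmod (heat_symbol mu l) <= exp M * rres l.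
Proof.
  intros Hmu. unfold heat_symbol. rewrite Cmod_mult, Cmod_Cexp, res_RtoC, Cmod_R by exact Halpha.
  pose proof (rres_pos l) as Hr. pose proof (rres_le_1 l).
  rewrite Rabs_pos_eq, Rmult_comm by lra. apply Rmult_le_compat_r; [lra |].
  apply exp_monotone. simpl. nra.
Qed.

Lemma heat_symbol_dec (mu M l : R) : 0 <= mu <= M ->
  Cmod (heat_symbol mu l) <= exp M * cdec / (1 + Rabs l) ^ 2.
Proof.
  intros Hmu. eapply Rle_trans; [now apply heat_symbol_le |]. unfold Rdiv. rewrite Rmult_assoc.
  apply Rmult_le_compat_l; [apply Rlt_le, exp_pos |].
  eapply Rle_trans; [apply rres_dec |].
  apply Rmult_le_compat_r; [apply Rlt_le, Rinv_0_lt_compat, one_plus_sqr_pos, Rabs_pos |].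
  unfold cdec. pose proof (Rinv_0_lt_compat _ Halpha). nra.
Qed.

Lemma heat_symbol_even (mu l : R) : heat_symbol mu (RtoC (- l)) = heat_symbol mu l.
Proof.
  unfold heat_symbol. rewrite !res_RtoC by exact Halpha.
  replace (rres (- l)) with (rres l) by (unfold rres; f_equal; ring). reflexivity.
Qed.

Lemma heat_line_abs (mu z : R) : heat_line mu (Rabs z) = heat_line mu z.
Proof.
  apply half_line_ext. intros l _. f_equal. f_equal. f_equal.
  unfold Rabs. destruct (Rcase_abs z); [| reflexivity].
  replace (l * - z) with (- (l * z)) by ring. apply cos_neg.
Qed.

(** Exchange the two integrations; the even symbol turns the exponential into [2 cos (l (x -
    y))], whose integral is the kernel at [|x - y|]. *)
Lemma line_convolution (g : R -> C) (mu x M : R) : 0 <= mu -> cont g -> dec g M ->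
  half_line_int (fun l => half_fourier g (RtoC l) * Cexp (Ci * RtoC l * x) * heat_symbol mu (RtoC l)
     + half_fourier g (RtoC (- l)) * Cexp (Ci * RtoC (- l) * x) * heat_symbol mu (RtoC (- l)))%C
  = half_line_int (fun y => g y * heat_int mu (Rabs (x - y)))%C.
Proof.
  intros Hmu Hg HM. pose proof (dec_nonneg g M HM) as HM0.
  pose (h := fun l y : R => (g y * (RtoC (2 * cos (l * (x - y))) * heat_symbol mu l))%C).
  assert (Hsym : cont (fun l : R => heat_symbol mu l)) by apply (cont2_r _ mu cont_heat_symbol_line).
  assert (Hh : cont2 h).
  { intros q. unfold h. apply contp_mult; [ct |]. apply contp_mult.
    - apply contp_RtoC, contR_mult; [ct |].
      apply (contR_comp (fun q : RR => fst q * (x - snd q)) cos); [ct | apply continuity_cos].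
    - apply (contp_app (fun l : R => heat_symbol mu l)); [exact Hsym | ct]. }
  transitivity (half_line_int (fun l => half_line_int (h l))).
  - apply half_line_ext. intros l Hl.
    rewrite heat_symbol_even.
    assert (D1 : forall l : R, dec (fun y : R => Cexp (- (Ci * l * y)) * g y)%C M).
    { intros l'. apply dec_fourier_integrand; [exact HM | simpl; lra]. }
    unfold half_fourier.
    pose (F := fun l' : R => fun y : R => (Cexp (- (Ci * l' * y)) * g y)%C).
    assert (CF : forall l', cont (F l')) by (intros l'; now apply cont_fourier_integrand).
    pose (c1 := (heat_symbol mu l * Cexp (Ci * l * x))%C).
    pose (c2 := (heat_symbol mu l * Cexp (Ci * RtoC (- l) * x))%C).
    transitivity (half_line_int (fun y : R => c1 * F l y + c2 * F (- l)%R y)%C).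
    + rewrite (half_line_plus (fun y => c1 * F l y)%C (fun y => c2 * F (- l)%R y)%C (Cmod c1 * M) (Cmod c2 * M)).
      * rewrite (half_line_Cmult c1 (F l) M (CF l) (D1 l)), (half_line_Cmult c2 (F (- l)) M (CF (- l)) (D1 (- l))).
        unfold c1, c2, F. ring.
      * intros y. apply contp_mult; [ct | apply CF].
      * intros y. apply contp_mult; [ct | apply CF].
      * apply (dec_mult (F l) (fun _ => c1)); [apply D1 | intros; lra].
      * apply (dec_mult (F (- l)) (fun _ => c2)); [apply D1 | intros; lra].
    + apply half_line_ext. intros y _. unfold h, c1, c2, F.
      rewrite <- Cexp_two_cos, RtoC_mult, RtoC_minus, RtoC_opp.
      replace (Ci * (l * (x - y)))%C with (Ci * l * x + - (Ci * l * y))%C by ring.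
      replace (- (Ci * l * x + - (Ci * l * y)))%C with (Ci * - l * x + - (Ci * - l * y))%C by ring.
      rewrite !Cexp_plus. ring.
  - rewrite (half_line_swap h (M * (2 * (exp mu * cdec))) Hh).
    + apply half_line_ext. intros y Hy. unfold h.
      rewrite (half_line_Cmult _ _ (exp mu * cdec)).
      * f_equal. rewrite <- heat_line_contour by (trivial; apply Rabs_pos).
        rewrite heat_line_abs. reflexivity.
      * intros l. apply contp_mult; [apply (cont_two_cos (x - y)) | apply Hsym].
      * apply (dec_two_cos_res (x - y) (fun l : R => Cexp (mu * res l))); [apply Rlt_le, exp_pos |].
        intros l. rewrite Cmod_Cexp, res_RtoC by exact Halpha. apply exp_monotone. simpl.
        pose proof (rres_pos l). pose proof (rres_le_1 l). nra.
    + intros l y Hl Hy. unfold h. rewrite !Cmod_mult.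
      specialize (HM y Hy). pose proof (heat_symbol_dec mu mu l ltac:(lra)) as Hd.
      rewrite (Rabs_pos_eq l Hl) in Hd.
      assert (Hc : Cmod (RtoC (2 * cos (l * (x - y)))) <= 2).
      { rewrite Cmod_R, Rabs_mult, (Rabs_pos_eq 2) by lra.
        assert (Rabs (cos (l * (x - y))) <= 1) by (apply Rabs_le, COS_bound). lra. }
      replace (M * (2 * (exp mu * cdec)) / (1 + l) ^ 2 / (1 + y) ^ 2)
        with (M / (1 + y) ^ 2 * (2 * (exp mu * cdec / (1 + l) ^ 2))) by (unfold Rdiv; ring).
      apply Rmult_le_compat; try apply Cmod_ge_0; [apply Rmult_le_pos; apply Cmod_ge_0 | exact HM |].
      apply Rmult_le_compat; try apply Cmod_ge_0; assumption.
Qed.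

(** The solution of [u' = m u + g] with [u 0 = 0]. *)
Definition exp_conv (m : C) (g : R -> C) (x : R) : C := CRInt (fun y => Cexp (m * RtoC (x - y)) * g y)%C 0 x.

Lemma kcont1_heat_symbol (mu : R) : kcont1 (heat_symbol mu).
Proof.
  intros j Hj p. pose proof (kcont1_res j Hj).
  unfold heat_symbol. ct.
Qed.

Lemma cont_heat_int (mu : R) : cont (heat_int mu).
Proof.
  apply (KI_cont (fun (z : R) l => Cexp (Ci * l * z) * heat_symbol mu l)%C).
  intros j Hj q. pose proof (cont_k j Hj). pose proof (kcont1_heat_symbol mu j Hj). ct.
Qed.

(** On the contour [exp (i l (y - x))] can be integrated against [g] up to infinity, so the
    kernel is used at [y - x] for all [y]. For [y < x] this is not the kernel at [|x - y|];
    a correction over the segment from 0 to [x], where both signs are harmless, makes up for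
    it. *)
Lemma convolution_contour (g : R -> C) (mu x M : R) : 0 <= x -> cont g -> dec g M ->
  half_line_int (fun y => g y * heat_int mu (Rabs (x - y)))%C
  = KI (fun l => heat_symbol mu l * (Cexp (- (Ci * l * x)) * half_fourier g (- l)
       + (exp_conv (Ci * l) g x - exp_conv (- (Ci * l)) g x)))%C.
Proof.
  intros Hx Hg HM. pose proof (dec_nonneg g M HM) as HM0.
  pose proof (cont_heat_int mu) as HH. pose proof (kcont1_heat_symbol mu) as Hs.
  destruct (onK_bounded (fun l => l)) as [B [HB0 HB]].
  { intros j Hj. now apply cont_k. }
  destruct (onK_bounded _ Hs) as [Q [HQ0 HQ]]. destruct KI_bound as [L [HL0 HL]].
  pose (M1 := exp (B * x) * Q * M).
  assert (D1 : forall l, onK l -> dec (fun y : R => Cexp (Ci * l * RtoC (y - x)) * heat_symbol mu l * g y)%C M1).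
  { intros l Hl. unfold M1. apply (dec_mult g (fun y : R => Cexp (Ci * l * RtoC (y - x)) * heat_symbol mu l)%C M); [exact HM |].
    intros y Hy. rewrite Cmod_mult. apply Rmult_le_compat; try apply Cmod_ge_0; [| now apply HQ].
    rewrite Cmod_Cexp. apply exp_monotone.
    pose proof (onK_Im l Hl) as Him.
    specialize (HB l Hl). pose proof (Cmod_ge_Im l) as H1. pose proof (Rle_abs (Im l)).
    destruct l as [p q]. unfold Im in *. simpl in *. nra. }
  assert (C1 : kcontR (fun (y : R) l => Cexp (Ci * l * RtoC (y - x)) * heat_symbol mu l * g y)%C).
  { intros j Hj q. pose proof (cont_k j Hj). specialize (Hs j Hj). ct. }
  assert (E1 : half_line_int (fun y => g y * heat_int mu (y - x))%C
    = KI (fun l => heat_symbol mu l * (Cexp (- (Ci * l * x)) * half_fourier g (- l)))%C).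
  { transitivity (half_line_int (fun y => KI (fun l => Cexp (Ci * l * RtoC (y - x)) * heat_symbol mu l * g y)%C)).
    - apply half_line_ext. intros y _. unfold heat_int.
      rewrite <- KI_Cmult.
      + apply KI_ext. intros l _. unfold heat_symbol. ring.
      + intros j Hj q. pose proof (cont_k j Hj). specialize (Hs j Hj).
        apply contp_mult; [ct | apply Hs].
    - rewrite (KI_half_line_swap _ M1 C1 D1).
      apply KI_ext. intros l Hl. unfold half_fourier.
      rewrite Cmult_assoc, <- (half_line_Cmult _ _ M).
      + apply half_line_ext. intros y _. rewrite RtoC_minus.
        replace (Ci * l * (y - x))%C with (- (Ci * l * x) + - (Ci * - l * y))%C by ring.
        rewrite Cexp_plus. ring.
      + now apply cont_fourier_integrand.
      + apply dec_fourier_integrand; [exact HM |].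
        pose proof (onK_Im l Hl). simpl. unfold Im in *. lra. }
  (* the error made by the kernel at [y - x] for [y < x] *)
  pose (b := fun y : R => (g y * (heat_int mu (x - y) - heat_int mu (y - x)))%C).
  assert (Cb : cont b) by (unfold b; ct).
  assert (C2 : kcontR (fun (y : R) l => heat_symbol mu l * (Cexp (Ci * l * RtoC (x - y)) * g y - Cexp (- (Ci * l) * RtoC (x - y)) * g y))%C).
  { intros j Hj q. pose proof (cont_k j Hj). specialize (Hs j Hj). ct. }
  assert (E2 : CRInt b 0 x = KI (fun l => heat_symbol mu l * (exp_conv (Ci * l) g x - exp_conv (- (Ci * l)) g x))%C).
  { transitivity (CRInt (fun y => KI (fun l => heat_symbol mu l * (Cexp (Ci * l * RtoC (x - y)) * g y - Cexp (- (Ci * l) * RtoC (x - y)) * g y))%C) 0 x).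
    - apply CRInt_ext. intros y _. unfold b, heat_int.
      assert (Ck : forall z : R, kcont1 (fun l => Cexp (Ci * l * z) * (res l * Cexp (mu * res l)))%C).
      { intros z j Hj q. pose proof (cont_k j Hj). specialize (Hs j Hj).
        apply contp_mult; [ct | apply Hs]. }
      rewrite <- (KI_minus _ _ (Ck (x - y)) (Ck (y - x))).
      rewrite <- (KI_Cmult (g y)).
      + apply KI_ext. intros l _. unfold heat_symbol.
        replace (RtoC (y - x)) with (- RtoC (x - y))%C by (rewrite <- RtoC_opp; f_equal; ring).
        replace (Ci * l * - RtoC (x - y))%C with (- (Ci * l) * RtoC (x - y))%C by ring. ring.
      + intros j Hj p. apply contp_minus; apply (Ck _ j Hj).
    - rewrite (KI_CRInt_swap _ 0 x Hx C2).
      apply KI_ext. intros l _. unfold exp_conv. rewrite CRInt_Cmult, CRInt_minus by ct. reflexivity. }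
  transitivity (half_line_int (fun y => g y * heat_int mu (y - x)) + CRInt b 0 x)%C.
  - assert (Ch : cont (fun y => g y * heat_int mu (y - x))%C) by ct.
    assert (Dh : dec (fun y => g y * heat_int mu (y - x))%C (M * (L * (exp (B * x) * Q)))).
    { intros y Hy. rewrite Cmult_comm. rewrite Rmult_comm. revert y Hy. apply dec_mult; [exact HM |].
      intros y Hy. apply HL.
      - intros j Hj q. pose proof (cont_k j Hj). specialize (Hs j Hj).
        apply contp_mult; [ct | apply Hs].
      - intros l Hl. rewrite Cmod_mult. apply Rmult_le_compat; try apply Cmod_ge_0; [| now apply HQ].
        rewrite Cmod_Cexp. apply exp_monotone.
        pose proof (onK_Im l Hl) as Him.
        specialize (HB l Hl). pose proof (Cmod_ge_Im l) as H1. pose proof (Rle_abs (Im l)).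
        destruct l as [p q]. unfold Im in *. simpl in *. nra. }
    pose proof (dec_nonneg _ _ Dh) as HMh.
    assert (Cabs : cont (fun y => g y * heat_int mu (Rabs (x - y)))%C).
    { intros y. apply contp_mult; [apply Hg |].
      apply (contp_app (heat_int mu)); [exact HH |].
      apply (contR_comp (fun y => x - y) Rabs); [ct | apply Rcontinuity_abs]. }
    apply half_line_lim; [exact Cabs |].
    intros eps Heps.
    destruct (Rdiv_small _ eps Heps HMh) as [n [Hn0 Hn]].
    exists (n + x). intros q Hq.
    assert (Es : CRInt (fun y => g y * heat_int mu (Rabs (x - y)))%C 0 q
      = (CRInt (fun y => g y * heat_int mu (y - x)) 0 q + CRInt b 0 x)%C).
    { transitivity (CRInt (fun y => g y * heat_int mu (Rabs (x - y))) 0 x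
        + CRInt (fun y => g y * heat_int mu (Rabs (x - y))) x q)%C.
      { symmetry. exact (CRInt_Chasles _ 0 x q Cabs). }
      transitivity ((CRInt (fun y => g y * heat_int mu (y - x)) 0 x
        + CRInt (fun y => g y * heat_int mu (y - x)) x q) + CRInt b 0 x)%C.
      2: { f_equal. exact (CRInt_Chasles _ 0 x q Ch). }
      rewrite (CRInt_ext (fun y => g y * heat_int mu (Rabs (x - y)))%C (fun y => g y * heat_int mu (y - x) + b y)%C 0 x).
      - rewrite (CRInt_ext (fun y => g y * heat_int mu (Rabs (x - y)))%C (fun y => g y * heat_int mu (y - x))%C x q).
        + assert (Ep : CRInt (fun y => g y * heat_int mu (y - x) + b y)%C 0 x
            = (CRInt (fun y => g y * heat_int mu (y - x))%C 0 x + CRInt b 0 x)%C)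
            by exact (CRInt_plus _ b 0 x Ch Cb).
          rewrite Ep. ring.
        + intros y Hy. rewrite Rmin_left, Rmax_right in Hy by lra.
          rewrite Rabs_left by lra. do 2 f_equal. ring.
      - intros y Hy. rewrite Rmin_left, Rmax_right in Hy by lra.
        rewrite Rabs_pos_eq by lra. unfold b. ring. }
    rewrite Es.
    replace (CRInt (fun y => g y * heat_int mu (y - x)) 0 q + CRInt b 0 x - (half_line_int (fun y => g y * heat_int mu (y - x)) + CRInt b 0 x))%C
      with (CRInt (fun y => g y * heat_int mu (y - x)) 0 q - half_line_int (fun y => g y * heat_int mu (y - x)))%C by ring.
    eapply Rle_lt_trans; [apply (half_line_tail _ _ q Ch Dh); lra | apply Hn; lra].
  - rewrite E1, E2, <- KI_plus.
    + apply KI_ext. intros l _. ring.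
    + intros j Hj p. pose proof (cont_k j Hj) as Hk.
      apply contp_mult; [apply (Hs j Hj) |]. apply contp_mult; [ct |].
      apply (cont_half_fourier (fun _ : R => g) (fun r => - k j r)%C p M).
      * ct.
      * ct.
      * intros r. pose proof (onK_Im (k j r) ltac:(now exists j, r)) as H.
        unfold Im in *. simpl. lra.
      * now apply filter_forall.
    + intros j Hj p. pose proof (cont_k j Hj) as Hk.
      apply contp_mult; [apply (Hs j Hj) |].
      apply contp_minus; unfold exp_conv;
        [apply (cont_CRInt (fun (r : R) y => Cexp (Ci * k j r * RtoC (x - y)) * g y)%C)
        | apply (cont_CRInt (fun (r : R) y => Cexp (- (Ci * k j r) * RtoC (x - y)) * g y)%C)]; ct.
Qed.

(** * The contribution of a source on the real line *)

Variable beta : R.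
Hypothesis Hbeta : 0 < beta.

Local Notation c := (beta / alpha).
Local Notation omega := (Defs.omega alpha beta).

Lemma exp_conv_scale (m : C) (g : R -> C) (x : R) : cont g ->
  exp_conv m g x = (RtoC x * CRInt (fun th => Cexp (m * RtoC (x - x * th)) * g (x * th)%R) 0 1)%C.
Proof.
  intros Hg. unfold exp_conv.
  rewrite (CRInt_scale (fun y => Cexp (m * RtoC (x - y)) * g y)%C); [reflexivity | ct].
Qed.

(** After rescaling to the unit segment the end point [x] is a parameter of the integrand. *)
Lemma cont_exp_conv {T : UniformSpace} (m : T -> C) (g : T -> R -> C) (x : T -> R) :
  cont m -> cont (fun q : prod_UniformSpace T R_UniformSpace => g (fst q) (snd q)) ->
  (forall p, continuous x p) -> cont (fun p => exp_conv (m p) (g p) (x p)).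
Proof.
  intros Hm Hg Hx p0.
  apply (contp_ext (fun p => RtoC (x p) * CRInt (fun th => Cexp (m p * RtoC (x p - x p * th)) * g p (x p * th)%R) 0 1)%C).
  - intros p. symmetry. apply exp_conv_scale. now apply contT_r.
  - apply contp_mult; [apply contp_RtoC, Hx |].
    apply (cont_CRInt (fun p th => Cexp (m p * RtoC (x p - x p * th)) * g p (x p * th)%R)%C).
    intros q.
    assert (Hxq : continuous (fun q : prod_UniformSpace T R_UniformSpace => x (fst q)) q).
    { apply contR_fst. apply Hx. }
    assert (Hmq : contp (fun q : prod_UniformSpace T R_UniformSpace => m (fst q)) q).
    { apply contR_fst. apply Hm. }
    apply contp_mult; [ct |].
    apply (continuous_comp_2 (fun q : prod_UniformSpace T R_UniformSpace => fst q)
             (fun q : prod_UniformSpace T R_UniformSpace => x (fst q) * snd q) g).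
    + apply contp_fst.
    + ct.
    + apply (Hg (fst q, x (fst q) * snd q)).
Qed.

(** Constants apart, the dispersion relation is the bounded symbol [res]. *)
Lemma omega_res (l : C) : (1 + alpha * l ^ 2)%C <> RtoC 0 -> omega l = (RtoC c - RtoC c * res l)%C.
Proof.
  intros Hn. unfold Defs.omega, res.
  rewrite RtoC_div by lra. field. split; [exact Hn | apply RtoC_neq_0; lra].
Qed.

Lemma Cexp_omega (l : C) (t : R) : (1 + alpha * l ^ 2)%C <> RtoC 0 ->
  (Cexp (- omega l * t) * res l = RtoC (exp (- (c * t))) * heat_symbol (c * t) l)%C.
Proof.
  intros Hn. rewrite (omega_res l Hn). unfold heat_symbol.
  rewrite <- Cexp_RtoC, RtoC_opp, !RtoC_mult.
  replace (- (RtoC c - RtoC c * res l) * t)%C with (- (RtoC c * t) + RtoC c * t * res l)%C by ring.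
  rewrite Cexp_plus. ring.
Qed.

Lemma line_res_neq_0 (l : R) : (1 + alpha * RtoC l ^ 2)%C <> RtoC 0.
Proof.
  rewrite <- RtoC_pow, <- RtoC_mult, <- RtoC_plus. apply RtoC_neq_0.
  apply Rgt_not_eq, rres_den.
Qed.

Lemma c_pos : 0 < c.
Proof. now apply Rdiv_lt_0_compat. Qed.

(** Negative times are included, so that a bound near [t = 0] holds on both sides. *)
Definition source (g : R -> R -> C) : Prop :=
  cont2 g /\ forall T, exists M, forall t, t <= T -> dec (fun y => g y t) M.

Lemma source_cont_time (g : R -> R -> C) (t : R) : source g -> cont (fun y => g y t).
Proof. intros [H _]. now apply cont2_l. Qed.

Lemma source_swap (g : R -> R -> C) : source g -> cont2 (fun t y => g y t).
Proof. intros [H _] q. apply (contp_app2 g (fun q : RR => snd q) (fun q : RR => fst q)); [exact H | ct | ct]. Qed.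

Lemma source_local (g : R -> R -> C) (t0 : R) : source g -> exists M, locally t0 (fun t => dec (fun y => g y t) M).
Proof.
  intros [_ H]. destruct (H (t0 + 1)) as [M HM]. exists M.
  exists (mkposreal 1 Rlt_0_1). intros t Ht. apply HM.
  change (Rabs (t - t0) < 1) in Ht. apply Rabs_def2 in Ht. lra.
Qed.

Lemma cont_source_fourier {T : UniformSpace} (g : R -> R -> C) (lam : T -> C) (time : T -> R) :
  source g -> cont lam -> (forall p, Im (lam p) <= 0) -> (forall p, continuous time p) ->
  cont (fun p => half_fourier (fun y => g y (time p)) (lam p)).
Proof.
  intros Hg Hlam Him Ht p0.
  destruct (source_local g (time p0) Hg) as [M HM].
  apply (cont_half_fourier (fun p y => g y (time p)) lam p0 M); trivial.
  - intros q. apply (contp_app2 g (fun q : prod_UniformSpace T R_UniformSpace => snd q)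
      (fun q : prod_UniformSpace T R_UniformSpace => time (fst q))); [apply Hg | ct | apply contR_fst; apply Ht].
  - apply (Ht p0 _ HM).
Qed.

(** What [convolution_contour] produces for the source at time [tau]. *)
Definition source_symbol (g : R -> R -> C) (x tau : R) (l : C) : C :=
  (Cexp (- (Ci * l * x)) * half_fourier (fun y => g y tau) (- l)
   + (exp_conv (Ci * l) (fun y => g y tau) x - exp_conv (- (Ci * l)) (fun y => g y tau) x))%C.

Lemma onK_Im_opp (l : C) : onK l -> Im (- l)%C <= 0.
Proof.
  intros Hl. pose proof (onK_Im l Hl) as H.
  unfold Im in *. simpl. lra.
Qed.

Lemma kcont_source_symbol {T : UniformSpace} (g : R -> R -> C) (x tau : T -> R) :
  source g -> (forall p, continuous x p) -> (forall p, continuous tau p) ->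
  kcont (T := T) (fun p => source_symbol g (x p) (tau p)).
Proof.
  intros Hg Hx Ht j Hj. pose proof (cont_k j Hj) as Hk.
  assert (Ctau : forall q : prod_UniformSpace T R_UniformSpace, continuous (fun q => tau (fst q)) q).
  { intros q. apply contR_fst, Ht. }
  assert (Cx : forall q : prod_UniformSpace T R_UniformSpace, continuous (fun q => x (fst q)) q).
  { intros q. apply contR_fst, Hx. }
  assert (Cg : cont (fun q : prod_UniformSpace (prod_UniformSpace T R_UniformSpace) R_UniformSpace =>
     g (snd q) (tau (fst (fst q))))).
  { intros q. apply (contp_app2 g (fun q : prod_UniformSpace (prod_UniformSpace T R_UniformSpace) R_UniformSpace => snd q)
      (fun q : prod_UniformSpace (prod_UniformSpace T R_UniformSpace) R_UniformSpace => tau (fst (fst q))));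
      [apply Hg | ct | apply (contR_fst (fun q : prod_UniformSpace T R_UniformSpace => tau (fst q))); apply Ctau]. }
  intros q. unfold source_symbol. apply contp_plus; [apply contp_mult |].
  - specialize (Cx q). ct.
  - apply (cont_source_fourier g (fun q : prod_UniformSpace T R_UniformSpace => - k j (snd q))%C
             (fun q : prod_UniformSpace T R_UniformSpace => tau (fst q)) Hg).
    + ct.
    + intros p. apply onK_Im_opp. now exists j, (snd p).
    + exact Ctau.
  - apply contp_minus.
    + apply (cont_exp_conv (fun q : prod_UniformSpace T R_UniformSpace => Ci * k j (snd q))%C
        (fun (q : prod_UniformSpace T R_UniformSpace) y => g y (tau (fst q)))
        (fun q : prod_UniformSpace T R_UniformSpace => x (fst q))); [ct | exact Cg | exact Cx].
    + apply (cont_exp_conv (fun q : prod_UniformSpace T R_UniformSpace => - (Ci * k j (snd q)))%C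
        (fun (q : prod_UniformSpace T R_UniformSpace) y => g y (tau (fst q)))
        (fun q : prod_UniformSpace T R_UniformSpace => x (fst q))); [ct | exact Cg | exact Cx].
Qed.

(** On the real line [exp (omega tau)] and [exp (- omega t)] combine to the heat symbol for
    the time [t - tau]. *)
Lemma f_integrand_eq (g : R -> R -> C) (x t l : R) : source g ->
  f_integrand alpha beta g x t (RtoC l)
  = CRInt (fun tau => half_fourier (fun y => g y tau) (RtoC l) * Cexp (Ci * RtoC l * x)
        * (RtoC (exp (- (c * (t - tau)))) * heat_symbol (c * (t - tau)) (RtoC l)))%C 0 t.
Proof.
  intros Hg. unfold f_integrand, F_transform.
  assert (Hc : cont (fun tau => half_fourier (fun y => g y tau) (RtoC l))).
  { apply (cont_source_fourier g (fun _ : R => RtoC l) (fun tau => tau) Hg); [ct | intros; simpl; lra | ct]. }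
  rewrite <- CRInt_Cmult by ct.
  apply CRInt_ext. intros tau _.
  rewrite <- Cexp_omega by apply line_res_neq_0.
  unfold kernel. unfold Cdiv. fold (res (RtoC l)).
  rewrite RtoC_minus.
  replace (Ci * l * x - omega l * t)%C with (Ci * l * x + (- omega l * (t - tau)) + - (omega l * tau))%C by ring.
  rewrite !Cexp_plus.
  transitivity (Cexp (Ci * l * x) * Cexp (- omega l * (t - tau)) * (Cexp (- (omega l * tau)) * Cexp (omega l * tau)) * res l * half_fourier (fun y => g y tau) l)%C.
  - unfold res. ring.
  - rewrite Cexp_opp_l. ring.
Qed.

(** For each [tau] apply [line_convolution] and [convolution_contour], and exchange the
    integrals. The bound on the line, proportional to [t], is kept for the limit [t -> 0]. *)
Lemma f_integrand_line (g : R -> R -> C) (x t : R) : source g -> 0 <= x -> 0 <= t ->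
  exists V,
  is_RInt_gen (V := C_R_NormedModule) (fun l : R => f_integrand alpha beta g x t (RtoC l))
    (Rbar_locally m_infty) (Rbar_locally p_infty) V /\
  V = KI (fun l => CRInt (fun tau => Cexp (- omega l * RtoC (t - tau)) * (res l * source_symbol g x tau l)) 0 t)%C /\
  (forall M, (forall tau, 0 <= tau <= t -> dec (fun y => g y tau) M) ->
     Cmod V <= 2 * (t * (M * (exp (c * t) * cdec)))).
Proof.
  intros Hg Hx Ht. pose proof c_pos as Hcp.
  pose (H := fun (l tau : R) => (half_fourier (fun y => g y tau) (RtoC l) * Cexp (Ci * RtoC l * x)
        * (RtoC (exp (- (c * (t - tau)))) * heat_symbol (c * (t - tau)) (RtoC l)))%C).
  assert (Cf : cont2 (fun l tau : R => half_fourier (fun y => g y tau) (RtoC l))).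
  { apply (cont_source_fourier g (fun q : RR => RtoC (fst q)) (fun q : RR => snd q) Hg);
      [ct | intros; simpl; lra | ct]. }
  assert (CH : cont2 H).
  { intros q. unfold H. apply contp_mult; [ct |]. apply contp_mult.
    - apply contp_RtoC. apply (contR_comp (fun q : RR => - (c * (t - snd q))) exp); [ct |].
      apply derivable_continuous_pt, derivable_pt_exp.
    - apply (contp_app2 (fun mu l : R => heat_symbol mu l) (fun q : RR => c * (t - snd q)) (fun q : RR => fst q));
        [now apply cont_heat_symbol_line | ct | ct]. }
  pose (D := fun M => M * (exp (c * t) * cdec)).
  assert (HD : forall M tau, 0 <= tau <= t -> dec (fun y => g y tau) M ->
    ldec (fun l => H l tau) (D M)).
  { intros M tau Htau HM l. unfold H, D. rewrite !Cmod_mult, Cmod_Cexp_line, Rmult_1_r.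
    assert (H1 : Cmod (half_fourier (fun y => g y tau) (RtoC l)) <= M).
    { apply half_fourier_bound; [now apply source_cont_time | exact HM | simpl; lra]. }
    assert (H2 : Cmod (RtoC (exp (- (c * (t - tau))))) <= 1).
    { rewrite Cmod_R, Rabs_pos_eq by apply Rlt_le, exp_pos. rewrite <- exp_0. apply exp_monotone. nra. }
    assert (H3 : 0 <= c * (t - tau) <= c * t) by nra.
    pose proof (heat_symbol_dec (c * (t - tau)) (c * t) l H3) as H4.
    replace (M * (exp (c * t) * cdec) / (1 + Rabs l) ^ 2)
      with (M * (1 * (exp (c * t) * cdec / (1 + Rabs l) ^ 2)))
      by (unfold Rdiv at 1 3; ring).
    apply Rmult_le_compat; try apply Cmod_ge_0; [| exact H1 |].
    - apply Rmult_le_pos; apply Cmod_ge_0.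
    - apply Rmult_le_compat; try apply Cmod_ge_0; assumption. }
  pose (G := fun l : R => CRInt (H l) 0 t).
  assert (CG : cont G) by apply (cont_CRInt H 0 t CH).
  assert (LG : forall M, (forall tau, 0 <= tau <= t -> dec (fun y => g y tau) M) -> ldec G (t * D M)).
  { intros M HM l. unfold Rdiv. rewrite Rmult_assoc. replace t with (t - 0) at 1 by ring.
    apply (Cmod_CRInt_le (H l) 0 t); [exact Ht | now apply cont2_r |].
    intros tau Htau. apply (HD M tau Htau (HM tau Htau)). }
  assert (HM0 : exists M, forall tau, 0 <= tau <= t -> dec (fun y => g y tau) M).
  { destruct Hg as [_ Hb]. destruct (Hb t) as [M HM]. exists M. intros tau Htau. apply HM. lra. }
  destruct HM0 as [M HM].
  assert (CGm : cont (fun l => G (- l)%R)).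
  { intros p. apply (contp_app G (fun l => - l)); [exact CG | ct]. }
  exists (half_line_int (fun l => G l + G (- l)%R)%C). split; [| split].
  - apply (is_RInt_gen_ext (V := C_R_NormedModule) G).
    + apply filter_forall. intros [p q] l _. symmetry. now apply f_integrand_eq.
    + apply (is_line_dec G (t * D M) CG (LG M HM)).
  - pose (Hs := fun tau l : R => (H l tau + H (- l)%R tau)%C).
    assert (CHm : cont2 (fun l tau => H (- l)%R tau)).
    { intros q. apply (contp_app2 H (fun q : RR => - fst q) (fun q : RR => snd q)); [exact CH | ct | ct]. }
    assert (CHs : cont2 Hs).
    { intros q. unfold Hs. apply contp_plus.
      - apply (contp_app2 H (fun q : RR => snd q) (fun q : RR => fst q)); [exact CH | ct | ct].
      - apply (contp_app2 (fun l tau => H (- l)%R tau) (fun q : RR => snd q) (fun q : RR => fst q)); [exact CHm | ct | ct]. }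
    transitivity (CRInt (fun tau => half_line_int (Hs tau)) 0 t).
    + rewrite (half_line_CRInt_swap Hs 0 t (D M + D M) Ht CHs).
      * apply half_line_ext. intros l _. unfold G, Hs.
        rewrite <- CRInt_plus; [reflexivity | now apply cont2_r | now apply (cont2_r (fun l tau => H (- l)%R tau) l)].
      * intros tau Htau. destruct (line_dec_halves _ _ (HD M tau Htau (HM tau Htau))) as [D1 D2].
        now apply dec_plus.
    + transitivity (CRInt (fun tau => KI (fun l => Cexp (- omega l * RtoC (t - tau)) * (res l * source_symbol g x tau l))%C) 0 t).
      * apply CRInt_ext. intros tau Htau. rewrite Rmin_left, Rmax_right in Htau by lra.
        specialize (HM tau ltac:(lra)).
        assert (Hmu : 0 <= c * (t - tau)) by nra.
        assert (Cg : cont (fun y => g y tau)) by now apply source_cont_time.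
        set (E := RtoC (exp (- (c * (t - tau))))).
        transitivity (E * half_line_int (fun l => half_fourier (fun y => g y tau) (RtoC l) * Cexp (Ci * RtoC l * x) * heat_symbol (c * (t - tau)) (RtoC l)
           + half_fourier (fun y => g y tau) (RtoC (- l)) * Cexp (Ci * RtoC (- l) * x) * heat_symbol (c * (t - tau)) (RtoC (- l))))%C.
        -- transitivity (half_line_int (fun l => E * (/ E * Hs tau l))%C).
           { apply half_line_ext. intros l _. field. unfold E. apply RtoC_neq_0, Rgt_not_eq, exp_pos. }
           assert (En : E <> RtoC 0) by (unfold E; apply RtoC_neq_0, Rgt_not_eq, exp_pos).
           assert (Dt : dec (Hs tau) (D M + D M)).
           { destruct (line_dec_halves _ _ (HD M tau ltac:(lra) HM)) as [D1 D2]. now apply dec_plus. }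
           rewrite (half_line_Cmult E (fun l => / E * Hs tau l)%C (Cmod (/ E)%C * (D M + D M))).
           ++ f_equal. apply half_line_ext. intros l _. unfold Hs, H. fold E. field. exact En.
           ++ intros l. apply contp_mult; [ct | now apply cont2_r].
           ++ apply (dec_mult (Hs tau) (fun _ => / E)%C); [exact Dt | intros; lra].
        -- rewrite (line_convolution (fun y => g y tau) (c * (t - tau)) x M Hmu Cg HM).
           rewrite (convolution_contour (fun y => g y tau) (c * (t - tau)) x M Hx Cg HM).
           rewrite <- KI_Cmult.
           ++ apply KI_ext. intros l Hl.
              pose proof (onK_res l Hl) as Hn.
              unfold source_symbol. rewrite !Cmult_assoc, Cexp_omega by exact Hn. unfold E. ring.
           ++ intros j Hj p. apply contp_mult.
              ** apply (kcont1_heat_symbol (c * (t - tau)) j Hj).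
              ** apply (kcont1_T (fun _ : R => source_symbol g x tau) 0); [| exact Hj].
                 apply (kcont_source_symbol g (fun _ : R => x) (fun _ : R => tau) Hg); ct.
      * apply (KI_CRInt_swap (fun tau l => Cexp (- omega l * RtoC (t - tau)) * (res l * source_symbol g x tau l))%C 0 t Ht).
        intros j Hj q. pose proof (cont_k j Hj) as Hk.
        pose proof (kcont1_res j Hj) as Hr.
        assert (Hom : cont (fun r => omega (k j r))).
        { intros r. apply (contp_ext (fun r => RtoC c - RtoC c * res (k j r))%C); [| ct].
          intros r'. symmetry. apply omega_res.
          apply onK_res. now exists j, r'. }
        apply contp_mult; [ct |]. apply contp_mult; [ct |].
        apply (kcont_source_symbol g (fun _ : R => x) (fun tau => tau) Hg); [ct | ct | exact Hj].
  - intros M' HM'. pose proof (LG M' HM') as L. destruct (line_dec_halves _ _ L) as [D1 D2].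
    replace (2 * (t * (M' * (exp (c * t) * cdec)))) with (t * D M' + t * D M') by (unfold D; ring).
    apply half_line_bound.
    + intros l. apply contp_plus; [apply CG | apply CGm].
    + now apply dec_plus.
Qed.

(** * Fourier inversion on the half line *)

(** Integrate by parts up to [q] and let [q] tend to infinity. *)
Lemma half_fourier_derivative (g g' : R -> C) (M l : R) :
  cont g -> cont g' -> dec g M -> dec g' M -> (forall y, 0 < y -> der g y (g' y)) ->
  half_fourier g' (RtoC l) = (Ci * l * half_fourier g (RtoC l) - g 0)%C.
Proof.
  intros Hg Hg' Dg Dg' Hder.
  pose proof (dec_nonneg g M Dg) as HM0.
  pose proof (cont_fourier_integrand g (RtoC l) Hg) as Cg.
  pose proof (cont_fourier_integrand g' (RtoC l) Hg') as Cg'.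
  assert (Dh : dec (fun x : R => Cexp (- (Ci * l * x)) * g x)%C M) by (apply dec_fourier_integrand; [exact Dg | simpl; lra]).
  assert (Dh' : dec (fun x : R => Cexp (- (Ci * l * x)) * g' x)%C M) by (apply dec_fourier_integrand; [exact Dg' | simpl; lra]).
  assert (E : half_line_int (fun x : R => Cexp (- (Ci * l * x)) * g' x + - (Ci * l) * (Cexp (- (Ci * l * x)) * g x))%C = (- g 0)%C).
  { apply half_line_lim; [ct |]. intros eps Heps.
    destruct (Rdiv_small M eps Heps HM0) as [n [Hn0 Hn]].
    exists n. intros q Hq.
    rewrite (CRInt_der (fun x : R => Cexp (- (Ci * l * x)) * g x)%C); [| lra | ct | | ct].
    - replace (Ci * l * RtoC 0)%C with (RtoC 0) by ring.
      replace (- RtoC 0)%C with (RtoC 0) by ring. rewrite Cexp_0.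
      match goal with |- Cmod ?e < _ => replace e with (Cexp (- (Ci * l * q)) * g q)%C by ring end.
      eapply Rle_lt_trans; [apply (Dh q ltac:(lra)) |].
      eapply Rle_lt_trans; [| apply (Hn q Hq)].
      apply Rmult_le_compat_l; [exact HM0 |]. apply Rinv_le_contravar; [lra | nra].
    - intros x Hx. eapply der_eq; [| apply der_mult; [apply der_Cexp, der_opp, der_Cmult_l, der_id | apply Hder; lra]].
      cbv beta. ring. }
  rewrite (half_line_plus _ _ M (Cmod (- (Ci * l))%C * M)) in E; [| exact Cg' | ct | exact Dh' |].
  - rewrite (half_line_Cmult (- (Ci * l))%C _ M Cg Dh) in E.
    unfold half_fourier.
    transitivity ((half_line_int (fun x : R => Cexp (- (Ci * l * x)) * g' x) + - (Ci * l) * half_line_int (fun x : R => Cexp (- (Ci * l * x)) * g x)) + Ci * l * half_line_int (fun x : R => Cexp (- (Ci * l * x)) * g x))%C; [ring |].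
    rewrite E. ring.
  - apply (dec_mult (fun x : R => Cexp (- (Ci * l * x)) * g x)%C (fun _ => - (Ci * l))%C); [exact Dh | intros; lra].
Qed.

Lemma line_res_Cexp (x : R) : 0 <= x ->
  is_RInt_gen (V := C_R_NormedModule) (fun l : R => Cexp (Ci * l * x) * res l)%C
    (Rbar_locally m_infty) (Rbar_locally p_infty) (RtoC (PI * a * exp (- a * x))).
Proof.
  intros Hx. rewrite <- even_int_1 by assumption.
  pose proof line_res_cont as Hr.
  pose (F := fun l : R => (Cexp (Ci * l * x) * res l)%C).
  replace (even_int 1 x) with (half_line_int (fun l => F l + F (- l)%R)%C).
  - apply (is_line_dec F cdec); unfold F; [ct |].
    intros l. rewrite Cmod_mult, Cmod_Cexp_line, Rmult_1_l, res_RtoC, Cmod_R, Rabs_pos_eq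
      by (trivial; apply Rlt_le, rres_pos).
    eapply Rle_trans; [apply rres_dec |].
    apply Rmult_le_compat_r; [apply Rlt_le, Rinv_0_lt_compat, one_plus_sqr_pos, Rabs_pos |].
    unfold cdec. pose proof (Rinv_0_lt_compat _ Halpha). nra.
  - apply half_line_ext. intros l _. unfold F. rewrite !res_RtoC by exact Halpha.
    replace (rres (- l)) with (rres l) by (unfold rres; f_equal; ring).
    rewrite pow_1, RtoC_mult, <- Cexp_two_cos, RtoC_opp, RtoC_mult.
    replace (Ci * - l * x)%C with (- (Ci * (l * x)))%C by ring.
    replace (Ci * l * x)%C with (Ci * (l * x))%C by ring. ring.
Qed.

(** The truncated integrals are small by [lower_pole_int_le], whose bound contains [1 / A +
    1 / B]. *)
Lemma line_lower_pole (x : R) : 0 < x ->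
  is_RInt_gen (V := C_R_NormedModule) (fun l : R => Cexp (Ci * l * x) * / (l + Ci * a))%C
    (Rbar_locally m_infty) (Rbar_locally p_infty) (RtoC 0).
Proof.
  intros Hx. apply is_line.
  - intros l. apply contp_mult; [ct |]. apply contp_inv; [now apply lower_pole_neq | ct].
  - intros eps Heps.
    pose (b := / x + sqrt alpha / x ^ 2).
    assert (Hb : 0 < b).
    { unfold b. pose proof (Rinv_0_lt_compat x Hx). pose proof (sqrt_lt_R0 alpha Halpha).
      assert (0 < sqrt alpha / x ^ 2) by (apply Rdiv_lt_0_compat; [assumption | nra]). lra. }
    exists (2 * b / eps). intros A B HA HB.
    assert (Hp : 0 < 2 * b / eps) by (apply Rdiv_lt_0_compat; lra).
    replace (CRInt (fun l : R => Cexp (Ci * l * x) * / (l + Ci * a)) (- A) B - RtoC 0)%C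
      with (lower_pole_int A B x) by (unfold lower_pole_int; ring).
    eapply Rle_lt_trans; [apply lower_pole_int_le; lra |]. fold b.
    assert (HiA : / A < eps / (2 * b)).
    { replace (eps / (2 * b)) with (/ (2 * b / eps)) by (field; lra). apply Rinv_lt_contravar; nra. }
    assert (HiB : / B < eps / (2 * b)).
    { replace (eps / (2 * b)) with (/ (2 * b / eps)) by (field; lra). apply Rinv_lt_contravar; nra. }
    apply Rlt_le_trans with ((eps / (2 * b) + eps / (2 * b)) * b); [nra | right; field; lra].
Qed.

Lemma is_line_Cmult (z : C) (f : R -> C) (L : C) :
  is_RInt_gen (V := C_R_NormedModule) f (Rbar_locally m_infty) (Rbar_locally p_infty) L ->
  is_RInt_gen (V := C_R_NormedModule) (fun l => z * f l)%C (Rbar_locally m_infty) (Rbar_locally p_infty) (z * L)%C.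
Proof.
  intros H P HP.
  assert (Hc : contp (fun w : C => z * w)%C L).
  { apply contp_mult; [apply contp_const | apply continuous_id]. }
  specialize (H _ (Hc P HP)). unfold filtermapi, filtermap in *.
  revert H. apply filter_imp. intros [p q] [y [Hy1 Hy2]].
  exists (z * y)%C. split; [| exact Hy2]. now apply is_CRInt_Cmult.
Qed.

(** On each side of [x] the integrand has an explicit primitive, since the exponential
    solves the homogeneous equation; only the jump of its derivative at [x] and the boundary
    values survive. *)
Lemma green_convolution (g0 g1 g2 : R -> C) (M x : R) : 0 < x ->
  cont g0 -> cont g1 -> cont g2 -> dec g0 M -> dec g1 M ->
  (forall y, 0 < y -> der g0 y (g1 y)) -> (forall y, 0 < y -> der g1 y (g2 y)) ->
  half_line_int (fun y => (g0 y - alpha * g2 y) * Cexp (RtoC (- a * Rabs (x - y))))%C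
  = (2 * alpha * a * g0 x + Cexp (RtoC (- a * x)) * (alpha * g1 0 - alpha * a * g0 0))%C.
Proof.
  intros Hx C0 C1 C2 D0 D1 H01 H12.
  pose proof a_pos as Ha. pose proof a_sqr as Ea.
  pose (F1 := fun y : R => (Cexp (RtoC (- a * (x - y))) * (- alpha * g1 y + alpha * a * g0 y))%C).
  pose (F2 := fun y : R => (Cexp (RtoC (- a * (y - x))) * (- alpha * g1 y - alpha * a * g0 y))%C).
  assert (CF1 : cont F1) by (unfold F1; ct). assert (CF2 : cont F2) by (unfold F2; ct).
  pose (G := fun y : R => ((g0 y - alpha * g2 y) * Cexp (RtoC (- a * Rabs (x - y))))%C).
  assert (CG : cont G).
  { intros y. unfold G. apply contp_mult; [ct |]. apply contp_Cexp, contp_RtoC, contR_mult; [ct |].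
    apply (contR_comp (fun y => x - y) Rabs); [ct | apply Rcontinuity_abs]. }
  assert (I1 : CRInt G 0 x = (F1 x - F1 0)%C).
  { rewrite (CRInt_ext G (fun y => (g0 y - alpha * g2 y) * Cexp (RtoC (- a * (x - y))))%C).
    - apply CRInt_der; [lra | ct | | intros y _; apply CF1].
      intros y Hy. unfold F1.
      eapply der_eq; [| apply der_mult; [apply der_Cexp, der_RtoC | apply der_plus; apply der_Cmult_l; [apply H12; lra | apply H01; lra]]].
      2: { instantiate (1 := a). auto_derive; [trivial | ring]. }
      cbv beta.
      transitivity (Cexp (RtoC (- a * (x - y))) * ((alpha * (a * a)) * g0 y - alpha * g2 y))%C; [ring |].
      rewrite Ea. ring.
    - intros y Hy. rewrite Rmin_left, Rmax_right in Hy by lra. unfold G. rewrite Rabs_pos_eq by lra. reflexivity. }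
  assert (I2 : forall q, x < q -> CRInt G x q = (F2 q - F2 x)%C).
  { intros q Hq. rewrite (CRInt_ext G (fun y => (g0 y - alpha * g2 y) * Cexp (RtoC (- a * (y - x))))%C).
    - apply CRInt_der; [lra | ct | | intros y _; apply CF2].
      intros y Hy. unfold F2.
      eapply der_eq; [| apply der_mult; [apply der_Cexp, der_RtoC | apply der_minus; apply der_Cmult_l; [apply H12; lra | apply H01; lra]]].
      2: { instantiate (1 := - a). auto_derive; [trivial | ring]. }
      cbv beta. rewrite RtoC_opp.
      transitivity (Cexp (RtoC (- a * (y - x))) * ((alpha * (a * a)) * g0 y - alpha * g2 y))%C; [ring |].
      rewrite Ea. ring.
    - intros y Hy. rewrite Rmin_left, Rmax_right in Hy by lra. unfold G.
      rewrite Rabs_left by lra. replace (- (x - y)) with (y - x) by ring. reflexivity. }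
  assert (EF1 : F1 0 = (Cexp (RtoC (- a * x)) * (- alpha * g1 0 + alpha * a * g0 0))%C).
  { unfold F1. now rewrite Rminus_0_r. }
  assert (EF : (F1 x - F2 x = 2 * alpha * a * g0 x)%C).
  { unfold F1, F2. rewrite Rminus_diag, Rmult_0_r, Cexp_0. ring. }
  apply half_line_lim; [exact CG |]. intros eps Heps.
  pose proof (dec_nonneg g0 M D0) as HM0.
  destruct (Rdiv_small (alpha * M + alpha * a * M) eps Heps) as [n [Hn0 Hn]].
  { assert (0 <= alpha * M) by nra. assert (0 <= alpha * a * M) by (apply Rmult_le_pos; nra). lra. }
  exists (n + x). intros q Hq.
  assert (EI : CRInt G 0 q = (CRInt G 0 x + CRInt G x q)%C) by (symmetry; now apply CRInt_Chasles).
  fold G. rewrite EI, I1, I2, EF1 by lra.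
  match goal with |- Cmod ?e < _ => replace e with (F2 q + (F1 x - F2 x - 2 * alpha * a * g0 x))%C by ring end.
  rewrite EF. replace (F2 q + _)%C with (F2 q) by ring.
  eapply Rle_lt_trans; [| apply (Hn q); lra].
  unfold F2. rewrite Cmod_mult, Cmod_Cexp. simpl Re.
  assert (He : exp (- a * (q - x)) <= 1) by (rewrite <- exp_0; apply exp_monotone; nra).
  assert (Hdq : forall g, dec g M -> Cmod (g q) <= M / (1 + q)).
  { intros g Dg. eapply Rle_trans; [apply Dg; lra |].
    apply Rmult_le_compat_l; [exact HM0 |]. apply Rinv_le_contravar; nra. }
  pose proof (Hdq g0 D0) as B0. pose proof (Hdq g1 D1) as B1.
  pose proof (exp_pos (- a * (q - x))).
  rewrite <- (Rmult_1_l (_ / (1 + q))).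
  apply Rmult_le_compat; [lra | apply Cmod_ge_0 | exact He |].
  eapply Rle_trans; [apply Cmod_triangle |].
  rewrite Cmod_opp, !Cmod_mult, Cmod_opp, !Cmod_R, !Rabs_pos_eq by lra.
  unfold Rdiv in *. rewrite Rmult_plus_distr_r, !Rmult_assoc.
  apply Rplus_le_compat; [apply Rmult_le_compat_l; lra |].
  apply Rmult_le_compat_l; [lra |]. apply Rmult_le_compat_l; lra.
Qed.

(** Two integrations by parts express the transform of [g0] through that of [g = g0 - alpha
    g2] and the boundary values, all divided by [1 + alpha l^2]. This makes all terms
    absolutely integrable except one, in [1 / (l + i a)], whose integral is zero by
    [line_lower_pole]. *)
Lemma fourier_inversion (g0 g1 g2 : R -> C) (M x : R) : 0 < x ->
  cont g0 -> cont g1 -> cont g2 -> dec g0 M -> dec g1 M -> dec g2 M ->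
  (forall y, 0 < y -> der g0 y (g1 y)) -> (forall y, 0 < y -> der g1 y (g2 y)) ->
  is_RInt_gen (V := C_R_NormedModule) (fun l : R => half_fourier g0 (RtoC l) * Cexp (Ci * l * x))%C
    (Rbar_locally m_infty) (Rbar_locally p_infty) (2 * PI * g0 x)%C.
Proof.
  intros Hx C0 C1 C2 D0 D1 D2 H01 H12.
  pose proof a_pos as Ha. pose proof a_sqr as Ea.
  pose proof (sqrt_lt_R0 alpha Halpha) as Hs.
  assert (Hal : RtoC alpha <> RtoC 0) by (apply RtoC_neq_0; lra).
  pose (g := fun y => (g0 y - alpha * g2 y)%C).
  assert (Cg : cont g) by (unfold g; ct).
  assert (Dg : dec g (M + alpha * M)).
  { unfold g. apply dec_plus; [exact D0 |]. apply dec_opp.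
    apply (dec_mono _ (Cmod (RtoC alpha) * M)); [right; rewrite Cmod_R, Rabs_pos_eq; lra |].
    apply (dec_mult g2 (fun _ => RtoC alpha)); [exact D2 | intros; lra]. }
  assert (Eg : forall l : R, half_fourier g (RtoC l)
    = ((1 + alpha * l ^ 2) * half_fourier g0 l + Ci * alpha * l * g0 0 + alpha * g1 0)%C).
  { intros l. unfold g, Cminus.
    rewrite (half_fourier_ext _ (fun x => g0 x + (- RtoC alpha) * g2 x)%C) by (intros; ring).
    rewrite (half_fourier_plus g0 (fun x => - RtoC alpha * g2 x)%C _ M (Cmod (- RtoC alpha) * M)); trivial.
    - rewrite (half_fourier_Cmult _ g2 _ M); trivial; [| simpl; lra].
      rewrite (half_fourier_derivative g1 g2 M), (half_fourier_derivative g0 g1 M) by assumption.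
      transitivity ((1 - (Ci * Ci) * alpha * l ^ 2) * half_fourier g0 l + Ci * alpha * l * g0 0 + alpha * g1 0)%C; [ring |].
      rewrite Ci_sqr. ring.
    - ct.
    - apply (dec_mult g2 (fun _ => - RtoC alpha)%C); [exact D2 | intros; lra].
    - simpl; lra. }
  pose (A := fun l : R => (half_fourier g (RtoC l) * Cexp (Ci * l * x) * heat_symbol 0 l)%C).
  pose (VA := half_line_int (fun y => g y * heat_int 0 (Rabs (x - y)))%C).
  assert (LA : is_RInt_gen (V := C_R_NormedModule) A (Rbar_locally m_infty) (Rbar_locally p_infty) VA).
  { unfold VA. rewrite <- (line_convolution g 0 x (M + alpha * M)); trivial; [| lra].
    apply (is_line_dec A ((M + alpha * M) * (exp 0 * cdec))).
    - intros l. unfold A. apply contp_mult; [apply contp_mult; [| ct] |].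
      + apply (cont_half_fourier (fun _ : R => g) (fun l => RtoC l) l (M + alpha * M)); [ct | ct | intros; simpl; lra | now apply filter_forall].
      + apply (cont2_r _ 0 cont_heat_symbol_line).
    - intros l. unfold A. rewrite !Cmod_mult, Cmod_Cexp_line, Rmult_1_r.
      unfold Rdiv. rewrite Rmult_assoc. apply Rmult_le_compat; try apply Cmod_ge_0.
      + apply half_fourier_bound; [exact Cg | exact Dg | simpl; lra].
      + apply (heat_symbol_dec 0 0 l). lra. }
  assert (EVA : VA = (PI * a * (2 * alpha * a * g0 x + Cexp (RtoC (- a * x)) * (alpha * g1 0 - alpha * a * g0 0)))%C).
  { unfold VA. rewrite <- (green_convolution g0 g1 g2 M x Hx C0 C1 C2 D0 D1 H01 H12).
    rewrite <- (half_line_Cmult _ _ (M + alpha * M)).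
    - apply half_line_ext. intros y _. unfold heat_int.
      rewrite (KI_ext _ (fun l => Cexp (Ci * l * RtoC (Rabs (x - y))) * res l)%C).
      + rewrite KI_res_Cexp, Cexp_RtoC, !RtoC_mult.
        unfold g. ring.
      + intros l _. replace (RtoC 0 * res l)%C with (RtoC 0) by ring. rewrite Cexp_0. ring.
    - intros y. apply contp_mult; [apply Cg |]. apply contp_Cexp, contp_RtoC, contR_mult; [ct |].
      apply (contR_comp (fun y => x - y) Rabs); [ct | apply Rcontinuity_abs].
    - intros y Hy. rewrite Cmod_mult, <- (Rmult_1_r (_ / _)).
      apply Rmult_le_compat; try apply Cmod_ge_0; [now apply Dg |].
      rewrite Cmod_Cexp, <- exp_0. apply exp_monotone. simpl. pose proof (Rabs_pos (x - y)). nra. }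
  pose (b := (alpha * a * g0 0 - alpha * g1 0)%C).
  pose proof (is_line_Cmult b _ _ (line_res_Cexp x ltac:(lra))) as LB.
  pose proof (is_line_Cmult (- Ci * g0 0)%C _ _ (line_lower_pole x Hx)) as LC.
  pose proof (is_RInt_gen_plus (V := C_R_NormedModule) _ _ _ _ (is_RInt_gen_plus (V := C_R_NormedModule) _ _ _ _ LA LB) LC) as L.
  match type of L with is_RInt_gen _ _ _ ?X => replace (2 * PI * g0 x)%C with X end.
  - revert L. apply is_RInt_gen_ext. apply filter_forall. intros pq l _.
    change ((A l + b * (Cexp (Ci * l * x) * res l) + - Ci * g0 0 * (Cexp (Ci * l * x) * / (l + Ci * a)))%C
      = (half_fourier g0 (RtoC l) * Cexp (Ci * l * x))%C).
    unfold A, heat_symbol. replace (RtoC 0 * res l)%C with (RtoC 0) by ring. rewrite Cexp_0, Eg.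
    pose proof (line_res_neq_0 l) as Hn.
    pose proof (lower_pole_neq l) as Hp.
    assert (Hp2 : (l - Ci * a)%C <> RtoC 0).
    { intros E. apply (f_equal snd) in E. simpl in E. lra. }
    (* [l res l] is not absolutely integrable: its slowly decaying part is the pole below the line *)
    assert (El : (l * res l = / alpha * / (l + Ci * a) + Ci * a * res l)%C).
    { unfold res. rewrite factor_root by exact Halpha. field. repeat split; assumption. }
    assert (Er : ((1 + alpha * l ^ 2) * res l = 1)%C) by (unfold res; field; exact Hn).
    transitivity (((1 + alpha * l ^ 2) * res l * half_fourier g0 l + (Ci * alpha * g0 0) * (l * res l) + alpha * a * g0 0 * res l - Ci * g0 0 * / (l + Ci * a)) * Cexp (Ci * l * x))%C.
    + unfold b. ring.
    + rewrite Er, El.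
      transitivity ((half_fourier g0 l + ((Ci * Ci) * alpha * a * g0 0 + alpha * a * g0 0) * res l + Ci * g0 0 * / (l + Ci * a) * (alpha * / alpha - 1)) * Cexp (Ci * l * x))%C; [ring |].
      rewrite Ci_sqr, Cinv_r by exact Hal. ring.
  - change ((VA + b * RtoC (PI * a * exp (- a * x)) + - Ci * g0 0 * RtoC 0)%C = (2 * PI * g0 x)%C).
    rewrite EVA, Cexp_RtoC, !RtoC_mult. unfold b.
    transitivity (2 * PI * (alpha * (a * a)) * g0 x)%C; [ring |]. rewrite Ea. ring.
Qed.

(** * Integrands on the contour with all their partial derivatives *)

Lemma exp_conv_0 (m : C) (g : R -> C) : exp_conv m g 0 = RtoC 0.
Proof. apply CRInt_point. Qed.

Lemma exp_conv_plus (m : C) (f g : R -> C) (x : R) : cont f -> cont g ->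
  exp_conv m (fun y => f y + g y)%C x = (exp_conv m f x + exp_conv m g x)%C.
Proof.
  intros Hf Hg. unfold exp_conv.
  rewrite <- (CRInt_plus (fun y => Cexp (m * RtoC (x - y)) * f y)%C (fun y => Cexp (m * RtoC (x - y)) * g y)%C) by ct.
  apply CRInt_ext. intros y _. ring.
Qed.

Lemma exp_conv_Cmult (m z : C) (f : R -> C) (x : R) : cont f ->
  exp_conv m (fun y => z * f y)%C x = (z * exp_conv m f x)%C.
Proof.
  intros Hf. unfold exp_conv.
  rewrite <- (CRInt_Cmult z (fun y => Cexp (m * RtoC (x - y)) * f y)%C) by ct.
  apply CRInt_ext. intros y _. ring.
Qed.

Lemma der_exp_conv (m : C) (g : R -> C) (x : R) : cont g ->
  der (exp_conv m g) x (m * exp_conv m g x + g x)%C.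
Proof.
  intros Hg.
  assert (Hc : cont (fun y : R => Cexp (- (m * y)) * g y)%C) by ct.
  assert (E : forall x, exp_conv m g x = (Cexp (m * x) * CRInt (fun y : R => Cexp (- (m * y)) * g y) 0 x)%C).
  { intros z. rewrite <- CRInt_Cmult by exact Hc. apply CRInt_ext. intros y _.
    rewrite RtoC_minus. replace (m * (z - y))%C with (m * z + - (m * y))%C by ring. rewrite Cexp_plus. ring. }
  apply (der_ext (fun x : R => Cexp (m * x) * CRInt (fun y : R => Cexp (- (m * y)) * g y) 0 x)%C).
  - intros z. symmetry. apply E.
  - eapply der_eq; [| apply der_mult; [apply der_Cexp, der_Cmult_l, der_id | apply der_CRInt, Hc]].
    cbv beta. rewrite E.
    transitivity (m * (Cexp (m * x) * CRInt (fun y : R => Cexp (- (m * y)) * g y) 0 x) + (Cexp (- (m * x)) * Cexp (m * x)) * g x)%C;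
      [ring | rewrite Cexp_opp_l; ring].
Qed.

Lemma der_exp_conv_param (m : C) (g g' : R -> R -> C) (p x : R) : 0 <= x ->
  cont2 g -> cont2 g' ->
  locally p (fun p => forall y, 0 <= y <= x -> der (fun p => g p y) p (g' p y)) ->
  der (fun p => exp_conv m (g p) x) p (exp_conv m (g' p) x).
Proof.
  intros Hx Hg Hg' Hd.
  apply (der_CRInt_param (fun p y => Cexp (m * RtoC (x - y)) * g p y)%C (fun p y => Cexp (m * RtoC (x - y)) * g' p y)%C 0 x p Hx).
  - ct.
  - ct.
  - revert Hd. apply filter_imp. intros p' Hp' y Hy. now apply der_Cmult_l, Hp'.
Qed.

Lemma locally_pos (x : R) (P : R -> Prop) : 0 < x -> (forall y, 0 < y -> P y) -> locally x P.
Proof.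
  intros Hx HP. apply (filter_imp (fun y => 0 < y)); [exact HP | now apply (open_gt 0)].
Qed.

(** [g n m] stands for the derivative of order [n] in [x] and [m] in [t]. Derivatives are
    required only where they are two-sided; at negative arguments [g] is an arbitrary
    continuous extension. *)
Definition smooth_source (g : nat -> nat -> R -> R -> C) : Prop :=
  (forall n m, source (g n m)) /\
  (forall n m x t, 0 < x -> 0 <= t -> der (fun x => g n m x t) x (g (S n) m x t)) /\
  (forall n m x t, 0 <= x -> 0 < t -> der (g n m x) t (g n (S m) x t)).

(** Partial derivatives of all orders of an integrand on the contour. *)
Definition family (Q : nat -> nat -> C -> R -> R -> C) : Prop :=
  (forall n m, kcontRR (fun p l => Q n m l (fst p) (snd p))) /\
  (forall n m l x t, onK l -> 0 < x -> 0 <= t -> der (fun x => Q n m l x t) x (Q (S n) m l x t)) /\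
  (forall n m l x t, onK l -> 0 <= x -> 0 < t -> der (Q n m l x) t (Q n (S m) l x t)).

Lemma kcont_x (h : R -> R -> C -> C) (t : R) :
  kcontRR (fun p l => h (fst p) (snd p) l) -> kcontR (fun x l => h x t l).
Proof.
  intros H j Hj q.
  apply (contp_app3 (fun x t r => h x t (k j r)) (fun q : RR => fst q) (fun _ => t) (fun q : RR => snd q));
    [apply (H j Hj) | ct | ct | ct].
Qed.

Lemma kcont_t (h : R -> R -> C -> C) (x : R) :
  kcontRR (fun p l => h (fst p) (snd p) l) -> kcontR (h x).
Proof.
  intros H j Hj q.
  apply (contp_app3 (fun x t r => h x t (k j r)) (fun _ => x) (fun q : RR => fst q) (fun q : RR => snd q));
    [apply (H j Hj) | ct | ct | ct].
Qed.

(** Differentiation under the integral sign; the joint continuity holds up to [x = 0] and [t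
    = 0]. *)
Lemma family_KI (Q : nat -> nat -> C -> R -> R -> C) : family Q ->
  (forall n m, cont2 (fun x t => KI (fun l => Q n m l x t))) /\
  (forall n m x t, 0 < x -> 0 <= t -> der (fun x => KI (fun l => Q n m l x t)) x (KI (fun l => Q (S n) m l x t))) /\
  (forall n m x t, 0 <= x -> 0 < t -> der (fun t => KI (fun l => Q n m l x t)) t (KI (fun l => Q n (S m) l x t))).
Proof.
  intros [HC [Hx Ht]]. split; [| split].
  - intros n m. apply (KI_cont (fun (p : RR) l => Q n m l (fst p) (snd p))), HC.
  - intros n m x t Hxp Htp.
    apply (KI_der (fun x l => Q n m l x t) (fun x l => Q (S n) m l x t)).
    + apply (kcont_x (fun x t l => Q n m l x t)), HC.
    + apply (kcont_x (fun x t l => Q (S n) m l x t)), HC.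
    + apply locally_pos; [exact Hxp |]. intros y Hy l Hl. now apply Hx.
  - intros n m x t Hxp Htp.
    apply (KI_der (fun t l => Q n m l x t) (fun t l => Q n (S m) l x t)).
    + apply (kcont_t (fun x t l => Q n m l x t)), HC.
    + apply (kcont_t (fun x t l => Q n (S m) l x t)), HC.
    + apply locally_pos; [exact Htp |]. intros y Hy l Hl. now apply Ht.
Qed.

Lemma family_plus (P Q : nat -> nat -> C -> R -> R -> C) : family P -> family Q ->
  family (fun n m l x t => P n m l x t + Q n m l x t)%C.
Proof.
  intros [P1 [P2 P3]] [Q1 [Q2 Q3]]. split; [| split].
  - intros n m j Hj q. apply contp_plus; [apply (P1 n m j Hj) | apply (Q1 n m j Hj)].
  - intros. apply der_plus; auto.
  - intros n m l x t Hl Hx Ht. apply (der_plus (P n m l x) (Q n m l x)); auto.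
Qed.

Lemma family_Cmult (z : C -> C) (Q : nat -> nat -> C -> R -> R -> C) : kcont1 z -> family Q ->
  family (fun n m l x t => z l * Q n m l x t)%C.
Proof.
  intros Hz [Q1 [Q2 Q3]]. split; [| split].
  - intros n m j Hj q. specialize (Hz j Hj). apply contp_mult; [ct | apply (Q1 n m j Hj)].
  - intros. apply der_Cmult_l; auto.
  - intros n m l x t Hl Hx Ht. apply (der_Cmult_l (z l) (Q n m l x)); auto.
Qed.

Definition exp_family (mu : C -> C) (Phi : nat -> C -> R -> C) (n m : nat) (l : C) (x t : R) : C :=
  (mu l ^ n * Cexp (mu l * x) * Phi m l t)%C.

Lemma family_exp (mu : C -> C) (Phi : nat -> C -> R -> C) : kcont1 mu ->
  (forall m, kcontR (fun t l => Phi m l t)) ->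
  (forall m l t, onK l -> 0 < t -> der (Phi m l) t (Phi (S m) l t)) ->
  family (exp_family mu Phi).
Proof.
  intros Hmu HP Hd. split; [| split].
  - intros n m j Hj q. specialize (Hmu j Hj). specialize (HP m j Hj). unfold exp_family.
    apply contp_mult; [ct |].
    apply (contp_app2 (fun t r => Phi m (k j r) t) (fun q : RRR => snd (fst q)) (fun q : RRR => snd q)); [exact HP | ct | ct].
  - intros n m l x t Hl Hx Ht. unfold exp_family.
    eapply der_eq; [| apply der_Cmult_r, der_Cmult_l, der_Cexp, der_Cmult_l, der_id].
    cbv beta. simpl. ring.
  - intros n m l x t Hl Hx Ht. unfold exp_family.
    apply (der_Cmult_l _ (Phi m l)). now apply Hd.
Qed.

(** The recursion is the rule [(g * e)' = mu (g * e) + g] for the convolution with [exp (mu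
    x)], which involves no boundary values of [g]. *)
Fixpoint space_conv (mu : C -> C) (g : nat -> nat -> R -> R -> C) (n m : nat) (l : C) (x t : R) : C :=
  match n with
  | O => exp_conv (mu l) (fun y => g 0%nat m y t) x
  | S n => (mu l * space_conv mu g n m l x t + g n m x t)%C
  end.

Lemma family_space_conv (mu : C -> C) (g : nat -> nat -> R -> R -> C) : kcont1 mu -> smooth_source g ->
  family (space_conv mu g).
Proof.
  intros Hmu [Hs [Hx Ht]].
  assert (Cg : forall n m, cont2 (g n m)) by (intros n m; apply (Hs n m)).
  split; [| split].
  - intros n m. induction n as [|n IH]; intros j Hj q; simpl.
    + specialize (Hmu j Hj).
      apply (cont_exp_conv (fun q : RRR => mu (k j (snd q))) (fun (q : RRR) y => g 0%nat m y (snd (fst q)))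
               (fun q : RRR => fst (fst q))).
      * ct.
      * intros q'. apply (contp_app2 (g 0%nat m) (fun q : prod_UniformSpace RRR R_UniformSpace => snd q)
           (fun q : prod_UniformSpace RRR R_UniformSpace => snd (fst (fst q)))); [apply Cg | ct | ct].
      * ct.
    + specialize (IH j Hj). specialize (Hmu j Hj). specialize (Cg n m).
      apply contp_plus; [apply contp_mult; [ct | apply IH] |].
      apply (contp_app2 (g n m) (fun q : RRR => fst (fst q)) (fun q : RRR => snd (fst q))); [exact Cg | ct | ct].
  - intros n m l x t Hl Hxp Htp. induction n as [|n IH].
    + simpl. apply (der_exp_conv (mu l) (fun y => g 0%nat m y t) x). apply (cont2_l (g 0%nat m) t), Cg.
    + cbn [space_conv]. apply der_plus; [apply der_Cmult_l, IH | now apply Hx].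
  - intros n m l x t Hl Hxp Htp. induction n as [|n IH].
    + apply (der_exp_conv_param (mu l) (fun t y => g 0%nat m y t) (fun t y => g 0%nat (S m) y t) t x Hxp).
      * apply source_swap, Hs.
      * apply source_swap, Hs.
      * apply locally_pos; [exact Htp |]. intros t' Ht' y Hy. apply (Ht 0%nat m y t'); [lra | exact Ht'].
    + apply (der_plus (fun t => mu l * space_conv mu g n m l x t)%C (g n m x)); [apply der_Cmult_l, IH | now apply Ht].
Qed.

(** The same recursion as in [space_conv], in the variable [t]. *)
Fixpoint time_conv (nu : C -> C) (P : nat -> nat -> C -> R -> R -> C) (n m : nat) (l : C) (x t : R) : C :=
  match m with
  | O => exp_conv (nu l) (P n 0%nat l x) t
  | S m => (nu l * time_conv nu P n m l x t + P n m l x t)%C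
  end.

Lemma cont_family_t (P : nat -> nat -> C -> R -> R -> C) (n m : nat) (l : C) (x : R) : family P -> onK l ->
  cont (P n m l x).
Proof.
  intros [P1 _] [j [r [Hj ->]]] t.
  apply (contp_app3 (fun x t r => P n m (k j r) x t) (fun _ => x) (fun t : R => t) (fun _ => r));
    [apply (P1 n m j Hj) | ct | ct | ct].
Qed.

Lemma cont2_family (P : nat -> nat -> C -> R -> R -> C) (n m : nat) (l : C) : family P -> onK l ->
  cont2 (P n m l).
Proof.
  intros [P1 _] [j [r [Hj ->]]] q.
  apply (contp_app3 (fun x t r => P n m (k j r) x t) (fun q : RR => fst q) (fun q : RR => snd q) (fun _ => r));
    [apply (P1 n m j Hj) | ct | ct | ct].
Qed.

Lemma family_time_conv (nu : C -> C) (P : nat -> nat -> C -> R -> R -> C) : kcont1 nu -> family P ->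
  family (time_conv nu P).
Proof.
  intros Hnu HP. pose proof HP as [P1 [P2 P3]].
  split; [| split].
  - intros n m. induction m as [|m IH]; intros j Hj q; simpl.
    + specialize (Hnu j Hj). specialize (P1 n 0%nat j Hj).
      apply (cont_exp_conv (fun q : RRR => nu (k j (snd q))) (fun (q : RRR) y => P n 0%nat (k j (snd q)) (fst (fst q)) y)
               (fun q : RRR => snd (fst q))).
      * ct.
      * intros q'. apply (contp_app3 (fun x t r => P n 0%nat (k j r) x t)
          (fun q : prod_UniformSpace RRR R_UniformSpace => fst (fst (fst q)))
          (fun q : prod_UniformSpace RRR R_UniformSpace => snd q)
          (fun q : prod_UniformSpace RRR R_UniformSpace => snd (fst q))); [exact P1 | ct | ct | ct].
      * ct.
    + specialize (IH j Hj). specialize (Hnu j Hj). specialize (P1 n m j Hj).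
      apply contp_plus; [apply contp_mult; [ct | apply IH] | apply P1].
  - intros n m l x t Hl Hxp Htp. induction m as [|m IH].
    + apply (der_exp_conv_param (nu l) (P n 0%nat l) (P (S n) 0%nat l) x t Htp).
      * now apply cont2_family.
      * now apply cont2_family.
      * apply locally_pos; [exact Hxp |]. intros x' Hx' y Hy. apply P2; [exact Hl | exact Hx' | lra].
    + cbn [time_conv]. apply der_plus; [apply der_Cmult_l, IH | now apply P2].
  - intros n m l x t Hl Hxp Htp. induction m as [|m IH].
    + apply (der_exp_conv (nu l) (P n 0%nat l x) t). now apply cont_family_t.
    + apply (der_plus (fun t => nu l * time_conv nu P n m l x t)%C (P n m l x)); [apply der_Cmult_l, IH | now apply P3].
Qed.

(** * The solution with vanishing initial values *)

Section Sources.

Variables (g : nat -> nat -> R -> R -> C) (z : nat -> R -> C).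
Hypothesis Hg : smooth_source g.
Hypothesis Hzc : forall m, cont (z m).
Hypothesis Hz : forall m t, 0 < t -> der (z m) t (z (S m) t).

Definition nu (l : C) : C := (- omega l)%C.

Definition source_fourier (m : nat) (l : C) (t : R) : C := half_fourier (fun y => g 0%nat m y t) (- l).

Definition coef_zeta (l : C) : C := (- (Ci / PI) * (l * res l * robin l))%C.
Definition coef_reflected (l : C) : C := (- / (2 * PI) * (res l * ((gamma0 - Ci * gamma1 * l) * robin l)))%C.
Definition coef_source (l : C) : C := (/ (2 * PI) * res l)%C.

(** The inhomogeneity of the ordinary differential equation in time solved by the integrand:
    the boundary term, the reflected source, and the three parts of [source_symbol]. *)
Definition forcing (n m : nat) (l : C) (x t : R) : C :=
  (coef_zeta l * exp_family (fun l => Ci * l)%C (fun m _ t => z m t) n m l x t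
   + coef_reflected l * exp_family (fun l => Ci * l)%C source_fourier n m l x t
   + coef_source l * exp_family (fun l => - (Ci * l))%C source_fourier n m l x t
   + (coef_source l * space_conv (fun l => Ci * l)%C g n m l x t
   + - coef_source l * space_conv (fun l => - (Ci * l))%C g n m l x t))%C.

Lemma kcont1_omega : kcont1 omega.
Proof.
  intros j Hj r. pose proof (kcont1_res j Hj) as Hr.
  apply (contp_ext (fun r => RtoC c - RtoC c * res (k j r))%C); [| ct].
  intros r'. symmetry. apply omega_res.
  apply onK_res. now exists j, r'.
Qed.

Lemma kcont1_nu : kcont1 nu.
Proof. intros j Hj r. pose proof (kcont1_omega j Hj). unfold nu. ct. Qed.

Ltac kct_source :=
  let j := fresh "j" in let Hj := fresh "Hj" in
  intros j Hj; intros;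
  let H1 := fresh in pose proof (cont_k j Hj) as H1;
  let H2 := fresh in pose proof (kcont1_res j Hj) as H2;
  let H3 := fresh in pose proof (kcont1_robin j Hj) as H3;
  let H4 := fresh in pose proof (kcont1_nu j Hj) as H4;
  ct.

Lemma kcont1_coef_zeta : kcont1 coef_zeta.
Proof. unfold coef_zeta. kct_source. Qed.
Lemma kcont1_coef_reflected : kcont1 coef_reflected.
Proof. unfold coef_reflected. kct_source. Qed.
Lemma kcont1_coef_source : kcont1 coef_source.
Proof. unfold coef_source. kct_source. Qed.

Lemma kcont_source_fourier (m : nat) : kcontR (fun t l => source_fourier m l t).
Proof.
  intros j Hj. pose proof (cont_k j Hj) as Hk. destruct Hg as [Hs _].
  apply (cont_source_fourier (g 0%nat m) (fun q : RR => - k j (snd q))%C (fun q : RR => fst q) (Hs 0%nat m)).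
  - ct.
  - intros p. apply onK_Im_opp. now exists j, (snd p).
  - ct.
Qed.

Lemma der_source_fourier (m : nat) (l : C) (t : R) : onK l -> 0 < t ->
  der (source_fourier m l) t (source_fourier (S m) l t).
Proof.
  intros Hl Ht. destruct Hg as [Hs [_ Hd]].
  pose proof (onK_Im_opp l Hl) as Him.
  destruct (source_local (g 0%nat m) t (Hs 0%nat m)) as [M1 HM1].
  destruct (source_local (g 0%nat (S m)) t (Hs 0%nat (S m))) as [M2 HM2].
  apply (half_line_der (fun t y => Cexp (- (Ci * - l * y)) * g 0%nat m y t)%C
           (fun t y => Cexp (- (Ci * - l * y)) * g 0%nat (S m) y t)%C t (Rmax M1 M2)).
  - pose proof (source_swap _ (Hs 0%nat m)). ct.
  - pose proof (source_swap _ (Hs 0%nat (S m))). ct.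
  - apply locally_pos; [exact Ht |]. intros t' Ht' y Hy. apply (der_Cmult_l _ (g 0%nat m y)). now apply Hd.
  - generalize (filter_and _ _ HM1 HM2). apply filter_imp. intros t' [H1 H2]. split.
    + apply (dec_fourier_integrand (fun y => g 0%nat m y t')); [| exact Him].
      eapply dec_mono; [apply Rmax_l | exact H1].
    + apply (dec_fourier_integrand (fun y => g 0%nat (S m) y t')); [| exact Him].
      eapply dec_mono; [apply Rmax_r | exact H2].
Qed.

Lemma family_forcing : family forcing.
Proof.
  unfold forcing.
  assert (Hp : kcont1 (fun l => Ci * l)%C) by kct_source.
  assert (Hm : kcont1 (fun l => - (Ci * l))%C) by kct_source.
  apply (family_plus (fun n m l x t => coef_zeta l * exp_family (fun l => Ci * l)%C (fun m _ t => z m t) n m l x t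
   + coef_reflected l * exp_family (fun l => Ci * l)%C source_fourier n m l x t
   + coef_source l * exp_family (fun l => - (Ci * l))%C source_fourier n m l x t)%C
   (fun n m l x t => coef_source l * space_conv (fun l => Ci * l)%C g n m l x t
   + - coef_source l * space_conv (fun l => - (Ci * l))%C g n m l x t)%C).
  - apply (family_plus (fun n m l x t => coef_zeta l * exp_family (fun l => Ci * l)%C (fun m _ t => z m t) n m l x t
      + coef_reflected l * exp_family (fun l => Ci * l)%C source_fourier n m l x t)%C).
    + apply family_plus.
      * apply family_Cmult; [apply kcont1_coef_zeta |]. apply family_exp; [exact Hp | |].
        -- intros m j Hj q. specialize (Hzc m). ct.
        -- intros m l t _ Ht. now apply Hz.
      * apply family_Cmult; [apply kcont1_coef_reflected |]. apply family_exp; [exact Hp | exact kcont_source_fourier | exact der_source_fourier].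
    + apply family_Cmult; [apply kcont1_coef_source |]. apply family_exp; [exact Hm | exact kcont_source_fourier | exact der_source_fourier].
  - apply family_plus.
    + apply family_Cmult; [apply kcont1_coef_source |]. now apply family_space_conv.
    + apply (family_Cmult (fun l => - coef_source l)%C); [| now apply family_space_conv].
      intros j Hj r. apply contp_opp, (kcont1_coef_source j Hj).
Qed.

(** The integrand of the solution: zero at [t = 0], with derivative [nu evolution + forcing]
    in time. *)
Definition evolution : nat -> nat -> C -> R -> R -> C := time_conv nu forcing.

Lemma family_evolution : family evolution.
Proof. apply family_time_conv; [apply kcont1_nu | apply family_forcing]. Qed.

(** Every exponential in [x] solves [y'' = - l^2 y], except that the convolutions see the
    source. *)
Lemma forcing_second_derivative (m : nat) (l : C) (x t : R) :
  forcing 2 m l x t = (- l ^ 2 * forcing 0 m l x t + 2 * Ci * l * coef_source l * g 0%nat m x t)%C.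
Proof.
  unfold forcing, exp_family. cbn [space_conv].
  set (A := exp_conv (Ci * l) _ x). set (B := exp_conv (- (Ci * l)) _ x).
  transitivity ((Ci * Ci) * l ^ 2 * (coef_zeta l * ((Ci * l) ^ 0 * Cexp (Ci * l * x) * z m t) +
    coef_reflected l * ((Ci * l) ^ 0 * Cexp (Ci * l * x) * source_fourier m l t) +
    coef_source l * ((- (Ci * l)) ^ 0 * Cexp (- (Ci * l) * x) * source_fourier m l t) +
    (coef_source l * A + - coef_source l * B)) + 2 * Ci * l * coef_source l * g 0%nat m x t)%C.
  - simpl. ring.
  - rewrite Ci_sqr. ring.
Qed.

(** The dispersion relation. *)
Lemma nu_mult (l : C) : onK l -> (nu l * (1 + alpha * l ^ 2) = - beta * l ^ 2)%C.
Proof.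
  intros Hl. pose proof (onK_res l Hl) as Hn.
  unfold nu, Defs.omega. field. exact Hn.
Qed.

Lemma nu_shift (l : C) : onK l -> (alpha * nu l + beta = beta * res l)%C.
Proof.
  intros Hl. pose proof (onK_res l Hl) as Hn.
  unfold nu, Defs.omega, res. field. exact Hn.
Qed.

(** For each [tau] the integrand is [l res l ^ 2 exp (mu res l)] up to a constant, hence
    exact. *)
Lemma KI_id_res_time_conv (h : R -> C) (t : R) : 0 <= t -> cont h ->
  KI (fun l => l * res l ^ 2 * exp_conv (nu l) h t)%C = RtoC 0.
Proof.
  intros Ht Hh.
  assert (Hc : kcontR (fun tau l => h tau * (l * res l ^ 2 * Cexp (nu l * RtoC (t - tau))))%C) by kct_source.
  transitivity (KI (fun l => CRInt (fun tau => h tau * (l * res l ^ 2 * Cexp (nu l * RtoC (t - tau))))%C 0 t)).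
  - apply KI_ext. intros l Hl. unfold exp_conv. rewrite <- CRInt_Cmult by ct.
    apply CRInt_ext. intros tau _. ring.
  - rewrite <- (KI_CRInt_swap _ 0 t Ht Hc).
    rewrite (CRInt_ext _ (fun _ => RtoC 0)); [rewrite CRInt_const; ring |].
    intros tau _. rewrite (KI_Cmult (h tau)); [| kct_source].
    rewrite (KI_ext _ (fun l => RtoC (exp (- (c * (t - tau)))) * (l * res l ^ 2 * Cexp (RtoC (c * (t - tau)) * res l)))%C).
    + rewrite KI_Cmult; [| kct_source].
      rewrite KI_id_res_Cexp. ring.
    + intros l Hl. pose proof (onK_res l Hl) as Hn.
      pose proof (Cexp_omega l (t - tau) Hn) as E.
      unfold nu, heat_symbol in *.
      transitivity (l * res l * (Cexp (- omega l * RtoC (t - tau)) * res l))%C; [ring |].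
      rewrite E. ring.
Qed.

(** Fubini: the transform is an average of exponentials. *)
Lemma KI_Cexp_source_fourier (q : C -> C) (t : R) : kcont1 q ->
  (forall y, 0 <= y -> KI (fun l => Cexp (Ci * l * y) * q l)%C = RtoC 0) ->
  KI (fun l => q l * source_fourier 0 l t)%C = RtoC 0.
Proof.
  intros Hq H0. destruct Hg as [Hs _].
  destruct (proj2 (Hs 0%nat 0%nat) t) as [M1 HM1]. specialize (HM1 t (Rle_refl t)).
  pose (h := fun y => g 0%nat 0%nat y t).
  assert (Ch : cont h) by (apply source_cont_time, Hs).
  destruct (onK_bounded q Hq) as [B [HB0 HB]].
  assert (Hc : kcontR (fun y l => h y * (Cexp (Ci * l * y) * q l))%C).
  { intros j Hj p. pose proof (cont_k j Hj). specialize (Hq j Hj). ct. }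
  transitivity (KI (fun l => half_line_int (fun y : R => h y * (Cexp (Ci * l * y) * q l))%C)).
  - apply KI_ext. intros l Hl. unfold source_fourier, half_fourier.
    rewrite <- (half_line_Cmult (q l) _ M1).
    + apply half_line_ext. intros y _. replace (- (Ci * - l * y))%C with (Ci * l * y)%C by ring. unfold h. ring.
    + now apply cont_fourier_integrand.
    + apply dec_fourier_integrand; [exact HM1 |]. now apply onK_Im_opp.
  - rewrite <- (KI_half_line_swap _ (1 * B * M1) Hc).
    + transitivity (half_line_int (fun _ => RtoC 0)); [| apply half_line_zero].
      apply half_line_ext. intros y Hy.
      rewrite (KI_Cmult (h y)), (H0 y Hy); [ring |].
      intros j Hj p. pose proof (cont_k j Hj). specialize (Hq j Hj). ct.
    + intros l Hl y Hy. rewrite Cmult_comm. revert y Hy.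
      apply (dec_mult h (fun y : R => Cexp (Ci * l * y) * q l)%C); [exact HM1 |].
      intros y Hy. rewrite Cmod_mult. apply Rmult_le_compat; try apply Cmod_ge_0; [| now apply HB].
      now apply Cmod_Cexp_onK.
Qed.

Lemma KI_space_conv (sg : R) (x t : R) : 0 <= x ->
  KI (fun l => exp_conv (sg * (Ci * l)) (fun y => g 0%nat 0%nat y t) x) = RtoC 0.
Proof.
  intros Hx. destruct Hg as [Hs _].
  pose (h := fun y => g 0%nat 0%nat y t).
  assert (Ch : cont h) by (apply source_cont_time, Hs).
  assert (Hc : kcontR (fun y l => Cexp (sg * (Ci * l) * RtoC (x - y)) * h y)%C).
  { intros j Hj p. pose proof (cont_k j Hj). ct. }
  transitivity (CRInt (fun y => KI (fun l => Cexp (sg * (Ci * l) * RtoC (x - y)) * h y)%C) 0 x).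
  { symmetry. exact (KI_CRInt_swap _ 0 x Hx Hc). }
  rewrite (CRInt_ext _ (fun _ => RtoC 0)); [rewrite CRInt_const; ring |].
  intros y _.
  rewrite (KI_ext _ (fun l => h y * Cexp (Ci * l * RtoC (sg * (x - y))))%C).
  - rewrite KI_Cmult, (KI_Cexp K_closed); [ring |].
    apply kcont1_Cexp.
  - intros l _. rewrite RtoC_mult. replace (Ci * l * (sg * RtoC (x - y)))%C with (sg * (Ci * l) * RtoC (x - y))%C by ring. ring.
Qed.

Lemma kcont1_family (Q : nat -> nat -> C -> R -> R -> C) (n m : nat) (x t : R) :
  family Q -> kcont1 (fun l => Q n m l x t).
Proof. intros [H _]. exact (kcont1_T (fun (p : RR) l => Q n m l (fst p) (snd p)) (x, t) (H n m)). Qed.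

Lemma PI_neq_0_C : RtoC PI <> RtoC 0.
Proof. apply RtoC_neq_0. pose proof PI_RGT_0. lra. Qed.

Lemma two_PI_neq_0_C : (2 * PI)%C <> RtoC 0.
Proof. apply Cmult_neq_0; [apply RtoC_neq_0; lra | apply PI_neq_0_C]. Qed.

Lemma KI_zero_Cmult (y : C) (h : C -> C) : kcont1 h -> KI h = RtoC 0 -> KI (fun l => y * h l)%C = RtoC 0.
Proof. intros Hh E. rewrite (KI_Cmult y h Hh), E. ring. Qed.

Lemma KI_zero_plus (h1 h2 : C -> C) : kcont1 h1 -> kcont1 h2 -> KI h1 = RtoC 0 -> KI h2 = RtoC 0 ->
  KI (fun l => h1 l + h2 l)%C = RtoC 0.
Proof. intros H1 H2 E1 E2. rewrite (KI_plus h1 h2 H1 H2), E1, E2. ring. Qed.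

Lemma KI_zero_lincomb (y1 y2 y3 y4 y5 : C) (h1 h2 h3 h4 h5 : C -> C) :
  kcont1 h1 -> kcont1 h2 -> kcont1 h3 -> kcont1 h4 -> kcont1 h5 ->
  KI h1 = RtoC 0 -> KI h2 = RtoC 0 -> KI h3 = RtoC 0 -> KI h4 = RtoC 0 -> KI h5 = RtoC 0 ->
  KI (fun l => y1 * h1 l + (y2 * h2 l + (y3 * h3 l + (y4 * h4 l + y5 * h5 l))))%C = RtoC 0.
Proof.
  intros H1 H2 H3 H4 H5 E1 E2 E3 E4 E5.
  pose (vanishing := fun h => kcont1 h /\ KI h = RtoC 0).
  assert (Vm : forall y h, vanishing h -> vanishing (fun l => y * h l)%C).
  { intros y h [H E]. split; [| exact (KI_zero_Cmult y h H E)].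
    intros j Hj p. specialize (H j Hj). ct. }
  assert (Vp : forall h h', vanishing h -> vanishing h' -> vanishing (fun l => h l + h' l)%C).
  { intros h h' [H E] [H' E']. split; [| exact (KI_zero_plus h h' H H' E E')].
    intros j Hj p. specialize (H j Hj). specialize (H' j Hj). ct. }
  exact (proj2 (Vp _ _ (Vm y1 h1 (conj H1 E1)) (Vp _ _ (Vm y2 h2 (conj H2 E2))
    (Vp _ _ (Vm y3 h3 (conj H3 E3)) (Vp _ _ (Vm y4 h4 (conj H4 E4)) (Vm y5 h5 (conj H5 E5))))))).
Qed.

Lemma kcont1_source_fourier (t : R) : kcont1 (fun l => source_fourier 0 l t).
Proof. exact (kcont1_T (fun (t : R) l => source_fourier 0 l t) t (kcont_source_fourier 0)). Qed.

Lemma kcont1_exp_conv (mu : C -> C) (h : R -> C) (x : R) : kcont1 mu -> cont h ->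
  kcont1 (fun l => exp_conv (mu l) h x).
Proof.
  intros Hmu Hh j Hj. specialize (Hmu j Hj).
  apply (cont_exp_conv (fun r => mu (k j r)) (fun (_ : R) y => h y) (fun _ => x)); ct.
Qed.

Lemma KI_Cexp_robin_shift (x y : R) :
  KI (fun l => Cexp (Ci * l * y) * (Cexp (Ci * l * x) * ((gamma0 - Ci * gamma1 * l) * robin l)))%C = RtoC 0.
Proof.
  pose proof K_closed as Hcl.
  rewrite (KI_ext _ (fun l => gamma0 * (Cexp (Ci * l * RtoC (x + y)) * robin l)
     + - (Ci * gamma1) * (Cexp (Ci * l * RtoC (x + y)) * l * robin l))%C).
  - apply KI_zero_plus; [kct_source | kct_source | |]; (apply KI_zero_Cmult; [kct_source |]).
    + apply KI_Cexp_robin.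
    + apply KI_Cexp_id_robin.
  - intros l _. rewrite RtoC_plus. replace (Ci * l * (x + y))%C with (Ci * l * y + Ci * l * x)%C by ring.
    rewrite Cexp_plus. ring.
Qed.

(** The factor [1 + alpha l^2] removes the only singularity of the forcing inside the
    contour; after Fubini every term is the integral of a function holomorphic inside. *)
Lemma KI_forcing_regular (x t : R) : 0 <= x ->
  KI (fun l => (1 + alpha * l ^ 2) * forcing 0 0 l x t)%C = RtoC 0.
Proof.
  intros Hx. pose proof two_PI_neq_0_C as H2pi. pose proof PI_neq_0_C as Hpi.
  assert (Cg : cont (fun y => g 0%nat 0%nat y t)) by (apply source_cont_time, Hg).
  pose proof (kcont1_source_fourier t) as Csf.
  assert (Csp : forall sg : R, kcont1 (fun l => exp_conv (sg * (Ci * l)) (fun y => g 0%nat 0%nat y t) x)).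
  { intros sg. apply (kcont1_exp_conv (fun l => sg * (Ci * l))%C); [kct_source | exact Cg]. }
  rewrite (KI_ext _ (fun l =>
     - (Ci / PI) * z 0%nat t * (Cexp (Ci * l * x) * l * robin l)
     + (- / (2 * PI) * (Cexp (Ci * l * x) * ((gamma0 - Ci * gamma1 * l) * robin l) * source_fourier 0 l t)
     + (/ (2 * PI) * (Cexp (Ci * l * - x) * source_fourier 0 l t)
     + (/ (2 * PI) * exp_conv (1 * (Ci * l)) (fun y => g 0%nat 0%nat y t) x
     + - / (2 * PI) * exp_conv (RtoC (-1) * (Ci * l)) (fun y => g 0%nat 0%nat y t) x))))%C).
  - assert (K1 : kcont1 (fun l => Cexp (Ci * l * x) * l * robin l)%C) by kct_source.
    assert (K2 : kcont1 (fun l => Cexp (Ci * l * x) * ((gamma0 - Ci * gamma1 * l) * robin l) * source_fourier 0 l t)%C).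
    { intros j Hj p. apply contp_mult; [| apply (Csf j Hj)]. revert p. revert j Hj. kct_source. }
    assert (K3 : kcont1 (fun l => Cexp (Ci * l * - x) * source_fourier 0 l t)%C).
    { intros j Hj p. apply contp_mult; [| apply (Csf j Hj)]. revert p. revert j Hj. kct_source. }
    pose proof (Csp 1) as K4. pose proof (Csp (-1)) as K5.
    apply (KI_zero_lincomb _ _ _ _ _ _ _ _ _ _ K1 K2 K3 K4 K5).
    + apply KI_Cexp_id_robin.
    + apply (KI_Cexp_source_fourier (fun l => Cexp (Ci * l * x) * ((gamma0 - Ci * gamma1 * l) * robin l))%C).
      * kct_source.
      * intros y _. apply KI_Cexp_robin_shift.
    + apply (KI_Cexp_source_fourier (fun l => Cexp (Ci * l * - x))%C).
      * kct_source.
      * intros y _. rewrite (KI_ext _ (fun l => Cexp (Ci * l * RtoC (y - x)))).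
        -- apply (KI_Cexp K_closed).
        -- intros l _. rewrite <- Cexp_plus, RtoC_minus. f_equal. ring.
    + now apply KI_space_conv.
    + now apply KI_space_conv.
  - intros l Hl. pose proof (onK_res l Hl) as Hn.
    assert (Er : ((1 + alpha * l ^ 2) * res l = 1)%C) by (unfold res; field; exact Hn).
    unfold forcing, exp_family, coef_zeta, coef_reflected, coef_source. cbn [space_conv Cpow].
    replace (1 * (Ci * l))%C with (Ci * l)%C by ring.
    replace (RtoC (-1) * (Ci * l))%C with (- (Ci * l))%C by (change (RtoC (-1)) with (RtoC (- (1))); rewrite RtoC_opp; ring).
    replace (- (Ci * l) * x)%C with (Ci * l * - x)%C by ring.
    set (A := exp_conv (Ci * l) _ x). set (B := exp_conv (- (Ci * l)) _ x).
    set (E1 := Cexp (Ci * l * x)). set (E2 := Cexp (Ci * l * - x)).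
    set (S0 := source_fourier 0 l t).
    transitivity (((1 + alpha * l ^ 2) * res l) * (- (Ci / PI) * z 0%nat t * (E1 * l * robin l) +
      (- / (2 * PI) * (E1 * ((gamma0 - Ci * gamma1 * l) * robin l) * S0) +
      (/ (2 * PI) * (E2 * S0) + (/ (2 * PI) * A + - / (2 * PI) * B)))))%C; [ring |].
    rewrite Er. ring.
Qed.

Definition sol (n m : nat) (x t : R) : C := KI (fun l => evolution n m l x t).

Lemma evolution_second_derivative (l : C) (x t : R) : onK l ->
  evolution 2 0 l x t = (- l ^ 2 * evolution 0 0 l x t
    + 2 * Ci * l * coef_source l * exp_conv (nu l) (g 0%nat 0%nat x) t)%C.
Proof.
  intros Hl. unfold evolution. cbn [time_conv].
  assert (C0 : cont (forcing 0 0 l x)) by (apply cont_family_t; [apply family_forcing | exact Hl]).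
  assert (Cg : cont (g 0%nat 0%nat x)) by (apply cont2_r, Hg).
  rewrite <- (exp_conv_Cmult (nu l) (- l ^ 2)%C _ t C0), <- (exp_conv_Cmult (nu l) (2 * Ci * l * coef_source l)%C _ t Cg).
  rewrite <- exp_conv_plus by ct.
  unfold exp_conv. apply CRInt_ext. intros tau _. rewrite forcing_second_derivative. reflexivity.
Qed.

(** Under the integral the equation becomes [(1 + alpha l^2) forcing], which integrates to
    zero, plus two terms produced by the source. One contains the residue of [l res l],
    which gives back the source, and the other is exact. *)
Lemma sol_equation (x t : R) : 0 <= x -> 0 <= t ->
  (sol 0 1 x t - alpha * sol 2 1 x t - beta * sol 2 0 x t)%C = g 0%nat 0%nat x t.
Proof.
  intros Hx Ht.
  pose proof PI_neq_0_C as Hpi.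
  assert (Hal : RtoC alpha <> RtoC 0) by (apply RtoC_neq_0; lra).
  pose proof (fun n m => kcont1_family evolution n m x t family_evolution) as Ce.
  pose proof (kcont1_family forcing 0 0 x t family_forcing) as Cf.
  assert (Cg : cont (g 0%nat 0%nat x)) by (apply cont2_r, Hg).
  assert (Cb : kcont1 (fun l => l * res l ^ 2 * exp_conv (nu l) (g 0%nat 0%nat x) t)%C).
  { intros j Hj p. apply contp_mult; [| apply (kcont1_exp_conv nu _ t kcont1_nu Cg j Hj)].
    revert p. revert j Hj. kct_source. }
  assert (Cr : kcont1 (fun l => (1 + alpha * l ^ 2) * forcing 0 0 l x t)%C).
  { intros j Hj p. apply contp_mult; [| apply (Cf j Hj)]. revert p. revert j Hj. kct_source. }
  unfold sol.
  rewrite <- (KI_Cmult alpha _ (Ce 2%nat 1%nat)), <- (KI_Cmult beta _ (Ce 2%nat 0%nat)).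
  assert (Ca : forall y n m, kcont1 (fun l => y * evolution n m l x t)%C).
  { intros y n m j Hj p. apply contp_mult; [ct | apply (Ce n m j Hj)]. }
  rewrite <- (KI_minus _ _ (Ce 0%nat 1%nat) (Ca (RtoC alpha) 2%nat 1%nat)).
  rewrite <- (KI_minus (fun l => evolution 0 1 l x t - alpha * evolution 2 1 l x t)%C _); [| | apply Ca].
  2: { intros j Hj p. apply contp_minus; [apply (Ce _ _ j Hj) | apply (Ca _ _ _ j Hj)]. }
  rewrite (KI_ext _ (fun l => (1 + alpha * l ^ 2) * forcing 0 0 l x t
     + (- (Ci * alpha / PI) * g 0%nat 0%nat x t * (l * res l)
     + - (Ci * beta / PI) * (l * res l ^ 2 * exp_conv (nu l) (g 0%nat 0%nat x) t)))%C).
  - assert (Cid : kcont1 (fun l => l * res l)%C) by kct_source.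
    rewrite (KI_plus _ _ Cr), KI_plus, (KI_Cmult _ _ Cid), (KI_Cmult _ _ Cb).
    + rewrite KI_forcing_regular, KI_id_res_time_conv by assumption.
      rewrite KI_id_res.
      transitivity (- (Ci * Ci) * g 0%nat 0%nat x t)%C; [field; split; assumption | rewrite Ci_sqr; ring].
    + intros j Hj p. apply contp_mult; [ct | apply (Cid j Hj)].
    + intros j Hj p. apply contp_mult; [ct | apply (Cb j Hj)].
    + intros j Hj p. apply contp_plus; (apply contp_mult; [ct |]); [apply (Cid j Hj) | apply (Cb j Hj)].
  - intros l Hl. pose proof (nu_mult l Hl) as E1. pose proof (nu_shift l Hl) as E2.
    change (evolution 0 1 l x t) with (nu l * evolution 0 0 l x t + forcing 0 0 l x t)%C.
    change (evolution 2 1 l x t) with (nu l * evolution 2 0 l x t + forcing 2 0 l x t)%C.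
    rewrite (evolution_second_derivative l x t Hl), forcing_second_derivative.
    set (X := evolution 0 0 l x t). set (F := forcing 0 0 l x t). set (G := g 0%nat 0%nat x t).
    set (B := exp_conv (nu l) (g 0%nat 0%nat x) t).
    transitivity ((1 + alpha * l ^ 2) * F + (nu l * (1 + alpha * l ^ 2) + beta * l ^ 2) * X
      - alpha * (2 * Ci * l * coef_source l) * G - (alpha * nu l + beta) * (2 * Ci * l * coef_source l) * B)%C; [ring |].
    rewrite E1, E2. unfold coef_source. field. exact Hpi.
Qed.

(** Continuous up to [x = 0], so that the boundary condition amounts to its value there. *)
Definition robin_trace (x t : R) : C :=
  (gamma0 * (alpha * sol 0 1 x t + beta * sol 0 0 x t) + gamma1 * (alpha * sol 1 1 x t + beta * sol 1 0 x t))%C.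

(** At [x = 0] the reflected source cancels the free one, which is the purpose of the
    reflection coefficient. What remains of [alpha u_t + beta u] is [zeta] times the residue
    of [l res l], plus an exact term. *)
Lemma robin_trace_0 (t : R) : 0 <= t -> robin_trace 0 t = z 0%nat t.
Proof.
  intros Ht. pose proof PI_neq_0_C as Hpi. pose proof two_PI_neq_0_C as H2pi.
  assert (Hal : RtoC alpha <> RtoC 0) by (apply RtoC_neq_0; lra).
  pose proof (fun n m => kcont1_family evolution n m 0 t family_evolution) as Ce.
  assert (Ca : forall y n m, kcont1 (fun l => y * evolution n m l 0 t)%C).
  { intros y n m j Hj p. apply contp_mult; [ct | apply (Ce n m j Hj)]. }
  assert (Cap : forall y y' n, kcont1 (fun l => y * evolution n 1 l 0 t + y' * evolution n 0 l 0 t)%C).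
  { intros y y' n j Hj p. apply contp_plus; [apply (Ca _ _ _ j Hj) | apply (Ca _ _ _ j Hj)]. }
  assert (Cm : forall y h, kcont1 h -> kcont1 (fun l => y * h l)%C).
  { intros y h Hh j Hj p. apply contp_mult; [ct | apply (Hh j Hj)]. }
  assert (Cid : kcont1 (fun l => l * res l)%C) by kct_source.
  assert (Cb : kcont1 (fun l => l * res l ^ 2 * exp_conv (nu l) (z 0%nat) t)%C).
  { intros j Hj p. apply contp_mult; [| apply (kcont1_exp_conv nu _ t kcont1_nu (Hzc 0%nat) j Hj)].
    revert p. revert j Hj. kct_source. }
  unfold robin_trace, sol.
  rewrite <- !(fun y n m => KI_Cmult y _ (Ce n m)).
  rewrite <- !(fun y y' n => KI_plus _ _ (Ca y n 1%nat) (Ca y' n 0%nat)).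
  rewrite <- !(fun y'' y y' n => KI_Cmult y'' _ (Cap y y' n)).
  rewrite <- (KI_plus _ _ (Cm gamma0 _ (Cap (RtoC alpha) (RtoC beta) 0%nat)) (Cm gamma1 _ (Cap (RtoC alpha) (RtoC beta) 1%nat))).
  rewrite (KI_ext _ (fun l => - (Ci * alpha / PI) * z 0%nat t * (l * res l)
     + - (Ci * beta / PI) * (l * res l ^ 2 * exp_conv (nu l) (z 0%nat) t))%C).
  - rewrite (KI_plus _ _ (Cm _ _ Cid) (Cm _ _ Cb)), (KI_Cmult _ _ Cid), (KI_Cmult _ _ Cb).
    rewrite KI_id_res, KI_id_res_time_conv by trivial.
    transitivity (- (Ci * Ci) * z 0%nat t)%C; [field; split; assumption | rewrite Ci_sqr; ring].
  - intros l Hl. pose proof (nu_shift l Hl) as E.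
    pose proof (onK_robin l Hl) as Hr.
    (* the reflected and the free source cancel at the boundary *)
    assert (F0 : forall tau, (gamma0 * forcing 0 0 l 0 tau + gamma1 * forcing 1 0 l 0 tau)%C
       = (- (Ci / PI) * (l * res l) * z 0%nat tau)%C).
    { intros tau. unfold forcing, exp_family. cbn [space_conv Cpow].
      rewrite !exp_conv_0. replace (Ci * l * RtoC 0)%C with (RtoC 0) by ring.
      replace (- (Ci * l) * RtoC 0)%C with (RtoC 0) by ring. rewrite Cexp_0.
      unfold coef_zeta, coef_reflected, coef_source, robin. field. repeat split; assumption. }
    assert (C0 : cont (forcing 0 0 l 0)) by (apply cont_family_t; [apply family_forcing | exact Hl]).
    assert (C1 : cont (forcing 1 0 l 0)) by (apply cont_family_t; [apply family_forcing | exact Hl]).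
    assert (E0 : (gamma0 * evolution 0 0 l 0 t + gamma1 * evolution 1 0 l 0 t)%C
       = (- (Ci / PI) * (l * res l) * exp_conv (nu l) (z 0%nat) t)%C).
    { unfold evolution. cbn [time_conv].
      rewrite <- (exp_conv_Cmult (nu l) gamma0 _ t C0), <- (exp_conv_Cmult (nu l) gamma1 _ t C1).
      rewrite <- exp_conv_plus by ct.
      rewrite <- (exp_conv_Cmult (nu l) _ (z 0%nat) t (Hzc 0%nat)).
      unfold exp_conv. apply CRInt_ext. intros tau _. rewrite F0. reflexivity. }
    change (evolution 0 1 l 0 t) with (nu l * evolution 0 0 l 0 t + forcing 0 0 l 0 t)%C.
    change (evolution 1 1 l 0 t) with (nu l * evolution 1 0 l 0 t + forcing 1 0 l 0 t)%C.
    set (X0 := evolution 0 0 l 0 t) in *. set (X1 := evolution 1 0 l 0 t) in *.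
    transitivity (alpha * (gamma0 * forcing 0 0 l 0 t + gamma1 * forcing 1 0 l 0 t)
       + (alpha * nu l + beta) * (gamma0 * X0 + gamma1 * X1))%C; [ring |].
    rewrite F0, E0, E. field. exact Hpi.
Qed.

Lemma exp_conv_omega (l : C) (h : R -> C) (t : R) : cont h ->
  exp_conv (nu l) h t = (Cexp (- (omega l * t)) * CRInt (fun tau => Cexp (omega l * tau) * h tau) 0 t)%C.
Proof.
  intros Hh. unfold exp_conv. rewrite <- CRInt_Cmult by ct. apply CRInt_ext. intros tau _.
  unfold nu. rewrite RtoC_minus.
  replace (- omega l * (t - tau))%C with (- (omega l * t) + omega l * tau)%C by ring. rewrite Cexp_plus. ring.
Qed.

(** Separates the boundary data, the reflected source and the free source; the last one is
    the part that stems from the real line. *)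
Lemma evolution_parts (l : C) (x t : R) : onK l ->
  evolution 0 0 l x t = (coef_zeta l * Cexp (Ci * l * x) * exp_conv (nu l) (z 0%nat) t
   + coef_reflected l * Cexp (Ci * l * x) * exp_conv (nu l) (source_fourier 0 l) t
   + / (2 * PI) * CRInt (fun tau => Cexp (- omega l * RtoC (t - tau)) * (res l * source_symbol (g 0%nat 0%nat) x tau l)) 0 t)%C.
Proof.
  intros Hl. unfold evolution. cbn [time_conv].
  assert (Csf : cont (source_fourier 0 l)).
  { destruct Hl as [j [r [Hj ->]]]. apply (cont2_l (fun t r => source_fourier 0 (k j r) t) r), (kcont_source_fourier 0 j Hj). }
  assert (Css : cont (fun tau => source_symbol (g 0%nat 0%nat) x tau l)).
  { destruct Hl as [j [r [Hj ->]]].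
    apply (cont2_l (fun tau r => source_symbol (g 0%nat 0%nat) x tau (k j r)) r).
    apply (kcont_source_symbol (g 0%nat 0%nat) (fun _ : R => x) (fun tau : R => tau)); [apply Hg | ct | ct | exact Hj]. }
  rewrite <- (exp_conv_Cmult (nu l) (coef_zeta l * Cexp (Ci * l * x))%C _ t (Hzc 0%nat)).
  rewrite <- (exp_conv_Cmult (nu l) (coef_reflected l * Cexp (Ci * l * x))%C _ t Csf).
  rewrite <- exp_conv_plus by (specialize (Hzc 0%nat); ct).
  change (CRInt (fun tau => Cexp (- omega l * RtoC (t - tau)) * (res l * source_symbol (g 0%nat 0%nat) x tau l))%C 0 t)
    with (exp_conv (nu l) (fun tau => res l * source_symbol (g 0%nat 0%nat) x tau l)%C t).
  rewrite <- exp_conv_Cmult by ct. rewrite <- exp_conv_plus by (specialize (Hzc 0%nat); ct).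
  unfold exp_conv at 1 2. apply CRInt_ext. intros tau _. f_equal.
  unfold forcing, exp_family, source_symbol, coef_source. cbn [space_conv Cpow].
  change (half_fourier (fun y => g 0%nat 0%nat y tau) (- l)) with (source_fourier 0 l tau).
  replace (- (Ci * l) * x)%C with (- (Ci * l * x))%C by ring. ring.
Qed.

Lemma kcont1_part_zeta (x t : R) : kcont1 (fun l => coef_zeta l * Cexp (Ci * l * x) * exp_conv (nu l) (z 0%nat) t)%C.
Proof.
  intros j Hj p. apply contp_mult; [apply contp_mult |].
  - apply (kcont1_coef_zeta j Hj).
  - apply (kcont1_Cexp x j Hj).
  - apply (kcont1_exp_conv nu _ t kcont1_nu (Hzc 0%nat) j Hj).
Qed.

Lemma kcont1_part_reflected (x t : R) :
  kcont1 (fun l => coef_reflected l * Cexp (Ci * l * x) * exp_conv (nu l) (source_fourier 0 l) t)%C.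
Proof.
  intros j Hj p. apply contp_mult; [apply contp_mult |].
  - apply (kcont1_coef_reflected j Hj).
  - apply (kcont1_Cexp x j Hj).
  - pose proof (kcont1_nu j Hj) as Hn.
    apply (cont_exp_conv (fun r => nu (k j r)) (fun r => source_fourier 0 (k j r)) (fun _ => t)); [exact Hn | | ct].
    intros q. apply (contp_app2 (fun t r => source_fourier 0 (k j r) t) (fun q : RR => snd q) (fun q : RR => fst q));
      [apply (kcont_source_fourier 0 j Hj) | ct | ct].
Qed.

Lemma sol_parts (x t : R) : 0 <= x -> 0 <= t -> exists V,
  is_RInt_gen (V := C_R_NormedModule) (fun l : R => f_integrand alpha beta (g 0%nat 0%nat) x t (RtoC l))
    (Rbar_locally m_infty) (Rbar_locally p_infty) V /\
  sol 0 0 x t = (KI (fun l => coef_zeta l * Cexp (Ci * l * x) * exp_conv (nu l) (z 0%nat) t)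
   + KI (fun l => coef_reflected l * Cexp (Ci * l * x) * exp_conv (nu l) (source_fourier 0 l) t)
   + / (2 * PI) * V)%C /\
  (forall M, (forall tau, 0 <= tau <= t -> dec (fun y => g 0%nat 0%nat y tau) M) ->
     Cmod V <= 2 * (t * (M * (exp (c * t) * cdec)))).
Proof.
  intros Hx Ht. destruct Hg as [Hs _].
  destruct (f_integrand_line (g 0%nat 0%nat) x t (Hs 0%nat 0%nat) Hx Ht)
    as [V [HV [EV BV]]].
  exists V. split; [exact HV | split; [| exact BV]].
  pose proof (kcont1_part_zeta x t) as C1. pose proof (kcont1_part_reflected x t) as C2.
  assert (C3 : kcont1 (fun l => CRInt (fun tau => Cexp (- omega l * RtoC (t - tau)) * (res l * source_symbol (g 0%nat 0%nat) x tau l)) 0 t)%C).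
  { intros j Hj p.
    apply (cont_exp_conv (fun r => nu (k j r)) (fun r tau => res (k j r) * source_symbol (g 0%nat 0%nat) x tau (k j r))%C (fun _ => t)).
    - apply (kcont1_nu j Hj).
    - intros q. pose proof (kcont1_res j Hj) as Hr.
      apply contp_mult; [ct |].
      apply (contp_app2 (fun tau r => source_symbol (g 0%nat 0%nat) x tau (k j r)) (fun q : RR => snd q) (fun q : RR => fst q)); [| ct | ct].
      apply (kcont_source_symbol (g 0%nat 0%nat) (fun _ : R => x) (fun tau : R => tau)); [apply Hs | ct | ct | exact Hj].
    - ct. }
  rewrite EV, <- (KI_Cmult _ _ C3), <- (KI_plus _ _ C1 C2), <- KI_plus.
  - unfold sol. apply KI_ext. intros l Hl. now apply evolution_parts.
  - intros j Hj p. apply contp_plus; [apply (C1 j Hj) | apply (C2 j Hj)].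
  - intros j Hj p. apply contp_mult; [ct | apply (C3 j Hj)].
Qed.

Lemma exp_conv_small (W : R) : (forall l, onK l -> Cmod (nu l) <= W) ->
  forall l h t M, onK l -> cont h -> 0 <= t <= 1 -> (forall tau, 0 <= tau <= t -> Cmod (h tau) <= M) ->
  Cmod (exp_conv (nu l) h t) <= t * (exp W * M).
Proof.
  intros HW l h t M Hl Hh Ht HM. unfold exp_conv. replace t with (t - 0) at 2 by ring.
  apply (Cmod_CRInt_le (fun y => Cexp (nu l * RtoC (t - y)) * h y)%C 0 t); [lra | ct |].
  intros tau Htau. rewrite Cmod_mult. apply Rmult_le_compat; try apply Cmod_ge_0; [| now apply HM].
  rewrite Cmod_Cexp. apply exp_monotone. specialize (HW l Hl).
  eapply Rle_trans; [apply Rle_abs |]. eapply Rle_trans; [apply re_le_Cmod |].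
  rewrite Cmod_mult, Cmod_R, Rabs_pos_eq by lra. pose proof (Cmod_ge_0 (nu l)). nra.
Qed.

(** The contour has finite length and all integrands are convolutions over a time of length
    [t]; [x] enters only through [|exp (i l x)| <= 1]. For the free source, whose contour
    form grows with [x], the bound on the real line is used. *)
Lemma sol_small : exists B, 0 <= B /\ forall x t, 0 <= x -> 0 <= t <= 1 -> Cmod (sol 0 0 x t) <= B * t.
Proof.
  destruct KI_bound as [L [HL0 HL]].
  destruct (onK_bounded nu kcont1_nu) as [W [HW0 HW]].
  destruct (onK_bounded coef_zeta kcont1_coef_zeta) as [B1 [HB10 HB1]].
  destruct (onK_bounded coef_reflected kcont1_coef_reflected) as [B2 [HB20 HB2]].
  destruct (bounded_on_segment (z 0%nat) 0 1) as [Z HZ]; [intros; apply Hzc |].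
  destruct Hg as [Hs _]. destruct (proj2 (Hs 0%nat 0%nat) 1) as [M HM].
  assert (HM0 : 0 <= M) by apply (dec_nonneg _ _ (HM 1 (Rle_refl 1))).
  assert (HZ0 : 0 <= Z) by (eapply Rle_trans; [apply Cmod_ge_0 | apply (HZ 0); lra]).
  pose proof c_pos as Hcp.
  pose (D := exp c * cdec).
  assert (HD0 : 0 <= D) by (unfold D; pose proof (exp_pos c); pose proof cdec_pos; nra).
  pose proof (exp_pos W) as HeW.
  pose (P1 := L * (B1 * (exp W * Z))). pose (P2 := L * (B2 * (exp W * M))).
  assert (HP1 : 0 <= P1) by (unfold P1; repeat apply Rmult_le_pos; lra).
  assert (HP2 : 0 <= P2) by (unfold P2; repeat apply Rmult_le_pos; lra).
  pose (I := Cmod (/ (2 * PI))%C). pose proof (Cmod_ge_0 (/ (2 * PI))%C) as HI. fold I in HI.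
  exists (P1 + P2 + I * (2 * (M * D))). split.
  { assert (0 <= I * (2 * (M * D))) by (apply Rmult_le_pos; [exact HI | apply Rmult_le_pos; [lra | now apply Rmult_le_pos]]). lra. }
  intros x t Hx Ht. destruct (sol_parts x t Hx ltac:(lra)) as [V [_ [E HV]]]. rewrite E.
  assert (Hterm : forall (q : C -> C) (h : C -> R -> C) Bq Mh, 0 <= Bq -> 0 <= Mh ->
    (forall l, onK l -> Cmod (q l) <= Bq) -> (forall l, onK l -> cont (h l)) ->
    (forall l tau, onK l -> 0 <= tau <= t -> Cmod (h l tau) <= Mh) ->
    kcont1 (fun l => q l * Cexp (Ci * l * x) * exp_conv (nu l) (h l) t)%C ->
    Cmod (KI (fun l => q l * Cexp (Ci * l * x) * exp_conv (nu l) (h l) t)%C) <= L * (Bq * (exp W * Mh)) * t).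
  { intros q h Bq Mh HBq HMh Hq Hh HhM Hc.
    replace (L * (Bq * (exp W * Mh)) * t) with (L * (Bq * 1 * (t * (exp W * Mh)))) by ring.
    apply HL; [exact Hc |]. intros l Hl. rewrite !Cmod_mult.
    apply Rmult_le_compat; try apply Cmod_ge_0; [apply Rmult_le_pos; apply Cmod_ge_0 | |].
    - apply Rmult_le_compat; try apply Cmod_ge_0; [now apply Hq |].
      now apply Cmod_Cexp_onK.
    - apply exp_conv_small; [exact HW | exact Hl | now apply Hh | exact Ht |]. intros tau Htau. now apply HhM. }
  eapply Rle_trans; [apply Cmod_triangle |].
  rewrite Rmult_plus_distr_r. apply Rplus_le_compat.
  - eapply Rle_trans; [apply Cmod_triangle |]. rewrite Rmult_plus_distr_r. apply Rplus_le_compat.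
    + apply (Hterm coef_zeta (fun _ => z 0%nat) B1 Z HB10 HZ0 HB1); [intros; apply Hzc | | apply kcont1_part_zeta].
      intros l tau _ Htau. apply HZ. lra.
    + apply (Hterm coef_reflected (source_fourier 0) B2 M HB20 HM0 HB2); [| | apply kcont1_part_reflected].
      * intros l [j [r [Hj ->]]]. apply (cont2_l (fun t r => source_fourier 0 (k j r) t) r), (kcont_source_fourier 0 j Hj).
      * intros l tau Hl Htau. apply half_fourier_bound; [apply source_cont_time, Hs | apply HM; lra |].
        now apply onK_Im_opp.
  - rewrite Cmod_mult. fold I. rewrite Rmult_assoc. apply Rmult_le_compat_l; [exact HI |].
    eapply Rle_trans; [apply (HV M); intros tau Htau; apply HM; lra |].
    unfold D. assert (He : exp (c * t) <= exp c) by (apply exp_monotone; nra).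
    pose proof cdec_pos.
    assert (exp (c * t) * cdec <= exp c * cdec) by nra.
    assert (M * (exp (c * t) * cdec) <= M * (exp c * cdec)) by nra. nra.
Qed.

End Sources.

(** * Continuous extension of the data *)

Lemma Rmax_0_nonneg (x : R) : Rnonneg (Rmax 0 x).
Proof. apply Rmax_l. Qed.

Lemma Rmax_0_id (x : R) : 0 <= x -> Rmax 0 x = x.
Proof. apply Rmax_right. Qed.

Lemma cont_clamped (h h' : R -> C) : derivative_on Rnonneg h h' -> cont (fun x => h (Rmax 0 x)).
Proof.
  intros H x. apply (cont_comp_within Rnonneg h (fun x => Rmax 0 x)); [apply Rmax_0_nonneg | ct |].
  eapply contp_of_within; [apply H |]; apply Rmax_0_nonneg.
Qed.

Lemma der_clamped (h h' : R -> C) (x : R) : derivative_on Rnonneg h h' -> 0 < x ->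
  der (fun x => h (Rmax 0 x)) x (h' (Rmax 0 x)).
Proof.
  intros H Hx. rewrite Rmax_0_id by lra.
  apply (is_derive_ext_loc (V := C_R_NormedModule) h).
  - apply locally_pos; [exact Hx |]. intros y Hy. now rewrite Rmax_0_id by lra.
  - apply (der_of_within Rnonneg); [| apply H; unfold Rnonneg; lra].
    apply locally_pos; [exact Hx |]. intros y Hy. unfold Rnonneg. lra.
Qed.

Lemma bound_at_0 (h : R -> C) (M : R) : cont h -> (forall y, 0 < y -> Cmod (h y) <= M) -> Cmod (h 0) <= M.
Proof.
  intros Hh HM. destruct (Rle_dec (Cmod (h 0)) M) as [H | H]; [exact H | exfalso].
  destruct (proj1 (contp_iff h 0) (Hh 0) (Cmod (h 0) - M)) as [d Hd]; [lra |].
  pose proof (cond_pos d) as Hd0.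
  assert (Hb : Cmod (h (d / 2)%R - h 0)%C < Cmod (h 0) - M).
  { apply Hd. change (Rabs (d / 2 - 0) < d). rewrite Rabs_pos_eq; lra. }
  specialize (HM (d / 2) ltac:(lra)).
  pose proof (Cmod_triangle (h (d / 2)) (- (h (d / 2)%R - h 0))%C) as Ht.
  rewrite Cmod_opp in Ht. replace (h (d / 2)%R + - (h (d / 2)%R - h 0))%C with (h 0) in Ht by ring. lra.
Qed.

(** [(1 + y)^2 <= 2 (1 + y^2)]; at [y = 0] the bounds hold by continuity. *)
Lemma dec_of_moments (h : R -> C) (M0 M2 : R) : cont h ->
  (forall y, 0 < y -> Cmod (h y) <= M0) -> (forall y, 0 < y -> y ^ 2 * Cmod (h y) <= M2) ->
  dec h (2 * (M0 + M2)).
Proof.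
  intros Hc H0 H2.
  assert (Hy : forall y, 0 < y -> Cmod (h y) <= 2 * (M0 + M2) / (1 + y) ^ 2).
  { intros y Hy. specialize (H0 y Hy). specialize (H2 y Hy).
    pose proof (one_plus_sqr_pos y ltac:(lra)) as Hp. pose proof (Cmod_ge_0 (h y)) as Hm.
    apply (Rmult_le_reg_r ((1 + y) ^ 2)); [exact Hp |].
    unfold Rdiv. rewrite Rmult_assoc, Rinv_l, Rmult_1_r by lra.
    assert ((1 + y) ^ 2 <= 2 * (1 + y ^ 2)) by (pose proof (pow2_ge_0 (1 - y)); lra).
    pose proof (Rmult_le_compat_l _ _ _ Hm H) as Hle. lra. }
  intros y [Hy0 | <-]; [now apply Hy |].
  replace (2 * (M0 + M2) / (1 + 0) ^ 2) with (2 * (M0 + M2)) by field.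
  apply bound_at_0; [exact Hc |]. intros y Hy0. eapply Rle_trans; [now apply Hy |].
  assert (0 <= 2 * (M0 + M2)).
  { pose proof (H0 y Hy0). pose proof (H2 y Hy0). pose proof (Cmod_ge_0 (h y)). pose proof (pow2_ge_0 y). nra. }
  apply Rle_div_l; [apply one_plus_sqr_pos; lra |].
  assert (1 <= (1 + y) ^ 2) by nra. nra.
Qed.

(** Composition with the retraction [Rmax 0] of the line onto the half line. *)
Lemma schwartz_extension (u0 : R -> C) : schwartz_half_line u0 -> exists U : nat -> R -> C,
  (forall n, cont (U n)) /\ (forall n, exists M, dec (U n) M) /\
  (forall n y, 0 < y -> der (U n) y (U (S n) y)) /\ (forall x, 0 <= x -> U 0%nat x = u0 x).
Proof.
  intros [G [[H0 Hd] HM]]. exists (fun n x => G n (Rmax 0 x)).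
  assert (HC : forall n, cont (fun x => G n (Rmax 0 x))) by (intros n; apply (cont_clamped (G n) (G (S n))), Hd).
  split; [exact HC | split; [| split]].
  - intros n. destruct (HM n 0%nat) as [M0 HM0]. destruct (HM n 2%nat) as [M2 HM2].
    exists (2 * (M0 + M2)). apply dec_of_moments; [apply HC | |]; intros y Hy; rewrite Rmax_0_id by lra.
    + specialize (HM0 y ltac:(lra)). simpl in HM0. lra.
    + apply HM2. lra.
  - intros n y Hy. apply (der_clamped (G n) (G (S n))); [apply Hd | exact Hy].
  - intros x Hx. rewrite Rmax_0_id by exact Hx. now apply H0.
Qed.

Lemma smooth_extension (zeta : R -> C) : smooth_on Rnonneg zeta -> exists z : nat -> R -> C,
  (forall m, cont (z m)) /\ (forall m t, 0 < t -> der (z m) t (z (S m) t)) /\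
  (forall t, 0 <= t -> z 0%nat t = zeta t).
Proof.
  intros [G [H0 Hd]]. exists (fun n x => G n (Rmax 0 x)). split; [| split].
  - intros n. apply (cont_clamped (G n) (G (S n))), Hd.
  - intros n y Hy. apply (der_clamped (G n) (G (S n))); [apply Hd | exact Hy].
  - intros x Hx. rewrite Rmax_0_id by exact Hx. now apply H0.
Qed.

Lemma source_extension (f : R -> R -> C) (P : nat -> nat -> R -> R -> C) :
  partials_on Rnonneg f P ->
  (forall (T : R) (n m l : nat), 0 < T -> exists M : R, forall x t : R, 0 < x -> 0 <= t <= T ->
     x ^ l * Cmod (P n m x t) <= M) ->
  exists g, smooth_source g /\ forall x t, 0 <= x -> 0 <= t -> g 0%nat 0%nat x t = f x t.
Proof.
  intros [H0 [Hx [Ht Hc]]] HM.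
  exists (fun n m x t => P n m (Rmax 0 x) (Rmax 0 t)). split; [split; [| split] |].
  - intros n m. split.
    + intros q.
      apply (cont_comp_within (T := RR) (S := RR) (fun p : R * R => Rnonneg (fst p) /\ Rnonneg (snd p))
               (fun p => P n m (fst p) (snd p)) (fun q : RR => (Rmax 0 (fst q), Rmax 0 (snd q)))).
      * intros p. split; apply Rmax_0_nonneg.
      * apply (contp_pair (fun q : RR => Rmax 0 (fst q)) (fun q : RR => Rmax 0 (snd q))); ct.
      * apply (Hc n m). split; apply Rmax_0_nonneg.
    + intros T. assert (HT : 0 < Rmax 1 T) by (eapply Rlt_le_trans; [apply Rlt_0_1 | apply Rmax_l]).
      destruct (HM (Rmax 1 T) n m 0%nat HT) as [M0 HM0]. destruct (HM (Rmax 1 T) n m 2%nat HT) as [M2 HM2].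
      exists (2 * (M0 + M2)). intros t HtT.
      assert (Hrange : 0 <= Rmax 0 t <= Rmax 1 T).
      { split; [apply Rmax_l |]. apply Rmax_lub; [lra |]. eapply Rle_trans; [exact HtT | apply Rmax_r]. }
      apply dec_of_moments.
      * apply (cont_clamped (fun x => P n m x (Rmax 0 t)) (fun x => P (S n) m x (Rmax 0 t))), Hx, Rmax_0_nonneg.
      * intros y Hy. rewrite (Rmax_0_id y) by lra. specialize (HM0 y _ Hy Hrange). simpl in HM0. lra.
      * intros y Hy. rewrite (Rmax_0_id y) by lra. now apply HM2.
  - intros n m x t Hxp _.
    apply (der_clamped (fun x => P n m x (Rmax 0 t)) (fun x => P (S n) m x (Rmax 0 t))); [apply Hx, Rmax_0_nonneg | exact Hxp].
  - intros n m x t _ Htp.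
    apply (der_clamped (P n m (Rmax 0 x)) (P n (S m) (Rmax 0 x))); [apply Ht, Rmax_0_nonneg | exact Htp].
  - intros x t Hxp Htp. rewrite !Rmax_0_id by assumption. now apply H0.
Qed.

Lemma solution_ext (u0 v0 zeta z : R -> C) (f g : R -> R -> C) (x t : R) :
  0 <= t -> (forall y, 0 <= y -> u0 y = v0 y) -> (forall tau, 0 <= tau -> zeta tau = z tau) ->
  (forall y tau, 0 <= y -> 0 <= tau -> f y tau = g y tau) ->
  solution alpha beta gamma0 gamma1 u0 zeta f K x t = solution alpha beta gamma0 gamma1 v0 z g K x t /\
  u0_integrand alpha beta u0 x t = u0_integrand alpha beta v0 x t /\
  f_integrand alpha beta f x t = f_integrand alpha beta g x t.
Proof.
  intros Ht Hu Hz Hf.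
  assert (E1 : half_fourier u0 = half_fourier v0).
  { apply functional_extensionality. intros l. now apply half_fourier_ext. }
  assert (E2 : (fun l => zeta_tilde alpha beta zeta l t) = (fun l => zeta_tilde alpha beta z l t)).
  { apply functional_extensionality. intros l. apply CRInt_ext. intros tau Htau.
    rewrite Rmin_left, Rmax_right in Htau by lra. rewrite Hz by lra. reflexivity. }
  assert (E3 : (fun l => F_transform alpha beta f l t) = (fun l => F_transform alpha beta g l t)).
  { apply functional_extensionality. intros l. apply CRInt_ext. intros tau Htau.
    rewrite Rmin_left, Rmax_right in Htau by lra.
    rewrite (half_fourier_ext (fun x => f x tau) (fun x => g x tau)); [reflexivity |].
    intros y Hy. apply Hf; lra. }
  assert (Eu : u0_integrand alpha beta u0 x t = u0_integrand alpha beta v0 x t).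
  { unfold u0_integrand. now rewrite E1. }
  assert (Ef : f_integrand alpha beta f x t = f_integrand alpha beta g x t).
  { unfold f_integrand. apply functional_extensionality. intros l.
    now rewrite (f_equal (fun h => h l) E3). }
  split; [| split; assumption].
  assert (Z2 : (fun l : C => kernel alpha beta x t l / ((1 + alpha * l ^ 2) * (Ci * gamma1 * l + gamma0))
       * l * zeta_tilde alpha beta zeta l t)%C
    = (fun l : C => kernel alpha beta x t l / ((1 + alpha * l ^ 2) * (Ci * gamma1 * l + gamma0))
       * l * zeta_tilde alpha beta z l t)%C).
  { apply functional_extensionality. intros l. now rewrite (f_equal (fun h => h l) E2). }
  assert (Z3 : (fun l : C => kernel alpha beta x t l / (1 + alpha * l ^ 2) * reflection gamma0 gamma1 l
       * F_transform alpha beta f (- l) t)%C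
    = (fun l : C => kernel alpha beta x t l / (1 + alpha * l ^ 2) * reflection gamma0 gamma1 l
       * F_transform alpha beta g (- l) t)%C).
  { apply functional_extensionality. intros l. now rewrite (f_equal (fun h => h (- l)%C) E3). }
  unfold solution. now rewrite Eu, Ef, E1, Z2, Z3.
Qed.

(** * The terms of the solution formula *)

Lemma kcont1_ext (h1 h2 : C -> C) : (forall l, onK l -> h1 l = h2 l) -> kcont1 h2 -> kcont1 h1.
Proof.
  intros E H j Hj. intros p. apply (contp_ext (fun r => h2 (k j r))); [| apply (H j Hj)].
  intros r. symmetry. apply E. now exists j, r.
Qed.

Lemma omega_opp (l : C) : omega (- l)%C = omega l.
Proof. unfold Defs.omega. now replace ((- l) ^ 2)%C with (l ^ 2)%C by ring. Qed.

Lemma kernel_split (x t : R) (l : C) :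
  kernel alpha beta x t l = (Cexp (Ci * l * x) * Cexp (- (omega l * t)))%C.
Proof. unfold kernel. now rewrite <- Cexp_plus. Qed.

(** The constant [i PI] inverts the factor [- i / PI] of the boundary term. *)
Lemma zeta_contour (z : nat -> R -> C) (x t : R) : (forall m, cont (z m)) ->
  contour_int K (fun l : C =>
       kernel alpha beta x t l / ((1 + alpha * l ^ 2) * (Ci * gamma1 * l + gamma0))
       * l * zeta_tilde alpha beta (z 0%nat) l t)%C
  = (Ci * PI * KI (fun l => coef_zeta l * Cexp (Ci * l * x) * exp_conv (nu l) (z 0%nat) t))%C.
Proof.
  intros Hz.
  pose proof (kcont1_part_zeta z Hz x t) as Hc.
  rewrite <- (KI_Cmult _ _ Hc).
  assert (E : forall l, onK l -> (kernel alpha beta x t l / ((1 + alpha * l ^ 2) * (Ci * gamma1 * l + gamma0))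
       * l * zeta_tilde alpha beta (z 0%nat) l t)%C
     = (Ci * PI * (coef_zeta l * Cexp (Ci * l * x) * exp_conv (nu l) (z 0%nat) t))%C).
  { intros l Hl.
    pose proof (onK_res l Hl) as Hn.
    pose proof (onK_robin l Hl) as Hr.
    pose proof PI_neq_0_C as Hpi.
    rewrite (exp_conv_omega l (z 0%nat) t (Hz 0%nat)), kernel_split.
    unfold zeta_tilde, coef_zeta, robin, res.
    set (J := CRInt _ 0 t). set (E1 := Cexp (Ci * l * x)). set (E2 := Cexp (- (omega l * t))).
    replace (Ci * gamma1 * l + gamma0)%C with (gamma0 + Ci * gamma1 * l)%C by ring.
    transitivity (- (Ci * Ci) * (E1 * E2 / ((1 + alpha * l ^ 2) * (gamma0 + Ci * gamma1 * l)) * l * J))%C.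
    - rewrite Ci_sqr. ring.
    - field. repeat split; assumption. }
  rewrite contour_int_KI.
  - apply KI_ext, E.
  - apply (kcont1_ext _ _ E). intros j Hj p. apply contp_mult; [ct | apply (Hc j Hj)].
Qed.

(** The transform at [- l] has the same exponent because [omega] is even. *)
Lemma reflected_contour (g : nat -> nat -> R -> R -> C) (x t : R) : smooth_source g ->
  kcont1 (fun l : C => kernel alpha beta x t l / (1 + alpha * l ^ 2) * reflection gamma0 gamma1 l
       * F_transform alpha beta (g 0%nat 0%nat) (- l) t)%C /\
  KI (fun l : C => kernel alpha beta x t l / (1 + alpha * l ^ 2) * reflection gamma0 gamma1 l
       * F_transform alpha beta (g 0%nat 0%nat) (- l) t)%C
  = (- (2 * PI) * KI (fun l => coef_reflected l * Cexp (Ci * l * x) * exp_conv (nu l) (source_fourier g 0 l) t))%C.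
Proof.
  intros Hg.
  pose proof (kcont1_part_reflected g Hg x t) as Hc.
  rewrite <- (KI_Cmult _ _ Hc).
  assert (E : forall l, onK l -> (kernel alpha beta x t l / (1 + alpha * l ^ 2) * reflection gamma0 gamma1 l
       * F_transform alpha beta (g 0%nat 0%nat) (- l) t)%C
     = (- (2 * PI) * (coef_reflected l * Cexp (Ci * l * x) * exp_conv (nu l) (source_fourier g 0 l) t))%C).
  { intros l Hl.
    pose proof (onK_res l Hl) as Hn.
    pose proof (onK_robin l Hl) as Hr.
    pose proof PI_neq_0_C as Hpi.
    assert (Csf : cont (source_fourier g 0 l)).
    { destruct Hl as [j [r [Hj ->]]].
      apply (cont2_l (fun t r => source_fourier g 0 (k j r) t) r).
      apply (kcont_source_fourier g Hg 0 j Hj). }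
    rewrite (exp_conv_omega l _ t Csf), kernel_split.
    unfold F_transform. rewrite omega_opp.
    unfold reflection, coef_reflected, robin, res.
    change (CRInt (fun tau : R => Cexp (omega l * tau) * half_fourier (fun x : R => g 0%nat 0%nat x tau) (- l))%C 0 t)
      with (CRInt (fun tau : R => Cexp (omega l * tau) * source_fourier g 0 l tau)%C 0 t).
    set (J := CRInt _ 0 t). set (E1 := Cexp (Ci * l * x)). set (E2 := Cexp (- (omega l * t))).
    field. repeat split; assumption. }
  split.
  - apply (kcont1_ext _ _ E). intros j Hj p. apply contp_mult; [ct | apply (Hc j Hj)].
  - apply KI_ext, E.
Qed.

Lemma sol_formula (g : nat -> nat -> R -> R -> C) (z : nat -> R -> C) (x t : R) :
  smooth_source g -> (forall m, cont (z m)) -> 0 <= x -> 0 <= t ->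
  ex_real_line_int (f_integrand alpha beta (g 0%nat 0%nat) x t) /\
  sol g z 0 0 x t =
  (- (Ci / PI) * contour_int K (fun l : C =>
       kernel alpha beta x t l / ((1 + alpha * l ^ 2) * (Ci * gamma1 * l + gamma0))
       * l * zeta_tilde alpha beta (z 0%nat) l t)
   + / (2 * PI) * real_line_int (f_integrand alpha beta (g 0%nat 0%nat) x t)
   - / (2 * PI) * contour_int K (fun l : C =>
       kernel alpha beta x t l / (1 + alpha * l ^ 2) * reflection gamma0 gamma1 l
       * F_transform alpha beta (g 0%nat 0%nat) (- l) t))%C.
Proof.
  intros Hg Hz Hx Ht. pose proof PI_neq_0_C as Hpi.
  destruct (sol_parts g z Hg Hz x t Hx Ht) as [V [HV [E _]]].
  split; [now exists V |].
  assert (EV : real_line_int (f_integrand alpha beta (g 0%nat 0%nat) x t) = V).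
  { exact (is_RInt_gen_unique (V := C_R_CompleteNormedModule) _ V HV). }
  destruct (reflected_contour g x t Hg) as [Hc ER].
  assert (Halg : forall A B V' : C, (A + B + / (2 * PI) * V'
     = - (Ci / PI) * (Ci * PI * A) + / (2 * PI) * V' - / (2 * PI) * (- (2 * PI) * B))%C).
  { intros A B V'. transitivity (- (Ci * Ci) * A + B + / (2 * PI) * V')%C; [rewrite Ci_sqr; ring | field; exact Hpi]. }
  rewrite EV, (zeta_contour z x t Hz), (contour_int_KI _ Hc), ER, E. apply Halg.
Qed.

(** * The contribution of the initial values *)

(** Every positive point is interior to the open half line, so restricted neighbourhoods
    have the same limits. *)
Lemma derivative_on_of_der (h h' : R -> C) : (forall x, 0 < x -> der h x (h' x)) -> derivative_on Rpos h h'.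
Proof.
  intros H x Hx. destruct (H x Hx) as [Hl Hd]. split; [exact Hl |].
  intros y Hy eps. assert (Ey : x = y).
  { apply (is_filter_lim_locally_unique (K := R_AbsRing) (V := R_NormedModule)).
    intros P HP. specialize (Hy P HP). unfold within in Hy.
    apply (filter_imp (fun z => Rpos z /\ (Rpos z -> P z))); [tauto |].
    apply filter_and; [apply locally_pos; [exact Hx | trivial] | exact Hy]. }
  subst y. unfold within. generalize (Hd x (fun P HP => HP) eps). apply filter_imp. tauto.
Qed.

Section Initial.

Variable U : nat -> R -> C.
Hypothesis HUc : forall n, cont (U n).
Hypothesis HUb : forall n, exists M, dec (U n) M.
Hypothesis HUd : forall n y, 0 < y -> der (U n) y (U (S n) y).

(** The derivatives of [exp (- c t)], bounded at negative times by the retraction [Rmax 0]. *)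
Definition decay (m : nat) (t : R) : R := (- c) ^ m * exp (- (c * Rmax 0 t)).

Lemma decay_der (m : nat) (t : R) : 0 < t -> is_derive (decay m) t (decay (S m) t).
Proof.
  intros Ht. unfold decay. rewrite Rmax_0_id by lra.
  apply (is_derive_ext_loc (fun t => (- c) ^ m * exp (- (c * t)))).
  - apply locally_pos; [exact Ht |]. intros y Hy. now rewrite Rmax_0_id by lra.
  - auto_derive; [trivial |]. simpl. ring.
Qed.

Lemma contR_decay {T : UniformSpace} (m : nat) (f : T -> R) (p : T) :
  continuous f p -> continuous (fun q => decay m (f q)) p.
Proof.
  intros Hf. unfold decay.
  apply (contR_mult (fun _ => (- c) ^ m) (fun q => exp (- (c * Rmax 0 (f q))))); [apply continuous_const |].
  apply (contR_comp (fun q => - (c * Rmax 0 (f q))) exp); [| apply derivable_continuous_pt, derivable_pt_exp].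
  apply (contR_opp (fun q => c * Rmax 0 (f q))), (contR_mult (fun _ => c) (fun q => Rmax 0 (f q))); [apply continuous_const |].
  apply (contR_Rmax (fun _ => 0) f); [apply continuous_const | exact Hf].
Qed.

Lemma decay_bound (m : nat) (t : R) : Rabs (decay m t) <= Rabs ((- c) ^ m).
Proof.
  unfold decay. rewrite Rabs_mult. rewrite <- (Rmult_1_r (Rabs ((- c) ^ m))) at 2.
  apply Rmult_le_compat_l; [apply Rabs_pos |].
  rewrite Rabs_pos_eq by (apply Rlt_le, exp_pos). rewrite <- exp_0. apply exp_monotone.
  pose proof c_pos. pose proof (Rmax_l 0 t). nra.
Qed.

(** The function [exp (- c t) u0] satisfies the equation with the right-hand side [- c exp
    (- c t) u0]; this source compensates it. *)
Definition initial_source (n m : nat) (x t : R) : C := (RtoC c * (RtoC (decay m t) * U n x))%C.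

Lemma smooth_initial_source : smooth_source initial_source.
Proof.
  unfold initial_source. split; [split |split].
  - intros q. apply contp_mult; [ct |]. apply contp_mult.
    + apply contp_RtoC, contR_decay. ct.
    + specialize (HUc n). ct.
  - intros T. destruct (HUb n) as [M HM]. exists (Rabs c * Rabs ((- c) ^ m) * M). intros t _ y Hy.
    rewrite !Cmod_mult, !Cmod_R. unfold Rdiv. rewrite !Rmult_assoc.
    apply Rmult_le_compat_l; [apply Rabs_pos |].
    apply Rmult_le_compat; [apply Rabs_pos | apply Cmod_ge_0 | apply decay_bound | now apply HM].
  - intros n m x t Hx _. apply der_Cmult_l, der_Cmult_l. now apply HUd.
  - intros n m x t _ Ht. apply der_Cmult_l, der_Cmult_r, der_RtoC. now apply decay_der.
Qed.

(** Since [omega - c = - c res], the integral is elementary and the factor [res] is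
    cancelled. *)
Lemma relaxation_integral (l : C) (t : R) : (1 + alpha * l ^ 2)%C <> RtoC 0 -> 0 <= t ->
  (Cexp (- (omega l * t)) * (res l * CRInt (fun tau => Cexp (omega l * tau) * (c * decay 0 tau)) 0 t)
   = Cexp (- (omega l * t)) - decay 0 t)%C.
Proof.
  intros Hn Ht.
  assert (Hr : res l <> RtoC 0).
  { unfold res. intros E. apply (f_equal (fun y => (1 + alpha * l ^ 2) * y)%C) in E.
    rewrite Cinv_r in E by exact Hn. replace ((1 + alpha * l ^ 2) * RtoC 0)%C with (RtoC 0) in E by ring.
    apply RtoC_inj in E. lra. }
  pose proof (omega_res l Hn) as Ew.
  assert (Ed : forall tau, 0 <= tau -> RtoC (decay 0 tau) = Cexp (- (c * tau))).
  { intros tau Htau. unfold decay. rewrite Rmax_0_id by exact Htau. simpl. rewrite Rmult_1_l.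
    rewrite <- RtoC_mult, <- RtoC_opp, Cexp_RtoC. reflexivity. }
  assert (EI : CRInt (fun tau => Cexp (omega l * tau) * (c * decay 0 tau))%C 0 t
     = (- (/ res l * Cexp (- (c * res l * t))) - - (/ res l * Cexp (- (c * res l * 0))))%C).
  { rewrite (CRInt_ext _ (fun tau : R => c * Cexp (- (c * res l * tau)))%C).
    - apply (CRInt_der_all (fun tau : R => - (/ res l * Cexp (- (c * res l * tau))))%C); [ct |].
      intros tau. eapply der_eq; [| apply der_opp, der_Cmult_l, der_Cexp, der_opp, der_Cmult_l, der_id].
      cbv beta. field. exact Hr.
    - intros tau Htau. rewrite Rmin_left, Rmax_right in Htau by lra.
      rewrite Ed, Ew by lra.
      transitivity (c * (Cexp ((c - c * res l) * tau) * Cexp (- (c * tau))))%C; [ring |].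
      rewrite <- Cexp_plus. do 2 f_equal. ring. }
  rewrite EI, Ed by exact Ht.
  replace (- (c * res l * 0))%C with (RtoC 0) by ring. rewrite Cexp_0.
  transitivity (Cexp (- (omega l * t)) - Cexp (- (omega l * t)) * Cexp (- (c * res l * t)))%C; [field; exact Hr |].
  rewrite <- Cexp_plus, Ew. f_equal. f_equal. ring.
Qed.

Lemma F_transform_initial (l : C) (t : R) : Im l <= 0 ->
  F_transform alpha beta (initial_source 0 0) l t
  = (half_fourier (U 0%nat) l * CRInt (fun tau => Cexp (omega l * tau) * (c * decay 0 tau)) 0 t)%C.
Proof.
  intros Hl. destruct (HUb 0) as [M HM].
  assert (Hc : cont (fun tau : R => Cexp (omega l * tau) * (c * decay 0 tau))%C).
  { intros tau. apply contp_mult; [ct |]. apply contp_mult; [ct |]. apply contp_RtoC, (contR_decay 0 (fun t => t)). ct. }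
  rewrite <- CRInt_Cmult by exact Hc. apply CRInt_ext. intros tau _.
  unfold initial_source.
  transitivity (Cexp (omega l * tau) * ((RtoC c * RtoC (decay 0 tau)) * half_fourier (U 0%nat) l))%C; [| ring].
  f_equal. rewrite <- (half_fourier_Cmult _ (U 0%nat) l M (HUc 0) HM Hl).
  apply half_fourier_ext. intros y _. ring.
Qed.

(** The first part has no time dependence in its symbol and is treated by Fourier inversion;
    the second is absolutely integrable. *)
Lemma u0_integrand_split (x t l : R) : 0 <= t ->
  u0_integrand alpha beta (U 0%nat) x t (RtoC l)
  = (scal (V := C_R_NormedModule) (decay 0 t) (half_fourier (U 0%nat) (RtoC l) * Cexp (Ci * l * x))
     + f_integrand alpha beta (initial_source 0 0) x t (RtoC l))%C.
Proof.
  intros Ht. pose proof (line_res_neq_0 l) as Hn.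
  pose proof (relaxation_integral (RtoC l) t Hn Ht) as E.
  unfold u0_integrand, f_integrand. rewrite scal_C, F_transform_initial by (simpl; lra).
  rewrite kernel_split. unfold Cdiv. change (/ (1 + alpha * RtoC l ^ 2))%C with (res (RtoC l)).
  set (J := CRInt _ 0 t) in *. set (H := half_fourier _ _). set (E1 := Cexp (Ci * l * x)).
  set (W := Cexp (- (omega (RtoC l) * t))) in *.
  transitivity (H * E1 * (decay 0 t + W * (res (RtoC l) * J)))%C; [rewrite E; ring | ring].
Qed.

Lemma cont_zero (m : nat) : cont ((fun _ _ => RtoC 0 : C) m : R -> C).
Proof. intros p. apply contp_const. Qed.

Lemma u0_line (x t : R) : 0 < x -> 0 <= t -> exists V,
  is_RInt_gen (V := C_R_NormedModule) (fun l : R => f_integrand alpha beta (initial_source 0 0) x t (RtoC l))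
    (Rbar_locally m_infty) (Rbar_locally p_infty) V /\
  is_RInt_gen (V := C_R_NormedModule) (fun l : R => u0_integrand alpha beta (U 0%nat) x t (RtoC l))
    (Rbar_locally m_infty) (Rbar_locally p_infty) (decay 0 t * (2 * PI * U 0%nat x) + V)%C.
Proof.
  intros Hx Ht.
  destruct (proj1 (sol_formula
    initial_source (fun _ _ => RtoC 0) x t smooth_initial_source cont_zero (Rlt_le _ _ Hx) Ht)) as [V HV].
  exists V. split; [exact HV |].
  replace (fun l : R => u0_integrand alpha beta (U 0%nat) x t (RtoC l)) with
    (fun l : R => plus (G := C_R_NormedModule) (scal (V := C_R_NormedModule) (decay 0 t) (half_fourier (U 0%nat) (RtoC l) * Cexp (Ci * l * x))%C)
     (f_integrand alpha beta (initial_source 0 0) x t (RtoC l)))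
    by (apply functional_extensionality; intros l; symmetry; now apply u0_integrand_split).
  apply (is_RInt_gen_plus (V := C_R_NormedModule)); [| exact HV].
  rewrite <- scal_C. apply (is_RInt_gen_scal (V := C_R_NormedModule)).
  destruct (HUb 0) as [M0 HM0]. destruct (HUb 1) as [M1 HM1]. destruct (HUb 2) as [M2 HM2].
  apply (fourier_inversion (U 0%nat) (U 1%nat) (U 2%nat) (Rmax M0 (Rmax M1 M2)) x Hx); auto.
  - eapply dec_mono; [| exact HM0]. apply Rmax_l.
  - eapply dec_mono; [| exact HM1]. eapply Rle_trans; [apply Rmax_l | apply Rmax_r].
  - eapply dec_mono; [| exact HM2]. eapply Rle_trans; [apply Rmax_r | apply Rmax_r].
Qed.

(** The identity of [u0_integrand_split] at reflected arguments; here the first part is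
    holomorphic inside the contour and drops out. *)
Lemma u0_contour (x t : R) : 0 <= t ->
  contour_int K (fun l : C => half_fourier (U 0%nat) (- l) * reflection gamma0 gamma1 l * kernel alpha beta x t l)%C
  = (- (2 * PI) * KI (fun l => coef_reflected l * Cexp (Ci * l * x) * exp_conv (nu l) (source_fourier initial_source 0 l) t))%C.
Proof.
  intros Ht.
  pose proof smooth_initial_source as Hp.
  destruct (reflected_contour initial_source x t Hp) as [Hc <-].
  pose (q := fun l : C => (Cexp (Ci * l * x) * ((gamma0 - Ci * gamma1 * l) * robin l))%C).
  assert (Hq : kcont1 q).
  { intros j Hj p. pose proof (cont_k j Hj).
    pose proof (kcont1_robin j Hj) as Hr.
    change (cont (fun r => robin (k j r))) in Hr. unfold q. ct. }
  (* at time 0 the transform of the source is [c] times that of the initial values *)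
  assert (Hz : KI (fun l => q l * source_fourier initial_source 0 l 0)%C = RtoC 0).
  { apply (KI_Cexp_source_fourier initial_source Hp q 0 Hq).
    intros y _. apply KI_Cexp_robin_shift. }
  assert (Hzc : kcont1 (fun l => q l * source_fourier initial_source 0 l 0)%C).
  { intros j Hj p. apply contp_mult; [apply (Hq j Hj) |].
    apply (kcont1_source_fourier initial_source Hp 0 j Hj). }
  pose proof c_pos as Hcp.
  assert (Hc0 : RtoC c <> RtoC 0) by (apply RtoC_neq_0; lra).
  assert (E : forall l, onK l -> (half_fourier (U 0%nat) (- l) * reflection gamma0 gamma1 l * kernel alpha beta x t l)%C
     = (kernel alpha beta x t l / (1 + alpha * l ^ 2) * reflection gamma0 gamma1 l
       * F_transform alpha beta (initial_source 0 0) (- l) t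
       + decay 0 t / c * (q l * source_fourier initial_source 0 l 0))%C).
  { intros l Hl.
    pose proof (onK_res l Hl) as Hn.
    pose proof (onK_Im_opp l Hl) as Him.
    destruct (HUb 0) as [M HM].
    assert (ES : source_fourier initial_source 0 l 0 = (RtoC c * half_fourier (U 0%nat) (- l))%C).
    { unfold source_fourier. rewrite <- (half_fourier_Cmult _ (U 0%nat) _ M (HUc 0) HM Him).
      apply half_fourier_ext. intros y _. unfold initial_source, decay.
      rewrite Rmax_0_id by lra. rewrite Rmult_0_r, Ropp_0, exp_0. simpl. rewrite Rmult_1_l. ring. }
    pose proof (relaxation_integral l t Hn Ht) as ER.
    rewrite ES, (F_transform_initial _ t Him), !omega_opp, kernel_split.
    unfold reflection, q, Cdiv. change (/ (1 + alpha * l ^ 2))%C with (res l).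
    change (/ (gamma0 + Ci * gamma1 * l))%C with (robin l).
    set (J := CRInt _ 0 t) in *. set (H := half_fourier _ _). set (E1 := Cexp (Ci * l * x)).
    set (W := Cexp (- (omega l * t))) in *. set (r := robin l). set (G := (gamma0 - Ci * gamma1 * l)%C).
    transitivity (H * G * r * E1 * (W * (res l * J) + decay 0 t * (/ c * c)))%C; [| ring].
    rewrite ER, (Cinv_l _ Hc0). ring. }
  assert (Hzc' : kcont1 (fun l => decay 0 t / c * (q l * source_fourier initial_source 0 l 0))%C).
  { intros j Hj p. apply contp_mult; [ct | apply (Hzc j Hj)]. }
  rewrite contour_int_KI.
  - rewrite (KI_ext _ _ E), (KI_plus _ _ Hc Hzc'), (KI_Cmult _ _ Hzc), Hz. ring.
  - apply (kcont1_ext _ _ E). intros j Hj p. apply contp_plus; [apply (Hc j Hj) | apply (Hzc' j Hj)].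
Qed.

Lemma initial_formula (x t : R) : 0 < x -> 0 <= t ->
  ex_real_line_int (u0_integrand alpha beta (U 0%nat) x t) /\
  (/ (2 * PI) * real_line_int (u0_integrand alpha beta (U 0%nat) x t)
   - / (2 * PI) * contour_int K (fun l : C =>
       half_fourier (U 0%nat) (- l) * reflection gamma0 gamma1 l * kernel alpha beta x t l)
   = decay 0 t * U 0%nat x + sol initial_source (fun _ _ => RtoC 0) 0 0 x t)%C.
Proof.
  intros Hx Ht. pose proof PI_neq_0_C as Hpi.
  destruct (u0_line x t Hx Ht) as [V [HV HL]].
  split; [eexists; exact HL |].
  assert (EL : real_line_int (u0_integrand alpha beta (U 0%nat) x t) = (decay 0 t * (2 * PI * U 0%nat x) + V)%C).
  { exact (is_RInt_gen_unique (V := C_R_CompleteNormedModule) _ _ HL). }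
  destruct (sol_parts initial_source (fun _ _ => RtoC 0)
    smooth_initial_source cont_zero x t (Rlt_le _ _ Hx) Ht) as [V' [HV' [E _]]].
  assert (EV : V' = V).
  { rewrite <- (is_RInt_gen_unique (V := C_R_CompleteNormedModule) _ V HV).
    symmetry. exact (is_RInt_gen_unique (V := C_R_CompleteNormedModule) _ V' HV'). }
  rewrite E, EV, EL, (u0_contour x t Ht).
  rewrite (KI_ext (fun l => coef_zeta l * _ * _)%C (fun _ => RtoC 0)), KI_zero.
  - match goal with |- context [KI ?h] => generalize (KI h) end. intros B. field. exact Hpi.
  - intros l _. unfold exp_conv. rewrite (CRInt_ext _ (fun _ => RtoC 0)); [rewrite CRInt_const; ring |].
    intros y _. ring.
Qed.

(** * The equation, the initial values and the boundary values *)

Variables (g : nat -> nat -> R -> R -> C) (z : nat -> R -> C).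
Hypothesis Hg : smooth_source g.
Hypothesis Hzc : forall m, cont (z m).
Hypothesis Hz : forall m t, 0 < t -> der (z m) t (z (S m) t).

Local Notation p := initial_source.
Local Notation z0 := (fun (_ : nat) (_ : R) => RtoC 0).

(** The first term carries the initial values, the second repairs the equation for it, and
    the third accounts for the given source and boundary data. *)
Definition solution_partial (n m : nat) (x t : R) : C :=
  (RtoC (decay m t) * U n x + sol p z0 n m x t + sol g z n m x t)%C.

Lemma der_zero_data (m : nat) (t : R) : 0 < t -> der (z0 m) t (z0 (S m) t).
Proof. intros _. apply der_const. Qed.

(** The terms with [u0] come from [initial_formula], those with [f] and [zeta] from
    [sol_formula]. *)
Lemma solution_decomposition (x t : R) : 0 < x -> 0 < t ->
  (ex_real_line_int (u0_integrand alpha beta (U 0%nat) x t) /\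
   ex_real_line_int (f_integrand alpha beta (g 0%nat 0%nat) x t)) /\
  solution alpha beta gamma0 gamma1 (U 0%nat) (z 0%nat) (g 0%nat 0%nat) K x t = solution_partial 0 0 x t.
Proof.
  intros Hx Ht.
  destruct (initial_formula x t Hx (Rlt_le _ _ Ht)) as [H1 E1].
  destruct (sol_formula g z x t Hg Hzc (Rlt_le _ _ Hx) (Rlt_le _ _ Ht)) as [H2 E2].
  split; [now split |].
  unfold solution_partial. rewrite <- E1, E2. unfold solution.
  repeat match goal with |- context [contour_int K ?h] => generalize (contour_int K h); intro end.
  repeat match goal with |- context [real_line_int ?h] => generalize (real_line_int h); intro end.
  ring.
Qed.

Lemma sol_regular (q : nat -> nat -> R -> R -> C) (y : nat -> R -> C) :
  smooth_source q -> (forall m, cont (y m)) -> (forall m t, 0 < t -> der (y m) t (y (S m) t)) ->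
  (forall n m, cont2 (sol q y n m)) /\
  (forall n m x t, 0 < x -> 0 <= t -> der (fun x => sol q y n m x t) x (sol q y (S n) m x t)) /\
  (forall n m x t, 0 <= x -> 0 < t -> der (sol q y n m x) t (sol q y n (S m) x t)).
Proof.
  intros Hq Hyc Hy. apply family_KI.
  now apply (family_evolution q y).
Qed.

Lemma solution_partials : partials_on Rpos (solution_partial 0 0) solution_partial.
Proof.
  destruct (sol_regular p z0 smooth_initial_source cont_zero der_zero_data) as [C1 [X1 T1]].
  destruct (sol_regular g z Hg Hzc Hz) as [C2 [X2 T2]].
  split; [trivial | split; [| split]].
  - intros n m t Ht. apply derivative_on_of_der. intros x Hx. unfold solution_partial, Rpos in *.
    apply der_plus; [apply der_plus |]; [apply der_Cmult_l; now apply HUd | apply X1 | apply X2]; lra.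
  - intros n m x Hx. apply derivative_on_of_der. intros t Ht. unfold solution_partial, Rpos in *.
    apply (der_plus (fun t => RtoC (decay m t) * U n x + sol p z0 n m x t)%C (sol g z n m x)).
    + apply (der_plus (fun t => RtoC (decay m t) * U n x)%C (sol p z0 n m x)).
      * now apply der_Cmult_r, der_RtoC, decay_der.
      * apply T1; lra.
    + apply T2; lra.
  - intros n m q _.
    assert (H : contp (fun q : RR => solution_partial n m (fst q) (snd q)) q).
    { unfold solution_partial. apply contp_plus; [apply contp_plus |]; [| apply C1 | apply C2].
      apply contp_mult; [apply contp_RtoC, contR_decay; ct | specialize (HUc n); ct]. }
    intros Q HQ. specialize (H Q HQ). unfold filtermap, within in *. revert H. apply filter_imp. auto.
Qed.

(** With [c = beta / alpha] the second derivatives of [exp (- c t) u0] cancel in the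
    equation. *)
Lemma solution_equation (x t : R) : 0 < x -> 0 < t ->
  (solution_partial 0 1 x t - alpha * solution_partial 2 1 x t - beta * solution_partial 2 0 x t)%C = g 0%nat 0%nat x t.
Proof.
  intros Hx Ht.
  pose proof (sol_equation p z0 smooth_initial_source cont_zero der_zero_data
    x t (Rlt_le _ _ Hx) (Rlt_le _ _ Ht)) as E1.
  pose proof (sol_equation g z Hg Hzc Hz
    x t (Rlt_le _ _ Hx) (Rlt_le _ _ Ht)) as E2.
  assert (D1 : RtoC (decay 1 t) = (- c * decay 0 t)%C).
  { unfold decay. rewrite <- RtoC_opp, <- RtoC_mult. f_equal. simpl. ring. }
  assert (Hal : RtoC alpha <> RtoC 0) by (apply RtoC_neq_0; lra).
  assert (Ec : RtoC c = (beta / alpha)%C) by (apply RtoC_div; lra).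
  unfold solution_partial. rewrite <- E2, D1.
  transitivity (- c * decay 0 t * U 0%nat x + (alpha * c - beta) * decay 0 t * U 2%nat x
    + (sol p z0 0 1 x t - alpha * sol p z0 2 1 x t - beta * sol p z0 2 0 x t)
    + (sol g z 0 1 x t - alpha * sol g z 2 1 x t - beta * sol g z 2 0 x t))%C; [ring |].
  rewrite E1. unfold initial_source. rewrite Ec.
  generalize (sol g z 0 1 x t), (sol g z 2 1 x t), (sol g z 2 0 x t). intros. field. exact Hal.
Qed.

Lemma decay_near_1 (eps : R) : 0 < eps -> at_right 0 (fun t => Rabs (decay 0 t - 1) < eps).
Proof.
  intros Heps. assert (Hc : contp (fun t : R => RtoC (decay 0 t)) 0).
  { apply contp_RtoC, (contR_decay 0 (fun t => t)). ct. }
  pose proof (proj1 (contp_iff _ _) Hc eps Heps) as H.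
  apply filter_le_within. revert H. apply filter_imp. intros t.
  replace (decay 0 0) with 1.
  - rewrite <- RtoC_minus, Cmod_R. trivial.
  - unfold decay. rewrite Rmax_0_id, Rmult_0_r, Ropp_0, exp_0 by lra. simpl. ring.
Qed.

Lemma solution_initial_values (eps : R) : 0 < eps ->
  at_right 0 (fun t : R => forall x : R, 0 < x -> Cmod (solution_partial 0 0 x t - U 0%nat x)%C < eps).
Proof.
  intros Heps. destruct (HUb 0) as [M HM]. pose proof (dec_nonneg _ _ HM) as HM0.
  destruct (sol_small p z0 smooth_initial_source cont_zero) as [B1 [HB1 H1]].
  destruct (sol_small g z Hg Hzc) as [B2 [HB2 H2]].
  pose (d := Rmin 1 (eps / (2 * (B1 + B2 + 1)))).
  assert (Hd : 0 < d).
  { apply Rmin_pos; [lra |]. apply Rdiv_lt_0_compat; lra. }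
  assert (Hnear : at_right 0 (fun t => 0 < t < d)).
  { exists (mkposreal d Hd). intros t Ht Ht0. split; [exact Ht0 |].
    change (Rabs (t - 0) < d) in Ht. apply Rabs_def2 in Ht. lra. }
  pose proof (decay_near_1 (eps / (2 * (M + 1))) ltac:(apply Rdiv_lt_0_compat; lra)) as Hdec.
  generalize (filter_and _ _ Hnear Hdec). apply filter_imp. intros t [Ht Hdt] x Hx.
  assert (Hd1 : d <= 1) by apply Rmin_l.
  assert (Hd2 : d <= eps / (2 * (B1 + B2 + 1))) by apply Rmin_r.
  specialize (H1 x t (Rlt_le _ _ Hx) ltac:(lra)). specialize (H2 x t (Rlt_le _ _ Hx) ltac:(lra)).
  unfold solution_partial.
  replace (RtoC (decay 0 t) * U 0%nat x + sol p z0 0 0 x t + sol g z 0 0 x t - U 0%nat x)%C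
    with (RtoC (decay 0 t - 1) * U 0%nat x + (sol p z0 0 0 x t + sol g z 0 0 x t))%C
    by (rewrite RtoC_minus; ring).
  eapply Rle_lt_trans; [apply Cmod_triangle |].
  assert (A1 : Cmod (RtoC (decay 0 t - 1) * U 0%nat x)%C <= eps / (2 * (M + 1)) * M).
  { rewrite Cmod_mult, Cmod_R. apply Rmult_le_compat; [apply Rabs_pos | apply Cmod_ge_0 | lra |].
    apply (dec_bound (U 0%nat)); [exact HM | lra]. }
  assert (A2 : Cmod (sol p z0 0 0 x t + sol g z 0 0 x t)%C <= (B1 + B2) * t).
  { eapply Rle_trans; [apply Cmod_triangle | lra]. }
  assert (A3 : eps / (2 * (M + 1)) * M <= eps / 2).
  { apply (Rmult_le_reg_r (2 * (M + 1))); [lra |]. field_simplify; [| lra]. nra. }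
  assert (A4 : (B1 + B2) * t < eps / 2).
  { apply Rle_lt_trans with ((B1 + B2) * (eps / (2 * (B1 + B2 + 1)))).
    - apply Rmult_le_compat_l; lra.
    - apply (Rmult_lt_reg_r (2 * (B1 + B2 + 1))); [lra |]. field_simplify; [| lra]. nra. }
  lra.
Qed.

(** [alpha u_t + beta u] vanishes for [exp (- c t) u0], and the continuity of the traces up
    to [x = 0] is uniform on bounded times. *)
Lemma solution_boundary_values (T eps : R) : 0 < T -> 0 < eps ->
  at_right 0 (fun x : R => forall t : R, 0 < t <= T ->
    Cmod (gamma0 * (alpha * solution_partial 0 1 x t + beta * solution_partial 0 0 x t)
          + gamma1 * (alpha * solution_partial 1 1 x t + beta * solution_partial 1 0 x t) - z 0%nat t)%C < eps).
Proof.
  intros HT Heps.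
  pose proof (proj1 (sol_regular p z0 smooth_initial_source cont_zero der_zero_data)) as C1.
  pose proof (proj1 (sol_regular g z Hg Hzc Hz)) as C2.
  pose (h := fun x t => (robin_trace p z0 x t + robin_trace g z x t)%C).
  assert (Hh : cont2 h).
  { assert (Hr : forall a00 a01 a10 a11 : R -> R -> C, cont2 a00 -> cont2 a01 -> cont2 a10 -> cont2 a11 ->
      cont2 (fun x t => gamma0 * (alpha * a01 x t + beta * a00 x t) + gamma1 * (alpha * a11 x t + beta * a10 x t))%C)
      by (intros; ct).
    pose proof (Hr _ _ _ _ (C1 0 0)%nat (C1 0 1)%nat (C1 1 0)%nat (C1 1 1)%nat) as R1.
    pose proof (Hr _ _ _ _ (C2 0 0)%nat (C2 0 1)%nat (C2 1 0)%nat (C2 1 1)%nat) as R2.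
    intros r. exact (contp_plus _ _ r (R1 r) (R2 r)). }
  pose proof (tube h 0 0 T (fun t _ => Hh (0, t)) eps Heps) as Ht.
  apply filter_le_within. revert Ht. apply filter_imp. intros x Hx t HtT.
  specialize (Hx t ltac:(lra)).
  assert (E0 : h 0 t = z 0%nat t).
  { unfold h.
    rewrite (robin_trace_0 p z0 smooth_initial_source cont_zero der_zero_data) by lra.
    rewrite (robin_trace_0 g z Hg Hzc Hz) by lra. ring. }
  rewrite E0 in Hx.
  assert (D1 : (alpha * decay 1 t + beta * decay 0 t)%C = RtoC 0).
  { rewrite <- !RtoC_mult, <- RtoC_plus. f_equal. unfold decay. simpl. field. lra. }
  assert (E : (gamma0 * (alpha * solution_partial 0 1 x t + beta * solution_partial 0 0 x t)
          + gamma1 * (alpha * solution_partial 1 1 x t + beta * solution_partial 1 0 x t))%C = h x t).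
  { unfold solution_partial, h, robin_trace.
    transitivity ((alpha * decay 1 t + beta * decay 0 t) * (gamma0 * U 0%nat x + gamma1 * U 1%nat x)
      + (gamma0 * (alpha * sol p z0 0 1 x t + beta * sol p z0 0 0 x t) + gamma1 * (alpha * sol p z0 1 1 x t + beta * sol p z0 1 0 x t)
      + (gamma0 * (alpha * sol g z 0 1 x t + beta * sol g z 0 0 x t) + gamma1 * (alpha * sol g z 1 1 x t + beta * sol g z 1 0 x t))))%C;
      [ring | rewrite D1; ring]. }
  rewrite E. exact Hx.
Qed.

End Initial.

End Solution.

Theorem theorem1 (alpha beta : R) (gamma0 gamma1 : C)
    (u0 zeta : R -> C) (f : R -> R -> C) (K : R -> C) :
  0 < alpha -> 0 < beta ->
  (gamma0 * sqrt alpha)%C <> gamma1 ->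
  schwartz_half_line u0 ->
  smooth_on Rnonneg zeta ->
  (exists P : nat -> nat -> R -> R -> C,
     partials_on Rnonneg f P /\
     forall (T : R) (n m l : nat), 0 < T ->
       exists M : R, forall x t : R, 0 < x -> 0 <= t <= T ->
         x ^ l * Cmod (P n m x t) <= M) ->
  admissible_contour alpha gamma0 gamma1 K ->
  let u := solution alpha beta gamma0 gamma1 u0 zeta f K in
  (* the improper integrals defining [u] converge *)
  (forall x t : R, 0 < x -> 0 < t ->
     ex_real_line_int (u0_integrand alpha beta u0 x t) /\
     ex_real_line_int (f_integrand alpha beta f x t)) /\
  (* [U n m] is the partial derivative of [u] of order n in x and m in t *)
  exists U : nat -> nat -> R -> R -> C,
    partials_on Rpos u U /\
    (forall x t : R, 0 < x -> 0 < t ->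
       (U 0%nat 1%nat x t - alpha * U 2%nat 1%nat x t
          - beta * U 2%nat 0%nat x t)%C = f x t) /\
    (forall eps : R, 0 < eps ->
       at_right 0 (fun t : R => forall x : R, 0 < x ->
         Cmod (u x t - u0 x)%C < eps)) /\
    (forall T : R, 0 < T -> forall eps : R, 0 < eps ->
       at_right 0 (fun x : R => forall t : R, 0 < t <= T ->
         Cmod (gamma0 * (alpha * U 0%nat 1%nat x t + beta * U 0%nat 0%nat x t)
               + gamma1 * (alpha * U 1%nat 1%nat x t + beta * U 1%nat 0%nat x t)
               - zeta t)%C < eps)).
Proof.
  intros Halpha Hbeta Hgamma Hu0 Hzeta [P [HP HM]] Hadm u.
  destruct (contour_pieces_exist K (proj1 Hadm)) as [N [s [k [v HK]]]].
  destruct (schwartz_extension u0 Hu0) as [U [HUc [HUb [HUd EU]]]].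
  destruct (smooth_extension zeta Hzeta) as [z [Hzc [Hz Ez]]].
  destruct (source_extension f P HP HM) as [g [Hg Eg]].
  assert (Hext : forall x t, 0 < x -> 0 < t ->
    (ex_real_line_int (u0_integrand alpha beta u0 x t) /\ ex_real_line_int (f_integrand alpha beta f x t)) /\
    u x t = solution_partial alpha N s k v gamma0 gamma1 beta U g z 0 0 x t).
  { intros x t Hx Ht. unfold u.
    destruct (solution_ext alpha K gamma0 gamma1 beta u0 (U 0%nat) zeta (z 0%nat) f (g 0%nat 0%nat) x t (Rlt_le _ _ Ht))
      as [-> [-> ->]].
    - intros y Hy. symmetry. now apply EU.
    - intros y Hy. symmetry. now apply Ez.
    - intros y tau Hy Htau. symmetry. now apply Eg.
    - now apply (solution_decomposition alpha Halpha K N s k v HK gamma0 gamma1 Hgamma Hadm beta Hbeta U HUc HUb HUd g z Hg Hzc). }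
  split; [intros x t Hx Ht; now apply Hext |].
  exists (solution_partial alpha N s k v gamma0 gamma1 beta U g z). split; [| split; [| split]].
  - destruct (solution_partials alpha Halpha K N s k v HK gamma0 gamma1 Hgamma Hadm beta Hbeta U HUc HUb HUd g z Hg Hzc Hz)
      as [_ Hpart].
    split; [| exact Hpart]. intros x t Hx Ht. symmetry. now apply Hext.
  - intros x t Hx Ht. rewrite <- (Eg x t) by lra.
    now apply (solution_equation alpha Halpha K N s k v HK gamma0 gamma1 Hgamma Hadm beta Hbeta U HUc HUb HUd g z Hg Hzc Hz).
  - intros eps Heps.
    pose proof (solution_initial_values alpha Halpha K N s k v HK gamma0 gamma1 Hgamma Hadm beta Hbeta U HUc HUb HUd g z Hg Hzc eps Heps) as H.
    destruct H as [d Hd]. exists d. intros t Ht Ht0 x Hx.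
    rewrite (proj2 (Hext x t Hx Ht0)), <- (EU x) by lra. now apply (Hd t Ht Ht0).
  - intros T HT eps Heps.
    pose proof (solution_boundary_values alpha Halpha K N s k v HK gamma0 gamma1 Hgamma Hadm beta Hbeta U HUc HUb HUd g z Hg Hzc Hz T eps HT Heps) as H.
    revert H. apply filter_imp. intros x Hx t Ht. rewrite <- (Ez t) by lra. now apply Hx.
Qed.
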